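(* Let $(K,n)\in(\mathbb{N}^* )^2$ and let $\mu\in H^3((0,1),\mathbb{R})$ satisfy (H1)$_K$ and (H2)$_{K,n}$. If $n\ge 2$, the system (S) is not $H^{2n-3}$-STLC around the ground state; if $n=1$, it is not $W^{-1,\infty}$-STLC around the ground state. More precisely, there exists $C>0$ such that for every $A\in(0,|A^n_K|/4)$ there exists $T^*>0$ such that for every $T\in(0,T^* )$ there exists $\eta>0$ such that for every real $u\in H^{2n-3}(0,T)$ with $\|u\|_{H^{2n-3}(0,T)}\le\eta$ (if $n\ge2$), resp. every real $u\in L^2(0,T)$ with $\|u_1\|_{L^\infty(0,T)}\le\eta$ (if $n=1$), the solution $\psi$ of (S) with $\psi(0)=\varphi_1$ satisfies $$-\operatorname{sign}(A^n_K)\,\Im\langle\psi(T),\varphi_K e^{-i\lambda_1T}\rangle\ \ge\ A\|u_n\|_{L^2(0,T)}^2-C\|(\psi-\psi_1)(T)\|_{L^2(0,1)}^2 .$$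
   Context: System (S): $i\partial_t\psi=-\partial_x^2\psi-u(t)\mu(x)\psi$ on $(0,T)\times(0,1)$, $\psi(t,0)=\psi(t,1)=0$, with real scalar control $u\in L^2(0,T)$; for $\mu\in H^3$ and $\psi(0)=\varphi_1$ it has a unique solution $\psi\in C^0([0,T],H^3_{(0)})$ with $\|\psi(t)\|_{L^2}=1$. $\langle f,g\rangle=\int_0^1 f\bar g$. $A=-d^2/dx^2$ with domain $H^2\cap H^1_0(0,1)$; eigenvalues $\lambda_j=(j\pi)^2$, eigenfunctions $\varphi_j=\sqrt2\sin(j\pi x)$, $j\ge1$; $\psi_j(t,x)=\varphi_j(x)e^{-i\lambda_jt}$. $H^s_{(0)}=D(A^{s/2})$ with norm $(\sum_j|j^s\langle\varphi,\varphi_j\rangle|^2)^{1/2}$. Iterated primitives: $u_0=u$, $u_{k+1}(t)=\int_0^tu_k$. (H1)$_K$: $\langle\mu\varphi_1,\varphi_K\rangle=0$. (H2)$_{K,n}$: with $c_j=\langle\mu\varphi_1,\varphi_j\rangle\langle\mu\varphi_K,\varphi_j\rangle$, one has $\sum_j j^{4n}|c_j|<\infty$, and, defining for $p\ge1$ $$A^p_K=(-1)^{p-1}\sum_{j\ge1}\Big(\lambda_j-\tfrac{\lambda_1+\lambda_K}{2}\Big)(\lambda_K-\lambda_j)^{p-1}(\lambda_j-\lambda_1)^{p-1}c_j,$$ $A^p_K=0$ for $p=1,\dots,n-1$ and $A^n_K\neq0$. STLC: given normed spaces $(E_T,\|\cdot\|_{E_T})$ of real functions on $[0,T]$, (S)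 is $E$-STLC around the ground state if there is $s\in\mathbb{N}$ such that for every $T>0$, $\varepsilon>0$ there is $\delta>0$ such that every $\psi_f$ in the unit sphere of $L^2(0,1)$ with $\|\psi_f-\psi_1(T)\|_{H^s_{(0)}}<\delta$ is reached at time $T$ from $\varphi_1$ by some real $u\in L^2(0,T)\cap E_T$ with $\|u\|_{E_T}<\varepsilon$. ''$H^{2n-3}$-STLC'' uses $E_T=H^{2n-3}(0,T)$; ''$W^{-1,\infty}$-STLC'' uses $E_T=L^2(0,T)$ with norm $\|u_1\|_{L^\infty(0,T)}$. *)

(* Defs.v *)
From HB Require Import structures.
From mathcomp Require Import all_boot all_order all_algebra.
From mathcomp Require Import all_classical all_reals all_analysis.
From mathcomp Require Import complex.

Set Implicit Arguments.
Unset Strict Implicit.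
Unset Printing Implicit Defensive.

Import Order.TTheory GRing.Theory Num.Theory.
Import numFieldNormedType.Exports.

Local Open Scope classical_set_scope.
Local Open Scope ring_scope.
Local Open Scope complex_scope.

Section BilinearSchrodinger.
Variable R : realType.

Local Notation leb := (@lebesgue_measure R).

Definition Icc (a b : R) : set R := [set x | a <= x <= b].

Definition rint (a b : R) (f : R -> R) : R := Rintegral leb (Icc a b) f.

Definition L2 (a b : R) (f : R -> R) : Prop :=
  measurable_fun (Icc a b) f /\
  (\int[leb]_(x in Icc a b) ((f x) ^+ 2)%:E < +oo)%E.

Definition L2norm (a b : R) (f : R -> R) : R :=
  Num.sqrt (rint a b (fun x => f x ^+ 2)).

Definition cre (z : R[i]) : R := let: a +i* _ := z in a.
Definition cim (z : R[i]) : R := let: _ +i* b := z in b.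

Definition cL2 (a b : R) (g : R -> R[i]) : Prop :=
  L2 a b (fun x => cre (g x)) /\ L2 a b (fun x => cim (g x)).

Definition cint (a b : R) (g : R -> R[i]) : R[i] :=
  rint a b (fun x => cre (g x)) +i* rint a b (fun x => cim (g x)).

Definition cinner (f g : R -> R[i]) : R[i] :=
  cint 0 1 (fun x => f x * conjc (g x)).

Definition cL2norm (g : R -> R[i]) : R :=
  Num.sqrt (rint 0 1 (fun x => cre (g x) ^+ 2 + cim (g x) ^+ 2)).

Definition cexp (theta : R) : R[i] := cos theta +i* sin theta.

(** spectral data of A = -d^2/dx^2 on (0,1) with Dirichlet conditions *)
Definition lam (j : nat) : R := (j%:R * pi) ^+ 2.
Definition phi (j : nat) (x : R) : R := Num.sqrt 2 * sin (j%:R * pi * x).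

Definition psi1 (t : R) (x : R) : R[i] := (phi 1 x)%:C * cexp (- (lam 1 * t)).

(** Sobolev space H^k(a,b) in dimension one: a chain v_0 = f, v_1, ..., v_k
   of L^2(a,b) functions, each v_m (m < k) being a.e. on [a,b] a constant plus
   the primitive of v_(m+1) (i.e. v_(m+1) is the weak derivative of v_m). *)
Definition Hk_chain (a b : R) (k : nat) (f : R -> R) (v : nat -> R -> R) : Prop :=
  v 0%N = f /\
  (forall m, (m <= k)%N -> L2 a b (v m)) /\
  (forall m, (m < k)%N -> exists c : R,
     {ae leb, forall x, a <= x <= b -> v m x = c + rint a x (v m.+1)}).

Definition Hk_norm2 (a b : R) (k : nat) (v : nat -> R -> R) : R :=
  \sum_(m < k.+1) rint a b (fun x => v m x ^+ 2).

Definition inHk (a b : R) (k : nat) (f : R -> R) : Prop :=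
  exists v, Hk_chain a b k f v.

Definition Hk_le (a b : R) (k : nat) (f : R -> R) (eta : R) : Prop :=
  exists v, Hk_chain a b k f v /\ Num.sqrt (Hk_norm2 a b k v) <= eta.
Definition Hk_lt (a b : R) (k : nat) (f : R -> R) (eta : R) : Prop :=
  exists v, Hk_chain a b k f v /\ Num.sqrt (Hk_norm2 a b k v) < eta.

Fixpoint prim (u : R -> R) (k : nat) : R -> R :=
  match k with
  | 0%N => u
  | k'.+1 => fun t => rint 0 t (prim u k')
  end.

(** psi is the solution on [0,T] of (S) with control u, dipole moment mu and
   psi(0) = phi_1: psi(t) in L^2(0,1), t |-> psi(t) continuous in L^2(0,1),
   and the Duhamel (mild) formula in the eigenbasis of A:
   <psi(t),phi_j> = delta_{1j} e^{-i lam_j t}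
                    + i int_0^t u(s) e^{-i lam_j (t-s)} <mu psi(s), phi_j> ds. *)
Definition is_solution (mu : R -> R) (T : R) (u : R -> R)
    (psi : R -> R -> R[i]) : Prop :=
  (forall t, 0 <= t <= T -> cL2 0 1 (psi t)) /\
  (forall t0, 0 <= t0 <= T -> forall e : R, 0 < e -> exists d : R, 0 < d /\
     forall t, 0 <= t <= T -> `|t - t0| < d ->
       cL2norm (fun x => psi t x - psi t0 x) < e) /\
  (forall t, 0 <= t <= T -> forall j : nat, (1 <= j)%N ->
     cinner (psi t) (fun x => (phi j x)%:C) =
       (if j == 1%N then cexp (- (lam j * t)) else 0)
       + 'i * cint 0 t (fun s => (u s)%:C * cexp (- (lam j * (t - s)))
                 * cinner (fun x => (mu x)%:C * psi s x) (fun x => (phi j x)%:C))).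

Definition Hs0_lt (s : nat) (g : R -> R[i]) (delta : R) : Prop :=
  ((\sum_(1 <= j <oo)
      ((j%:R ^+ (2 * s)) *
         (cre (cinner g (fun x => (phi j x)%:C)) ^+ 2
          + cim (cinner g (fun x => (phi j x)%:C)) ^+ 2))%:E)
   < (delta ^+ 2)%:E)%E.

(** generic E-STLC around the ground state, where EnormLt T u eps means
   "u in E_T and ||u||_{E_T} < eps" *)
Definition STLC (mu : R -> R) (EnormLt : R -> (R -> R) -> R -> Prop) : Prop :=
  exists s : nat, forall T : R, 0 < T -> forall eps : R, 0 < eps ->
    exists delta : R, 0 < delta /\
    forall psif : R -> R[i], cL2 0 1 psif -> cL2norm psif = 1 ->
      Hs0_lt s (fun x => psif x - psi1 T x) delta ->
      exists u : R -> R, L2 0 T u /\ EnormLt T u eps /\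
        exists psi, is_solution mu T u psi /\
          cL2norm (fun x => psi T x - psif x) = 0.

Definition STLC_H (mu : R -> R) (k : nat) : Prop :=
  STLC mu (fun T u eps => Hk_lt 0 T k u eps).

(** W^{-1,infty}-STLC: E_T = L^2(0,T) with norm ||u_1||_{L^infty(0,T)}
   (u_1 is continuous, so the L^infty norm is the sup over [0,T]) *)
Definition STLC_W (mu : R -> R) : Prop :=
  STLC mu (fun T u eps => forall t, 0 <= t <= T -> `|prim u 1 t| < eps).

Definition mcoef (mu : R -> R) (j k : nat) : R :=
  rint 0 1 (fun x => mu x * phi j x * phi k x).

Definition H1 (mu : R -> R) (K : nat) : Prop := mcoef mu 1 K = 0.

Definition cK (mu : R -> R) (K j : nat) : R := mcoef mu 1 j * mcoef mu K j.

Definition ApK_term (mu : R -> R) (K p j : nat) : R :=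
  (-1) ^+ (p.-1) * (lam j - (lam 1 + lam K) / 2)
  * (lam K - lam j) ^+ (p.-1) * (lam j - lam 1) ^+ (p.-1) * cK mu K j.

Definition ApK (mu : R -> R) (K p : nat) : R :=
  limn (fun N => \sum_(1 <= j < N) ApK_term mu K p j).

Definition H2 (mu : R -> R) (K n : nat) : Prop :=
  cvgn (fun N => \sum_(1 <= j < N) (j%:R ^+ (4 * n) * `|cK mu K j|)) /\
  (forall p, (1 <= p < n)%N -> ApK mu K p = 0) /\
  ApK mu K n != 0.

Definition ctrl_small (n : nat) (T : R) (u : R -> R) (eta : R) : Prop :=
  if (2 <= n)%N then Hk_le 0 T (2 * n - 3) u eta
  else forall t, 0 <= t <= T -> `|prim u 1 t| <= eta.

End BilinearSchrodinger.

(* Main.v *)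
(* Write th = u_1. The gauge transform exp(- i th mu) psi solves an equation driven by th instead of u.
   Expand its K-th coefficient to second order around the ground state. The linear term vanishes by
   (H1), and the quadratic one consists of the integral of th^2 exp(i (lam_K - lam_1) t) and of
   iterated integrals of th against exponentials, summed over the intermediate modes j. Integrating by
   parts in the iterated integrals replaces u_p by u_(p+1), at the cost of boundary terms in u_(p+1)(T)
   and of the integral of u_(p+1)^2 exp(i (lam_K - lam_1) t), whose total coefficient is A^(p+1)_K up
   to a constant. Hence only the integral of u_n^2 exp(i (lam_K - lam_1) t), with coefficient - i
   A^n_K, survives, and for small T its imaginary part has constant sign.
   The boundary terms are controlled by the distance from psi(T) to the ground state: the linearised
   coefficients along n modes with <mu phi_1, phi_j> <> 0 determine u_1(T), ..., u_n(T) through a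
   Vandermonde system. The cubic remainder, of size |u_1|^3 in L^2, is absorbed in |u_n|^2 by
   interpolating u_1 between u_n and the smallness of u in H^(2n-3).
   Small-time controllability then fails since the inequality excludes the targets exp(- i lam_1 T)
   (cos b phi_1 + i sign(A^n_K) sin b phi_K) for small b > 0. *)
Require Import Defs.
From HB Require Import structures.
From mathcomp Require Import all_boot all_order all_algebra.
From mathcomp Require Import all_classical all_reals all_analysis.
From mathcomp Require Import measurable_realfun complex ring lra zify.
Import Order.TTheory GRing.Theory Num.Theory.
Import numFieldNormedType.Exports.
Set Implicit Arguments.
Unset Strict Implicit.
Unset Printing Implicit Defensive.
Local Open Scope classical_set_scope.
Local Open Scope ring_scope.

(** A mild solution is merely continuous with values in L^2, so the gauge factor is not applied to
    the equation: it is moved to the test functions exp(i z m) phi_j, which satisfy the Dirichlet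
    conditions, and z then follows th. Testing against functions other than sines is what calls for
    the completeness of the sine basis. The sum over intermediate modes is cut at N, with bounds
    uniform in N, and N tends to infinity for each fixed control. Since mu in H^3 gives the
    coefficients <Dop K, phi_j> only a decay 1 / j, uniformity rests on the orthogonality in time of
    the exponentials exp(i lam_j s) on [0, 2 / pi]. The exponent 2n - 3 comes from interpolation: in
    the chain u_n, ..., u_1, u, ..., u^(2n-3) the function u_1 stands at one third of the length 3(n
    - 1). The interpolation constant depends on T, so eta is chosen after T, whereas C is fixed
    before. The factor 1/4 is what remains of 3/4, a lower bound of the cosine for small T, after
    two errors of size 1/4. *)

Section Arithmetic.
Variable F : realFieldType.
Implicit Types a b c d x y z : F.

Lemma le_eq a b : a = b -> a <= b.
Proof. by move=> ->. Qed.

Lemma lerD_mul a b c d : 0 <= a -> 0 <= b -> 0 <= c -> 0 <= d -> a * c + b * d <= (a + b) * (c + d).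
Proof. by move=> *; rewrite mulrDl !mulrDr; apply: lerD; rewrite ?lerDl ?lerDr mulr_ge0. Qed.

Lemma absorb_half a b z : z <= a + b -> b <= 2^-1 * z -> z <= 2 * a.
Proof. lra. Qed.

Lemma sqr_sum3 x y z : (x + y + z) ^+ 2 <= 3 * (x ^+ 2 + y ^+ 2 + z ^+ 2).
Proof.
have := sqr_ge0 (x - y); have := sqr_ge0 (x - z); have := sqr_ge0 (y - z).
by rewrite !expr2 => *; nra.
Qed.

Lemma mul2_le_sqr x y : 2 * (x * y) <= x ^+ 2 + y ^+ 2.
Proof. by have := sqr_ge0 (x - y); rewrite !expr2 => *; nra. Qed.

End Arithmetic.

Ltac nonneg := repeat first [done | apply: addr_ge0 | apply: mulr_ge0].

(** * Integrals and continuity on a segment *)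

Section Integration.
Variable R : realType.
Local Notation leb := (@lebesgue_measure R).
Implicit Types (a b c t : R) (f g h F G H : R -> R).

Lemma IccE a b : Icc a b = `[a, b]%classic.
Proof. by apply/seteqP; split => x /=; rewrite /Icc/= in_itv. Qed.

Lemma measurable_Icc a b : measurable (Icc a b : set (measurableTypeR R)).
Proof. by rewrite IccE; exact: measurable_itv. Qed.
Hint Resolve measurable_Icc : core.

Definition intg a b f := leb.-integrable (Icc a b) (EFin \o f).

Lemma intg_sub a b c d f : a <= c -> d <= b -> intg a b f -> intg c d f.
Proof.
move=> ac db; apply: integrableS => //.
by move=> x; rewrite /Icc/= => /andP[cx xd]; apply/andP; split; [exact: le_trans cx|exact: le_trans db].
Qed.

Lemma intgD a b f g : intg a b f -> intg a b g -> intg a b (fun x => f x + g x).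
Proof. by move=> hf hg; exact: integrableD hf hg. Qed.

Lemma intgB a b f g : intg a b f -> intg a b g -> intg a b (fun x => f x - g x).
Proof. by move=> hf hg; exact: integrableB hf hg. Qed.

Lemma intgZ a b k f : intg a b f -> intg a b (fun x => k * f x).
Proof. by move=> hf; exact: integrableZl hf. Qed.

Lemma intg_norm a b f : intg a b f -> intg a b (fun x => `|f x|).
Proof. by move=> hf; exact: integrable_abse hf. Qed.

Lemma intg_measurable a b f : intg a b f -> measurable_fun (Icc a b) f.
Proof. by move=> hf; apply/measurable_EFinP; exact: measurable_int hf. Qed.

Lemma eq_intg a b f g : (forall x, a <= x <= b -> f x = g x) -> intg a b f -> intg a b g.
Proof.
move=> fg; apply: eq_integrable => //= x; rewrite inE => /fg ->//.
Qed.

Lemma eq_rint a b f g : (forall x, a <= x <= b -> f x = g x) -> rint a b f = rint a b g.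
Proof. by move=> fg; apply: eq_Rintegral => x; rewrite inE => /fg. Qed.

Lemma rintD a b f g : intg a b f -> intg a b g ->
  rint a b (fun x => f x + g x) = rint a b f + rint a b g.
Proof. by move=> hf hg; exact: RintegralD. Qed.

Lemma rintB a b f g : intg a b f -> intg a b g ->
  rint a b (fun x => f x - g x) = rint a b f - rint a b g.
Proof. by move=> hf hg; exact: RintegralB. Qed.

Lemma rintZ a b k f : intg a b f -> rint a b (fun x => k * f x) = k * rint a b f.
Proof. by move=> hf; exact: RintegralZl. Qed.

Lemma rint_norm a b f : intg a b f -> `|rint a b f| <= rint a b (fun x => `|f x|).
Proof. by move=> hf; exact: le_normr_Rintegral. Qed.

Lemma ler_rint a b f g : intg a b f -> intg a b g ->
  (forall x, a <= x <= b -> f x <= g x) -> rint a b f <= rint a b g.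
Proof. by move=> hf hg fg; apply: le_Rintegral. Qed.

Lemma rint_ge0 a b f : (forall x, a <= x <= b -> 0 <= f x) -> 0 <= rint a b f.
Proof. by move=> f0; apply: Rintegral_ge0. Qed.

Lemma rint_cst a b k : a <= b -> rint a b (fun=> k) = k * (b - a).
Proof.
move=> ab; rewrite /rint Rintegral_cst//; congr (_ * _).
rewrite IccE; have := @lebesgue_measure_itv R `[a, b]; rewrite /= => ->; rewrite lte_fin.
have [//|ba] := ltP a b; have -> : a = b by apply/eqP; rewrite eq_le ab.
by rewrite subrr.
Qed.

Lemma intg_cst a b k : intg a b (fun=> k).
Proof.
rewrite /intg IccE; apply/integrableP; split; first exact: measurable_cst.
under eq_integral do rewrite /=.
rewrite integral_cst//= lebesgue_measure_itv/=.
by case: ifP => _; rewrite ?mule0// -EFinD -EFinM ltry.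
Qed.

Lemma rint_pt a f : rint a a f = 0.
Proof. by rewrite /rint IccE set_itv1 Rintegral_set1. Qed.

Lemma rint_cat a b c f : a <= c -> c <= b -> intg a b f ->
  rint a b f = rint a c f + rint c b f.
Proof.
move=> ac cb; rewrite /intg /rint !IccE => hf.
have := @Rintegral_itvB R f (BLeft a) (BRight b) c hf.
rewrite !bnd_simp => /(_ ac cb) e.
rewrite -(@Rintegral_itv_obnd_cbnd _ c); last first.
  by apply: integrableS hf => //; apply: subset_itvr; rewrite bnd_simp.
by rewrite -e addrC subrK.
Qed.

(** Lets [mu] and the weak derivatives of the control, known up to null sets, be exchanged for
    chosen representatives under the integral. *)
Lemma ae_rint a b f g : measurable_fun (Icc a b) f -> measurable_fun (Icc a b) g ->
  {ae leb, forall x, a <= x <= b -> f x = g x} -> rint a b f = rint a b g.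
Proof.
move=> mf mg fg; congr fine; apply: ae_eq_integral => //.
- exact/measurable_EFinP.
- exact/measurable_EFinP.
- by move: fg; apply: negligibleS => x /= nx h; apply: nx => /h /= ->.
Qed.

(** Continuity relative to the segment only, in metric form, so that moduli can be extracted and
    combined by hand; [contP] translates to the subspace topology. *)
Definition cont a b f := forall s, a <= s <= b -> forall e, 0 < e ->
  exists2 d : R, 0 < d & forall t, a <= t <= b -> `|t - s| < d -> `|f t - f s| < e.

Lemma contP a b f : cont a b f <-> {within `[a, b], continuous f}.
Proof.
split.
- move=> cf; apply/subspace_continuousP => s; rewrite /= in_itv/= => sab.
  apply/cvgrPdist_lt => e e0; have [d d0 h] := cf s sab e e0.
  rewrite /prop_near1 /= nbhs_simpl /within/=.
  near=> t => tab; rewrite distrC; apply: h; first by rewrite in_itv in tab.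
  near: t; apply/nbhs_ballP; exists d => //= y; by rewrite /ball/= distrC.
- move/subspace_continuousP => cf s sab e e0.
  have := cf s; rewrite /= in_itv/= => /(_ sab)/cvgrPdist_lt/(_ e e0).
  rewrite /prop_near1 /= nbhs_simpl /within/= => /nbhs_ballP[d d0 h].
  exists d => // t tab ts; rewrite distrC; apply: h => /=; last by rewrite in_itv.
  by rewrite /ball/= distrC.
Unshelve. all: by end_near.
Qed.

Lemma eq_cont a b f g : (forall x, a <= x <= b -> f x = g x) -> cont a b f -> cont a b g.
Proof.
move=> fg cf s sab e e0; have [d d0 h] := cf s sab e e0.
by exists d => // t tab ts; rewrite -!fg//; exact: h.
Qed.

Lemma cont_cst a b k : cont a b (fun=> k).
Proof. by move=> s _ e e0; exists 1 => // t _ _; rewrite subrr normr0. Qed.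

Lemma cont_id a b : cont a b id.
Proof. by move=> s _ e e0; exists e. Qed.

Lemma contD a b f g : cont a b f -> cont a b g -> cont a b (fun x => f x + g x).
Proof. by move=> /contP cf /contP cg; apply/contP => x; apply: (@continuousD _ _ (subspace `[a, b]%classic) f g); [exact: cf|exact: cg]. Qed.

Lemma contN a b f : cont a b f -> cont a b (fun x => - f x).
Proof. by move=> /contP cf; apply/contP => x; apply: (@continuousN _ _ (subspace `[a, b]%classic) f); exact: cf. Qed.

Lemma contB a b f g : cont a b f -> cont a b g -> cont a b (fun x => f x - g x).
Proof. by move=> cf cg; apply: contD => //; exact: contN. Qed.

Lemma contM a b f g : cont a b f -> cont a b g -> cont a b (fun x => f x * g x).
Proof. by move=> /contP cf /contP cg; apply/contP => x; apply: (@continuousM _ (subspace `[a, b]%classic) f g); [exact: cf|exact: cg]. Qed.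

Lemma cont_norm a b f : cont a b f -> cont a b (fun x => `|f x|).
Proof.
move=> cf s sab e e0; have [d d0 h] := cf s sab e e0; exists d => // t tab ts.
by apply: le_lt_trans (h t tab ts); exact: ler_dist_dist.
Qed.

Lemma cont_comp a b f h : continuous h -> cont a b f -> cont a b (h \o f).
Proof. move=> ch cf s sab e e0; have /cvgrPdist_lt/(_ e e0)/nbhs_ballP[r r0 hr] := ch (f s).
have [d d0 hd] := cf s sab r r0; exists d => // t tab ts; rewrite distrC; apply: hr.
by rewrite /ball/= distrC; exact: hd. Qed.

Lemma continuous_cont a b f : continuous f -> cont a b f.
Proof. by move=> cf; apply: (@cont_comp a b id f cf); exact: cont_id. Qed.

Lemma contX a b f n : cont a b f -> cont a b (fun x => f x ^+ n).
Proof.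
move=> cf; elim: n => [|n IH]; first exact: cont_cst.
by apply: eq_cont (contM cf IH) => x _; rewrite exprS.
Qed.

Lemma cont_sum a b (I : Type) (r : seq I) (P : pred I) (f : I -> R -> R) :
  (forall i, P i -> cont a b (f i)) -> cont a b (fun x => \sum_(i <- r | P i) f i x).
Proof.
move=> cf; elim: r => [|i r IH].
  by apply: eq_cont (cont_cst 0) => x _; rewrite big_nil.
case: (boolP (P i)) => Pi.
  by apply: eq_cont (contD (cf i Pi) IH) => x _; rewrite big_cons Pi.
by apply: eq_cont IH => x _; rewrite big_cons (negbTE Pi).
Qed.

Lemma cont_measurable a b f : cont a b f -> measurable_fun (Icc a b) f.
Proof.
move=> /contP cf; rewrite IccE; apply: subspace_continuous_measurable_fun => //.
Qed.

Lemma cont_bounded a b f : cont a b f -> exists2 M : R, 0 <= M & forall x, a <= x <= b -> `|f x| <= M.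
Proof.
move=> /contP cf.
have /compact_bounded[M [_ mrt]] := continuous_compact cf (@segment_compact _ a b).
exists (`|M| + 1); first by rewrite addr_ge0.
move=> x xab; apply: (mrt (`|M| + 1)); first by rewrite ltr_pwDr// ler_norm.
by exists x => //=; rewrite in_itv.
Qed.

Lemma intg_cont a b f : cont a b f -> intg a b f.
Proof.
move=> /contP cf; rewrite /intg IccE; apply: continuous_compact_integrable => //.
exact: segment_compact.
Qed.

Lemma intg_dom a b f g : measurable_fun (Icc a b) f -> intg a b g ->
  (forall x, a <= x <= b -> `|f x| <= g x) -> intg a b f.
Proof.
move=> mf hg fg; apply: le_integrable hg => //; first exact/measurable_EFinP.
move=> x /= /fg h; by rewrite lee_fin (le_trans h)// ler_norm.
Qed.

Lemma intgM_bd a b f g M : intg a b f -> measurable_fun (Icc a b) g ->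
  (forall x, a <= x <= b -> `|g x| <= M) -> intg a b (fun x => f x * g x).
Proof.
move=> hf mg gM; apply: (@intg_dom _ _ _ (fun x => M * `|f x|)).
- by apply: measurable_funM => //; exact: intg_measurable.
- exact/intgZ/intg_norm.
- by move=> x /gM h; rewrite normrM mulrC ler_wpM2r.
Qed.

Lemma intgM_cont a b f g : intg a b f -> cont a b g -> intg a b (fun x => f x * g x).
Proof.
move=> hf cg; have [M _ gM] := cont_bounded cg.
by apply: (intgM_bd hf _ gM); exact: cont_measurable.
Qed.

Lemma cont_prim a b f : a <= b -> intg a b f -> cont a b (fun x => rint a x f).
Proof.
move=> ab hf; apply/contP.
have := @parameterized_integral_continuous R a b f ab.
rewrite /parameterized_integral -IccE => /(_ hf).
by rewrite (_ : (fun x => rint a x f) = (fun x : R => \int[leb]_(t in `[a, x]) f t))//;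
  apply/funext => x; rewrite /rint IccE.
Qed.

End Integration.
#[export] Hint Resolve measurable_Icc : core.

(** * Absolutely continuous functions *)

Section Primitives.
Variable R : realType.
Implicit Types (a b c d e s t x y : R) (f g h F G H : R -> R).

(** Continuous induction. At the supremum of the points up to which the estimate holds, the local
    hypothesis bounds increments on both sides; added to the estimate reached just before the
    supremum, it carries the estimate further, unless the supremum is b. *)
Lemma local_estimate a b (D H : R -> R) e : a <= b -> 0 < e ->
  (forall x y, a <= x -> x <= y -> y <= b -> H x <= H y) ->
  (forall s, a <= s <= b -> exists2 d : R, 0 < d &
     forall x y, a <= x -> x <= y -> y <= b -> `|x - s| < d -> `|y - s| < d ->
       `|D y - D x| <= e * (H y - H x)) ->
  `|D b - D a| <= e * (H b - H a).
Proof.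
move=> ab e0 Hm loc.
pose S := [set t | a <= t <= b /\ forall r, a <= r <= t -> `|D r - D a| <= e * (H r - H a)].
have Sa : S a.
  split; first by rewrite lexx.
  by move=> r ra; have -> : r = a by [apply/eqP; rewrite eq_le andbC]; rewrite !subrr mulr0 normr0.
have hS : has_sup S by split; [exists a|exists b => t [/andP[]]].
set s := sup S.
have ub t : S t -> t <= s by move=> St; apply: sup_upper_bound.
have as_ : a <= s by exact: ub.
have sb : s <= b by apply: ge_sup; [exists a|move=> t [/andP[]]].
have [|d d0 hd] := loc s; first by rewrite as_.
have [r0 Sr0] := sup_adherent d0 hS; rewrite -/s => r0s.
have r0le : r0 <= s by exact: ub.
have [/andP[ar0 r0b] hr0] := Sr0.
have key t : a <= t -> t <= b -> t < s + d -> `|D t - D a| <= e * (H t - H a).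
  move=> at_ tb tsd; have [tr|rt] := leP t r0; first by apply: hr0; rewrite at_.
  have := hd r0 t ar0 (ltW rt) tb.
  have -> : `|r0 - s| < d by rewrite ltr_distl; apply/andP; split; lra.
  have -> : `|t - s| < d by rewrite ltr_distl; apply/andP; split; lra.
  move=> /(_ isT isT) h1.
  have h2 := hr0 r0; rewrite ar0 lexx in h2; have {}h2 := h2 isT.
  have -> : D t - D a = (D t - D r0) + (D r0 - D a) by ring.
  by apply: le_trans (ler_normD _ _) _; lra.
have [bs|sb'] := leP b s; first by apply: key => //; lra.
pose t := Num.min b (s + d / 2).
have st : s < t by rewrite lt_min sb' /= ltrDl divr_gt0.
have tb : t <= b by rewrite ge_min lexx.
have td : t < s + d by rewrite gt_min; apply/orP; right; rewrite ltrD2l; lra.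
have : S t.
  split; first by rewrite tb andbT (le_trans as_)// ltW.
  move=> r /andP[ar rt]; apply: key => //; first exact: le_trans tb.
  exact: le_lt_trans td.
by move=> /ub; rewrite leNgt st.
Qed.

(* Replaces almost everywhere differentiation: increments of D that are locally negligible with respect
   to those of a monotone H make D constant. *)
Lemma local_const a b (D H : R -> R) : a <= b ->
  (forall x y, a <= x -> x <= y -> y <= b -> H x <= H y) ->
  (forall e, 0 < e -> forall s, a <= s <= b -> exists2 d : R, 0 < d &
     forall x y, a <= x -> x <= y -> y <= b -> `|x - s| < d -> `|y - s| < d ->
       `|D y - D x| <= e * (H y - H x)) ->
  D b = D a.
Proof.
move=> ab Hm loc; apply/eqP; rewrite -subr_eq0 -normr_le0.
apply/ler_addgt0Pr => e e0; rewrite add0r.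
have K0 : 0 < H b - H a + 1 by rewrite ltr_wpDl// subr_ge0 Hm.
have e1 : 0 < e / (H b - H a + 1) by rewrite divr_gt0.
apply: le_trans (local_estimate ab e1 Hm (loc _ e1)) _.
by rewrite -mulrA ler_piMr ?(ltW e0)// ler_pdivrMl// mulr1 lerDl.
Qed.

(* F is absolutely continuous on [a, b] with a.e. derivative f. *)
Definition isprim a b F f := intg a b f /\ forall t, a <= t <= b -> F t = F a + rint a t f.

Lemma isprim_intg a b F f : isprim a b F f -> intg a b f.
Proof. by case. Qed.

Lemma isprim_diff a b F f x y : isprim a b F f -> a <= x -> x <= y -> y <= b ->
  F y - F x = rint x y f.
Proof.
move=> [hf hF] ax xy yb; rewrite hF ?(le_trans ax xy)//= [F x]hF ?ax ?(le_trans xy)//.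
rewrite (rint_cat ax xy); first by ring.
exact: intg_sub hf.
Qed.

Lemma isprim_cont a b F f : a <= b -> isprim a b F f -> cont a b F.
Proof.
move=> ab [hf hF]; apply: eq_cont (contD (cont_cst (F a)) (cont_prim ab hf)) => x xab.
by rewrite -hF.
Qed.

Lemma isprim_ext a b F f G g : (forall x, a <= x <= b -> F x = G x) ->
  (forall x, a <= x <= b -> f x = g x) -> isprim a b F f -> isprim a b G g.
Proof.
move=> FG fg [hf hF]; split; first exact: eq_intg fg hf.
move=> t /andP[at_ tb]; rewrite -!FG ?lexx ?at_ ?(le_trans at_)// hF ?at_//.
congr (_ + _); apply: eq_rint => x /andP[ax xt]; apply: fg.
by rewrite ax (le_trans xt).
Qed.

(** By [local_const], applied to F minus the integral of f and to the integral of h: it suffices to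
    compare increments near each point, with an error small relative to the mass of an integrable h.
    The product and chain rules are instances. *)
Lemma isprimI a b F f h : a <= b -> intg a b f -> intg a b h ->
  (forall x, a <= x <= b -> 0 <= h x) ->
  (forall e, 0 < e -> forall s, a <= s <= b -> exists2 d : R, 0 < d &
     forall x y, a <= x -> x <= y -> y <= b -> `|x - s| < d -> `|y - s| < d ->
       `|F y - F x - rint x y f| <= e * rint x y h) ->
  isprim a b F f.
Proof.
move=> ab hf hh h0 loc; split => // t /andP[at_ tb].
have hft : intg a t f by exact: intg_sub hf.
have cat (k : R -> R) x y : intg a b k -> a <= x -> x <= y -> y <= b ->
    rint a y k - rint a x k = rint x y k.
  move=> hk ax xy yb; rewrite (rint_cat ax xy); first by ring.
  exact: intg_sub hk.
have := @local_const a t (fun z => F z - rint a z f) (fun z => rint a z h) at_.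
rewrite /= rint_pt subr0 => E; suff E' : F t - rint a t f = F a by rewrite -E' subrK.
apply: E.
- move=> x y ax xy yt; rewrite -subr_ge0 cat// ?(le_trans yt)//.
  apply: rint_ge0 => z /andP[xz zy]; apply: h0.
  by rewrite (le_trans ax)//= (le_trans zy)// (le_trans yt).
- move=> e e0 s /andP[as_ st].
  have [|d d0 hd] := loc e e0 s; first by rewrite as_ (le_trans st).
  exists d => // x y ax xy yt xs ys.
  have yb : y <= b by exact: le_trans tb.
  rewrite (_ : _ - _ = F y - F x - (rint a y f - rint a x f)); last by ring.
  by rewrite !cat//; exact: hd.
Qed.

Lemma isprim_cst a b k : isprim a b (fun=> k) (fun=> 0).
Proof.
split; first exact: intg_cst.
by move=> t /andP[at_ _]; rewrite rint_cst// mul0r addr0.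
Qed.

Lemma isprim_id a b : isprim a b id (fun=> 1).
Proof.
split; first exact: intg_cst.
by move=> t /andP[at_ _]; rewrite rint_cst// mul1r addrC subrK.
Qed.

Lemma isprimD a b F f G g : isprim a b F f -> isprim a b G g ->
  isprim a b (fun x => F x + G x) (fun x => f x + g x).
Proof.
move=> [hf hF] [hg hG]; split; first exact: intgD.
move=> t /andP[at_ tb]; rewrite rintD; [|exact: intg_sub hf|exact: intg_sub hg].
by rewrite hF ?at_// hG ?at_//; ring.
Qed.

Lemma isprimZ a b k F f : isprim a b F f -> isprim a b (fun x => k * F x) (fun x => k * f x).
Proof.
move=> [hf hF]; split; first exact: intgZ.
move=> t /andP[at_ tb]; rewrite rintZ; last exact: intg_sub hf.
by rewrite hF ?at_//; ring.
Qed.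

Lemma isprimN a b F f : isprim a b F f -> isprim a b (fun x => - F x) (fun x => - f x).
Proof. by move=> /(isprimZ (-1)); apply: isprim_ext => x _; rewrite mulN1r. Qed.

Lemma isprimB a b F f G g : isprim a b F f -> isprim a b G g ->
  isprim a b (fun x => F x - G x) (fun x => f x - g x).
Proof. by move=> hF /isprimN hG; exact: isprimD. Qed.

Lemma isprim_sum a b (I : Type) (r : seq I) (P : pred I) (F f : I -> R -> R) :
  (forall i, P i -> isprim a b (F i) (f i)) ->
  isprim a b (fun x => \sum_(i <- r | P i) F i x) (fun x => \sum_(i <- r | P i) f i x).
Proof.
move=> h; elim: r => [|i r IH].
  by apply: isprim_ext (isprim_cst a b 0) => x _; rewrite big_nil.
case: (boolP (P i)) => Pi.
  by apply: isprim_ext (isprimD (h i Pi) IH) => x _; rewrite big_cons Pi.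
by apply: isprim_ext IH => x _; rewrite big_cons (negbTE Pi).
Qed.

Lemma isprim_prim a b f : a <= b -> intg a b f -> isprim a b (fun t => rint a t f) f.
Proof. by move=> ab hf; split => // t _; rewrite rint_pt add0r. Qed.

Lemma ler_norm_rint a b f h e : intg a b f -> intg a b h ->
  (forall r, a <= r <= b -> `|f r| <= e * h r) -> `|rint a b f| <= e * rint a b h.
Proof.
move=> hf hh le; apply: le_trans (rint_norm hf) _.
by rewrite -rintZ//; apply: ler_rint => //; [exact: intg_norm|exact: intgZ].
Qed.

Lemma isprimM a b F f G g : a <= b -> isprim a b F f -> isprim a b G g ->
  isprim a b (fun x => F x * G x) (fun x => f x * G x + F x * g x).
Proof.
move=> ab hF hG; have cF := isprim_cont ab hF; have cG := isprim_cont ab hG.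
have [hf _] := hF; have [hg _] := hG.
have hfG : intg a b (fun x => f x * G x) by exact: intgM_cont.
have hFg : intg a b (fun x => F x * g x).
  by apply: eq_intg (intgM_cont hg cF) => x _; rewrite mulrC.
apply: (@isprimI _ _ _ _ (fun x => `|f x| + `|g x|)) => //.
- exact: intgD.
- by apply: intgD; exact: intg_norm.
move=> e e0 s sab.
have e2 : 0 < e / 2 by rewrite divr_gt0.
have [d1 d10 h1] := cF s sab _ e2; have [d2 d20 h2] := cG s sab _ e2.
exists (Num.min d1 d2); first by rewrite lt_min d10.
move=> x y ax xy yb; rewrite !lt_min => /andP[x1 x2] /andP[y1 y2].
have sub k : intg a b k -> intg x y k by exact: intg_sub.
have near r : x <= r <= y -> `|F r - F s| < e / 2 /\ `|G r - G s| < e / 2.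
  move=> /andP[xr ry].
  have rab : a <= r <= b by rewrite (le_trans ax)//= (le_trans ry).
  split; [apply: h1 => //|apply: h2 => //];
    rewrite ltr_distl; move: x1 x2 y1 y2; rewrite !ltr_distl; lra.
(* The error of the product rule only involves oscillations of F and G over [x, y], small by
   continuity, integrated against f and g. *)
have -> : F y * G y - F x * G x - rint x y (fun r => f r * G r + F r * g r) =
   rint x y (fun r => f r * (G y - G r) + g r * (F x - F r)).
  rewrite rintD; [|exact: sub|exact: sub].
  rewrite (@eq_rint _ _ _ (fun r => f r * (G y - G r) + g r * (F x - F r))
     (fun r => (G y * f r - f r * G r) + (F x * g r - F r * g r))); last by move=> r _; ring.
  rewrite rintD; [|by apply: sub; apply: intgB => //; exact: intgZ..].
  rewrite !rintB ?rintZ; try (by apply: sub => //; exact: intgZ).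
  rewrite -(isprim_diff hF ax xy yb) -(isprim_diff hG ax xy yb); ring.
apply: ler_norm_rint.
- apply: sub; apply: intgD; apply: intgM_cont => //; apply: contB => //; exact: cont_cst.
- by apply: sub; apply: intgD; exact: intg_norm.
move=> r rxy; have [Fr Gr] := near r rxy.
have [Fx _] : `|F x - F s| < e / 2 /\ `|G x - G s| < e / 2 by apply: near; rewrite lexx.
have [_ Gy] : `|F y - F s| < e / 2 /\ `|G y - G s| < e / 2 by apply: near; rewrite xy lexx.
apply: le_trans (ler_normD _ _) _; rewrite !normrM mulrDr mulrC [X in _ + X]mulrC.
apply: lerD; apply: ler_wpM2r => //.
- rewrite (_ : G y - G r = (G y - G s) - (G r - G s)); last by ring.
  apply: le_trans (ler_normB _ _) _; lra.
- rewrite (_ : F x - F r = (F x - F s) - (F r - F s)); last by ring.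
  apply: le_trans (ler_normB _ _) _; lra.
Qed.

(** The quadratic Taylor remainder is enough: |F y - F x|^2 is at most the oscillation of F times
    the integral of |f|, hence locally negligible with respect to it. Sine and cosine are the
    intended [h]. *)
Lemma isprim_comp a b F f (h k : R -> R) :
  (forall x y, `|k y - k x| <= `|y - x|) ->
  (forall x y, `|h y - h x - k x * (y - x)| <= (y - x) ^+ 2) ->
  a <= b -> isprim a b F f -> isprim a b (fun x => h (F x)) (fun x => k (F x) * f x).
Proof.
move=> klip hk ab hF; have cF := isprim_cont ab hF; have hf := hF.1.
have ck : cont a b (fun x => k (F x)).
  move=> s sab e e0; have [d d0 hd] := cF s sab e e0; exists d => // t tab ts.
  by apply: le_lt_trans (hd t tab ts); exact: klip.
have hkf : intg a b (fun x => k (F x) * f x).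
  by apply: eq_intg (intgM_cont hf ck) => x _; rewrite mulrC.
apply: (@isprimI _ _ _ _ (fun x => `|f x|)) => //; first exact: intg_norm.
move=> e e0 s sab.
have e2 : 0 < e / 4 by rewrite divr_gt0.
have [d d0 hd] := cF s sab _ e2; exists d => // x y ax xy yb xs ys.
have sub u : intg a b u -> intg x y u by exact: intg_sub.
have near r : x <= r <= y -> `|F r - F x| < e / 2.
  move=> /andP[xr ry].
  have ra : a <= r by exact: le_trans xr.
  have rb : r <= b by exact: le_trans yb.
  have Fr : `|F r - F s| < e / 4.
    apply: hd; rewrite ?ra//; move: xs ys; rewrite !ltr_distl; lra.
  have Fx : `|F x - F s| < e / 4 by apply: hd => //; rewrite ax (le_trans xy).
  rewrite (_ : F r - F x = (F r - F s) - (F x - F s)); last by ring.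
  apply: le_lt_trans (ler_normB _ _) _; lra.
have Fyx := isprim_diff hF ax xy yb.
have E1 : `|k (F x) * (F y - F x) - rint x y (fun r => k (F r) * f r)| <= e / 2 * rint x y (fun r => `|f r|).
  rewrite Fyx -rintZ; last exact: sub.
  rewrite -rintB; [|by apply: sub; exact: intgZ|exact: sub].
  apply: ler_norm_rint.
  - by apply: sub; apply: intgB => //; exact: intgZ.
  - by apply: sub; exact: intg_norm.
  move=> r /near Fr; rewrite -mulrBl normrM; apply: ler_wpM2r => //.
  by apply: le_trans (klip _ _) _; rewrite distrC ltW.
have E2 : (F y - F x) ^+ 2 <= e / 2 * rint x y (fun r => `|f r|).
  rewrite -[leLHS]ger0_norm ?sqr_ge0// expr2 normrM.
  apply: ler_pM => //; first by apply/ltW/near; rewrite xy lexx.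
  by rewrite Fyx; apply: rint_norm; exact: sub.
rewrite (_ : h (F y) - h (F x) - rint x y (fun x => k (F x) * f x) =
   (h (F y) - h (F x) - k (F x) * (F y - F x)) +
   (k (F x) * (F y - F x) - rint x y (fun r => k (F r) * f r))); last by ring.
apply: le_trans (ler_normD _ _) _; have := hk (F x) (F y); lra.
Qed.

Lemma sin_lip x y : `|sin y - sin x| <= `|y - x|.
Proof.
wlog xy : x y / x <= y => [h|].
  by have [/h//|/ltW/h] := leP x y; rewrite distrC [leRHS]distrC.
have [c _ ->] := @MVT_segment R sin cos x y xy (fun z _ => is_derive_sin z)
  (continuous_subspaceT (@continuous_sin R)).
by rewrite normrM ler_piMl// cos_max.
Qed.

Lemma cos_lip x y : `|cos y - cos x| <= `|y - x|.
Proof.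
have e z : cos z = sin (z + pi / 2) :> R by rewrite sinDpihalf.
rewrite !e; apply: le_trans (sin_lip _ _) _.
by rewrite (_ : _ - _ = y - x)//; ring.
Qed.

Lemma sin_taylor1 x y : `|sin y - sin x - cos x * (y - x)| <= (y - x) ^+ 2.
Proof.
have H (u v : R) : u <= v -> exists2 c, u <= c <= v & sin v - sin u = cos c * (v - u).
  move=> uv; have [c cuv ->] := @MVT_segment R sin cos u v uv (fun z _ => is_derive_sin z)
    (continuous_subspaceT (@continuous_sin R)).
  by exists c => //; move: cuv; rewrite in_itv.
have [c cxy ->] : exists2 c, `|c - x| <= `|y - x| & sin y - sin x = cos c * (y - x).
  have [xy|/ltW yx] := leP x y.
    have [c /andP[xc cy] ->] := H _ _ xy; exists c => //.
    by rewrite !ger0_norm ?subr_ge0// lerD2r.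
  have [c /andP[yc cx] E] := H _ _ yx; exists c; last by rewrite -opprB E; ring.
  by rewrite !ler0_norm ?subr_le0// lerN2 lerD2r.
rewrite -mulrBl -[leRHS]ger0_norm ?sqr_ge0// expr2 !normrM; apply: ler_wpM2r => //.
exact: le_trans (cos_lip _ _) _.
Qed.

Lemma cos_taylor1 x y : `|cos y - cos x - (- sin x) * (y - x)| <= (y - x) ^+ 2.
Proof.
have e z : cos z = sin (z + pi / 2) :> R by rewrite sinDpihalf.
have e' z : - sin z = cos (z + pi / 2) :> R by rewrite cosDpihalf.
rewrite !e (e' x); have := sin_taylor1 (x + pi / 2) (y + pi / 2).
rewrite (_ : y + pi / 2 - (x + pi / 2) = y - x)//; ring.
Qed.

Lemma isprim_sin a b F f : a <= b -> isprim a b F f ->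
  isprim a b (fun x => sin (F x)) (fun x => cos (F x) * f x).
Proof. exact: (isprim_comp cos_lip sin_taylor1). Qed.

Lemma isprim_cos a b F f : a <= b -> isprim a b F f ->
  isprim a b (fun x => cos (F x)) (fun x => - sin (F x) * f x).
Proof.
apply: (@isprim_comp _ _ _ _ cos (fun x => - sin x)) => // [x y|]; last exact: cos_taylor1.
by rewrite -opprD normrN; exact: sin_lip.
Qed.

Lemma isprim_lin a b k : isprim a b (fun x => k * x) (fun=> k).
Proof. by apply: isprim_ext (isprimZ k (isprim_id a b)) => x _; rewrite ?mulr1. Qed.

End Primitives.

(** * Square-integrable functions *)

Section SquareIntegrable.
Variable R : realType.
Local Notation leb := (@lebesgue_measure R).
Implicit Types (a b c d e s t x y : R) (f g h F G H : R -> R).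

Lemma L2_sq a b f : L2 a b f -> intg a b (fun x => f x ^+ 2).
Proof.
move=> [mf ff]; apply/integrableP; split.
  by apply/measurable_EFinP; exact: measurable_funX.
move: ff; congr (_ < _)%E; apply: eq_integral => x _ /=.
by rewrite ger0_norm ?sqr_ge0.
Qed.

Lemma L2I a b f : measurable_fun (Icc a b) f -> intg a b (fun x => f x ^+ 2) -> L2 a b f.
Proof.
move=> mf /integrableP[_ ff]; split => //.
move: ff; congr (_ < _)%E; apply: eq_integral => x _ /=.
by rewrite ger0_norm ?sqr_ge0.
Qed.

Lemma L2M_intg a b f g : L2 a b f -> L2 a b g -> intg a b (fun x => f x * g x).
Proof.
move=> hf hg; apply: (@intg_dom _ _ _ _ (fun x => f x ^+ 2 + g x ^+ 2)).
- by apply: measurable_funM; [exact: hf.1|exact: hg.1].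
- by apply: intgD; exact: L2_sq.
move=> x _; rewrite normrM -(real_normK (num_real (f x))) -(real_normK (num_real (g x))).
have := sqr_ge0 (`|f x| - `|g x|); have := normr_ge0 (f x); have := normr_ge0 (g x); nra.
Qed.

Lemma L2_cont a b f : cont a b f -> L2 a b f.
Proof. by move=> cf; apply: L2I; [exact: cont_measurable|exact/intg_cont/contX]. Qed.

Lemma L2_intg a b f : L2 a b f -> intg a b f.
Proof.
move=> hf; have := L2M_intg hf (L2_cont (@cont_cst R a b 1)).
by apply: eq_intg => x _; rewrite mulr1.
Qed.

Lemma L2D a b f g : L2 a b f -> L2 a b g -> L2 a b (fun x => f x + g x).
Proof.
move=> hf hg; apply: L2I; first by apply: measurable_funD; [exact: hf.1|exact: hg.1].
apply: (@eq_intg _ _ _ (fun x => (f x ^+ 2 + 2 * (f x * g x)) + g x ^+ 2)).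
  by move=> x _; ring.
by apply: intgD; [apply: intgD; [exact: L2_sq|exact/intgZ/L2M_intg]|exact: L2_sq].
Qed.

Lemma L2Mb a b f g M : L2 a b f -> measurable_fun (Icc a b) g ->
  (forall x, a <= x <= b -> `|g x| <= M) -> L2 a b (fun x => g x * f x).
Proof.
move=> hf mg gM; apply: L2I; first by apply: measurable_funM => //; exact: hf.1.
apply: (@eq_intg _ _ _ (fun x => f x ^+ 2 * g x ^+ 2)); first by move=> x _; ring.
apply: (@intgM_bd _ _ _ _ _ (M ^+ 2)).
- exact: L2_sq.
- exact: measurable_funX.
by move=> x /gM h; rewrite normrX ler_pXn2r// nnegrE ?(le_trans _ h).
Qed.

Lemma L2Mc a b f g : L2 a b f -> cont a b g -> L2 a b (fun x => g x * f x).
Proof.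
move=> hf cg; have [M _ gM] := cont_bounded cg.
by apply: (L2Mb hf _ gM); exact: cont_measurable.
Qed.

Lemma L2Z a b k f : L2 a b f -> L2 a b (fun x => k * f x).
Proof. by move=> hf; apply: L2Mc => //; exact: cont_cst. Qed.

Lemma eq_L2 a b f g : (forall x, a <= x <= b -> f x = g x) -> L2 a b f -> L2 a b g.
Proof.
move=> fg hf; apply: L2I; last by apply: eq_intg (L2_sq hf) => x /fg ->.
by apply: eq_measurable_fun hf.1 => x; rewrite inE => /fg ->.
Qed.

Lemma L2N a b f : L2 a b f -> L2 a b (fun x => - f x).
Proof. by move=> /(L2Z (-1)); apply: eq_L2 => x _; rewrite mulN1r. Qed.

Lemma L2B a b f g : L2 a b f -> L2 a b g -> L2 a b (fun x => f x - g x).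
Proof. by move=> hf /L2N hg; exact: L2D. Qed.

Lemma L2_sum a b (I : Type) (r : seq I) (P : pred I) (f : I -> R -> R) :
  (forall i, P i -> L2 a b (f i)) -> L2 a b (fun x => \sum_(i <- r | P i) f i x).
Proof.
move=> cf; elim: r => [|i r IH].
  by apply: eq_L2 (L2_cont (cont_cst 0)) => x _; rewrite big_nil.
case: (boolP (P i)) => Pi.
  by apply: eq_L2 (L2D (cf i Pi) IH) => x _; rewrite big_cons Pi.
by apply: eq_L2 IH => x _; rewrite big_cons (negbTE Pi).
Qed.

Lemma L2_sub a b c d f : a <= c -> d <= b -> L2 a b f -> L2 c d f.
Proof.
move=> ac db hf; apply: L2I; last exact: intg_sub (L2_sq hf).
apply: measurable_funS hf.1 => //; first exact: measurable_Icc.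
move=> x; rewrite /Icc/= => /andP[cx xd]; apply/andP; split; [exact: le_trans cx|exact: le_trans db].
Qed.

Definition ip a b f g := rint a b (fun x => f x * g x).

Lemma ipC a b f g : ip a b f g = ip a b g f.
Proof. by apply: eq_rint => x _; rewrite mulrC. Qed.

Lemma eq_ip a b f g f' g' : (forall x, a <= x <= b -> f x = f' x) ->
  (forall x, a <= x <= b -> g x = g' x) -> ip a b f g = ip a b f' g'.
Proof. by move=> ff gg; apply: eq_rint => x xab; rewrite ff// gg. Qed.

Lemma ipDl a b f g h : L2 a b f -> L2 a b g -> L2 a b h ->
  ip a b (fun x => f x + g x) h = ip a b f h + ip a b g h.
Proof.
move=> hf hg hh; rewrite /ip -rintD; [|exact: L2M_intg..].
by apply: eq_rint => x _; rewrite mulrDl.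
Qed.

Lemma ipZl a b k f h : L2 a b f -> L2 a b h -> ip a b (fun x => k * f x) h = k * ip a b f h.
Proof.
move=> hf hh; rewrite /ip -rintZ; last exact: L2M_intg.
by apply: eq_rint => x _; rewrite mulrA.
Qed.

Lemma ipNl a b f h : L2 a b f -> L2 a b h -> ip a b (fun x => - f x) h = - ip a b f h.
Proof.
move=> hf hh; rewrite -mulN1r -ipZl//.
by apply: eq_rint => x _; rewrite mulN1r.
Qed.

Lemma ipBl a b f g h : L2 a b f -> L2 a b g -> L2 a b h ->
  ip a b (fun x => f x - g x) h = ip a b f h - ip a b g h.
Proof. by move=> hf hg hh; rewrite ipDl ?ipNl//; exact: L2N. Qed.

Lemma ipDr a b f g h : L2 a b f -> L2 a b g -> L2 a b h ->
  ip a b h (fun x => f x + g x) = ip a b h f + ip a b h g.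
Proof. by move=> hf hg hh; rewrite ipC ipDl// ![ip a b _ h]ipC. Qed.

Lemma ipZr a b k f h : L2 a b f -> L2 a b h -> ip a b h (fun x => k * f x) = k * ip a b h f.
Proof. by move=> hf hh; rewrite ipC ipZl// ipC. Qed.

Lemma ipBr a b f g h : L2 a b f -> L2 a b g -> L2 a b h ->
  ip a b h (fun x => f x - g x) = ip a b h f - ip a b h g.
Proof. by move=> hf hg hh; rewrite ipC ipBl// ![ip a b _ h]ipC. Qed.

Lemma ip_suml a b (I : Type) (r : seq I) (P : pred I) (f : I -> R -> R) h :
  (forall i, P i -> L2 a b (f i)) -> L2 a b h ->
  ip a b (fun x => \sum_(i <- r | P i) f i x) h = \sum_(i <- r | P i) ip a b (f i) h.
Proof.
move=> hf hh; elim: r => [|i r IH].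
  rewrite big_nil /ip (@eq_rint _ _ _ _ (fun=> 0 * 0)) ?rintZ ?mul0r//; first exact: intg_cst.
  by move=> x _; rewrite big_nil !mul0r.
rewrite big_cons; case: (boolP (P i)) => Pi; last first.
  by rewrite -IH; apply: eq_ip => // x _; rewrite big_cons (negbTE Pi).
rewrite -IH -ipDl//; [|exact: hf|exact: L2_sum].
by apply: eq_ip => // x _; rewrite big_cons Pi.
Qed.

Lemma ip_ge0 a b f : 0 <= ip a b f f.
Proof. by apply: rint_ge0 => x _; rewrite -expr2 sqr_ge0. Qed.

Lemma L2norm_ge0 a b f : 0 <= L2norm a b f.
Proof. exact: sqrtr_ge0. Qed.

Lemma L2norm2 a b f : L2norm a b f ^+ 2 = ip a b f f.
Proof.
rewrite sqr_sqrtr; last by apply: rint_ge0 => x _; exact: sqr_ge0.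
by apply: eq_rint => x _; rewrite expr2.
Qed.

Lemma eq_L2norm a b f g : (forall x, a <= x <= b -> f x = g x) -> L2norm a b f = L2norm a b g.
Proof. by move=> fg; congr Num.sqrt; apply: eq_rint => x /fg ->. Qed.

Lemma ip_CauchySchwarz2 a b f g : L2 a b f -> L2 a b g -> ip a b f g ^+ 2 <= ip a b f f * ip a b g g.
Proof.
move=> hf hg.
have Q k : 0 <= ip a b f f - 2 * k * ip a b f g + k ^+ 2 * ip a b g g.
  have := ip_ge0 a b (fun x => f x - k * g x).
  rewrite ipBl ?ipBr ?ipZl ?ipZr ?[ip a b g f]ipC//; try by [apply: L2Z|apply: L2B => //; apply: L2Z].
  by move=> h; apply: (le_trans h); apply: le_eq; ring.
have := ip_ge0 a b g; rewrite le_eqVlt => /orP[/eqP g0|g0]; last first.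
  have := Q (ip a b f g / ip a b g g).
  rewrite (_ : _ + _ = (ip a b f f * ip a b g g - ip a b f g ^+ 2) / ip a b g g).
    by rewrite pmulr_lge0 ?invr_gt0// subr_ge0.
  by field; rewrite gt_eqF.
rewrite -g0 mulr0; have [->|n0] := eqVneq (ip a b f g) 0; first by rewrite expr0n.
(* The quadratic in k is affine here; this k would give it the value -1. *)
have := Q ((ip a b f f + 1) / (2 * ip a b f g)).
rewrite -g0 mulr0 addr0 (_ : _ - _ = -1); last by field.
by rewrite ler0N1.
Qed.

Lemma ip_CauchySchwarz a b f g : L2 a b f -> L2 a b g -> `|ip a b f g| <= L2norm a b f * L2norm a b g.
Proof.
move=> hf hg; rewrite -ler_sqr ?nnegrE ?mulr_ge0 ?L2norm_ge0//.
by rewrite real_normK ?num_real// exprMn !L2norm2 ip_CauchySchwarz2.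
Qed.

Lemma L2norm_triangle a b f g : L2 a b f -> L2 a b g ->
  L2norm a b (fun x => f x + g x) <= L2norm a b f + L2norm a b g.
Proof.
move=> hf hg; rewrite -ler_sqr ?nnegrE ?addr_ge0 ?L2norm_ge0//.
rewrite L2norm2 ipDl ?ipDr ?[ip a b g f]ipC//; try exact: L2D.
have := ip_CauchySchwarz hf hg; have := ler_norm (ip a b f g).
by rewrite sqrrD !L2norm2 -mulr_natr; lra.
Qed.

Lemma L2normZ a b k f : L2 a b f -> L2norm a b (fun x => k * f x) = `|k| * L2norm a b f.
Proof.
move=> hf; rewrite -sqrtr_sqr -sqrtrM ?sqr_ge0//; congr Num.sqrt.
rewrite -rintZ; last exact: L2_sq.
by apply: eq_rint => x _; rewrite exprMn.
Qed.

Lemma L2normN a b f : L2norm a b (fun x => - f x) = L2norm a b f.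
Proof. by congr Num.sqrt; apply: eq_rint => x _; rewrite sqrrN. Qed.

Lemma L2norm_dom a b f g M : L2 a b f -> L2 a b g -> 0 <= M ->
  (forall x, a <= x <= b -> `|f x| <= M * `|g x|) -> L2norm a b f <= M * L2norm a b g.
Proof.
move=> hf hg M0 fg; rewrite -[M in leRHS]ger0_norm// -L2normZ//.
apply: ler_wsqrtr; apply: ler_rint; [exact: L2_sq|exact/L2_sq/L2Z|].
move=> x /fg h; rewrite -[leLHS]ger0_norm ?sqr_ge0// -[leRHS]ger0_norm ?sqr_ge0// !normrX.
by rewrite ler_pXn2r// ?nnegrE// normrM (ger0_norm M0).
Qed.

Lemma norm1_le_L2norm a b f : a <= b -> L2 a b f ->
  rint a b (fun x => `|f x|) <= Num.sqrt (b - a) * L2norm a b f.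
Proof.
move=> ab hf; have hn : L2 a b (fun x => `|f x|).
  apply: L2I; first by apply: measurableT_comp => //; exact: hf.1.
  by apply: eq_intg (L2_sq hf) => x _; rewrite real_normK ?num_real.
have := ip_CauchySchwarz (L2_cont (@cont_cst R a b 1)) hn.
rewrite /ip (@eq_rint _ _ _ _ (fun x => `|f x|)); last by move=> x _; rewrite mul1r.
rewrite {1}/L2norm expr1n rint_cst// mul1r => /(le_trans (ler_norm _)).
rewrite (_ : L2norm a b (fun x => `|f x|) = L2norm a b f)//.
by congr Num.sqrt; apply: eq_rint => x _; rewrite real_normK ?num_real.
Qed.

Lemma rint_dct a b (f_ : nat -> R -> R) f g :
  (forall n, measurable_fun (Icc a b) (f_ n)) -> measurable_fun (Icc a b) f -> intg a b g ->
  {ae leb, forall x, a <= x <= b -> (fun n => f_ n x) @ \oo --> f x} ->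
  (forall n x, a <= x <= b -> `|f_ n x| <= g x) ->
  (fun n => rint a b (f_ n)) @ \oo --> rint a b f.
Proof.
move=> mf_ mf hg cvf fg.
have [] := @dominated_convergence _ _ R leb (Icc a b) (measurable_Icc a b)
   (fun n => EFin \o f_ n) (EFin \o f) (EFin \o g).
- by move=> n; apply/measurable_EFinP; exact: mf_.
- exact/measurable_EFinP.
- move: cvf; apply: negligibleS => x /= nx h; apply: nx => xab.
  by apply: cvg_EFin; [near=> n|exact: h].
- exact: hg.
- by apply: aeW => x n xab /=; rewrite lee_fin; exact: fg.
move=> hf _; rewrite /rint /Rintegral => h.
apply: fine_cvg; rewrite fineK//; exact: integrable_fin_num hf.
Unshelve. all: by end_near.
Qed.

End SquareIntegrable.

(** * Completeness of the sine basis *)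

Section SineBasis.
Variable R : realType.
Local Notation leb := (@lebesgue_measure R).
Implicit Types (a b c d e s t x y : R) (f g h F G H : R -> R).

Lemma sin_natpi (j : nat) : sin (j%:R * pi) = 0 :> R.
Proof.
elim: j => [|j IH]; first by rewrite mul0r sin0.
by rewrite -natr1 mulrDl mul1r sinDpi IH oppr0.
Qed.

Lemma cos_natpi (j : nat) : cos (j%:R * pi) = (-1) ^+ j :> R.
Proof.
elim: j => [|j IH]; first by rewrite mul0r cos0.
by rewrite -natr1 mulrDl mul1r cosDpi IH exprS mulN1r.
Qed.

Lemma phi_at0 (j : nat) : phi j 0 = 0 :> R.
Proof. by rewrite /phi mulr0 sin0 mulr0. Qed.

Lemma phi_at1 (j : nat) : phi j 1 = 0 :> R.
Proof. by rewrite /phi mulr1 sin_natpi mulr0. Qed.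

Definition dphi (j : nat) x : R := Num.sqrt 2 * (j%:R * pi) * cos (j%:R * pi * x).

Lemma isprim_phi a b (j : nat) : a <= b -> isprim a b (phi j) (dphi j).
Proof.
move=> ab; apply: isprim_ext (isprimZ (Num.sqrt 2) (isprim_sin ab (isprim_lin a b (j%:R * pi)))) => x _ //.
by rewrite /dphi; ring.
Qed.

Lemma isprim_dphi a b (j : nat) : a <= b -> isprim a b (dphi j) (fun x => - lam R j * phi j x).
Proof.
move=> ab; apply: isprim_ext (isprimZ (Num.sqrt 2 * (j%:R * pi)) (isprim_cos ab (isprim_lin a b (j%:R * pi)))) => x _ //.
by rewrite /lam /phi; ring.
Qed.

Lemma cont_phi a b (j : nat) : cont a b (phi j).
Proof.
apply: continuous_cont => x.
apply: (@continuousM _ _ (cst (Num.sqrt 2)) (fun x => sin (j%:R * pi * x))); first exact: cst_continuous.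
apply: (@continuous_comp _ _ _ (fun x => j%:R * pi * x) sin); last exact: continuous_sin.
by apply: (@continuousM _ _ (cst (j%:R * pi)) id); [exact: cst_continuous|exact: id].
Qed.

Lemma L2_phi a b (j : nat) : L2 a b (phi j).
Proof. by apply: L2_cont; exact: cont_phi. Qed.

Lemma phi_bound (j : nat) x : `|phi j x| <= 2 :> R.
Proof.
rewrite normrM ger0_norm ?sqrtr_ge0//.
have s2 : Num.sqrt 2 <= 2 :> R.
  by rewrite -ler_sqr ?nnegrE ?sqrtr_ge0// sqr_sqrtr//; lra.
apply: le_trans (_ : 2 * 1 <= _); last by rewrite mulr1.
by apply: ler_pM => //; exact: sin_max.
Qed.

Lemma rint_cosl a b (k : R) : a <= b -> k != 0 ->
  rint a b (fun x => cos (k * x)) = (sin (k * b) - sin (k * a)) / k.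
Proof.
move=> ab k0; have H := isprim_sin ab (isprim_lin a b k).
have := isprim_diff H (lexx a) ab (lexx b) => ->.
rewrite (@eq_rint _ _ _ (fun x => cos (k * x) * k) (fun x => k * cos (k * x))); last by move=> x _; rewrite mulrC.
rewrite rintZ; first by field.
by apply: intg_cont; apply: continuous_cont => x; apply: (@continuous_comp _ _ _ (fun x => k * x) cos);
  [apply: (@continuousM _ _ (cst k) id); [exact: cst_continuous|exact: id]|exact: continuous_cos].
Qed.

Lemma rint_cos_natpi (j : nat) : rint 0 1 (fun x => cos (j%:R * pi * x)) = (j == 0%N)%:R :> R.
Proof.
have [->|j0] := eqVneq j 0%N.
  rewrite (@eq_rint _ _ _ _ (fun=> 1)); first by rewrite rint_cst// subr0 mulr1.
  by move=> x _; rewrite !mul0r cos0.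
rewrite rint_cosl ?mulf_neq0 ?pnatr_eq0 ?(gt_eqF (pi_gt0 R))//.
by rewrite mulr0 sin0 mulr1 sin_natpi subr0 mul0r.
Qed.

Lemma cont_cosl a b k : cont a b (fun x => cos (k * x)).
Proof.
by apply: continuous_cont => x; apply: (@continuous_comp _ _ _ (fun x => k * x) cos);
  [apply: (@continuousM _ _ (cst k) id); [exact: cst_continuous|exact: id]|exact: continuous_cos].
Qed.

Lemma cont_sinl a b k : cont a b (fun x => sin (k * x)).
Proof.
by apply: continuous_cont => x; apply: (@continuous_comp _ _ _ (fun x => k * x) sin);
  [apply: (@continuousM _ _ (cst k) id); [exact: cst_continuous|exact: id]|exact: continuous_sin].
Qed.

Lemma cosD_natpi (j k : nat) x :
  cos (j%:R * pi * x) * cos (k%:R * pi * x) =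
  2^-1 * (cos (`|j - k|%N%:R * pi * x) + cos ((j + k)%:R * pi * x)).
Proof.
have -> : cos (`|j - k|%N%:R * pi * x) = cos (j%:R * pi * x - k%:R * pi * x).
  have [jk|/ltnW kj] := leqP j k.
    by rewrite distnEr// natrB// -cosN; congr cos; ring.
  by rewrite distnEl// natrB//; congr cos; ring.
have -> : (j + k)%:R * pi * x = j%:R * pi * x + k%:R * pi * x by rewrite natrD; ring.
by rewrite cosB cosD; field.
Qed.

Lemma sinD_natpi (j k : nat) x :
  sin (j%:R * pi * x) * sin (k%:R * pi * x) =
  2^-1 * (cos (`|j - k|%N%:R * pi * x) - cos ((j + k)%:R * pi * x)).
Proof.
have -> : cos (`|j - k|%N%:R * pi * x) = cos (j%:R * pi * x - k%:R * pi * x).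
  have [jk|/ltnW kj] := leqP j k.
    by rewrite distnEr// natrB// -cosN; congr cos; ring.
  by rewrite distnEl// natrB//; congr cos; ring.
have -> : (j + k)%:R * pi * x = j%:R * pi * x + k%:R * pi * x by rewrite natrD; ring.
by rewrite cosB cosD; field.
Qed.

Lemma ip_phi (j k : nat) : (0 < j)%N -> ip 0 1 (phi j) (phi k) = (j == k)%:R :> R.
Proof.
move=> j0; rewrite /ip (@eq_rint _ _ _ _
  (fun x => cos (`|j - k|%N%:R * pi * x) - cos ((j + k)%:R * pi * x))); last first.
  move=> x _; by rewrite /phi mulrACA -expr2 sqr_sqrtr// sinD_natpi; field.
rewrite rintB; [|exact/intg_cont/cont_cosl..].
by rewrite !rint_cos_natpi distn_eq0 addn_eq0 (gtn_eqF j0) subr0.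
Qed.

Lemma ip_dphi (j k : nat) : (0 < j)%N -> ip 0 1 (dphi j) (dphi k) = (j == k)%:R * lam R j :> R.
Proof.
move=> j0; rewrite /ip (@eq_rint _ _ _ _
  (fun x => ((j%:R * pi) * (k%:R * pi)) * (cos (`|j - k|%N%:R * pi * x) + cos ((j + k)%:R * pi * x)))); last first.
  move=> x _; rewrite /dphi.
  transitivity (Num.sqrt 2 ^+ 2 * ((j%:R * pi) * (k%:R * pi)) * (cos (j%:R * pi * x) * cos (k%:R * pi * x))).
    by ring.
  by rewrite sqr_sqrtr// cosD_natpi; field.
rewrite rintZ; last by apply: intgD; exact/intg_cont/cont_cosl.
rewrite rintD; [|exact/intg_cont/cont_cosl..].
rewrite !rint_cos_natpi distn_eq0 addn_eq0 (gtn_eqF j0) addr0.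
by have [->|] := eqVneq j k; rewrite ?mulr1 ?mul1r ?mulr0 ?mul0r// /lam expr2.
Qed.

End SineBasis.

(** * Density of the sines in L^2(0, 1) *)

Section SineCompleteness.
Variable R : realType.
Local Notation leb := (@lebesgue_measure R).
Implicit Types (a b c d e s t x y : R) (f g h m F G H : R -> R).

Lemma L2_dct a b (f_ : nat -> R -> R) f G :
  (forall n, L2 a b (f_ n)) -> L2 a b f -> intg a b (fun x => G x ^+ 2) ->
  (forall n x, a <= x <= b -> `|f x - f_ n x| <= G x) ->
  {ae leb, forall x, a <= x <= b -> (fun n => f_ n x) @ \oo --> f x} ->
  forall e, 0 < e -> exists n, L2norm a b (fun x => f x - f_ n x) < e.
Proof.
move=> hf_ hf hG fG cvf e e0.
have L n : L2 a b (fun x => f x - f_ n x) by exact: L2B.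
have : (fun n => rint a b (fun x => (f x - f_ n x) ^+ 2)) @ \oo --> rint a b (fun=> 0 : R).
  apply: (@rint_dct _ _ _ _ _ (fun x => G x ^+ 2)) => //.
  - by move=> n; apply: intg_measurable; exact: L2_sq.
  - by move: cvf; apply: negligibleS => x /= nx h; apply: nx => /h {}h;
    have := cvgM (cvgB (cvg_cst (f x)) h) (cvgB (cvg_cst (f x)) h); rewrite subrr mulr0; exact.
  - by move=> n x xab; have h := fG n x xab; rewrite normrX ler_pXn2r// ?nnegrE ?(le_trans _ h).
have r0 : rint a b (fun=> 0) = 0 :> R by rewrite /rint Rintegral_cst// mul0r.
rewrite r0 => /cvgrPdist_lt /(_ (e ^+ 2)); rewrite exprn_gt0// => /(_ isT)[N _ /(_ N)].
rewrite /= leqnn => /(_ isT); rewrite sub0r normrN => h; exists N.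
rewrite -ltr_sqr ?nnegrE ?L2norm_ge0 ?ltW// /L2norm sqr_sqrtr; last first.
  by apply: rint_ge0 => x _; exact: sqr_ge0.
exact: le_lt_trans (ler_norm _) h.
Qed.

(** Inductive, so that stability under multipliers goes by induction on the combination; the index 0
    adds only the zero function. *)
Inductive sspan : (R -> R) -> Prop :=
| sspan_phi (j : nat) : sspan (phi j)
| sspan_0 : sspan (fun=> 0)
| sspan_lin k f g : sspan f -> sspan g -> sspan (fun x => k * f x + g x).

Lemma eq_sspan f g : (forall x, f x = g x) -> sspan f -> sspan g.
Proof. by move=> /funext ->. Qed.

Lemma sspan_L2 f : sspan f -> L2 0 1 f.
Proof.
elim=> [j||k {}f g _ hf _ hg]; first exact: L2_phi.
- exact/L2_cont/cont_cst.
- by apply: L2D => //; exact: L2Z.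
Qed.

(** Multipliers of the span. They form an algebra, which contains cos(pi x) because cos(pi x) phi_j
    is the half-sum of the two neighbouring sines; all polynomials in cos(pi x) are thus
    available. *)
Definition smul m := forall f, sspan f -> sspan (fun x => m x * f x).

Lemma smul_cst k : smul (fun=> k).
Proof. by move=> f hf; apply: eq_sspan (sspan_lin k hf sspan_0) => x; rewrite addr0. Qed.

Lemma smulD m h : smul m -> smul h -> smul (fun x => m x + h x).
Proof.
move=> hm hh f hf; apply: eq_sspan (sspan_lin 1 (hm f hf) (hh f hf)) => x.
by rewrite mul1r mulrDl.
Qed.

Lemma smulM m h : smul m -> smul h -> smul (fun x => m x * h x).
Proof.
by move=> hm hh f hf; apply: eq_sspan (hm _ (hh _ hf)) => x; rewrite mulrA.
Qed.

Lemma smulX m n : smul m -> smul (fun x => m x ^+ n).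
Proof.
move=> hm; elim: n => [|n IH]; first exact: smul_cst.
by move=> f hf; apply: eq_sspan (smulM hm IH hf) => x; rewrite exprS.
Qed.

Lemma smul_cos : smul (fun x => cos (pi * x)).
Proof.
move=> f; elim=> [j||k {}f g _ hf _ hg].
- case: j => [|j].
    by apply: eq_sspan sspan_0 => x; rewrite /phi !mul0r sin0 !mulr0.
  apply: eq_sspan (sspan_lin (2^-1) (sspan_phi j.+2) (smul_cst (2^-1) (sspan_phi j))) => x.
  rewrite /phi.
  have -> : j.+2%:R * pi * x = j.+1%:R * pi * x + pi * x by rewrite -(natr1 j.+1); ring.
  have -> : j%:R * pi * x = j.+1%:R * pi * x - pi * x by rewrite -(natr1 j); ring.
  by rewrite sinD sinB; field.
- by apply: eq_sspan sspan_0 => x; rewrite mulr0.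
- by apply: eq_sspan (sspan_lin k hf hg) => x; ring.
Qed.

(* Membership in the L^2-closure of the span of the sines. *)
Definition sapp f := forall e, 0 < e -> exists2 h, sspan h & L2norm 0 1 (fun x => f x - h x) < e.

Lemma sapp_limit f : L2 0 1 f ->
  (forall e, 0 < e -> exists g, [/\ L2 0 1 g, sapp g & L2norm 0 1 (fun x => f x - g x) < e]) ->
  sapp f.
Proof.
move=> hf H e e0; have e2 : 0 < e / 2 by rewrite divr_gt0.
have [g [hg sg fg]] := H _ e2; have [h sh gh] := sg _ e2; exists h => //.
have hh := sspan_L2 sh.
rewrite (@eq_L2norm _ _ _ _ (fun x => (f x - g x) + (g x - h x))); last by move=> x _; ring.
by apply: le_lt_trans (L2norm_triangle _ _) _; [exact: L2B|exact: L2B|lra].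
Qed.

Lemma sapp_lin k f g : L2 0 1 f -> L2 0 1 g -> sapp f -> sapp g -> sapp (fun x => k * f x + g x).
Proof.
move=> hf hg sf sg e e0.
have e1 : 0 < e / 2 / (`|k| + 1) by rewrite !divr_gt0// ltr_wpDl.
have e2 : 0 < e / 2 by rewrite divr_gt0.
have [f' sf' ff'] := sf _ e1; have [g' sg' gg'] := sg _ e2.
exists (fun x => k * f' x + g' x); first exact: sspan_lin.
have hf' := sspan_L2 sf'; have hg' := sspan_L2 sg'.
rewrite (@eq_L2norm _ _ _ _ (fun x => k * (f x - f' x) + (g x - g' x))); last by move=> x _; ring.
have hff : L2 0 1 (fun x => f x - f' x) by exact: L2B.
apply: le_lt_trans (L2norm_triangle _ _) _; [exact: L2Z|exact: L2B|].
rewrite L2normZ//.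
have : `|k| * L2norm 0 1 (fun x => f x - f' x) <= e / 2.
  apply: le_trans (_ : (`|k| + 1) * L2norm 0 1 (fun x => f x - f' x) <= _).
    by apply: ler_wpM2r; [exact: L2norm_ge0|rewrite lerDl].
  by move: ff'; rewrite ltr_pdivlMr ?ltr_wpDl// mulrC => /ltW.
lra.
Qed.

Lemma sapp_sspan f : sspan f -> sapp f.
Proof.
move=> sf e e0; exists f => //.
rewrite (@eq_L2norm _ _ _ _ (fun=> 0)); last by move=> x _; rewrite subrr.
by rewrite /L2norm (@eq_rint _ _ _ _ (fun=> 0)) ?rint_cst ?mul0r ?sqrtr0// => x _; rewrite expr0n.
Qed.

Lemma sapp_sum (N : nat) (f : nat -> R -> R) : (forall i, L2 0 1 (f i)) -> (forall i, (i < N)%N -> sapp (f i)) ->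
  sapp (fun x => \sum_(i < N) f i x).
Proof.
move=> hf; elim: N => [|N IH] sf.
  by rewrite (_ : (fun x => _) = (fun=> 0)); [exact/sapp_sspan/sspan_0|apply/funext => x; rewrite big_ord0].
rewrite (_ : (fun x => _) = (fun x => 1 * f N x + \sum_(i < N) f i x)); last first.
  by apply/funext => x; rewrite big_ord_recr /= mul1r addrC.
by apply: sapp_lin; [exact: hf|exact: L2_sum|exact: sf|apply: IH => i iN; apply: sf; exact: ltnW].
Qed.

Definition stp c x : R := (x < c)%R%:R.

Lemma measurable_stp c D : measurable_fun D (stp c).
Proof.
apply: measurable_funTS.
rewrite (_ : stp c = \1_(`]-oo, c[%classic)); first exact: measurable_indic.
by apply/funext => x; rewrite indicE /stp mem_setE in_itv.
Qed.

Lemma stp01 c x : 0 <= stp c x <= 1.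
Proof. by rewrite /stp; case: (x < c); rewrite ?lexx ler01. Qed.

Lemma stp_bound c x : `|stp c x| <= 1.
Proof. by rewrite /stp normr_nat; case: (x < c); rewrite ?lexx ?ler01. Qed.

Lemma L2_phi1_mul a b h M : measurable_fun (Icc a b) h -> (forall x, a <= x <= b -> `|h x| <= M) ->
  L2 a b (fun x => phi 1 x * h x).
Proof.
move=> mh hM; apply: (@eq_L2 _ _ _ (fun x => h x * phi 1 x)); first by move=> x _; rewrite mulrC.
by apply: L2Mb mh hM; exact: L2_phi.
Qed.

Lemma one_sub_expn_ge (a : R) (m : nat) : 0 <= a <= 1 -> 1 - m%:R * a <= (1 - a) ^+ m.
Proof.
move=> /andP[a0 a1]; elim: m => [|m IH]; first by rewrite mul0r subr0 expr0.
rewrite exprS; apply: le_trans (_ : (1 - a) * (1 - m%:R * a) <= _).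
  rewrite -natr1; have : 0 <= m%:R * a * a by rewrite !mulr_ge0.
  lra.
by apply: ler_wpM2l => //; rewrite subr_ge0.
Qed.

(** From (1 + a)^m >= m a and (1 - a)^m (1 + a)^m <= 1. Together with the Bernoulli inequality
    above, it decides the limit of (1 - y^n)^(2^n) on either side of 1/2. *)
Lemma one_sub_expn_le (a : R) (m : nat) : 0 <= a <= 1 -> (1 - a) ^+ m * (m%:R * a) <= 1.
Proof.
move=> /andP[a0 a1]; have : m%:R * a <= (1 + a) ^+ m.
  elim: m => [|m IH]; first by rewrite mul0r expr0.
  rewrite exprS -natr1 mulrDl mul1r [X in _ <= X]mulrDl mul1r; apply: lerD => //.
  by rewrite ler_peMr// exprn_ege1// lerDl.
move=> h; apply: le_trans (_ : (1 - a) ^+ m * (1 + a) ^+ m <= _).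
  by apply: ler_wpM2l => //; rewrite exprn_ge0// subr_ge0.
rewrite -exprMn; apply: exprn_ile1; [rewrite mulr_ge0 ?subr_ge0// addr_ge0//|].
by have := mulr_ge0 a0 a0; lra.
Qed.

(* Polynomials in cos (pi x) approximating a step function; hence phi_1 times a step is in the closed span. *)
Lemma step_poly_cvg (y : R) : 0 <= y <= 1 -> y != 2^-1 ->
  (fun n => (1 - y ^+ n) ^+ (2 ^ n)) @ \oo --> ((y < 2^-1)%R%:R : R).
Proof.
move=> /andP[y0 y1] yn.
have yn1 n : 0 <= y ^+ n <= 1 by rewrite exprn_ge0//= exprn_ile1.
(* The quantity m a of the two preceding bounds is (2 y)^n: it tends to 0 for y < 1/2 and to
   infinity for y > 1/2. *)
have pw n : (2 ^ n)%:R * y ^+ n = (2 * y) ^+ n :> R by rewrite natrX exprMn.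
have [yl|yg] := ltP y 2^-1.
  apply/subr_cvg0.
  apply: (@squeeze_cvgr _ _ _ _ (fun n => - (2 * y) ^+ n) (fun=> 0)).
  - near=> n; rewrite -pw; have := one_sub_expn_ge (2 ^ n) (yn1 n) => h.
    have h2 : (1 - y ^+ n) ^+ (2 ^ n) <= 1.
      by have /andP[h3 h4] := yn1 n; apply: exprn_ile1; lra.
    have -> : (true%:R : R) = 1 by [].
    by apply/andP; split; lra.
  - rewrite -oppr0; apply: cvgN; apply: cvg_expr.
    by rewrite ger0_norm ?mulr_ge0//; lra.
  - exact: cvg_cst.
have y2 : 2^-1 < y by rewrite lt_neqAle eq_sym yn.
apply: (@squeeze_cvgr _ _ _ _ (fun=> 0) (fun n => (2 * y)^-1 ^+ n)).
- near=> n; have := one_sub_expn_le (2 ^ n) (yn1 n); rewrite pw => h.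
  apply/andP; split; first by rewrite exprn_ge0// subr_ge0; case/andP: (yn1 n).
  by rewrite exprVn -[leRHS]mul1r ler_pdivlMr// exprn_gt0//; lra.
- exact: cvg_cst.
- apply: cvg_expr; rewrite ger0_norm ?invr_ge0 ?mulr_ge0//.
  by rewrite invf_lt1; lra.
Unshelve. all: by end_near.
Qed.

Lemma sapp_stp c : 0 <= c <= 1 -> sapp (fun x => phi 1 x * stp c x).
Proof.
move=> c01.
(* Affine in cos(pi x), with values in [0, 1], increasing in x on [0, 1] and equal to 1/2 exactly at
   x = c; [q n] therefore converges to the step off that point. *)
pose Y x : R := 2^-1 + (cos (pi * c) - cos (pi * x)) / 4.
have Y01 x : 0 <= Y x <= 1.
  have := cos_geN1 (pi * c); have := cos_le1 (pi * c).
  have := cos_geN1 (pi * x); have := cos_le1 (pi * x); rewrite /Y; lra.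
have inpi x : 0 <= x <= 1 -> pi * x \in `[0, (pi : R)].
  move=> /andP[x0 x1]; rewrite in_itv/= mulr_ge0 ?pi_ge0//=.
  by rewrite ler_piMr ?pi_ge0.
have Ylt x : 0 <= x <= 1 -> (Y x < 2^-1) = (x < c).
  move=> x01; rewrite /Y gtrDl pmulr_llt0 ?invr_gt0// subr_lt0.
  by rewrite ltr_cos ?inpi// ltr_pM2l// pi_gt0.
have Ygt x : 0 <= x <= 1 -> (2^-1 < Y x) = (c < x).
  move=> x01; rewrite /Y ltrDl pmulr_lgt0 ?invr_gt0// subr_gt0.
  by rewrite ltr_cos ?inpi// ltr_pM2l// pi_gt0.
pose q (n : nat) x := (1 - Y x ^+ n) ^+ (2 ^ n).
have q01 n x : 0 <= q n x <= 1.
  have /andP[h1 h2] := Y01 x.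
  have h : 0 <= Y x ^+ n <= 1 by rewrite exprn_ge0//= exprn_ile1.
  rewrite /q exprn_ge0 ?subr_ge0 ?(andP h).2//=.
  by rewrite exprn_ile1 ?subr_ge0 ?(andP h).2// lerBlDr lerDl (andP h).1.
have smY : smul Y.
  have h : smul (fun x => (2^-1 + cos (pi * c) / 4) + (- 4^-1) * cos (pi * x)).
    by apply: smulD; [exact: smul_cst|apply: smulM; [exact: smul_cst|exact: smul_cos]].
  by move=> f hf; apply: eq_sspan (h f hf) => x; rewrite /Y; congr (_ * _); field.
have smq n : smul (q n).
  apply: smulX => f hf.
  have h : smul (fun x => 1 + (-1) * Y x ^+ n).
    by apply: smulD; [exact: smul_cst|apply: smulM; [exact: smul_cst|exact: smulX]].
  by apply: eq_sspan (h f hf) => x; congr (_ * _); ring.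
have hst : L2 0 1 (fun x => phi 1 x * stp c x).
  by apply: (@L2_phi1_mul _ _ _ 1); [exact: measurable_stp|move=> x _; exact: stp_bound].
have sq n : sspan (fun x => phi 1 x * q n x).
  by apply: eq_sspan (smq n _ (sspan_phi 1)) => x; rewrite mulrC.
apply: sapp_limit => // e e0.
have [||||n hn] := @L2_dct 0 1 (fun n x => phi 1 x * q n x) (fun x => phi 1 x * stp c x) (fun=> 2) _ hst _ _ _ _ e0.
- by move=> n; apply: sspan_L2.
- exact: intg_cst.
- move=> n x _; rewrite -mulrBr normrM.
  apply: le_trans (_ : 2 * 1 <= _); last by rewrite mulr1.
  apply: ler_pM => //; first exact: phi_bound.
  by have := q01 n x; have := stp01 c x; rewrite ler_norml; lra.
- exists [set c]; split; [exact: measurable_set1|exact: lebesgue_measure_set1|].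
  move=> x /= nx; apply: contrapT => xc; apply: nx => x01.
  apply: cvgM; first exact: cvg_cst.
  rewrite /stp -(Ylt x x01); apply: step_poly_cvg => //.
  apply/eqP => Ye; apply: xc; apply/eqP; rewrite eq_le !leNgt -(Ylt x x01) -(Ygt x x01) Ye.
  by rewrite ltxx.
by exists (fun x => phi 1 x * q n x); split => //; [exact: sspan_L2|exact: sapp_sspan].
Qed.

(** Value of g at the left end of the cell containing x in the grid of mesh 1/N, written as a
    combination of steps; it vanishes at x = 1. *)
Definition stepfun (g : R -> R) (N : nat) x : R :=
  \sum_(i < N) g (i%:R / N%:R) * (stp (i.+1%:R / N%:R) x - stp (i%:R / N%:R) x).

Lemma stepfunE g (N : nat) x : 0 <= x < 1 -> (0 < N)%N ->
  stepfun g N x = g ((Num.truncn (N%:R * x))%:R / N%:R).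
Proof.
move=> /andP[x0 x1] N0; have N0' : 0 < N%:R :> R by rewrite ltr0n.
set k := Num.truncn _.
have Nx0 : 0 <= N%:R * x by rewrite mulr_ge0// ltW.
have /andP[kx xk] := truncn_itv Nx0; rewrite -/k in kx xk.
have kN : (k < N)%N.
  by rewrite -(ltr_nat R); apply: le_lt_trans kx _; rewrite gtr_pMr.
have st i : stp (i%:R / N%:R) x = (k < i)%N%:R.
  congr (nat_of_bool _)%:R; rewrite ltr_pdivlMr// mulrC.
  apply/idP/idP => [h|h]; first by rewrite -(ltr_nat R); exact: le_lt_trans h.
  by apply: lt_le_trans xk _; rewrite ler_nat.
rewrite /stepfun (bigD1 (Ordinal kN))//= big1 ?addr0.
  by rewrite !st ltnSn ltnn subr0 mulr1.
move=> i ik; rewrite !st ltnS leq_eqVlt.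
have -> : (k == i :> nat) = false by apply: contra_neqF ik => /eqP ki; apply/val_inj.
by rewrite subrr mulr0.
Qed.

(** Dominated convergence of the step approximations, each a combination of functions already in the
    closed span. The point 1, where [stepfun] vanishes, is discarded as a null set. *)
Lemma sapp_cont g : cont 0 1 g -> sapp (fun x => phi 1 x * g x).
Proof.
move=> cg; have [M M0 gM] := cont_bounded cg.
have mst N D : measurable_fun D (stepfun g N).
  by apply: measurable_sum => i; apply: measurable_funM => //; apply: measurable_funB; exact: measurable_stp.
have Nk (N k : nat) : (k <= N)%N -> 0 <= (k%:R / N%:R : R) <= 1.
  move=> kN; rewrite divr_ge0//=; case: N kN => [|N] kN; first by rewrite invr0 mulr0.
  by rewrite ler_pdivrMr ?ltr0n// mul1r ler_nat.
have bst (N : nat) x : 0 <= x <= 1 -> `|stepfun g N x| <= M.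
  move=> /andP[x0 x1]; case: N => [|N]; first by rewrite /stepfun big_ord0 normr0.
  have [xl|xg] := ltP x 1.
    rewrite stepfunE ?x0//; apply: gM; apply: Nk.
    rewrite -ltnS -(ltr_nat R); apply: le_lt_trans (_ : N.+1%:R * x < _).
      by have /andP[] := truncn_itv (mulr_ge0 (ler0n R N.+1) x0).
    apply: lt_trans (_ : N.+1%:R < _); last by rewrite ltr_nat.
    by rewrite gtr_pMr// ltr0n.
  have s0 k : (k <= N.+1)%N -> stp (k%:R / N.+1%:R) x = 0.
    move=> kN; rewrite /stp ltNge (le_trans _ xg)//.
    by have /andP[] := Nk _ _ kN.
  rewrite /stepfun big1 ?normr0// => i _; rewrite !s0 ?subrr ?mulr0//.
    by rewrite ltnW.
have hg : L2 0 1 (fun x => phi 1 x * g x).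
  by apply: (@L2_phi1_mul _ _ _ M) => //; exact: cont_measurable.
have hst N : L2 0 1 (fun x => phi 1 x * stepfun g N x).
  by apply: (@L2_phi1_mul _ _ _ M) => // x; exact: bst.
have sst N : sapp (fun x => phi 1 x * stepfun g N.+1 x).
  rewrite (_ : (fun x => _) = (fun x => \sum_(i < N.+1)
     phi 1 x * (g (i%:R / N.+1%:R) * (stp (i.+1%:R / N.+1%:R) x - stp (i%:R / N.+1%:R) x)))); last first.
    by apply/funext => x; rewrite /stepfun mulr_sumr.
  apply: (@sapp_sum N.+1 (fun i x => phi 1 x * (g (i%:R / N.+1%:R) * (stp (i.+1%:R / N.+1%:R) x - stp (i%:R / N.+1%:R) x)))).
    move=> i; apply: (@L2_phi1_mul _ _ _ (`|g (i%:R / N.+1%:R)| * 1)).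
      by apply: measurable_funM => //; apply: measurable_funB; exact: measurable_stp.
    move=> x _; rewrite normrM; apply: ler_wpM2l => //.
    by have := stp01 (i.+1%:R / N.+1%:R) x; have := stp01 (i%:R / N.+1%:R) x; rewrite ler_norml; lra.
  move=> i iN; set p := i.+1%:R / _; set q := i%:R / _; set k := g _.
  have hs c : L2 0 1 (fun x => phi 1 x * stp c x).
    by apply: (@L2_phi1_mul _ _ _ 1); [exact: measurable_stp|move=> x _; exact: stp_bound].
  have sp : sapp (fun x => phi 1 x * stp p x) by apply: sapp_stp; exact: Nk.
  have sq : sapp (fun x => phi 1 x * stp q x) by apply: sapp_stp; apply: Nk; exact: ltnW.
  have h0 : sapp (fun=> 0) by apply: sapp_sspan; exact: sspan_0.
  have L0 : L2 0 1 (fun=> 0 : R) by apply: L2_cont; exact: cont_cst.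
  have s1 := sapp_lin k (hs p) L0 sp h0.
  have s2 := sapp_lin (- k) (hs q) (L2D (L2Z k (hs p)) L0) sq s1.
  rewrite (_ : (fun x => _) = (fun x => - k * (phi 1 x * stp q x) + (k * (phi 1 x * stp p x) + 0)))//.
  by apply/funext => x; ring.
apply: sapp_limit => // e e0.
have [||||n hn] := @L2_dct 0 1 (fun n x => phi 1 x * stepfun g n.+1 x) (fun x => phi 1 x * g x) (fun=> 4 * M) _ hg _ _ _ _ e0.
- by move=> n; exact: hst.
- exact: intg_cst.
- move=> n x x01; rewrite -mulrBr normrM.
  apply: le_trans (_ : 2 * (M + M) <= _); last by lra.
  apply: ler_pM => //; first exact: phi_bound.
  by apply: le_trans (ler_normB _ _) _; apply: lerD; [exact: gM|exact: bst].
- exists [set 1]; split; [exact: measurable_set1|exact: lebesgue_measure_set1|].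
  move=> x /= nx; apply: contrapT => xc; apply: nx => /andP[x0 x1].
  apply: cvgM; first exact: cvg_cst.
  have xl : x < 1 by rewrite lt_neqAle x1 andbT; apply/eqP.
  apply/cvgrPdist_lt => d d0; have [r r0 hr] := cg x (introT andP (conj x0 x1)) d d0.
  near=> N; rewrite stepfunE ?x0// distrC; apply: hr.
    apply: Nk; rewrite -ltnS -(ltr_nat R); apply: le_lt_trans (_ : N.+1%:R * x < _).
      by have /andP[] := truncn_itv (mulr_ge0 (ler0n R N.+1) x0).
    apply: lt_trans (_ : N.+1%:R < _); last by rewrite ltr_nat.
    by rewrite gtr_pMr// ltr0n.
  have /andP[h1 h2] := truncn_itv (mulr_ge0 (ler0n R N.+1) x0).
  have N0 : 0 < N.+1%:R :> R by rewrite ltr0n.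
  have Nr : N.+1%:R^-1 < r by near: N; exact: near_infty_natSinv_lt (PosNum r0).
  rewrite distrC ger0_norm; last by rewrite subr_ge0 ler_pdivrMr// [X in _ <= X]mulrC.
  apply: le_lt_trans Nr; rewrite lerBlDr; set tr := Num.truncn _ in h1 h2 *.
  have -> : N.+1%:R^-1 + tr%:R / N.+1%:R = tr.+1%:R / N.+1%:R :> R.
    by rewrite -(natr1 tr) mulrDl mul1r addrC.
  by rewrite ler_pdivlMr// [X in X <= _]mulrC ltW.
by exists (fun x => phi 1 x * stepfun g n.+1 x); split.
Unshelve. all: by end_near.
Qed.

Lemma sapp_bounded h M : measurable_fun (Icc 0 1) h -> 0 < M ->
  (forall x, 0 <= x <= 1 -> `|h x| <= M) -> sapp (fun x => phi 1 x * h x).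
Proof.
move=> mh M0 hM.
have hh : L2 0 1 (fun x => phi 1 x * h x) by exact: L2_phi1_mul mh hM.
have ih : intg 0 1 h.
  by apply: (@intg_dom _ _ _ _ (fun=> M)) => //; exact: intg_cst.
have fin01 : (leb (Icc 0 1) < +oo)%E.
  rewrite IccE; have -> : leb `[0, 1]%classic = 1%:E by rewrite lebesgue_measure_itv/= lte_fin ltr01 -EFinD subr0.
  by rewrite ltry.
have [g_ [cg ig]] := approximation_continuous_integrable (measurable_Icc (0 : R) 1) fin01 ih.
move=> /fine_cvgP[_ /cvgrPdist_lt cvg0].
(* Truncating the L^1 approximant at level M keeps it continuous and no farther from h. The square
   of the error is then at most 2 M times the error, so that L^1 closeness yields L^2 closeness. *)
pose k n x := Num.max (- M) (Num.min M (g_ n x)).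
have kM n x : `|k n x| <= M.
  by rewrite ler_norml le_max lexx/= ge_max ge_min lexx/= andbT; lra.
have kh n x : 0 <= x <= 1 -> `|h x - k n x| <= `|h x - g_ n x|.
  move=> /hM; rewrite ler_norml /k => /andP[h1 h2].
  have [Mg|gM] := leP M (g_ n x).
    rewrite max_r; last by lra.
    by rewrite !ler0_norm; lra.
  have [gM'|Mg'] := leP (g_ n x) (- M).
    by rewrite !ger0_norm; lra.
  by rewrite lexx.
have ck n : cont 0 1 (k n).
  have lip (x y : R) : `|Num.max (- M) (Num.min M y) - Num.max (- M) (Num.min M x)| <= `|y - x|.
    case: (leP M y) => My; case: (leP M x) => Mx; rewrite ?(@max_r _ _ (- M) M); try lra.
    - by rewrite subrr normr0.
    - by case: (leP x (- M)) => hx; rewrite !ger0_norm; lra.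
    - by case: (leP y (- M)) => hy; rewrite !ler0_norm; lra.
    - case: (leP y (- M)) => hy; case: (leP x (- M)) => hx.
      + by rewrite subrr normr0.
      + by rewrite !ler0_norm; lra.
      + by rewrite !ger0_norm; lra.
      + by [].
  move=> s s01 e e0; have [d d0 hd] := continuous_cont (cg n) s01 e0.
  by exists d => // t t01 ts; apply: le_lt_trans (hd t t01 ts); exact: lip.
apply: sapp_limit => // e e0.
(* The denominator leaves room for the factor 8 M below: 4 bounds phi_1^2, and 2 M the size of h
   minus its truncated approximant. *)
have e2 : 0 < e ^+ 2 / (16 * M) by rewrite divr_gt0 ?exprn_gt0// mulr_gt0.
have [N _ /(_ N (leqnn N))] := cvg0 _ e2; rewrite sub0r normrN => hN.
have iN : intg 0 1 (g_ N) by exact: ig.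
have hN' : rint 0 1 (fun x => `|h x - g_ N x|) < e ^+ 2 / (16 * M).
  exact: le_lt_trans (ler_norm _) hN.
exists (fun x => phi 1 x * k N x); split.
- by apply: (@L2_phi1_mul _ _ _ M) => //; exact: cont_measurable.
- exact: sapp_cont.
have hk : L2 0 1 (fun x => phi 1 x * k N x) by apply: (@L2_phi1_mul _ _ _ M) => //; exact: cont_measurable.
rewrite -ltr_sqr ?nnegrE ?L2norm_ge0 ?ltW// /L2norm sqr_sqrtr; last first.
  by apply: rint_ge0 => x _; exact: sqr_ge0.
apply: le_lt_trans (_ : (8 * M) * rint 0 1 (fun x => `|h x - g_ N x|) < _); last first.
  move: hN'; rewrite ltr_pdivlMr ?mulr_gt0// => h1.
  have : 0 <= rint 0 1 (fun x => `|h x - g_ N x|) by apply: rint_ge0.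
  by nra.
have iabs : intg 0 1 (fun x => `|h x - g_ N x|) by apply: intg_norm; exact: intgB.
rewrite -rintZ//; apply: ler_rint; [exact/L2_sq/L2B|exact: intgZ|].
move=> x x01; rewrite -mulrBr exprMn.
have h1 := kh N x x01; have h2 := kM N x; have h3 := hM x x01.
have h4 : phi 1 x ^+ 2 <= 4.
  rewrite -real_normK ?num_real// (_ : 4 = 2 ^+ 2); last by ring.
  by rewrite ler_pXn2r// ?nnegrE// phi_bound.
have h5 : (h x - k N x) ^+ 2 <= 2 * M * `|h x - g_ N x|.
  rewrite -real_normK ?num_real// expr2; apply: ler_pM => //.
  by apply: le_trans (ler_normB _ _) _; lra.
rewrite (_ : 8 * M * `|h x - g_ N x| = 4 * (2 * M * `|h x - g_ N x|)); last by ring.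
by apply: ler_pM => //; exact: sqr_ge0.
Qed.

Lemma dist_maxl a x y : `|Num.max y a - Num.max x a| <= `|y - x|.
Proof.
case: (leP y a) => hy; case: (leP x a) => hx //.
- by rewrite subrr normr0.
- by rewrite !ler0_norm; lra.
- by rewrite !ger0_norm; lra.
Qed.

Lemma phi1_gt0 x : 0 < x < 1 -> 0 < phi 1 x :> R.
Proof.
move=> /andP[x0 x1]; rewrite /phi mul1r mulr_gt0 ?sqrtr_gt0//.
by apply: sin_gt0_pi; rewrite mulr_gt0 ?pi_gt0//= gtr_pMr ?pi_gt0.
Qed.

(** Written as phi_1 times f / phi_1, with f cut off to the points where |f| <= n + 1 and phi_1 >= 1
    / (n + 1): the quotient is bounded there, and these sets exhaust (0, 1) because phi_1 > 0
    inside. *)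
Lemma sapp_L2 f : L2 0 1 f -> sapp f.
Proof.
move=> hf.
have mphi : measurable_fun (Icc 0 1) (phi 1 : R -> R) by apply: cont_measurable; exact: cont_phi.
(* Both conditions are put into one inequality on a measurable function, from which the
   measurability of the set is read off. *)
pose A (n : nat) := [set x : R | 0 <= Num.min (n.+1%:R - `|f x|) (phi 1 x - n.+1%:R^-1)].
pose fn (n : nat) x := f x * \1_(A n) x.
pose w (n : nat) x : R := (Num.max (phi 1 x) n.+1%:R^-1)^-1.
pose h (n : nat) x := w n x * fn n x.
have mw n : measurable_fun (Icc 0 1) (w n).
  pose v (y : R) := (Num.max y n.+1%:R^-1)^-1.
  apply: (@measurableT_comp _ _ _ _ _ _ v) => //.
  apply: continuous_measurable_fun => y.
  apply: (@cvgV _ _ _ _ (fun y => Num.max y n.+1%:R^-1)).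
    by rewrite gt_eqF// lt_max invr_gt0 ltr0n orbT.
  apply/cvgrPdist_lt => e e0; near=> z; apply: le_lt_trans (_ : `|y - z| < e).
    exact: dist_maxl.
  near: z; apply/nbhs_ballP; exists e => //= z; by rewrite /ball.
have mA n : measurable (Icc 0 1 `&` A n : set (measurableTypeR R)).
  rewrite (_ : A n = (fun x => Num.min (n.+1%:R - `|f x|) (phi 1 x - n.+1%:R^-1)) @^-1` `[0, +oo[%classic); last first.
    by apply/seteqP; split => x /=; rewrite in_itv/= andbT.
  have : measurable_fun (Icc 0 1) (fun x : R => Num.min (n.+1%:R - `|f x|) (phi 1 x - n.+1%:R^-1)).
    apply: measurable_minr; last by apply: measurable_funB.
    apply: measurable_funB => //.
    by apply: measurableT_comp => //; exact: hf.1.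
  by apply => //; exact: measurable_Icc.
have m1A n : measurable_fun (Icc 0 1) (\1_(A n) : R -> R).
  have h1 : measurable_fun (Icc 0 1) (\1_(Icc 0 1 `&` A n) : R -> R).
    by apply: measurable_indic; exact: mA.
  apply: eq_measurable_fun h1 => x; rewrite inE => x01.
  rewrite !indicE; congr (nat_of_bool _)%:R; apply/idP/idP; rewrite !inE; first by case.
  by move=> hx; split.
have b1A n x : 0 <= (\1_(A n) x : R) <= 1.
  by rewrite indicE; case: (x \in A n); rewrite ?lexx ler01.
have hfn n : L2 0 1 (fn n).
  apply: (@eq_L2 _ _ _ (fun x => \1_(A n) x * f x)); first by move=> x _; rewrite mulrC.
  by apply: (@L2Mb _ _ _ _ _ 1) => // x _; have := b1A n x; rewrite ler_norml; lra.
have sfn n : sapp (fn n).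
  have n0 : 0 < n.+1%:R^-1 :> R by rewrite invr_gt0 ltr0n.
  have -> : fn n = (fun x => phi 1 x * h n x).
    apply/funext => x; rewrite /h mulrA /fn indicE; case: (boolP (x \in A n)); rewrite ?mulr0//.
    rewrite inE /A/= le_min => /andP[_]; rewrite subr_ge0 => np.
    by rewrite /w max_l// mulfV ?mul1r// gt_eqF//; exact: lt_le_trans np.
  apply: (@sapp_bounded _ (n.+1%:R * n.+1%:R)); first by apply: measurable_funM => //; exact: (hfn n).1.
    by rewrite mulr_gt0.
  move=> x x01; rewrite /h /fn indicE; case: (boolP (x \in A n)); rewrite ?mulr0 ?normr0//.
  rewrite inE /A/= le_min !subr_ge0 => /andP[fx np].
  rewrite mulr1 normrM; apply: ler_pM => //.
  rewrite ger0_norm ?invr_ge0 ?le_max ?(ltW n0) ?orbT// invf_ple ?posrE ?ltr0n//.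
    by rewrite le_max lexx orbT.
  by rewrite lt_max n0 orbT.
apply: sapp_limit => // e e0.
have [||||n hn] := @L2_dct 0 1 fn f (fun x => `|f x|) _ hf _ _ _ _ e0.
- by [].
- by apply: eq_intg (L2_sq hf) => x _; rewrite real_normK ?num_real.
- move=> n x _; rewrite /fn -[X in `|X - _|]mulr1 -mulrBr normrM ler_piMr//.
  by have := b1A n x; rewrite ler_norml; lra.
- have N1 (a : R) : leb.-negligible [set a].
    by exists [set a]; split; [exact: measurable_set1|exact: lebesgue_measure_set1|].
  apply: negligibleS (negligibleU (N1 0) (N1 1)) => x /= nx; apply: contrapT => /not_orP[x0 x1]; apply: nx => /andP[x0' x1'].
  have xx : 0 < x < 1 by rewrite !lt_neqAle x0' x1' !andbT eq_sym; apply/andP; split; apply/eqP.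
  have p0 := phi1_gt0 xx.
  apply: cvg_near_cst; near=> n; rewrite /fn indicE mem_set ?mulr1// /A/= le_min !subr_ge0.
  apply/andP; split.
    apply: (@le_trans _ _ n%:R); last by rewrite ler_nat.
    by apply: ltW; near: n; exact: nbhs_infty_gtr.
  by apply: ltW; near: n; exact: near_infty_natSinv_lt (PosNum p0).
by exists (fn n); split.
Unshelve. all: by end_near.
Qed.

(** The orthogonal projection on the modes 1, ..., N - 1. *)
Definition PN (N : nat) f x : R := \sum_(1 <= j < N) ip 0 1 f (phi j) * phi j x.

Lemma L2_PN N f : L2 0 1 (PN N f).
Proof. by apply: L2_sum => j _; apply: L2Z; exact: L2_phi. Qed.

Lemma ip_PN N f (k : nat) : ip 0 1 (PN N f) (phi k) = if (1 <= k < N)%N then ip 0 1 f (phi k) else 0.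
Proof.
rewrite ip_suml; [|by move=> j _; apply: L2Z; exact: L2_phi|exact: L2_phi].
rewrite big_nat (eq_bigr (fun j => if j == k then ip 0 1 f (phi k) else 0)); last first.
  move=> j /andP[j1 jN]; rewrite ipZl ?ip_phi//; try exact: L2_phi.
  by case: eqVneq => [->|]; rewrite ?mulr1 ?mulr0.
case: ifP => [kN|kN].
  rewrite -big_nat (bigD1_seq k)/= ?mem_index_iota ?iota_uniq// eqxx big1 ?addr0//.
  by move=> j /negbTE ->.
rewrite big1// => j jN; case: eqP => // jk; by rewrite -jk jN in kN.
Qed.

Lemma Bessel_eq N f : L2 0 1 f ->
  ip 0 1 (fun x => f x - PN N f x) (fun x => f x - PN N f x) =
  ip 0 1 f f - \sum_(1 <= j < N) ip 0 1 f (phi j) ^+ 2.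
Proof.
move=> hf; have hP := L2_PN N f.
have e1 : ip 0 1 (PN N f) f = \sum_(1 <= j < N) ip 0 1 f (phi j) ^+ 2.
  rewrite ip_suml//; last by move=> j _; apply: L2Z; exact: L2_phi.
  by apply: eq_bigr => j _; rewrite ipZl ?expr2 ?[ip _ _ (phi j) _]ipC//; exact: L2_phi.
have e2 : ip 0 1 (PN N f) (PN N f) = \sum_(1 <= j < N) ip 0 1 f (phi j) ^+ 2.
  rewrite {1}/PN ip_suml//; last by move=> j _; apply: L2Z; exact: L2_phi.
  rewrite big_nat [RHS]big_nat; apply: eq_bigr => j jN.
  by rewrite ipZl//; [rewrite [ip _ _ (phi j) _]ipC ip_PN jN expr2|exact: L2_phi].
rewrite ipBl ?ipBr//; try exact: L2B.
by rewrite e2 e1 ipC e1; ring.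
Qed.

Lemma Bessel N f : L2 0 1 f -> \sum_(1 <= j < N) ip 0 1 f (phi j) ^+ 2 <= ip 0 1 f f.
Proof. by move=> hf; rewrite -subr_ge0 -Bessel_eq// ip_ge0. Qed.

Lemma PN_sspan f : sspan f -> exists N0, forall N, (N0 <= N)%N -> forall x, PN N f x = f x.
Proof.
elim=> [j||k {}f g sf [N1 h1] sg [N2 h2]].
- exists j.+1 => N jN x; rewrite /PN; case: j jN => [|j] jN.
    rewrite big1 => [|i _]; first by rewrite /phi !mul0r sin0 mulr0.
    rewrite ipC (@eq_ip _ _ _ _ _ (phi i) (fun=> 0)) => [||x' _]//.
      rewrite ipC /ip (@eq_rint _ _ _ _ (fun=> 0)) ?rint_cst ?mul0r// => x' _.
      by rewrite mul0r.
    by rewrite /phi !mul0r sin0 mulr0.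
  rewrite (bigD1_seq j.+1)/= ?mem_index_iota ?iota_uniq// ip_phi// eqxx mul1r big1 ?addr0//.
  by move=> i /negbTE ij; rewrite ip_phi// eq_sym ij mul0r.
- exists 0%N => N _ x; rewrite /PN big1// => i _.
  by rewrite /ip (@eq_rint _ _ _ _ (fun=> 0)) ?rint_cst ?mul0r// => x' _; rewrite mul0r.
- exists (maxn N1 N2) => N; rewrite geq_max => /andP[n1 n2] x.
  rewrite -(h1 N n1) -(h2 N n2) /PN mulr_sumr -big_split/=; apply: eq_bigr => i _.
  have hf := sspan_L2 sf; have hg := sspan_L2 sg.
  by rewrite ipDl ?ipZl//; [ring|exact: L2_phi|exact: L2Z|exact: L2_phi].
Qed.

(** [PN N] fixes an approximating combination h once N is large, so the residual of f is the
    residual of f - h, whose norm does not exceed that of f - h. *)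
Theorem sine_complete f : L2 0 1 f -> forall e, 0 < e ->
  exists N0, forall N, (N0 <= N)%N -> L2norm 0 1 (fun x => f x - PN N f x) < e.
Proof.
move=> hf e e0; have [h sh fh] := sapp_L2 hf e0; have [N0 hN] := PN_sspan sh.
exists N0 => N N0N; apply: le_lt_trans fh; have hh := sspan_L2 sh.
rewrite -ler_sqr ?nnegrE ?L2norm_ge0// !L2norm2.
set g := fun x => f x - h x; have hg : L2 0 1 g by exact: L2B.
have E x : f x - PN N f x = g x - PN N g x.
  have -> : PN N g x = PN N f x - PN N h x.
    by rewrite /PN -sumrB; apply: eq_bigr => i _; rewrite ipBl ?mulrBl//; exact: L2_phi.
  by rewrite hN// /g; ring.
rewrite (@eq_ip _ _ _ _ _ (fun x => g x - PN N g x) (fun x => g x - PN N g x))//.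
by rewrite Bessel_eq// gerBl; apply: sumr_ge0 => i _; exact: sqr_ge0.
Qed.

Lemma sin_coef_parseval f g : L2 0 1 f -> L2 0 1 g -> forall e, 0 < e ->
  exists N0, forall N, (N0 <= N)%N ->
  `|ip 0 1 f g - \sum_(1 <= j < N) ip 0 1 f (phi j) * ip 0 1 g (phi j)| < e.
Proof.
move=> hf hg e e0.
have e1 : 0 < e / (L2norm 0 1 g + 1) by rewrite divr_gt0// ltr_wpDl// L2norm_ge0.
have [N0 hN] := sine_complete hf e1; exists N0 => N /hN h.
have -> : \sum_(1 <= j < N) ip 0 1 f (phi j) * ip 0 1 g (phi j) = ip 0 1 (PN N f) g.
  rewrite ip_suml//; last by move=> j _; apply: L2Z; exact: L2_phi.
  by apply: eq_bigr => j _; rewrite ipZl ?[ip _ _ g _]ipC//; exact: L2_phi.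
rewrite -ipBl//; last exact: L2_PN.
have hB : L2 0 1 (fun x => f x - PN N f x) by apply: L2B => //; exact: L2_PN.
have CS := ip_CauchySchwarz hB hg; apply: (le_lt_trans CS).
have g1 : 0 < L2norm 0 1 g + 1 by rewrite ltr_wpDl// L2norm_ge0.
move: h; rewrite ltr_pdivlMr// mulrDr mulr1 => h.
have := L2norm_ge0 0 1 (fun x => f x - PN N f x); lra.
Qed.

End SineCompleteness.

(** * The mild solution in coordinates *)

Section Paths.
Variable R : realType.
Local Notation leb := (@lebesgue_measure R).
Implicit Types (a b c d e s t x y T : R) (g h m u : R -> R) (f p q w : R -> R -> R).

(* Continuity of t |-> f t from [0, T] to L^2(0, 1). *)
Definition pathL2 T f :=
  (forall t, 0 <= t <= T -> L2 0 1 (f t)) /\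
  (forall s, 0 <= s <= T -> forall e, 0 < e -> exists2 d : R, 0 < d &
     forall t, 0 <= t <= T -> `|t - s| < d -> L2norm 0 1 (fun x => f t x - f s x) < e).

Lemma pathL2_cst T g : L2 0 1 g -> pathL2 T (fun=> g).
Proof.
move=> hg; split => // s _ e e0; exists 1 => // t _ _.
by rewrite /L2norm (@eq_rint _ _ _ _ (fun=> 0)) ?rint_cst ?mul0r ?sqrtr0// => x _; rewrite subrr expr0n.
Qed.

Lemma pathL2_N T f : pathL2 T f -> pathL2 T (fun t x => - f t x).
Proof.
move=> [hf cf]; split; first by move=> t /hf; exact: L2N.
move=> s sT e e0; have [d d0 hd] := cf s sT e e0; exists d => // t tT ts.
rewrite -L2normN (@eq_L2norm _ _ _ _ (fun x => f t x - f s x)); first exact: hd.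
by move=> x _; ring.
Qed.

Lemma pathL2_D T f (g : R -> R -> R) : pathL2 T f -> pathL2 T g -> pathL2 T (fun t x => f t x + g t x).
Proof.
move=> [hf cf] [hg cg]; split; first by move=> t tT; apply: L2D; [exact: hf|exact: hg].
move=> s sT e e0; have e2 : 0 < e / 2 by rewrite divr_gt0.
have [d1 d10 h1] := cf s sT _ e2; have [d2 d20 h2] := cg s sT _ e2.
exists (Num.min d1 d2); first by rewrite lt_min d10.
move=> t tT; rewrite lt_min => /andP[t1 t2].
rewrite (@eq_L2norm _ _ _ _ (fun x => (f t x - f s x) + (g t x - g s x))); last by move=> x _; ring.
apply: le_lt_trans (L2norm_triangle _ _) _; [by apply: L2B; exact: hf|by apply: L2B; exact: hg|].
by have := h1 t tT t1; have := h2 t tT t2; lra.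
Qed.

(** With [cont_bounded], this gives the uniform bound on the path that its name announces. *)
Lemma pathL2_bound T f : 0 <= T -> pathL2 T f ->
  cont 0 T (fun t => L2norm 0 1 (f t)).
Proof.
move=> T0 [hf cf] s sT e e0; have [d d0 hd] := cf s sT e e0; exists d => // t tT ts.
apply: le_lt_trans (hd t tT ts); have ht := hf t tT; have hs := hf s sT.
rewrite ler_distl; apply/andP; split.
  rewrite lerBlDr -[X in _ <= _ + X]L2normN (_ : L2norm 0 1 (f s) = L2norm 0 1 (fun x => f t x + - (f t x - f s x))).
    by apply: L2norm_triangle => //; apply: L2N; exact: L2B.
  by apply: eq_L2norm => x _; ring.
rewrite addrC (_ : L2norm 0 1 (f t) = L2norm 0 1 (fun x => (f t x - f s x) + f s x)).
  by apply: L2norm_triangle => //; exact: L2B.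
by apply: eq_L2norm => x _; ring.
Qed.

Lemma pathL2_ip T f (g : R -> R -> R) : 0 <= T -> pathL2 T f -> pathL2 T g -> cont 0 T (fun t => ip 0 1 (f t) (g t)).
Proof.
move=> T0 pf pg s sT e e0; have [hf cf] := pf; have [hg cg] := pg.
have [M M0 fM] := cont_bounded (pathL2_bound T0 pf).
have [N N0 gN] := cont_bounded (pathL2_bound T0 pg).
have e1 : 0 < e / 2 / (N + 1) by rewrite !divr_gt0//; lra.
have e2 : 0 < e / 2 / (M + 1) by rewrite !divr_gt0//; lra.
have [d1 d10 h1] := cf s sT _ e1; have [d2 d20 h2] := cg s sT _ e2.
exists (Num.min d1 d2); first by rewrite lt_min d10.
move=> t tT; rewrite lt_min => /andP[t1 t2].
have ht := hf t tT; have hs := hf s sT; have gt_ := hg t tT; have gs := hg s sT.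
have hft : L2 0 1 (fun x => f t x - f s x) by exact: L2B.
have hgt : L2 0 1 (fun x => g t x - g s x) by exact: L2B.
rewrite (_ : _ - _ = ip 0 1 (fun x => f t x - f s x) (g t) + ip 0 1 (f s) (fun x => g t x - g s x)); last first.
  by rewrite ipBl// ipBr//; ring.
apply: le_lt_trans (ler_normD _ _) _.
have c1 := ip_CauchySchwarz hft gt_; have c2 := ip_CauchySchwarz hs hgt.
have k1 := h1 t tT t1; have k2 := h2 t tT t2.
rewrite ltr_pdivlMr in k1; last by lra.
rewrite ltr_pdivlMr in k2; last by lra.
have b1 := fM s sT; have b2 := gN t tT; rewrite !ger0_norm ?L2norm_ge0// in b1 b2.
have n1 := L2norm_ge0 0 1 (fun x => f t x - f s x); have n2 := L2norm_ge0 0 1 (fun x => g t x - g s x).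
have := ler_wpM2l n1 b2; have := ler_wpM2r n2 b1; lra.
Qed.

Lemma pathL2_ipr T f g : 0 <= T -> pathL2 T f -> L2 0 1 g -> cont 0 T (fun t => ip 0 1 (f t) g).
Proof. by move=> T0 pf hg; apply: (@pathL2_ip T f (fun=> g)) => //; exact: pathL2_cst. Qed.

(** Meant for weights such as cos(th t m(x)): bounded, and continuous in time uniformly in x, so
    that the variations of weight and path can be estimated separately in L^2. *)
Lemma pathL2_mul T f w M : 0 <= T -> pathL2 T f -> 0 <= M ->
  (forall t, measurable_fun (Icc 0 1) (w t)) -> (forall t x, 0 <= t <= T -> 0 <= x <= 1 -> `|w t x| <= M) ->
  (forall s, 0 <= s <= T -> forall e, 0 < e -> exists2 d : R, 0 < d &
    forall t, 0 <= t <= T -> `|t - s| < d -> forall x, 0 <= x <= 1 -> `|w t x - w s x| <= e) ->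
  pathL2 T (fun t x => w t x * f t x).
Proof.
move=> T0 pf M0 mw wM cw; have [hf cf] := pf.
have hwf s t : 0 <= s <= T -> 0 <= t <= T -> L2 0 1 (fun x => w s x * f t x).
  by move=> sT tT; apply: (L2Mb (hf t tT) (mw s)) => x; exact: wM.
split; first by move=> t tT; exact: hwf.
move=> s sT e e0.
have [N N0 fN] := cont_bounded (pathL2_bound T0 pf).
have e1 : 0 < e / 2 / (N + 1) by rewrite !divr_gt0//; lra.
have e2 : 0 < e / 2 / (M + 1) by rewrite !divr_gt0//; lra.
have [d1 d10 h1] := cw s sT _ e1; have [d2 d20 h2] := cf s sT _ e2.
exists (Num.min d1 d2); first by rewrite lt_min d10.
move=> t tT; rewrite lt_min => /andP[t1 t2].
rewrite (@eq_L2norm _ _ _ _ (fun x => w t x * (f t x - f s x) + (w t x - w s x) * f s x)); last first.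
  by move=> x _; ring.
have hft : L2 0 1 (fun x => f t x - f s x) by apply: L2B; exact: hf.
have hs := hf s sT.
have g1 : L2 0 1 (fun x => w t x * (f t x - f s x)) by apply: (L2Mb hft (mw t)) => x; exact: wM.
have g2 : L2 0 1 (fun x => (w t x - w s x) * f s x).
  by apply: (L2Mb hs _ (h1 t tT t1)); exact: measurable_funB.
apply: le_lt_trans (L2norm_triangle g1 g2) _.
have k1 : L2norm 0 1 (fun x => w t x * (f t x - f s x)) <= M * L2norm 0 1 (fun x => f t x - f s x).
  apply: L2norm_dom => // x x01; rewrite normrM; apply: ler_wpM2r => //; exact: wM.
have k2 : L2norm 0 1 (fun x => (w t x - w s x) * f s x) <= e / 2 / (N + 1) * L2norm 0 1 (f s).
  by apply: L2norm_dom => //; [exact: ltW|move=> x x01; rewrite normrM; apply: ler_wpM2r => //; exact: h1].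
have k3 := h2 t tT t2; rewrite ltr_pdivlMr in k3; last by lra.
have b1 := fN s sT; rewrite ger0_norm ?L2norm_ge0// in b1.
have k4 : e / 2 / (N + 1) * L2norm 0 1 (f s) <= e / 2.
  apply: le_trans (_ : e / 2 / (N + 1) * (N + 1) <= _); last by rewrite divfK//; lra.
  by apply: ler_wpM2l; [exact: ltW|lra].
by have := L2norm_ge0 0 1 (fun x => f t x - f s x); lra.
Qed.

Lemma pathL2_mulm T f m : 0 <= T -> pathL2 T f -> cont 0 1 m -> pathL2 T (fun t x => m x * f t x).
Proof.
move=> T0 pf cm; have [M M0 mM] := cont_bounded cm.
apply: (pathL2_mul T0 pf M0) => [t|t x _|s sT e e0]; [exact: cont_measurable|exact: mM|].
by exists 1 => // t _ _ x _; rewrite subrr normr0 ltW.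
Qed.

Lemma ip_bdd g h c : L2 0 1 g -> L2 0 1 h -> 0 <= c -> (forall x, 0 <= x <= 1 -> `|h x| <= c) ->
  `|ip 0 1 g h| <= c * L2norm 0 1 g.
Proof.
move=> hg hh c0 hc; apply: le_trans (ip_CauchySchwarz hg hh) _; rewrite mulrC.
apply: ler_wpM2r; first exact: L2norm_ge0.
have := @L2norm_dom R 0 1 h (fun=> 1) c hh (L2_cont (cont_cst 1)) c0.
rewrite {2}/L2norm expr1n rint_cst// subr0 mulr1 sqrtr1 mulr1; apply.
by move=> x /hc; rewrite normr1 mulr1.
Qed.

End Paths.

(** * Real and imaginary parts *)

Section ComplexParts.
Variable R : realType.
Local Open Scope complex_scope.
Implicit Types (z w : R[i]) (a : R).

Lemma creD z w : cre (z + w) = cre z + cre w. Proof. by case: z w => [a b] [c d]. Qed.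
Lemma cimD z w : cim (z + w) = cim z + cim w. Proof. by case: z w => [a b] [c d]. Qed.
Lemma creN z : cre (- z) = - cre z. Proof. by case: z. Qed.
Lemma cimN z : cim (- z) = - cim z. Proof. by case: z. Qed.
Lemma creM z w : cre (z * w) = cre z * cre w - cim z * cim w.
Proof. by case: z w => [a b] [c d]. Qed.
Lemma cimM z w : cim (z * w) = cre z * cim w + cim z * cre w.
Proof. by case: z w => [a b] [c d] /=; rewrite addrC. Qed.
Lemma cre_conj z : cre (conjc z) = cre z. Proof. by case: z. Qed.
Lemma cim_conj z : cim (conjc z) = - cim z. Proof. by case: z. Qed.
Lemma cre_real a : cre a%:C = a. Proof. by []. Qed.
Lemma cim_real a : cim a%:C = 0. Proof. by []. Qed.
Lemma cre_i : cre ('i : R[i]) = 0. Proof. by []. Qed.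
Lemma cim_i : cim ('i : R[i]) = 1. Proof. by []. Qed.
Lemma cre_exp a : cre (cexp a) = cos a. Proof. by []. Qed.
Lemma cim_exp a : cim (cexp a) = sin a. Proof. by []. Qed.

Definition creimE := (creD, cimD, creN, cimN, creM, cimM, cre_conj, cim_conj, cre_real, cim_real,
  cre_i, cim_i, cre_exp, cim_exp).

Lemma complexP z w : cre z = cre w -> cim z = cim w -> z = w.
Proof. by case: z w => [a b] [c d] /= -> ->. Qed.

Lemma cre_cinner (f : R -> R[i]) (g : R -> R) :
  cre (cinner f (fun x => (g x)%:C)) = ip 0 1 (fun x => cre (f x)) g.
Proof.
rewrite /cinner/= /ip; apply: eq_rint => x _.
by case: (f x) => a b /=; rewrite oppr0 mulr0 subr0.
Qed.

Lemma cim_cinner (f : R -> R[i]) (g : R -> R) :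
  cim (cinner f (fun x => (g x)%:C)) = ip 0 1 (fun x => cim (f x)) g.
Proof.
rewrite /cinner/= /ip; apply: eq_rint => x _.
by case: (f x) => a b /=; rewrite oppr0 mulr0 add0r.
Qed.

Lemma cre_cint (a b : R) (g : R -> R[i]) : cre (cint a b g) = rint a b (fun x => cre (g x)).
Proof. by []. Qed.

Lemma cim_cint (a b : R) (g : R -> R[i]) : cim (cint a b g) = rint a b (fun x => cim (g x)).
Proof. by []. Qed.

End ComplexParts.

(** * Coefficients of the mild solution as absolutely continuous functions *)

Section SolutionComponents.
Variable R : realType.
Local Notation leb := (@lebesgue_measure R).
Local Open Scope complex_scope.
Implicit Types (a b c d e s t x y T : R) (g h m mu u : R -> R).

Lemma ae_ip_mul mu m (f g : R -> R) : measurable_fun (Icc 0 1) mu -> cont 0 1 m ->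
  {ae leb, forall x, 0 <= x <= 1 -> mu x = m x} ->
  measurable_fun (Icc 0 1) f -> measurable_fun (Icc 0 1) g ->
  ip 0 1 (fun x => mu x * f x) g = ip 0 1 (fun x => m x * f x) g.
Proof.
move=> mmu cm ae mf mg; apply: ae_rint.
- by apply: measurable_funM => //; exact: measurable_funM.
- by apply: measurable_funM => //; apply: measurable_funM => //; exact: cont_measurable.
- by move: ae; apply: negligibleS => x /= nx h; apply: nx => /h ->.
Qed.

Lemma sol_pathL2 mu T u psi : is_solution mu T u psi ->
  pathL2 T (fun t x => cre (psi t x)) /\ pathL2 T (fun t x => cim (psi t x)).
Proof.
move=> [hL [hc _]]; split; split.
- by move=> t /hL [].
- move=> s sT e e0; have [d [d0 hd]] := hc s sT e e0; exists d => // t tT ts.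
  have [h1 h2] := hL t tT; have [h3 h4] := hL s sT.
  apply: le_lt_trans (hd t tT ts); apply: ler_wsqrtr.
  have l1 := L2B h1 h3; have l2 := L2B h2 h4.
  rewrite (@eq_rint _ _ _ (fun x => cre (psi t x - psi s x) ^+ 2 + cim (psi t x - psi s x) ^+ 2)
    (fun x => (cre (psi t x) - cre (psi s x)) ^+ 2 + (cim (psi t x) - cim (psi s x)) ^+ 2)); last first.
    by move=> x _; rewrite !creimE.
  apply: ler_rint; [exact: L2_sq|by apply: intgD; exact: L2_sq|].
  by move=> x _; rewrite lerDl sqr_ge0.
- by move=> t /hL [].
- move=> s sT e e0; have [d [d0 hd]] := hc s sT e e0; exists d => // t tT ts.
  have [h1 h2] := hL t tT; have [h3 h4] := hL s sT.
  apply: le_lt_trans (hd t tT ts); apply: ler_wsqrtr.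
  have l1 := L2B h1 h3; have l2 := L2B h2 h4.
  rewrite (@eq_rint _ _ _ (fun x => cre (psi t x - psi s x) ^+ 2 + cim (psi t x - psi s x) ^+ 2)
    (fun x => (cre (psi t x) - cre (psi s x)) ^+ 2 + (cim (psi t x) - cim (psi s x)) ^+ 2)); last first.
    by move=> x _; rewrite !creimE.
  apply: ler_rint; [exact: L2_sq|by apply: intgD; exact: L2_sq|].
  by move=> x _; rewrite lerDr sqr_ge0.
Qed.

(** Passage to the continuous representative [m] and to real components, in which the calculus of
    primitives is done. *)
Lemma sol_mild mu m T u psi (j : nat) : measurable_fun (Icc 0 1) mu -> cont 0 1 m ->
  {ae leb, forall x, 0 <= x <= 1 -> mu x = m x} -> is_solution mu T u psi -> (1 <= j)%N ->
  let p t x := cre (psi t x) in let q t x := cim (psi t x) in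
  let M s := ip 0 1 (fun x => m x * p s x) (phi j) in
  let N s := ip 0 1 (fun x => m x * q s x) (phi j) in
  forall t, 0 <= t <= T ->
    ip 0 1 (p t) (phi j) = (j == 1%N)%:R * cos (lam R j * t)
      - rint 0 t (fun s => u s * (cos (lam R j * (t - s)) * N s - sin (lam R j * (t - s)) * M s)) /\
    ip 0 1 (q t) (phi j) = - ((j == 1%N)%:R * sin (lam R j * t))
      + rint 0 t (fun s => u s * (cos (lam R j * (t - s)) * M s + sin (lam R j * (t - s)) * N s)).
Proof.
move=> mmu cm ae hsol j1 p q M N t tT; have [hL [_ hm]] := hsol.
have mphi : measurable_fun (Icc 0 1) (phi j : R -> R) by apply: cont_measurable; exact: cont_phi.
have E := hm t tT j j1; case/andP: tT => t0 tT.
have cM s : 0 <= s <= t -> cre (cinner (fun x => (mu x)%:C * psi s x) (fun x => (phi j x)%:C)) = M s.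
  move=> /andP[s0 st]; rewrite cre_cinner /M -(ae_ip_mul mmu cm ae)//.
    by apply: eq_ip => // x _; rewrite creM /= mul0r subr0.
  by have [|[]] := hL s; rewrite ?s0 ?(le_trans st).
have cN s : 0 <= s <= t -> cim (cinner (fun x => (mu x)%:C * psi s x) (fun x => (phi j x)%:C)) = N s.
  move=> /andP[s0 st]; rewrite cim_cinner /N -(ae_ip_mul mmu cm ae)//.
    by apply: eq_ip => // x _; rewrite cimM /= mul0r addr0.
  by have [|_ []] := hL s; rewrite ?s0 ?(le_trans st).
have E1 := congr1 (@cre R) E; have E2 := congr1 (@cim R) E.
rewrite cre_cinner in E1; rewrite cim_cinner in E2.
rewrite E1 E2 !creimE !cre_cint !cim_cint !mul0r !mul1r ?add0r ?addr0 ?sub0r.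
split.
  congr (_ + _).
    by case: (j == 1%N); rewrite /= ?mul1r ?mul0r// cosN.
  congr (- _); apply: eq_rint => s st.
  by rewrite !creimE cM// cN// cosN sinN !mul0r; ring.
congr (_ + _).
  by case: (j == 1%N); rewrite /= ?mul1r ?mul0r ?oppr0// sinN.
apply: eq_rint => s st.
by rewrite !creimE cM// cN// cosN sinN !mul0r; ring.
Qed.

Lemma isprim_cosl T (k : R) : 0 <= T -> isprim 0 T (fun t => cos (k * t)) (fun t => - k * sin (k * t)).
Proof.
move=> T0; apply: isprim_ext (isprim_cos T0 (isprim_lin 0 T k)) => x _ //.
by rewrite mulrC mulrN mulNr.
Qed.

Lemma isprim_sinl T (k : R) : 0 <= T -> isprim 0 T (fun t => sin (k * t)) (fun t => k * cos (k * t)).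
Proof. by move=> T0; apply: isprim_ext (isprim_sin T0 (isprim_lin 0 T k)) => x _ //; rewrite mulrC. Qed.

(* The j-th coefficient of (S), with psi = p + i q. *)
Definition coef_ode T u m (p q : R -> R -> R) (j : nat) :=
  isprim 0 T (fun t => ip 0 1 (p t) (phi j))
    (fun t => lam R j * ip 0 1 (q t) (phi j) - u t * ip 0 1 (fun x => m x * q t x) (phi j)) /\
  isprim 0 T (fun t => ip 0 1 (q t) (phi j))
    (fun t => - (lam R j * ip 0 1 (p t) (phi j)) + u t * ip 0 1 (fun x => m x * p t x) (phi j)).

(** The addition formulas split the Duhamel kernel into functions of t and functions of s. The
    coefficient becomes a combination of trigonometric functions times primitives, and the product
    rule applies. *)
Lemma sol_coef_ode mu m T u psi (j : nat) : measurable_fun (Icc 0 1) mu -> cont 0 1 m ->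
  {ae leb, forall x, 0 <= x <= 1 -> mu x = m x} -> 0 <= T -> L2 0 T u ->
  is_solution mu T u psi -> (1 <= j)%N ->
  coef_ode T u m (fun t x => cre (psi t x)) (fun t x => cim (psi t x)) j.
Proof.
move=> mmu cm ae T0 hu hsol j1; have iu := L2_intg hu.
have [pp pq] := sol_pathL2 hsol.
have H := sol_mild mmu cm ae hsol j1; move: H.
set p := fun t x => cre (psi t x); set q := fun t x => cim (psi t x).
set M := fun s => ip 0 1 (fun x => m x * p s x) (phi j).
set N := fun s => ip 0 1 (fun x => m x * q s x) (phi j).
move=> /= H; set k := lam R j in H *.
have cM : cont 0 T M by apply: pathL2_ipr => //; [exact: pathL2_mulm|exact: L2_phi].
have cN : cont 0 T N by apply: pathL2_ipr => //; [exact: pathL2_mulm|exact: L2_phi].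
have cc : cont 0 T (fun t => cos (k * t)) by exact: cont_cosl.
have cs : cont 0 T (fun t => sin (k * t)) by exact: cont_sinl.
(* [fa] and [fb] are the imaginary and real parts of u(s) exp(i k s) <m psi(s), phi_j>, free of
   t. *)
set fa := fun s => u s * (cos (k * s) * N s + sin (k * s) * M s).
set fb := fun s => u s * (cos (k * s) * M s - sin (k * s) * N s).
have ifa : intg 0 T fa by apply: intgM_cont => //; apply: contD; exact: contM.
have ifb : intg 0 T fb by apply: intgM_cont => //; apply: contB; exact: contM.
set dl : R := (j == 1%N)%:R.
have ha : isprim 0 T (fun t => dl - rint 0 t fa) (fun t => 0 - fa t).
  by apply: isprimB; [exact: isprim_cst|exact: isprim_prim].
have hb : isprim 0 T (fun t => rint 0 t fb) fb by exact: isprim_prim.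
have Hp t : 0 <= t <= T -> ip 0 1 (p t) (phi j) =
    cos (k * t) * (dl - rint 0 t fa) + sin (k * t) * rint 0 t fb.
  move=> tT; have [-> _] := H t tT; case/andP: tT => t0 tT.
  have sub f : intg 0 T f -> intg 0 t f by exact: intg_sub.
  rewrite (@eq_rint _ _ _ _ (fun s => cos (k * t) * fa s - sin (k * t) * fb s)); last first.
    by move=> s _; rewrite (_ : k * (t - s) = k * t - k * s) ?cosB ?sinB /fa /fb /M /N; ring.
  rewrite rintB ?rintZ; [|exact: sub|exact: sub|by apply: sub; exact: intgZ..].
  by rewrite -/dl; ring.
have Hq t : 0 <= t <= T -> ip 0 1 (q t) (phi j) =
    cos (k * t) * rint 0 t fb - sin (k * t) * (dl - rint 0 t fa).
  move=> tT; have [_ ->] := H t tT; case/andP: tT => t0 tT.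
  have sub f : intg 0 T f -> intg 0 t f by exact: intg_sub.
  rewrite (@eq_rint _ _ _ _ (fun s => cos (k * t) * fb s + sin (k * t) * fa s)); last first.
    by move=> s _; rewrite (_ : k * (t - s) = k * t - k * s) ?cosB ?sinB /fa /fb /M /N; ring.
  rewrite rintD ?rintZ; [|exact: sub|exact: sub|by apply: sub; exact: intgZ..].
  by rewrite -/dl; ring.
have pc := isprim_cosl k T0; have ps := isprim_sinl k T0.
split.
- apply: isprim_ext (isprimD (isprimM T0 pc ha) (isprimM T0 ps hb)) => t tT; first by rewrite -Hp.
  rewrite Hq// -/(N t) -/k /fa /fb.
  have -> : u t * N t = u t * N t * (cos (k * t) ^+ 2 + sin (k * t) ^+ 2) by rewrite cos2Dsin2 mulr1.
  ring.
- apply: isprim_ext (isprimB (isprimM T0 pc hb) (isprimM T0 ps ha)) => t tT; first by rewrite -Hq.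
  rewrite Hp// -/(M t) -/k /fa /fb.
  have -> : u t * M t = u t * M t * (cos (k * t) ^+ 2 + sin (k * t) ^+ 2) by rewrite cos2Dsin2 mulr1.
  ring.
Qed.

Lemma sol_init mu m T u psi (j : nat) : measurable_fun (Icc 0 1) mu -> cont 0 1 m ->
  {ae leb, forall x, 0 <= x <= 1 -> mu x = m x} -> 0 <= T ->
  is_solution mu T u psi -> (1 <= j)%N ->
  ip 0 1 (fun x => cre (psi 0 x)) (phi j) = (j == 1%N)%:R /\
  ip 0 1 (fun x => cim (psi 0 x)) (phi j) = 0.
Proof.
move=> mmu cm ae T0 hsol j1.
have [|-> ->] := sol_mild mmu cm ae hsol j1 (_ : 0 <= 0 <= T); first by rewrite lexx.
by rewrite !rint_pt !mulr0 cos0 sin0 mulr1 mulr0 subr0 oppr0 addr0.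
Qed.

End SolutionComponents.

(** * Parseval and integration by parts against the eigenfunctions *)

Section Parseval.
Variable R : realType.
Implicit Types (f g h : R -> R) (e : R).

Lemma sum_coef_PN N f g : L2 0 1 f -> L2 0 1 g ->
  \sum_(1 <= j < N) ip 0 1 f (phi j) * ip 0 1 g (phi j) = ip 0 1 (PN N f) g.
Proof.
move=> hf hg; rewrite ip_suml//; last by move=> j _; apply: L2Z; exact: L2_phi.
by apply: eq_bigr => j _; rewrite ipZl ?[ip _ _ g _]ipC//; exact: L2_phi.
Qed.

Lemma L2norm_PN_le N f : L2 0 1 f -> L2norm 0 1 (PN N f) <= L2norm 0 1 f.
Proof.
move=> hf; rewrite -ler_sqr ?nnegrE ?L2norm_ge0// !L2norm2.
rewrite -sum_coef_PN//; last exact: L2_PN.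
rewrite big_nat (eq_bigr (fun j => ip 0 1 f (phi j) ^+ 2)); last first.
  by move=> j jN; rewrite ip_PN jN expr2.
by rewrite -big_nat; exact: Bessel.
Qed.

Lemma coef_sum_bound N f g : L2 0 1 f -> L2 0 1 g ->
  `|\sum_(1 <= j < N) ip 0 1 f (phi j) * ip 0 1 g (phi j)| <= L2norm 0 1 f * L2norm 0 1 g.
Proof.
move=> hf hg; rewrite sum_coef_PN//; apply: le_trans (ip_CauchySchwarz (L2_PN N f) hg) _.
by apply: ler_wpM2r; [exact: L2norm_ge0|exact: L2norm_PN_le].
Qed.

Lemma parseval_cvg f g : L2 0 1 f -> L2 0 1 g ->
  (fun N => \sum_(1 <= j < N) ip 0 1 f (phi j) * ip 0 1 g (phi j)) @ \oo --> ip 0 1 f g.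
Proof.
move=> hf hg; apply/cvgrPdist_lt => e e0.
have [N0 h] := sin_coef_parseval hf hg e0.
by exists N0 => // N /=; exact: h.
Qed.

(** Two integrations by parts: the first boundary term vanishes with phi_j, the second with f. *)
Lemma ip_dirichlet f f1 f2 (j : nat) : isprim 0 1 f f1 -> isprim 0 1 f1 f2 ->
  f 0 = 0 -> f 1 = 0 -> ip 0 1 f2 (phi j) = - lam R j * ip 0 1 f (phi j).
Proof.
move=> h0 h1 f0 f10.
have cf := isprim_cont ler01 h0; have cf1 := isprim_cont ler01 h1.
have cphi : cont 0 1 (phi j : R -> R) by exact: cont_phi.
have cdphi : cont 0 1 (dphi j : R -> R) by exact: isprim_cont ler01 (@isprim_dphi R 0 1 j ler01).
have E1 := isprim_diff (isprimM ler01 h1 (@isprim_phi R 0 1 j ler01)) (lexx 0) ler01 (lexx 1).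
have E2 := isprim_diff (isprimM ler01 h0 (@isprim_dphi R 0 1 j ler01)) (lexx 0) ler01 (lexx 1).
rewrite phi_at0 phi_at1 !mulr0 subr0 in E1; rewrite f0 f10 !mul0r subr0 in E2.
rewrite rintD in E1; [|exact: intgM_cont (isprim_intg h1) cphi|exact: intg_cont (contM cf1 cdphi)].
rewrite rintD in E2; [|exact: intg_cont (contM cf1 cdphi)|]; last first.
  apply: intg_cont; apply: contM => //; exact: contM (cont_cst _) cphi.
have E3 : rint 0 1 (fun x => f x * (- lam R j * phi j x)) = - lam R j * ip 0 1 f (phi j).
  rewrite /ip -rintZ; last exact: intg_cont (contM cf cphi).
  by apply: eq_rint => x _; ring.
rewrite -E3; rewrite /ip; lra.
Qed.

Lemma isprim_sum1 (a b : R) (N : nat) (F f : nat -> R -> R) :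
  (forall j, (1 <= j)%N -> isprim a b (F j) (f j)) ->
  isprim a b (fun x => \sum_(1 <= j < N) F j x) (fun x => \sum_(1 <= j < N) f j x).
Proof.
move=> h; have : isprim a b (fun x => \sum_(1 <= j < N | (1 <= j)%N) F j x)
    (fun x => \sum_(1 <= j < N | (1 <= j)%N) f j x) by exact: isprim_sum.
by apply: isprim_ext => x _; rewrite big_nat_cond [RHS]big_nat; apply: eq_bigl => i; case: (1 <= i)%N; rewrite ?andbF ?andbT.
Qed.

End Parseval.

(** * Weak formulation and conservation of the norm *)

Section Evolution.
Variable R : realType.
Implicit Types (a b c d e s t x y T : R) (f g h m u : R -> R) (p q : R -> R -> R).

(** Multiplication by -i turns (p, q) into (q, -p) and preserves the equation; a statement on the
    real part therefore yields the one on the imaginary part. *)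
Lemma coef_ode_rot T u m p q (j : nat) : pathL2 T p -> cont 0 1 m ->
  coef_ode T u m p q j -> coef_ode T u m q (fun t x => - p t x) j.
Proof.
move=> [hp _] cm [h1 h2].
have L := L2_phi 0 1 j.
split; first apply: isprim_ext h2 => t tT //.
- have hpt := hp t tT; have hmp : L2 0 1 (fun x => m x * p t x) by exact: L2Mc.
  rewrite ipNl// (@eq_ip _ _ _ (fun x => m x * - p t x) _ (fun x => - (m x * p t x)) (phi j))//; last by move=> x _; ring.
  by rewrite ipNl//; ring.
- apply: isprim_ext (isprimN h1) => t tT; last by ring.
  by rewrite ipNl//; exact: hp.
Qed.

(** For [PN N g] the identity is a finite sum of coefficient equations, in which [ip_dirichlet]
    turns - lam_j <g, phi_j> into <g2, phi_j>. As [PN N g] and [PN N g2] converge in L^2 and the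
    paths are bounded, the limit may be taken under the time integral. *)
Lemma coef_ode_weak T u m p q g g1 g2 : 0 <= T -> intg 0 T u -> cont 0 1 m ->
  pathL2 T p -> pathL2 T q -> (forall j, (1 <= j)%N -> coef_ode T u m p q j) ->
  isprim 0 1 g g1 -> isprim 0 1 g1 g2 -> g 0 = 0 -> g 1 = 0 -> L2 0 1 g2 ->
  isprim 0 T (fun t => ip 0 1 (p t) g)
    (fun t => - ip 0 1 (q t) g2 - u t * ip 0 1 (fun x => m x * q t x) g).
Proof.
move=> T0 iu cm pp pq ode h0 h1 g0 g10 hg2; have [hp _] := pp; have [hq _] := pq.
have cg := isprim_cont ler01 h0; have hg : L2 0 1 g by exact: L2_cont.
have pmq : pathL2 T (fun t x => m x * q t x) by exact: pathL2_mulm.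
have hmq t : 0 <= t <= T -> L2 0 1 (fun x => m x * q t x) by move=> /(pmq.1).
have F1 h : L2 0 1 h -> intg 0 T (fun t => - ip 0 1 (q t) h).
  by move=> hh; apply/intg_cont/contN; exact: pathL2_ipr.
have F2 h : L2 0 1 h -> intg 0 T (fun t => u t * ip 0 1 (fun x => m x * q t x) h).
  by move=> hh; apply: intgM_cont => //; exact: pathL2_ipr pmq hh.
have F12 h k : L2 0 1 h -> L2 0 1 k ->
    intg 0 T (fun t => - ip 0 1 (q t) h - u t * ip 0 1 (fun x => m x * q t x) k).
  by move=> hh hk; apply: intgB; [exact: F1|exact: F2].
split; first exact: F12.
move=> t tT; have /andP[t0 tT'] := tT.
have T00 : 0 <= (0 : R) <= T by rewrite lexx.
have AN N : ip 0 1 (p t) (PN N g) = ip 0 1 (p 0) (PN N g) +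
    rint 0 t (fun r => - ip 0 1 (q r) (PN N g2) - u r * ip 0 1 (fun x => m x * q r x) (PN N g)).
  have H : isprim 0 T (fun t => \sum_(1 <= j < N) ip 0 1 g (phi j) * ip 0 1 (p t) (phi j))
     (fun t => \sum_(1 <= j < N) ip 0 1 g (phi j) * (lam R j * ip 0 1 (q t) (phi j) -
        u t * ip 0 1 (fun x => m x * q t x) (phi j))).
    by apply: isprim_sum1 => j j1; apply: isprimZ; exact: (ode j j1).1.
  have eP (f : R -> R) h : L2 0 1 f -> L2 0 1 h -> ip 0 1 f (PN N h) = \sum_(1 <= j < N) ip 0 1 h (phi j) * ip 0 1 f (phi j).
    by move=> hf hh; rewrite sum_coef_PN// ipC.
  have [_ /(_ t tT)] := H.
  rewrite -!eP//; [|exact: hp..].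
  move=> ->; congr (_ + _); apply: eq_rint => r /andP[r0 rt].
  have rT : 0 <= r <= T by rewrite r0 (le_trans rt).
  rewrite !eP//; [|exact: hmq|exact: hq].
  rewrite mulr_sumr -sumrN -sumrB !big_nat; apply: eq_bigr => j /andP[j1 _].
  by rewrite (ip_dirichlet j h0 h1 g0 g10); ring.
have [B B0 pB] := cont_bounded (pathL2_bound T0 pp).
have [B1 B10 qB] := cont_bounded (pathL2_bound T0 pq).
have [B2 B20 mqB] := cont_bounded (pathL2_bound T0 pmq).
have st f : intg 0 T f -> intg 0 t f by exact: intg_sub.
have iK : intg 0 t (fun r => B1 + `|u r| * B2).
  by apply: st; apply: intgD; [exact: intg_cst|apply: intgM_cont; [exact: intg_norm|exact: cont_cst]].
set K := rint 0 t (fun r => B1 + `|u r| * B2).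
have K0 : 0 <= K by apply: rint_ge0 => r _; rewrite addr_ge0// mulr_ge0.
apply/eqP; rewrite -subr_eq0 -normr_le0; apply/ler_addgt0Pr => e e0; rewrite add0r.
(* 2 B for the errors at times 0 and t, K for the error under the integral. *)
have C0 : 0 < 2 * B + K + 1 by lra.
have e1 : 0 < e / (2 * B + K + 1) by rewrite divr_gt0.
have [N1 hN1] := sine_complete hg e1; have [N2 hN2] := sine_complete hg2 e1.
pose N := maxn N1 N2.
have k1 := hN1 N (leq_maxl _ _); have k2 := hN2 N (leq_maxr _ _).
set e' := e / _ in e1 k1 k2.
have hgN : L2 0 1 (fun x => g x - PN N g x) by apply: L2B => //; exact: L2_PN.
have hg2N : L2 0 1 (fun x => g2 x - PN N g2 x) by apply: L2B => //; exact: L2_PN.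
have bd (f : R -> R) h b : L2 0 1 f -> L2 0 1 h -> L2norm 0 1 f <= b -> L2norm 0 1 h < e' -> `|ip 0 1 f h| <= b * e'.
  move=> hf hh fb he; apply: le_trans (ip_CauchySchwarz hf hh) _.
  by apply: ler_pM; rewrite ?L2norm_ge0// ltW.
have nb t' : 0 <= t' <= T -> L2norm 0 1 (p t') <= B by move=> /pB; rewrite ger0_norm ?L2norm_ge0.
have d1 := bd _ _ _ (hp t tT) hgN (nb t tT) k1.
have d2 := bd _ _ _ (hp 0 T00) hgN (nb 0 T00) k1.
have d3 : `|rint 0 t (fun r => - ip 0 1 (q r) g2 - u r * ip 0 1 (fun x => m x * q r x) g) -
   rint 0 t (fun r => - ip 0 1 (q r) (PN N g2) - u r * ip 0 1 (fun x => m x * q r x) (PN N g))| <= e' * K.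
  rewrite -rintB; [|apply: st; apply: F12 => //; exact: L2_PN..].
  apply: ler_norm_rint => //.
    by apply: intgB; apply: st; apply: F12 => //; exact: L2_PN.
  move=> r /andP[r0 rt]; have rT : 0 <= r <= T by rewrite r0 (le_trans rt).
  rewrite (_ : (- ip 0 1 (q r) g2 - u r * ip 0 1 (fun x => m x * q r x) g) -
      (- ip 0 1 (q r) (PN N g2) - u r * ip 0 1 (fun x => m x * q r x) (PN N g)) =
     - ip 0 1 (q r) (fun x => g2 x - PN N g2 x) -
     u r * ip 0 1 (fun x => m x * q r x) (fun x => g x - PN N g x)); last first.
    by rewrite !ipBr//; try (exact: L2_PN); [ring|exact: hmq|exact: hq].
  apply: le_trans (ler_normB _ _) _; rewrite normrN normrM mulrDr; apply: lerD.
    rewrite mulrC; apply: bd => //; first exact: hq.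
    by have := qB r rT; rewrite ger0_norm ?L2norm_ge0.
  rewrite mulrCA; apply: ler_wpM2l => //; rewrite mulrC; apply: bd => //; first exact: hmq.
  by have := mqB r rT; rewrite ger0_norm ?L2norm_ge0.
have E1 : ip 0 1 (p t) g = ip 0 1 (p t) (fun x => g x - PN N g x) + ip 0 1 (p t) (PN N g).
  by rewrite ipBr ?subrK//; [exact: L2_PN|exact: hp].
have E2 : ip 0 1 (p 0) g = ip 0 1 (p 0) (fun x => g x - PN N g x) + ip 0 1 (p 0) (PN N g).
  by rewrite ipBr ?subrK//; [exact: L2_PN|exact: hp].
rewrite E1 E2 AN.
set I1 := rint 0 t _ in d3 *; set I2 := rint 0 t _ in d3 *.
rewrite (_ : ip 0 1 (p t) (fun x => g x - PN N g x) + (ip 0 1 (p 0) (PN N g) + I2) -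
    (ip 0 1 (p 0) (fun x => g x - PN N g x) + ip 0 1 (p 0) (PN N g) + I1) =
    ip 0 1 (p t) (fun x => g x - PN N g x) - ip 0 1 (p 0) (fun x => g x - PN N g x) - (I1 - I2)); last by ring.
apply: le_trans (ler_normB _ _) _.
apply: le_trans (lerD (ler_normB _ _) d3) _.
have ee : e = e' * (2 * B + K + 1) by rewrite /e' divfK// gt_eqF.
clearbody e' I1 I2; rewrite ee; move: d1 d2 e1; clear.
set X := `|_|; set Y := `|_|; move=> d1 d2 e1; lra.
Qed.

(** In the partial sums of squared coefficients the eigenvalue terms cancel mode by mode, while the
    control terms converge by Parseval to 2 u (<q, m p> - <p, m q>) = 0, multiplication by m being
    symmetric. Dominated convergence then removes them from the time integral. *)
Lemma evol_norm T u m p q : 0 <= T -> intg 0 T u -> cont 0 1 m ->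
  pathL2 T p -> pathL2 T q -> (forall j, (1 <= j)%N -> coef_ode T u m p q j) ->
  (forall j, (1 <= j)%N -> ip 0 1 (p 0) (phi j) = (j == 1%N)%:R /\ ip 0 1 (q 0) (phi j) = 0) ->
  forall t, 0 <= t <= T -> ip 0 1 (p t) (p t) + ip 0 1 (q t) (q t) = 1.
Proof.
move=> T0 iu cm pp pq ode init t tT; have [hp _] := pp; have [hq _] := pq.
have /andP[t0 tT'] := tT.
have pmq : pathL2 T (fun t x => m x * q t x) by exact: pathL2_mulm.
have pmp : pathL2 T (fun t x => m x * p t x) by exact: pathL2_mulm.
pose cf f j := ip 0 1 f (phi j).
pose S N t := \sum_(1 <= j < N) (cf (p t) j * cf (p t) j + cf (q t) j * cf (q t) j).
pose G N r := \sum_(1 <= j < N) (cf (q r) j * cf (fun x => m x * p r x) j - cf (p r) j * cf (fun x => m x * q r x) j).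
have HS N : isprim 0 T (S N) (fun r => 2 * (u r * G N r)).
  have H : isprim 0 T (S N) (fun t => \sum_(1 <= j < N)
    (((lam R j * ip 0 1 (q t) (phi j) - u t * ip 0 1 (fun x => m x * q t x) (phi j)) * cf (p t) j
      + cf (p t) j * (lam R j * ip 0 1 (q t) (phi j) - u t * ip 0 1 (fun x => m x * q t x) (phi j)))
      + ((- (lam R j * ip 0 1 (p t) (phi j)) + u t * ip 0 1 (fun x => m x * p t x) (phi j)) * cf (q t) j
      + cf (q t) j * (- (lam R j * ip 0 1 (p t) (phi j)) + u t * ip 0 1 (fun x => m x * p t x) (phi j))))).
    by apply: isprim_sum1 => j /ode [ode1 ode2]; apply: isprimD; apply: isprimM.
  apply: isprim_ext H => r rT //; rewrite /G 2!mulr_sumr !big_nat; apply: eq_bigr => j /andP[j1 _].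
  by rewrite /cf; ring.
have cvS : (fun N => S N t) @ \oo --> ip 0 1 (p t) (p t) + ip 0 1 (q t) (q t).
  rewrite /S; under eq_fun do rewrite big_split/=.
  by apply: cvgD; apply: parseval_cvg; [exact: hp|exact: hp|exact: hq|exact: hq].
have S0 : \forall N \near \oo, S N 0 = 1.
  exists 2%N => // N /= N2; rewrite /S (bigD1_seq 1%N)/= ?mem_index_iota ?iota_uniq//.
  rewrite big_nat_cond big1 ?addr0 => [|j /andP[/andP[j1 _] /negbTE jn]].
    by rewrite /cf (init 1%N isT).1 (init 1%N isT).2 mulr0 addr0 mulr1.
  by rewrite /cf (init j j1).1 (init j j1).2 jn mulr0 addr0.
have [B B0 pB] := cont_bounded (pathL2_bound T0 pp).
have [B1 B10 qB] := cont_bounded (pathL2_bound T0 pq).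
have [B2 B20 mqB] := cont_bounded (pathL2_bound T0 pmq).
have [B3 B30 mpB] := cont_bounded (pathL2_bound T0 pmp).
have cvI : (fun N => rint 0 t (fun r => 2 * (u r * G N r))) @ \oo --> rint 0 t (fun=> 0 : R).
  apply: (@rint_dct _ _ _ _ _ (fun r => 2 * (B1 * B3 + B * B2) * `|u r|)).
  - move=> N; apply: intg_measurable; exact: intg_sub (lexx 0) tT' (HS N).1.
  - exact: measurable_cst.
  - by apply: intgZ; apply: intg_norm; exact: intg_sub iu.
  - apply: aeW => r /andP[r0 rt]; have rT : 0 <= r <= T by rewrite r0 (le_trans rt).
    have hpr := hp r rT; have hqr := hq r rT; have hmp := pmp.1 r rT; have hmq := pmq.1 r rT.
    have -> : (0 : R) = 2 * (u r * (ip 0 1 (q r) (fun x => m x * p r x) - ip 0 1 (p r) (fun x => m x * q r x))).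
      rewrite (_ : ip 0 1 (q r) _ = ip 0 1 (p r) (fun x => m x * q r x)) ?subrr ?mulr0//.
      by apply: eq_rint => x _; ring.
    apply: cvgM; first exact: cvg_cst.
    apply: cvgM; first exact: cvg_cst.
    rewrite /G; under eq_fun do rewrite sumrB.
    by apply: cvgB; exact: parseval_cvg.
  - move=> N r /andP[r0 rt]; have rT : 0 <= r <= T by rewrite r0 (le_trans rt).
    have hpr := hp r rT; have hqr := hq r rT; have hmp := pmp.1 r rT; have hmq := pmq.1 r rT.
    rewrite normrM (ger0_norm (ler0n _ 2)) -mulrA; apply: ler_wpM2l => //.
    rewrite normrM mulrC; apply: ler_wpM2r => //.
    rewrite /G sumrB; apply: le_trans (ler_normB _ _) _; apply: lerD.
      apply: le_trans (coef_sum_bound N hqr hmp) _; apply: ler_pM; rewrite ?L2norm_ge0//.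
        by have := qB r rT; rewrite ger0_norm ?L2norm_ge0.
      by have := mpB r rT; rewrite ger0_norm ?L2norm_ge0.
    apply: le_trans (coef_sum_bound N hpr hmq) _; apply: ler_pM; rewrite ?L2norm_ge0//.
      by have := pB r rT; rewrite ger0_norm ?L2norm_ge0.
    by have := mqB r rT; rewrite ger0_norm ?L2norm_ge0.
have cv1 : (fun N => S N t) @ \oo --> (1 : R).
  have -> : (1 : R) = 1 + rint 0 t (fun=> 0) by rewrite rint_cst// mul0r addr0.
  have H : (fun N => 1 + rint 0 t (fun r => 2 * (u r * G N r))) @ \oo --> 1 + rint 0 t (fun=> 0 : R).
    by apply: cvgD => //; exact: cvg_cst.
  apply: cvg_trans H; apply: near_eq_cvg.
  by move: S0; apply: filterS => N SN0; rewrite (HS N).2// SN0.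
exact: (cvg_unique _ cvS cv1).
Qed.

End Evolution.

(** * The gauge transform *)

Section MovingFrame.
Variable R : realType.
Implicit Types (a b c d e s t x y T : R) (f g h m u th : R -> R) (p q : R -> R -> R).

Lemma ipNr (a b : R) f h : L2 a b f -> L2 a b h -> ip a b h (fun x => - f x) = - ip a b h f.
Proof. by move=> hf hh; rewrite ipC ipNl// ipC. Qed.

(* Chain rule along a moving parameter z = th t, where L is the z-derivative of Xi: the terms - u L and th' L cancel. *)
Lemma isprim_chain2 T th u (Xi K L : R -> R -> R) (B C : R) : 0 <= T -> isprim 0 T th u ->
  0 <= C -> (forall t, 0 <= t <= T -> `|th t| <= B) ->
  (forall z, `|z| <= B -> isprim 0 T (Xi ^~ z) (fun t => K t z - u t * L t z)) ->
  (forall t z z', 0 <= t <= T -> `|z| <= B -> `|z'| <= B ->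
     [/\ `|Xi t z' - Xi t z - (z' - z) * L t z| <= C * (z' - z) ^+ 2,
         `|K t z' - K t z| <= C * `|z' - z| & `|L t z' - L t z| <= C * `|z' - z|]) ->
  (forall z, `|z| <= B -> cont 0 T (K ^~ z)) -> (forall z, `|z| <= B -> cont 0 T (L ^~ z)) ->
  isprim 0 T (fun t => Xi t (th t)) (fun t => K t (th t)).
Proof.
move=> T0 hth C0 thB hXi reg cK cL; have cth := isprim_cont T0 hth; have iu := isprim_intg hth.
have cKth : cont 0 T (fun t => K t (th t)).
  move=> s sT e e0; have e2 : 0 < e / 2 by rewrite divr_gt0.
  have eC : 0 < e / 2 / (C + 1) by rewrite !divr_gt0//; lra.
  have [d1 d10 h1] := cK _ (thB s sT) s sT _ e2; have [d2 d20 h2] := cth s sT _ eC.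
  exists (Num.min d1 d2); first by rewrite lt_min d10.
  move=> t tT; rewrite lt_min => /andP[t1 t2].
  rewrite (_ : _ - _ = (K t (th t) - K t (th s)) + (K t (th s) - K s (th s))); last by ring.
  apply: le_lt_trans (ler_normD _ _) _.
  have [_ k1 _] := reg t (th s) (th t) tT (thB s sT) (thB t tT).
  have k2 := h1 t tT t1; have k3 := h2 t tT t2.
  rewrite ltr_pdivlMr in k3; last by lra.
  by have := normr_ge0 (th t - th s); lra.
apply: (@isprimI _ _ _ _ _ (fun t => 1 + `|u t|)) => //.
- exact: intg_cont.
- by apply: intgD; [exact: intg_cst|exact: intg_norm].
move=> e e0 s sT.
have D0 : 0 < 4 * C + 3 by lra.
have n0 : 0 < e / (4 * C + 3) by rewrite divr_gt0.
(* Shares of the error: 2 C for the Taylor remainder [E1], 2 (C + 1) for freezing K and L. *)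
set eta := e / (4 * C + 3) in n0.
have eE : e = eta * (4 * C + 3) by rewrite /eta divfK// gt_eqF.
have [d1 d10 h1] := cL _ (thB s sT) s sT _ n0; have [d2 d20 h2] := cth s sT _ n0.
exists (Num.min d1 d2); first by rewrite lt_min d10.
move=> x y x0 xy yT; rewrite !lt_min => /andP[x1 x2] /andP[y1 y2].
have xT : 0 <= x <= T by rewrite x0 (le_trans xy).
have yT' : 0 <= y <= T by rewrite yT (le_trans x0).
have sub f : intg 0 T f -> intg x y f by exact: intg_sub.
have inr r : x <= r <= y -> 0 <= r <= T.
  by move=> /andP[xr ry]; rewrite (le_trans x0)//= (le_trans ry).
have nr r : x <= r <= y -> `|L r (th s) - L s (th s)| < eta /\ `|th r - th s| < eta.
  move=> rxy; have rT := inr r rxy; have /andP[xr ry] := rxy.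
  by split; [apply: h1 => //|apply: h2 => //];
    move: x1 x2 y1 y2; rewrite !ltr_distl; lra.
have Kx : intg 0 T (fun r => K r (th x)) by apply: intg_cont; exact: cK (thB x xT).
have Lx : intg 0 T (fun r => u r * L r (th x)).
  by apply: intgM_cont => //; exact: cL (thB x xT).
have Kt : intg 0 T (fun r => K r (th r)) by exact: intg_cont.
have ithx : th y - th x = rint x y u by exact: isprim_diff hth x0 xy yT.
have EX := isprim_diff (hXi _ (thB x xT)) x0 xy yT.
rewrite /= in EX.
set E1 := Xi y (th y) - Xi y (th x) - (th y - th x) * L y (th x).
(* With z frozen at th x, the integral of - u L given by [hXi] meets the first-order term (th y - th
   x) L y (th x). What is left are oscillations of L in time and of K in z, small by continuity. *)
have split3 : Xi y (th y) - Xi x (th x) - rint x y (fun r => K r (th r)) =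
    E1 + rint x y (fun r => u r * (L y (th x) - L r (th x)) + (K r (th x) - K r (th r))).
  have -> : rint x y (fun r => u r * (L y (th x) - L r (th x)) + (K r (th x) - K r (th r))) =
      (th y - th x) * L y (th x) + (rint x y (fun r => K r (th x) - u r * L r (th x))) - rint x y (fun r => K r (th r)).
    rewrite ithx mulrC -rintZ; last exact: sub.
    rewrite -rintD; [|by apply: sub; exact: intgZ|by apply: sub; exact: intgB].
    rewrite -rintB; [|by apply: sub; apply: intgD; [exact: intgZ|exact: intgB]|exact: sub].
    by apply: eq_rint => r _; ring.
  by rewrite -EX /E1; ring.
rewrite split3.
have hE1 : `|E1| <= (2 * C * eta) * rint x y (fun r => `|u r|).
  have [k1 _ _] := reg y (th x) (th y) yT' (thB x xT) (thB y yT').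
  apply: le_trans k1 _; rewrite (_ : 2 * C * eta * _ = C * (2 * eta * rint x y (fun r => `|u r|))); last by ring.
  apply: ler_wpM2l => //; rewrite -real_normK ?num_real// expr2.
  have [_ a1] := nr x (introT andP (conj (lexx x) xy)); have [_ a2] := nr y (introT andP (conj xy (lexx y))).
  apply: ler_pM => //; last by rewrite ithx; apply: rint_norm; exact: sub.
  rewrite (_ : th y - th x = (th y - th s) - (th x - th s)); last by ring.
  by apply: le_trans (ler_normB _ _) _; lra.
have ih : intg x y (fun r => 1 + `|u r|) by apply: sub; apply: intgD; [exact: intg_cst|exact: intg_norm].
have hE2 : `|rint x y (fun r => u r * (L y (th x) - L r (th x)) + (K r (th x) - K r (th r)))| <=
    (2 * (C + 1) * eta) * rint x y (fun r => 1 + `|u r|).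
  apply: ler_norm_rint => //.
    apply: sub; apply: intgD; last exact: intgB.
    apply: eq_intg (intgB (intgZ (L y (th x)) iu) Lx) => r _; ring.
  move=> r rxy; have rT := inr r rxy; have [Lr thr] := nr r rxy.
  have [Ly _] := nr y (introT andP (conj xy (lexx y))).
  have [_ thx] := nr x (introT andP (conj (lexx x) xy)).
  have [_ _ b1] := reg y (th s) (th x) yT' (thB s sT) (thB x xT).
  have [_ _ b2] := reg r (th s) (th x) rT (thB s sT) (thB x xT).
  have [_ b3 _] := reg r (th r) (th x) rT (thB r rT) (thB x xT).
  have b1' : C * `|th x - th s| <= C * eta by apply: ler_wpM2l => //; exact: ltW.
  have b3' : C * `|th x - th r| <= C * (2 * eta).
    apply: ler_wpM2l => //; rewrite (_ : th x - th r = (th x - th s) - (th r - th s)); last by ring.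
    by apply: le_trans (ler_normB _ _) _; lra.
  have b4 : `|L y (th x) - L r (th x)| <= 2 * (C + 1) * eta.
    rewrite (_ : _ - _ = (L y (th x) - L y (th s)) + (L y (th s) - L s (th s)) -
       ((L r (th x) - L r (th s)) + (L r (th s) - L s (th s)))); last by ring.
    apply: le_trans (ler_normB _ _) _.
    have := ler_normD (L y (th x) - L y (th s)) (L y (th s) - L s (th s)).
    by have := ler_normD (L r (th x) - L r (th s)) (L r (th s) - L s (th s)); lra.
  apply: le_trans (ler_normD _ _) _; rewrite normrM.
  have b5 := ler_wpM2l (normr_ge0 (u r)) b4.
  by lra.
apply: le_trans (ler_normD _ _) _.
have I1 : rint x y (fun r => `|u r|) <= rint x y (fun r => 1 + `|u r|).
  by apply: ler_rint => //; [apply: sub; exact: intg_norm|move=> r _; rewrite lerDr].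
have I0 : 0 <= rint x y (fun r => 1 + `|u r|) by apply: rint_ge0 => r _; rewrite addr_ge0.
have c1 : 0 <= 2 * C * eta by apply: mulr_ge0; [exact: mulr_ge0|exact: ltW].
have c2 := ler_wpM2l c1 I1.
have c3 : 0 <= eta * rint x y (fun r => 1 + `|u r|) by apply: mulr_ge0 => //; exact: ltW.
rewrite [in X in _ <= X]eE; move: hE1 hE2 c2 c3; clear.
by move: (rint x y (fun r => `|u r|)) (rint x y (fun r => 1 + `|u r|)) `|E1| `|rint _ _ _|; clear => *; lra.
Qed.

End MovingFrame.

(** * The gauged equation tested against the eigenfunctions *)

Section Gauge.
Variable R : realType.
Variables (m m1 m2 : R -> R).
Hypothesis m_prim : isprim 0 1 m m1.
Hypothesis m1_prim : isprim 0 1 m1 m2.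
Hypothesis m2_cont : cont 0 1 m2.
Implicit Types (s t x y z T : R) (g h u th : R -> R) (p q : R -> R -> R) (j : nat).

(* Dop and Vop are the coefficients of z and z^2 in the conjugation of - d^2/dx^2 by exp(i z m), applied to phi_j. *)
Definition Dop j x : R := 2 * m1 x * dphi j x + m2 x * phi j x.
Definition Vop j x : R := m1 x ^+ 2 * phi j x.

Let cm : cont 0 1 m. Proof. exact: isprim_cont ler01 m_prim. Qed.
Let cm1 : cont 0 1 m1. Proof. exact: isprim_cont ler01 m1_prim. Qed.

Lemma cont_dphi (a b : R) j : cont a b (dphi j : R -> R).
Proof. by apply: contM; [exact: cont_cst|exact: cont_cosl]. Qed.

Lemma cont_Dop j : cont 0 1 (Dop j).
Proof.
apply: contD; last by apply: contM => //; exact: cont_phi.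
by apply: contM; [apply: contM => //; exact: cont_cst|exact: cont_dphi].
Qed.

Lemma cont_Vop j : cont 0 1 (Vop j).
Proof. by apply: contM; [exact: contX|exact: cont_phi]. Qed.

Lemma L2_Dop j : L2 0 1 (Dop j). Proof. exact: L2_cont (cont_Dop j). Qed.
Lemma L2_Vop j : L2 0 1 (Vop j). Proof. exact: L2_cont (cont_Vop j). Qed.

(* gc + i gs = exp(i z m) phi_j, with x-derivatives gc1, gs1 and gc2, gs2. *)
Definition gc j z x : R := cos (z * m x) * phi j x.
Definition gs j z x : R := sin (z * m x) * phi j x.
Definition gc1 j z x : R := - sin (z * m x) * (z * m1 x) * phi j x + cos (z * m x) * dphi j x.
Definition gs1 j z x : R := cos (z * m x) * (z * m1 x) * phi j x + sin (z * m x) * dphi j x.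
Definition gc2 j z x : R := - (lam R j * gc j z x + z * (sin (z * m x) * Dop j x) + z ^+ 2 * (cos (z * m x) * Vop j x)).
Definition gs2 j z x : R := - (lam R j * gs j z x - z * (cos (z * m x) * Dop j x) + z ^+ 2 * (sin (z * m x) * Vop j x)).

Let zm z : isprim 0 1 (fun x => z * m x) (fun x => z * m1 x). Proof. exact: isprimZ. Qed.
Let czm z : isprim 0 1 (fun x => cos (z * m x)) (fun x => - sin (z * m x) * (z * m1 x)).
Proof. exact: isprim_cos ler01 (zm z). Qed.
Let szm z : isprim 0 1 (fun x => sin (z * m x)) (fun x => cos (z * m x) * (z * m1 x)).
Proof. exact: isprim_sin ler01 (zm z). Qed.

Lemma gc_prim j z : isprim 0 1 (gc j z) (gc1 j z).
Proof. exact: isprimM ler01 (czm z) (@isprim_phi R 0 1 j ler01). Qed.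

Lemma gs_prim j z : isprim 0 1 (gs j z) (gs1 j z).
Proof. exact: isprimM ler01 (szm z) (@isprim_phi R 0 1 j ler01). Qed.

Lemma gc1_prim j z : isprim 0 1 (gc1 j z) (gc2 j z).
Proof.
have hp := @isprim_phi R 0 1 j ler01; have hd := @isprim_dphi R 0 1 j ler01.
have zm1 := isprimZ z m1_prim.
have A1 := isprimM ler01 (isprimM ler01 (isprimN (szm z)) zm1) hp.
apply: isprim_ext (isprimD A1 (isprimM ler01 (czm z) hd)) => x _ //.
by rewrite /gc2 /gc /Dop /Vop; ring.
Qed.

Lemma gs1_prim j z : isprim 0 1 (gs1 j z) (gs2 j z).
Proof.
have hp := @isprim_phi R 0 1 j ler01; have hd := @isprim_dphi R 0 1 j ler01.
have zm1 := isprimZ z m1_prim.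
have A1 := isprimM ler01 (isprimM ler01 (czm z) zm1) hp.
apply: isprim_ext (isprimD A1 (isprimM ler01 (szm z) hd)) => x _ //.
by rewrite /gs2 /gs /Dop /Vop; ring.
Qed.

Let ccos z : cont 0 1 (fun x => cos (z * m x)). Proof. exact: isprim_cont ler01 (czm z). Qed.
Let csin z : cont 0 1 (fun x => sin (z * m x)). Proof. exact: isprim_cont ler01 (szm z). Qed.

Lemma cont_gc j z : cont 0 1 (gc j z). Proof. exact: isprim_cont ler01 (gc_prim j z). Qed.
Lemma cont_gs j z : cont 0 1 (gs j z). Proof. exact: isprim_cont ler01 (gs_prim j z). Qed.

Lemma cont_gc2 j z : cont 0 1 (gc2 j z).
Proof.
apply: contN; apply: contD; last first.
  by apply: contM (cont_cst _) _; apply: contM => //; exact: cont_Vop.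
apply: contD; first exact: contM (cont_cst _) (cont_gc j z).
by apply: contM (cont_cst _) _; apply: contM => //; exact: cont_Dop.
Qed.

Lemma cont_gs2 j z : cont 0 1 (gs2 j z).
Proof.
apply: contN; apply: contD; last first.
  by apply: contM (cont_cst _) _; apply: contM => //; exact: cont_Vop.
apply: contB; first exact: contM (cont_cst _) (cont_gs j z).
by apply: contM (cont_cst _) _; apply: contM => //; exact: cont_Dop.
Qed.

Lemma trig_taylor Mm x z z' : `|m x| <= Mm ->
  [/\ `|cos (z' * m x) - cos (z * m x) + (z' - z) * (m x * sin (z * m x))| <= Mm ^+ 2 * (z' - z) ^+ 2,
      `|sin (z' * m x) - sin (z * m x) - (z' - z) * (m x * cos (z * m x))| <= Mm ^+ 2 * (z' - z) ^+ 2,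
      `|cos (z' * m x) - cos (z * m x)| <= Mm * `|z' - z| &
      `|sin (z' * m x) - sin (z * m x)| <= Mm * `|z' - z|].
Proof.
move=> hM; have M0 := le_trans (normr_ge0 _) hM.
have D : z' * m x - z * m x = (z' - z) * m x by ring.
have D2 : (z' * m x - z * m x) ^+ 2 <= Mm ^+ 2 * (z' - z) ^+ 2.
  rewrite D exprMn mulrC; apply: ler_wpM2r; first exact: sqr_ge0.
  by rewrite -real_normK ?num_real// ler_pXn2r// nnegrE.
have D1 : `|z' * m x - z * m x| <= Mm * `|z' - z| by rewrite D normrM mulrC ler_wpM2r.
split.
- apply: le_trans D2; have := cos_taylor1 (z * m x) (z' * m x).
  by rewrite (_ : cos (z' * m x) - cos (z * m x) - - sin (z * m x) * (z' * m x - z * m x) =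
    cos (z' * m x) - cos (z * m x) + (z' - z) * (m x * sin (z * m x))); last by ring.
- apply: le_trans D2; have := sin_taylor1 (z * m x) (z' * m x).
  by rewrite (_ : sin (z' * m x) - sin (z * m x) - cos (z * m x) * (z' * m x - z * m x) =
    sin (z' * m x) - sin (z * m x) - (z' - z) * (m x * cos (z * m x))); last by ring.
- exact: le_trans (cos_lip _ _) D1.
- exact: le_trans (sin_lip _ _) D1.
Qed.

(* pt + i qt = exp(- i th m) (p + i q). *)
Definition pt p q th t x : R := cos (th t * m x) * p t x + sin (th t * m x) * q t x.
Definition qt p q th t x : R := cos (th t * m x) * q t x - sin (th t * m x) * p t x.

(** Supplies, uniformly in x, the Taylor and Lipschitz bounds in z that [isprim_chain2] demands. The
    factors z and z^2 in [gc2] and [gs2] confine the estimate to |z| <= B. *)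
Lemma gauge_lip1 j (B : R) : 0 <= B -> exists2 C : R, 0 <= C & forall x z z', 0 <= x <= 1 -> `|z| <= B -> `|z'| <= B ->
  [/\ `|gc j z' x - gc j z x + (z' - z) * (m x * gs j z x)| <= C * (z' - z) ^+ 2,
      `|gs j z' x - gs j z x - (z' - z) * (m x * gc j z x)| <= C * (z' - z) ^+ 2,
      `|gc j z' x - gc j z x| <= C * `|z' - z| & `|gs j z' x - gs j z x| <= C * `|z' - z|] /\
  `|gc2 j z' x - gc2 j z x| <= C * `|z' - z| /\ `|gs2 j z' x - gs2 j z x| <= C * `|z' - z|.
Proof.
move=> B0; have [Mm Mm0 hm] := cont_bounded cm.
have [Md Md0 hd] := cont_bounded (cont_Dop j); have [Mv Mv0 hv] := cont_bounded (cont_Vop j).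
have l0 : 0 <= lam R j by rewrite /lam sqr_ge0.
pose C := 2 * Mm ^+ 2 + 2 * Mm + lam R j * (2 * Mm) + (1 + B * Mm) * Md + (2 * B + B ^+ 2 * Mm) * Mv.
have C1 : 0 <= 2 * Mm ^+ 2 by rewrite mulr_ge0// sqr_ge0.
have C2 : 0 <= lam R j * (2 * Mm) by apply: mulr_ge0 => //; exact: mulr_ge0.
have C3 : 0 <= (1 + B * Mm) * Md by apply: mulr_ge0 => //; apply: addr_ge0 => //; exact: mulr_ge0.
have C4 : 0 <= (2 * B + B ^+ 2 * Mm) * Mv.
  by apply: mulr_ge0 => //; apply: addr_ge0; apply: mulr_ge0 => //; exact: sqr_ge0.
exists C; first by rewrite /C !addr_ge0// mulr_ge0.
move=> x z z' x01 zB zB'; have [t1 t2 t3 t4] := trig_taylor z z' (hm x x01).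
have hphi := phi_bound j x; have hD := hd x x01; have hV := hv x x01.
have key (a b : R) : `|a| <= b -> `|a * phi j x| <= 2 * b.
  by move=> ab; rewrite normrM mulrC; apply: ler_pM.
have s0 := sqr_ge0 (z' - z); have n0 := normr_ge0 (z' - z).
have le1 : 2 * Mm ^+ 2 <= C by rewrite /C; lra.
have le2 : 2 * Mm <= C by rewrite /C; lra.
split; [split|].
- rewrite (_ : _ + _ = (cos (z' * m x) - cos (z * m x) + (z' - z) * (m x * sin (z * m x))) * phi j x); last first.
    by rewrite /gc /gs; ring.
  by apply: le_trans (key _ _ t1) _; rewrite mulrA; apply: ler_wpM2r.
- rewrite (_ : _ - _ - _ = (sin (z' * m x) - sin (z * m x) - (z' - z) * (m x * cos (z * m x))) * phi j x); last first.
    by rewrite /gc /gs; ring.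
  by apply: le_trans (key _ _ t2) _; rewrite mulrA; apply: ler_wpM2r.
- rewrite /gc -mulrBl; apply: le_trans (key _ _ t3) _; rewrite mulrA; exact: ler_wpM2r.
- rewrite /gs -mulrBl; apply: le_trans (key _ _ t4) _; rewrite mulrA; exact: ler_wpM2r.
have lin (f : R -> R) h (M : R) : `|f (z' * m x) - f (z * m x)| <= Mm * `|z' - z| -> `|f (z' * m x)| <= 1 ->
    0 <= M -> `|h x| <= M ->
    [/\ `|z' * (f (z' * m x) * h x) - z * (f (z * m x) * h x)| <= (1 + B * Mm) * M * `|z' - z| &
     `|z' ^+ 2 * (f (z' * m x) * h x) - z ^+ 2 * (f (z * m x) * h x)| <= (2 * B + B ^+ 2 * Mm) * M * `|z' - z|].
  move=> fl f1 M0 hM.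
  have aux (k : R) (A D : R) : 0 <= A -> 0 <= D -> `|k| <= A * `|z' - z| + D * (Mm * `|z' - z|) -> `|k * h x| <= (A + D * Mm) * M * `|z' - z|.
    move=> A0 D0 hk; rewrite normrM mulrAC; apply: ler_pM => //.
    by apply: le_trans hk _; rewrite mulrDl mulrA.
  split.
    rewrite (_ : _ - _ = ((z' - z) * f (z' * m x) + z * (f (z' * m x) - f (z * m x))) * h x); last by ring.
    apply: aux => //; apply: le_trans (ler_normD _ _) _; rewrite !normrM mul1r; apply: lerD.
      by rewrite ler_piMr.
    by apply: ler_pM.
  rewrite (_ : _ - _ = ((z' - z) * (z' + z) * f (z' * m x) + z ^+ 2 * (f (z' * m x) - f (z * m x))) * h x); last by ring.
  apply: aux; [exact: mulr_ge0|exact: sqr_ge0|].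
  apply: le_trans (ler_normD _ _) _; rewrite !normrM; apply: lerD.
    apply: le_trans (_ : `|z' - z| * (2 * B) * 1 <= _); last by rewrite mulr1 mulrC.
    apply: ler_pM => //; apply: ler_pM => //.
    by apply: le_trans (ler_normD _ _) _; lra.
  by apply: ler_pM => //; rewrite expr2; apply: ler_pM.
have [d1 _] := lin sin (Dop j) Md t4 (sin_max _) Md0 hD.
have [_ v1] := lin cos (Vop j) Mv t3 (cos_max _) Mv0 hV.
have [d2 _] := lin cos (Dop j) Md t3 (cos_max _) Md0 hD.
have [_ v2] := lin sin (Vop j) Mv t4 (sin_max _) Mv0 hV.
have c1 : `|lam R j * (gc j z' x - gc j z x)| <= lam R j * (2 * Mm) * `|z' - z|.
  have h : `|gc j z' x - gc j z x| <= 2 * Mm * `|z' - z|.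
    by rewrite /gc -mulrBl -[X in _ <= X]mulrA; apply: key.
  by rewrite normrM (ger0_norm l0) -[X in _ <= X]mulrA; exact: (ler_wpM2l l0 h).
have c2 : `|lam R j * (gs j z' x - gs j z x)| <= lam R j * (2 * Mm) * `|z' - z|.
  have h : `|gs j z' x - gs j z x| <= 2 * Mm * `|z' - z|.
    by rewrite /gs -mulrBl -[X in _ <= X]mulrA; apply: key.
  by rewrite normrM (ger0_norm l0) -[X in _ <= X]mulrA; exact: (ler_wpM2l l0 h).
have fin (a b c : R) : `|a| <= lam R j * (2 * Mm) * `|z' - z| -> `|b| <= (1 + B * Mm) * Md * `|z' - z| ->
    `|c| <= (2 * B + B ^+ 2 * Mm) * Mv * `|z' - z| -> `|a + b + c| <= C * `|z' - z|.
  move=> ha hb hc; apply: le_trans (ler_normD _ _) _; apply: le_trans (lerD (ler_normD _ _) (lexx _)) _.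
  apply: le_trans (lerD (lerD ha hb) hc) _; rewrite -!mulrDl; apply: ler_wpM2r => //.
  by rewrite /C -!addrA; apply: ler_wpDl => //; apply: ler_wpDl => //; rewrite mulr_ge0.
split.
- rewrite (_ : gc2 j z' x - gc2 j z x = - (lam R j * (gc j z' x - gc j z x) +
    (z' * (sin (z' * m x) * Dop j x) - z * (sin (z * m x) * Dop j x)) +
    (z' ^+ 2 * (cos (z' * m x) * Vop j x) - z ^+ 2 * (cos (z * m x) * Vop j x)))); last by rewrite /gc2; ring.
  by rewrite normrN; exact: fin.
- rewrite (_ : gs2 j z' x - gs2 j z x = - (lam R j * (gs j z' x - gs j z x) +
    - (z' * (cos (z' * m x) * Dop j x) - z * (cos (z * m x) * Dop j x)) +
    (z' ^+ 2 * (sin (z' * m x) * Vop j x) - z ^+ 2 * (sin (z * m x) * Vop j x)))); last by rewrite /gs2; ring.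
  by rewrite normrN; apply: fin => //; rewrite normrN.
Qed.

(** Since <exp(- i th m)(p + i q), phi_j> = <p + i q, exp(i th m) phi_j>, the gauge acts on the test
    function. For fixed z this function vanishes at 0 and 1 and has two derivatives, so
    [coef_ode_weak] applies; [isprim_chain2] then sets z = th t, and its cancellation is the removal
    of u from the equation. *)
Lemma gauge_ode T u th p q j : 0 <= T -> isprim 0 T th u ->
  pathL2 T p -> pathL2 T q -> (forall j, (1 <= j)%N -> coef_ode T u m p q j) ->
  isprim 0 T (fun t => ip 0 1 (pt p q th t) (phi j))
    (fun t => lam R j * ip 0 1 (qt p q th t) (phi j) + th t * ip 0 1 (pt p q th t) (Dop j)
      + th t ^+ 2 * ip 0 1 (qt p q th t) (Vop j)).
Proof.
move=> T0 hth pp pq ode; have iu := isprim_intg hth; have cth := isprim_cont T0 hth.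
have [hp _] := pp; have [hq _] := pq.
have [B B0 thB] := cont_bounded cth.
have [C1 C10 hC] := gauge_lip1 j B0; have [Mm Mm0 hm] := cont_bounded cm.
pose C := C1 * (1 + Mm); have C0 : 0 <= C by apply: mulr_ge0 => //; exact: addr_ge0.
have CC k : 0 <= k -> C1 * k <= C * k.
  by move=> k0; apply: ler_wpM2r => //; rewrite ler_peMr// lerDl.
have pmp : pathL2 T (fun t x => m x * p t x) by exact: pathL2_mulm.
have pmq : pathL2 T (fun t x => m x * q t x) by exact: pathL2_mulm.
have Lc z : L2 0 1 (gc j z) by exact: L2_cont (cont_gc j z).
have Ls z : L2 0 1 (gs j z) by exact: L2_cont (cont_gs j z).
have Lc2 z : L2 0 1 (gc2 j z) by exact: L2_cont (cont_gc2 j z).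
have Ls2 z : L2 0 1 (gs2 j z) by exact: L2_cont (cont_gs2 j z).
pose Xi t z := ip 0 1 (p t) (gc j z) + ip 0 1 (q t) (gs j z).
pose K t z := - ip 0 1 (q t) (gc2 j z) + ip 0 1 (p t) (gs2 j z).
pose L t z := ip 0 1 (fun x => m x * q t x) (gc j z) - ip 0 1 (fun x => m x * p t x) (gs j z).
have g00 z k : gc k z 0 = 0 /\ gc k z 1 = 0 by rewrite /gc phi_at0 phi_at1 !mulr0.
have g01 z k : gs k z 0 = 0 /\ gs k z 1 = 0 by rewrite /gs phi_at0 phi_at1 !mulr0.
have pnp := pathL2_N pp.
have ode' k : (1 <= k)%N -> coef_ode T u m q (fun t x => - p t x) k.
  by move=> /ode; exact: coef_ode_rot.
have [Bp Bp0 pB] := cont_bounded (pathL2_bound T0 pp).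
have [Bq Bq0 qB] := cont_bounded (pathL2_bound T0 pq).
have nb t : 0 <= t <= T -> L2norm 0 1 (p t) <= Bp /\ L2norm 0 1 (q t) <= Bq.
  by move=> tT; have := pB t tT; have := qB t tT; rewrite !ger0_norm ?L2norm_ge0.
have H : isprim 0 T (fun t => Xi t (th t)) (fun t => K t (th t)).
  apply: (@isprim_chain2 _ T th u Xi K L B (C * (Bp + Bq))) => //.
  - by apply: mulr_ge0 => //; exact: addr_ge0.
  - move=> z zB; have [c0 c1] := g00 z j; have [s0 s1] := g01 z j.
    have A1 := coef_ode_weak T0 iu cm pp pq ode (gc_prim j z) (gc1_prim j z) c0 c1 (Lc2 z).
    have A2 := coef_ode_weak T0 iu cm pq pnp ode' (gs_prim j z) (gs1_prim j z) s0 s1 (Ls2 z).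
    apply: isprim_ext (isprimD A1 A2) => t tT //.
    have hpt := hp t tT; have hmp := pmp.1 t tT.
    rewrite ipNl// (@eq_ip _ _ _ (fun x => m x * - p t x) _ (fun x => - (m x * p t x)) (gs j z))//; last by move=> x _; ring.
    by rewrite ipNl// /K /L; ring.
  - move=> t z z' tT zB zB'.
    have hpt := hp t tT; have hqt := hq t tT; have hmp := pmp.1 t tT; have hmq := pmq.1 t tT.
    have [n1 n2] := nb t tT.
    have bnd (f : R -> R) (h : R -> R) (b B' : R) : L2 0 1 f -> L2norm 0 1 f <= B' -> cont 0 1 h -> 0 <= b ->
        (forall x, 0 <= x <= 1 -> `|h x| <= C * b) -> `|ip 0 1 f h| <= C * b * B'.
      move=> hf fB ch b0 hb; have Cb : 0 <= C * b by exact: mulr_ge0.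
      apply: le_trans (ip_bdd hf (L2_cont ch) Cb hb) _; exact: ler_wpM2l.
    have sum2 (a1 a2 b : R) : `|a1| <= C * b * Bp -> `|a2| <= C * b * Bq -> `|a1 + a2| <= C * (Bp + Bq) * b.
      move=> h1 h2; apply: le_trans (ler_normD _ _) _; apply: le_trans (lerD h1 h2) _.
      by rewrite -mulrDr mulrAC.
    have n0 := normr_ge0 (z' - z); have s0 := sqr_ge0 (z' - z).
    split.
    + rewrite (_ : _ - _ = ip 0 1 (p t) (fun x => gc j z' x - gc j z x + (z' - z) * (m x * gs j z x)) +
         ip 0 1 (q t) (fun x => gs j z' x - gs j z x - (z' - z) * (m x * gc j z x))); last first.
        have Lms : L2 0 1 (fun x => m x * gs j z x) by exact: L2Mc.
        have Lmc : L2 0 1 (fun x => m x * gc j z x) by exact: L2Mc.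
        rewrite ipDr//; [|exact: L2B|exact: L2Z]; rewrite ipBr// ipZr//.
        rewrite ipBr//; [|exact: L2B|exact: L2Z]; rewrite ipBr// ipZr//.
        rewrite /Xi /L.
        have -> : ip 0 1 (fun x => m x * q t x) (gc j z) = ip 0 1 (q t) (fun x => m x * gc j z x).
          by apply: eq_rint => x _; ring.
        have -> : ip 0 1 (fun x => m x * p t x) (gs j z) = ip 0 1 (p t) (fun x => m x * gs j z x).
          by apply: eq_rint => x _; ring.
        ring.
      apply: sum2; apply: bnd => //.
      * apply: contD; first by apply: contB; exact: cont_gc.
        by apply: contM (cont_cst _) _; apply: contM => //; exact: cont_gs.
      * by move=> x x01; apply: le_trans (CC _ _) => //; have [[]] := hC x z z' x01 zB zB'.
      * apply: contB; first by apply: contB; exact: cont_gs.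
        by apply: contM (cont_cst _) _; apply: contM => //; exact: cont_gc.
      * by move=> x x01; apply: le_trans (CC _ _) => //; have [[]] := hC x z z' x01 zB zB'.
    + rewrite (_ : _ - _ = ip 0 1 (p t) (fun x => gs2 j z' x - gs2 j z x) +
         (- ip 0 1 (q t) (fun x => gc2 j z' x - gc2 j z x))); last first.
        by rewrite !ipBr// /K; ring.
      apply: sum2; rewrite ?normrN; apply: bnd => //.
      * by apply: contB; exact: cont_gs2.
      * by move=> x x01; apply: le_trans (CC _ _) => //; have [_ []] := hC x z z' x01 zB zB'.
      * by apply: contB; exact: cont_gc2.
      * by move=> x x01; apply: le_trans (CC _ _) => //; have [_ []] := hC x z z' x01 zB zB'.
    + rewrite (_ : L t z' - L t z = ip 0 1 (p t) (fun x => - (m x * (gs j z' x - gs j z x))) +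
         ip 0 1 (q t) (fun x => m x * (gc j z' x - gc j z x))); last first.
        have lg : L2 0 1 (fun x => m x * (gs j z' x - gs j z x)) by apply: L2Mc => //; exact: L2B.
        rewrite ipNr//.
        have -> : ip 0 1 (q t) (fun x => m x * (gc j z' x - gc j z x)) = ip 0 1 (fun x => m x * q t x) (fun x => gc j z' x - gc j z x).
          by apply: eq_rint => x _; ring.
        have -> : ip 0 1 (p t) (fun x => m x * (gs j z' x - gs j z x)) = ip 0 1 (fun x => m x * p t x) (fun x => gs j z' x - gs j z x).
          by apply: eq_rint => x _; ring.
        by rewrite !ipBr// /L; ring.
      have mbd x (a : R) : 0 <= x <= 1 -> `|a| <= C1 * `|z' - z| -> `|m x * a| <= C * `|z' - z|.
        move=> x01 ha; rewrite normrM /C mulrAC mulrC; apply: ler_pM => //.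
        by apply: le_trans (hm x x01) _; rewrite lerDr.
      apply: sum2; apply: bnd => //.
      * by apply: contN; apply: contM => //; apply: contB; exact: cont_gs.
      * by move=> x x01; rewrite normrN; apply: mbd => //; have [[]] := hC x z z' x01 zB zB'.
      * by apply: contM => //; apply: contB; exact: cont_gc.
      * by move=> x x01; apply: mbd => //; have [[]] := hC x z z' x01 zB zB'.
  - move=> z _; apply: contD; last by exact: pathL2_ipr.
    by apply: contN; exact: pathL2_ipr.
  - move=> z _; apply: contB; [exact: pathL2_ipr pmq (Lc z)|exact: pathL2_ipr pmp (Ls z)].
apply: isprim_ext H => t tT.
  have hpt := hp t tT; have hqt := hq t tT.
  rewrite /Xi /pt ipDl//; [|exact: L2Mc|exact: L2Mc|exact: L2_phi].
  by congr (_ + _); apply: eq_rint => x _; rewrite /gc /gs; ring.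
have hpt := hp t tT; have hqt := hq t tT; set z := th t.
have LD := L2_Dop j; have LV := L2_Vop j.
have E1 : ip 0 1 (qt p q th t) (phi j) = ip 0 1 (q t) (gc j z) - ip 0 1 (p t) (gs j z).
  rewrite /qt ipBl//; [|exact: L2Mc|exact: L2Mc|exact: L2_phi].
  by congr (_ - _); apply: eq_rint => x _; rewrite /gc /gs -/z; ring.
have E2 : ip 0 1 (pt p q th t) (Dop j) = ip 0 1 (p t) (fun x => cos (z * m x) * Dop j x) + ip 0 1 (q t) (fun x => sin (z * m x) * Dop j x).
  rewrite /pt ipDl//; [|exact: L2Mc|exact: L2Mc].
  by congr (_ + _); apply: eq_rint => x _; rewrite -/z; ring.
have E3 : ip 0 1 (qt p q th t) (Vop j) = ip 0 1 (q t) (fun x => cos (z * m x) * Vop j x) - ip 0 1 (p t) (fun x => sin (z * m x) * Vop j x).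
  rewrite /qt ipBl//; [|exact: L2Mc|exact: L2Mc].
  by congr (_ - _); apply: eq_rint => x _; rewrite -/z; ring.
have lcD : L2 0 1 (fun x => cos (z * m x) * Dop j x) by exact: L2Mc.
have lsD : L2 0 1 (fun x => sin (z * m x) * Dop j x) by exact: L2Mc.
have lcV : L2 0 1 (fun x => cos (z * m x) * Vop j x) by exact: L2Mc.
have lsV : L2 0 1 (fun x => sin (z * m x) * Vop j x) by exact: L2Mc.
have E4 : ip 0 1 (q t) (gc2 j z) = - (lam R j * ip 0 1 (q t) (gc j z) + z * ip 0 1 (q t) (fun x => sin (z * m x) * Dop j x)
    + z ^+ 2 * ip 0 1 (q t) (fun x => cos (z * m x) * Vop j x)).
  rewrite /gc2 ipNr//; last by apply: L2D; [apply: L2D|]; exact: L2Z.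
  by rewrite ipDr// ?ipDr// ?ipZr//; try exact: L2Z; apply: L2D; exact: L2Z.
have E5 : ip 0 1 (p t) (gs2 j z) = - (lam R j * ip 0 1 (p t) (gs j z) - z * ip 0 1 (p t) (fun x => cos (z * m x) * Dop j x)
    + z ^+ 2 * ip 0 1 (p t) (fun x => sin (z * m x) * Vop j x)).
  rewrite /gs2 ipNr//; last by apply: L2D; [apply: L2B|]; exact: L2Z.
  by rewrite ipDr// ?ipBr// ?ipZr//; try exact: L2Z; apply: L2B; exact: L2Z.
by rewrite /K E1 E2 E3 E4 E5; ring.
Qed.

End Gauge.

(** * Commutator coefficients and distance of the gauged state to the ground state *)

Section Rotation.
Variable R : realType.
Variables (m m1 m2 m3 : R -> R).
Hypothesis m_prim : isprim 0 1 m m1.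
Hypothesis m1_prim : isprim 0 1 m1 m2.
Hypothesis m2_prim : isprim 0 1 m2 m3.
Implicit Types (s t x y z T : R) (g h u th : R -> R) (p q : R -> R -> R) (j k : nat).

Local Notation Dop := (Dop m1 m2).
Local Notation Vop := (Vop m1).
Local Notation pt := (pt m).
Local Notation qt := (qt m).

Let cm : cont 0 1 m. Proof. exact: isprim_cont ler01 m_prim. Qed.
Let cm1 : cont 0 1 m1. Proof. exact: isprim_cont ler01 m1_prim. Qed.
Let cm2 : cont 0 1 m2. Proof. exact: isprim_cont ler01 m2_prim. Qed.
Let LD j : L2 0 1 (Dop j). Proof. exact: (L2_Dop m1_prim cm2). Qed.
Let LV j : L2 0 1 (Vop j). Proof. exact: (L2_Vop m1_prim). Qed.
Let L2phi j : L2 0 1 (phi j : R -> R). Proof. exact: L2_phi. Qed.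
Let L2mphi j : L2 0 1 (fun x => m x * phi j x : R). Proof. by apply: L2Mc. Qed.

(** [Dop k] is the commutator (m phi_k)'' + lam_k m phi_k, and m phi_k satisfies the Dirichlet
    conditions. *)
Lemma Dop_coef j k : ip 0 1 (Dop k) (phi j) = (lam R k - lam R j) * ip 0 1 (fun x => m x * phi k x) (phi j).
Proof.
have hp := @isprim_phi R 0 1 k ler01; have hd := @isprim_dphi R 0 1 k ler01.
have A := isprimM ler01 m_prim hp.
have B := isprimD (isprimM ler01 m1_prim hp) (isprimM ler01 m_prim hd).
have := ip_dirichlet j A B; rewrite phi_at0 phi_at1 !mulr0 => /(_ erefl erefl).
rewrite (@eq_ip _ _ _ _ _ (fun x => Dop k x - lam R k * (m x * phi k x)) (phi j))//; last first.
  by move=> x _; rewrite /Dop; ring.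
rewrite ipBl ?ipZl//; last exact: L2Z.
by move=> E; rewrite mulrBl; lra.
Qed.

(** One integration by parts against the cosine primitive of phi_j. As [Dop k] need not vanish at
    the endpoints, no faster decay is available in general. *)
Lemma Dop_decay k : exists2 C : R, 0 <= C & forall j, `|j%:R * ip 0 1 (Dop k) (phi j)| <= C.
Proof.
have hp := @isprim_phi R 0 1 k ler01; have hd := @isprim_dphi R 0 1 k ler01.
have PD := isprimD (isprimM ler01 (isprimM ler01 (isprim_cst 0 1 2) m1_prim) hd) (isprimM ler01 m2_prim hp).
have [D' PD'] : exists D', isprim 0 1 (Dop k) D' by eexists; exact: PD.
have iD' := isprim_intg PD'.
have [M M0 hM] := cont_bounded (isprim_cont ler01 PD').
have iN := intg_norm iD'.
have I0 : 0 <= rint 0 1 (fun x => `|D' x|) by apply: rint_ge0.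
exists (2 * (2 * M) + 2 * rint 0 1 (fun x => `|D' x|)); first by rewrite addr_ge0// !mulr_ge0.
move=> j; pose cs x : R := Num.sqrt 2 * cos (j%:R * pi * x).
have s2 : Num.sqrt 2 <= 2 :> R by rewrite -ler_sqr ?nnegrE ?sqrtr_ge0// sqr_sqrtr//; lra.
have csb x : `|cs x| <= 2.
  rewrite normrM ger0_norm ?sqrtr_ge0//; apply: le_trans (_ : 2 * 1 <= _); last by rewrite mulr1.
  by apply: ler_pM => //; exact: cos_max.
have Pcs : isprim 0 1 cs (fun x => - (j%:R * pi) * phi j x).
  apply: isprim_ext (isprimZ (Num.sqrt 2) (isprim_cos ler01 (isprim_lin 0 1 (j%:R * pi)))) => x _ //.
  by rewrite /phi; ring.
have E := isprim_diff (isprimM ler01 PD' Pcs) (lexx 0) ler01 (lexx 1).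
have ccs := isprim_cont ler01 Pcs.
rewrite rintD in E; last 2 first.
- exact: intgM_cont.
- apply: intg_cont; apply: contM; first exact: isprim_cont ler01 PD'.
  by apply: contM; [exact: cont_cst|exact: cont_phi].
have E2 : rint 0 1 (fun x => Dop k x * (- (j%:R * pi) * phi j x)) = - pi * (j%:R * ip 0 1 (Dop k) (phi j)).
  rewrite (_ : - pi * _ = - (j%:R * pi) * ip 0 1 (Dop k) (phi j)); last by ring.
  rewrite /ip -rintZ; last exact: L2M_intg.
  by apply: eq_rint => x _; ring.
rewrite E2 in E.
have h1 : `|rint 0 1 (fun x => D' x * cs x)| <= 2 * rint 0 1 (fun x => `|D' x|).
  apply: ler_norm_rint => //; first exact: intgM_cont.
  by move=> x _; rewrite normrM mulrC; apply: ler_wpM2r.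
have h2 : `|Dop k 1 * cs 1 - Dop k 0 * cs 0| <= 2 * (2 * M).
  apply: le_trans (ler_normB _ _) _; rewrite (normrM (Dop k 1)) (normrM (Dop k 0)) (_ : 2 * (2 * M) = M * 2 + M * 2); last by ring.
  by apply: lerD; apply: ler_pM => //; apply: hM; rewrite ?lexx ler01.
have h3 : `|pi * (j%:R * ip 0 1 (Dop k) (phi j))| <= 2 * (2 * M) + 2 * rint 0 1 (fun x => `|D' x|).
  rewrite (_ : pi * _ = rint 0 1 (fun x => D' x * cs x) - (Dop k 1 * cs 1 - Dop k 0 * cs 0)); last by rewrite E; ring.
  by apply: le_trans (ler_normB _ _) _; rewrite addrC lerD.
apply: le_trans h3; rewrite [leRHS]normrM ler_peMl// ger0_norm ?pi_ge0//.
by apply: le_trans (pi_ge2 R); rewrite ler1n.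
Qed.

(** The function 2 m m' phi_j phi_k vanishes at 0 and 1, and its derivative is Dop_j m phi_k + m
    phi_j Dop_k + 2 m'^2 phi_j phi_k; Parseval and [Dop_coef] expand the first two terms. For (j, k)
    = (1, K) the series is that of A^1_K. *)
Lemma Vop_parseval j k : 
  (fun N => \sum_(1 <= l < N) (lam R l - (lam R j + lam R k) / 2) *
    (ip 0 1 (fun x => m x * phi j x) (phi l) * ip 0 1 (fun x => m x * phi k x) (phi l))) @ \oo
   --> ip 0 1 (Vop j) (phi k).
Proof.
have P1 := parseval_cvg (LD j) (L2mphi k); have P2 := parseval_cvg (L2mphi j) (LD k).
have -> : ip 0 1 (Vop j) (phi k) = - 2^-1 * (ip 0 1 (Dop j) (fun x => m x * phi k x) + ip 0 1 (fun x => m x * phi j x) (Dop k)).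
  have hp := @isprim_phi R 0 1 j ler01; have hk := @isprim_phi R 0 1 k ler01.
  have A := isprimM ler01 (isprimM ler01 m_prim m1_prim) (isprimM ler01 hp hk).
  have := isprim_diff A (lexx 0) ler01 (lexx 1); rewrite !phi_at0 !phi_at1 !mulr0 subrr => E.
  have -> : ip 0 1 (Dop j) (fun x => m x * phi k x) + ip 0 1 (fun x => m x * phi j x) (Dop k) = - 2 * ip 0 1 (Vop j) (phi k).
    rewrite /ip -rintD; [|exact: L2M_intg..].
    have iA := isprim_intg A; rewrite -[LHS]subr0 -[X in _ - X](mulr0 2) [X in _ * X]E -rintZ//.
    rewrite -rintB; last 2 first.
    - by apply: intgD; exact: L2M_intg.
    - by apply: intgZ; exact: (isprim_intg A).
    rewrite -rintZ; last exact: L2M_intg.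
    by apply: eq_rint => x _; rewrite /Dop /Vop; ring.
  by field.
have H : (fun N => - 2^-1 * (\sum_(1 <= l < N) ip 0 1 (Dop j) (phi l) * ip 0 1 (fun x => m x * phi k x) (phi l) +
   \sum_(1 <= l < N) ip 0 1 (fun x => m x * phi j x) (phi l) * ip 0 1 (Dop k) (phi l))) @ \oo -->
   - 2^-1 * (ip 0 1 (Dop j) (fun x => m x * phi k x) + ip 0 1 (fun x => m x * phi j x) (Dop k)).
  by apply: cvgM; [exact: cvg_cst|exact: cvgD].
move: H; apply: cvg_trans; apply: near_eq_cvg; near=> N.
rewrite /= -big_split mulr_sumr; apply: eq_bigr => l _; rewrite /= !Dop_coef.
by field.
Unshelve. all: by end_near.
Qed.

Section Frame.
Variables (T : R) (u : R -> R) (p q : R -> R -> R).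
Hypothesis T0 : 0 <= T.
Hypothesis iu : intg 0 T u.
Hypothesis pp : pathL2 T p.
Hypothesis pq : pathL2 T q.
Hypothesis ode : forall j, (1 <= j)%N -> coef_ode T u m p q j.
Hypothesis init : forall j, (1 <= j)%N ->
  ip 0 1 (p 0) (phi j) = (j == 1%N)%:R /\ ip 0 1 (q 0) (phi j) = 0.

Definition th t := rint 0 t u.
Let P := pt p q th.
Let Q := qt p q th.
Let hth : isprim 0 T th u. Proof. exact: isprim_prim. Qed.

Lemma gauge_ode_re j : isprim 0 T (fun t => ip 0 1 (P t) (phi j))
    (fun t => lam R j * ip 0 1 (Q t) (phi j) + th t * ip 0 1 (P t) (Dop j) + th t ^+ 2 * ip 0 1 (Q t) (Vop j)).
Proof. exact: (gauge_ode m_prim m1_prim cm2 _ T0 hth pp pq ode). Qed.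

Let cosw s t x : `|cos (th t * m x) - cos (th s * m x)| <= `|th t - th s| * `|m x|.
Proof. by apply: le_trans (cos_lip _ _) _; rewrite -mulrBl normrM. Qed.
Let sinw s t x : `|sin (th t * m x) - sin (th s * m x)| <= `|th t - th s| * `|m x|.
Proof. by apply: le_trans (sin_lip _ _) _; rewrite -mulrBl normrM. Qed.

Let pathw (w : R -> R) f : (forall z, cont 0 1 (fun x => w (z * m x))) -> (forall z, `|w z| <= 1) ->
  (forall s t x, `|w (th t * m x) - w (th s * m x)| <= `|th t - th s| * `|m x|) ->
  pathL2 T f -> pathL2 T (fun t x => w (th t * m x) * f t x).
Proof.
move=> cw w1 wl pf; have [M M0 mM] := cont_bounded cm.
apply: (pathL2_mul T0 pf ler01) => [t|t x _ _|s sT e e0]; [exact: cont_measurable|exact: w1|].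
have e1 : 0 < e / (M + 1) by rewrite divr_gt0//; lra.
have [d d0 hd] := isprim_cont T0 hth sT e1; exists d => // t tT ts x x01.
apply: le_trans (wl s t x) _; have k := hd t tT ts.
rewrite ltr_pdivlMr in k; last by lra.
apply: le_trans (ltW k); apply: ler_wpM2l => //.
by apply: le_trans (mM x x01) _; rewrite lerDl.
Qed.

Let ccos z : cont 0 1 (fun x => cos (z * m x)).
Proof. by apply: (isprim_cont ler01 (isprim_cos ler01 (isprimZ z m_prim))). Qed.
Let csin z : cont 0 1 (fun x => sin (z * m x)).
Proof. by apply: (isprim_cont ler01 (isprim_sin ler01 (isprimZ z m_prim))). Qed.

Lemma pathL2_P : pathL2 T P.
Proof.
apply: pathL2_D; first by apply: (pathw ccos) => //; exact: cos_max.
by apply: (pathw csin) => //; exact: sin_max.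
Qed.

Lemma pathL2_Q : pathL2 T Q.
Proof.
apply: pathL2_D; first by apply: (pathw ccos) => //; exact: cos_max.
by apply: pathL2_N; apply: (pathw csin) => //; exact: sin_max.
Qed.

Lemma frame_norm t : 0 <= t <= T -> ip 0 1 (P t) (P t) + ip 0 1 (Q t) (Q t) = 1.
Proof.
move=> tT; have LP := pathL2_P.1 t tT; have LQ := pathL2_Q.1 t tT.
have hpt := pp.1 t tT; have hqt := pq.1 t tT.
rewrite -[RHS](evol_norm T0 iu cm pp pq ode init tT) /ip.
rewrite -(rintD (L2M_intg LP LP) (L2M_intg LQ LQ)) -(rintD (L2M_intg hpt hpt) (L2M_intg hqt hqt)).
apply: eq_rint => x _; rewrite /P /Q /pt /qt.
have := cos2Dsin2 (th t * m x); move: (cos _) (sin _) (p t x) (q t x) => c s a b E.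
by transitivity ((c ^+ 2 + s ^+ 2) * (a * a + b * b)); [ring|rewrite E mul1r].
Qed.

(** [rp] and [rq] are the real and imaginary parts of the gauged state minus exp(- i lam_1 t)
    phi_1. *)
Let rp t x := P t x - cos (lam R 1 * t) * phi 1 x.
Let rq t x := Q t x + sin (lam R 1 * t) * phi 1 x.

Lemma pathL2_rp : pathL2 T rp.
Proof.
have h : pathL2 T (fun t x => - (cos (lam R 1 * t) * phi 1 x)).
  apply: pathL2_N; apply: (pathL2_mul T0 (pathL2_cst T (L2phi 1)) ler01 (w := fun t _ => cos (lam R 1 * t))) => //.
  - by move=> t x _ _; exact: cos_max.
  - move=> s sT e e0; have [d d0 hd] := cont_cosl (lam R 1) sT e0.
    by exists d => // t tT ts x _; apply/ltW/hd.
exact: pathL2_D pathL2_P h.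
Qed.

Lemma pathL2_rq : pathL2 T rq.
Proof.
have h : pathL2 T (fun t x => sin (lam R 1 * t) * phi 1 x).
  apply: (pathL2_mul T0 (pathL2_cst T (L2phi 1)) ler01 (w := fun t _ => sin (lam R 1 * t))) => //.
  - by move=> t x _ _; exact: sin_max.
  - move=> s sT e e0; have [d d0 hd] := cont_sinl (lam R 1) sT e0.
    by exists d => // t tT ts x _; apply/ltW/hd.
exact: pathL2_D pathL2_Q h.
Qed.

(** The pair (q, -p) is gauged into (Q, -P), so this is again [gauge_ode]. *)
Lemma gauge_ode_im j : isprim 0 T (fun t => ip 0 1 (Q t) (phi j))
    (fun t => - (lam R j * ip 0 1 (P t) (phi j)) + th t * ip 0 1 (Q t) (Dop j) - th t ^+ 2 * ip 0 1 (P t) (Vop j)).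
Proof.
have ode' k : (1 <= k)%N -> coef_ode T u m q (fun t x => - p t x) k by move=> /ode; exact: coef_ode_rot.
have H := gauge_ode m_prim m1_prim cm2 j T0 hth pq (pathL2_N pp) ode'.
have eP t : pt q (fun t x => - p t x) th t = Q t.
  by apply/funext => x; rewrite /pt /Q /qt; ring.
have eQ t : qt q (fun t x => - p t x) th t = (fun x => - P t x).
  by apply/funext => x; rewrite /P /pt /qt; ring.
apply: isprim_ext H => t tT; first by rewrite eP.
by have LP := pathL2_P.1 t tT; rewrite eP eQ !ipNl//; ring.
Qed.

Let R2 t := ip 0 1 (rp t) (rp t) + ip 0 1 (rq t) (rq t).
(** Real part of the overlap with the ground state. As both states have norm one, the squared
    distance [R2] is 2 (1 - w). *)
Let w t := cos (lam R 1 * t) * ip 0 1 (P t) (phi 1) - sin (lam R 1 * t) * ip 0 1 (Q t) (phi 1).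

Let R2E t : 0 <= t <= T -> R2 t = 2 * (1 - w t).
Proof.
move=> tT; have LP := pathL2_P.1 t tT; have LQ := pathL2_Q.1 t tT.
have N := frame_norm tT; have C := cos2Dsin2 (lam R 1 * t).
have Lc : L2 0 1 (fun x => cos (lam R 1 * t) * phi 1 x) by exact: L2Z.
have Ls : L2 0 1 (fun x => sin (lam R 1 * t) * phi 1 x) by exact: L2Z.
have LB : L2 0 1 (fun x => P t x - cos (lam R 1 * t) * phi 1 x) by exact: L2B.
have LD' : L2 0 1 (fun x => Q t x + sin (lam R 1 * t) * phi 1 x) by exact: L2D.
have n11 : ip 0 1 (phi 1) (phi 1) = 1 :> R by rewrite ip_phi.
have EP : ip 0 1 (rp t) (rp t) = ip 0 1 (P t) (P t) - 2 * (cos (lam R 1 * t) * ip 0 1 (P t) (phi 1)) + cos (lam R 1 * t) ^+ 2.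
  rewrite (ipBl LP Lc LB) (ipBr LP Lc LP) (ipBr LP Lc Lc) (ipZr _ (L2phi 1) LP) (ipC _ _ _ (P t)).
  by rewrite (ipZr _ (L2phi 1) LP) (ipZr _ (L2phi 1) Lc) (ipZl _ (L2phi 1) (L2phi 1)) n11; ring.
have EQ : ip 0 1 (rq t) (rq t) = ip 0 1 (Q t) (Q t) + 2 * (sin (lam R 1 * t) * ip 0 1 (Q t) (phi 1)) + sin (lam R 1 * t) ^+ 2.
  rewrite (ipDl LQ Ls LD') (ipDr LQ Ls LQ) (ipDr LQ Ls Ls) (ipZr _ (L2phi 1) LQ) (ipC _ _ _ (Q t)).
  by rewrite (ipZr _ (L2phi 1) LQ) (ipZr _ (L2phi 1) Ls) (ipZl _ (L2phi 1) (L2phi 1)) n11; ring.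
rewrite /R2 EP EQ /w.
transitivity ((ip 0 1 (P t) (P t) + ip 0 1 (Q t) (Q t)) + (cos (lam R 1 * t) ^+ 2 + sin (lam R 1 * t) ^+ 2)
  - 2 * (cos (lam R 1 * t) * ip 0 1 (P t) (phi 1) - sin (lam R 1 * t) * ip 0 1 (Q t) (phi 1))); first by ring.
by rewrite N C; ring.
Qed.

Let w' t := th t * (cos (lam R 1 * t) * ip 0 1 (rp t) (Dop 1) - sin (lam R 1 * t) * ip 0 1 (rq t) (Dop 1))
  + th t ^+ 2 * (cos (lam R 1 * t) * ip 0 1 (rq t) (Vop 1) + sin (lam R 1 * t) * ip 0 1 (rp t) (Vop 1)).

(** The ground state part drops out: <phi_1, Dop_1> = 0 by [Dop_coef], and its two Vop contributions
    cancel. Hence [w'] is linear in the residual, which makes the distance to the ground state of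
    first order in th. *)
Let wprim : isprim 0 T w w'.
Proof.
have pc := isprim_cosl (lam R 1) T0; have ps := isprim_sinl (lam R 1) T0.
apply: isprim_ext (isprimB (isprimM T0 pc (gauge_ode_re 1)) (isprimM T0 ps (gauge_ode_im 1))) => t tT //.
have LP := pathL2_P.1 t tT; have LQ := pathL2_Q.1 t tT.
have Lc : L2 0 1 (fun x => cos (lam R 1 * t) * phi 1 x) by exact: L2Z.
have Ls : L2 0 1 (fun x => sin (lam R 1 * t) * phi 1 x) by exact: L2Z.
have D0 : ip 0 1 (phi 1) (Dop 1) = 0 by rewrite ipC Dop_coef subrr mul0r.
have a1 : ip 0 1 (rp t) (Dop 1) = ip 0 1 (P t) (Dop 1).
  by rewrite (ipBl LP Lc (LD 1)) (ipZl _ (L2phi 1) (LD 1)) D0; ring.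
have a2 : ip 0 1 (rq t) (Dop 1) = ip 0 1 (Q t) (Dop 1).
  by rewrite (ipDl LQ Ls (LD 1)) (ipZl _ (L2phi 1) (LD 1)) D0; ring.
have a3 : ip 0 1 (rp t) (Vop 1) = ip 0 1 (P t) (Vop 1) - cos (lam R 1 * t) * ip 0 1 (phi 1) (Vop 1).
  by rewrite (ipBl LP Lc (LV 1)) (ipZl _ (L2phi 1) (LV 1)).
have a4 : ip 0 1 (rq t) (Vop 1) = ip 0 1 (Q t) (Vop 1) + sin (lam R 1 * t) * ip 0 1 (phi 1) (Vop 1).
  by rewrite (ipDl LQ Ls (LV 1)) (ipZl _ (L2phi 1) (LV 1)).
by rewrite /w' a1 a2 a3 a4; ring.
Qed.

Let cR2 : cont 0 T R2.
Proof. by apply: contD; apply: pathL2_ip => //; [exact: pathL2_rp|exact: pathL2_rp|exact: pathL2_rq|exact: pathL2_rq]. Qed.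

(** With S the supremum of the distance, |w'| is at most 2 N S (|th| + th^2), so that R2 = 2 (1 - w)
    gives S^2 <= 4 N I S, and one factor S is divided out. *)
Lemma rho_bound t : 0 <= t <= T ->
  ip 0 1 (rp t) (rp t) + ip 0 1 (rq t) (rq t) <=
  (4 * (L2norm 0 1 (Dop 1) + L2norm 0 1 (Vop 1)) * rint 0 T (fun t => `|th t| + th t ^+ 2)) ^+ 2.
Proof.
move=> tT; rewrite -/(R2 t).
set N := L2norm 0 1 (Dop 1) + L2norm 0 1 (Vop 1); set I := rint 0 T _.
have ND := L2norm_ge0 0 1 (Dop 1); have NV := L2norm_ge0 0 1 (Vop 1).
have N0 : 0 <= N by exact: addr_ge0.
have cth := isprim_cont T0 hth.
have ck : cont 0 T (fun t => `|th t| + th t ^+ 2) by apply: contD; [exact: cont_norm|exact: contX].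
have k0 r : 0 <= `|th r| + th r ^+ 2 by apply: addr_ge0 => //; exact: sqr_ge0.
have I0 : 0 <= I by apply: rint_ge0 => r _; exact: k0.
have R20 r : 0 <= R2 r by apply: addr_ge0; exact: ip_ge0.
pose E := [set y : R | exists2 r, 0 <= r <= T & y = Num.sqrt (R2 r)].
have [M M0 hM] := cont_bounded cR2.
have hE : has_sup E.
  split; first by exists (Num.sqrt (R2 t)); exists t.
  exists (Num.sqrt M) => y [r rT ->]; apply: ler_wsqrtr.
  by have := hM r rT; rewrite ger0_norm.
set S := sup E.
have hS r : 0 <= r <= T -> Num.sqrt (R2 r) <= S.
  by move=> rT; apply: sup_upper_bound => //; exists r.
have S0 : 0 <= S by apply: le_trans (hS t tT); exact: sqrtr_ge0.
have nr r : 0 <= r <= T -> L2norm 0 1 (rp r) <= S /\ L2norm 0 1 (rq r) <= S.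
  move=> rT; have h := hS r rT; split; apply: le_trans h.
    by rewrite -(ger0_norm (L2norm_ge0 0 1 (rp r))) -sqrtr_sqr L2norm2; apply: ler_wsqrtr; rewrite lerDl ip_ge0.
  by rewrite -(ger0_norm (L2norm_ge0 0 1 (rq r))) -sqrtr_sqr L2norm2; apply: ler_wsqrtr; rewrite lerDr ip_ge0.
have bw r : 0 <= r <= T -> `|w' r| <= (2 * N * S) * (`|th r| + th r ^+ 2).
  move=> rT; have [n1 n2] := nr r rT.
  have Lrp := pathL2_rp.1 r rT; have Lrq := pathL2_rq.1 r rT.
  have b1 (f g : R -> R) (c : R) : L2 0 1 f -> L2 0 1 g -> L2norm 0 1 f <= S -> L2norm 0 1 g <= N -> `|c| <= 1 -> `|c * ip 0 1 f g| <= N * S.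
    move=> hf hg fS gN c1; rewrite normrM; apply: le_trans (_ : 1 * (N * S) <= _); last by rewrite mul1r.
    apply: ler_pM => //; apply: le_trans (ip_CauchySchwarz hf hg) _; rewrite mulrC.
    by apply: ler_pM => //; exact: L2norm_ge0.
  have dN : L2norm 0 1 (Dop 1) <= N by rewrite lerDl.
  have vN : L2norm 0 1 (Vop 1) <= N by rewrite lerDr.
  have c1 := cos_max (lam R 1 * r); have s1 := sin_max (lam R 1 * r).
  rewrite /w'; apply: le_trans (ler_normD _ _) _; rewrite [leRHS]mulrDr; apply: lerD.
    rewrite normrM mulrC; apply: ler_wpM2r => //; apply: le_trans (ler_normB _ _) _.
    by rewrite (_ : 2 * N * S = N * S + N * S); [apply: lerD; exact: b1|ring].
  rewrite normrM mulrC (ger0_norm (sqr_ge0 (th r))); apply: ler_wpM2r; first exact: sqr_ge0.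
  apply: le_trans (ler_normD _ _) _.
  by rewrite (_ : 2 * N * S = N * S + N * S); [apply: lerD; exact: b1|ring].
have w0 : w 0 = 1.
  have P0 : P 0 = p 0.
    by apply/funext => x; rewrite /P /pt /th rint_pt !mul0r cos0 sin0; ring.
  by rewrite /w mulr0 cos0 sin0 P0 (init (leqnn 1)).1 mul0r subr0 mulr1.
have key r : 0 <= r <= T -> R2 r <= 4 * N * I * S.
  move=> rT; have /andP[r0 rT'] := rT; rewrite R2E//.
  have E1 := isprim_diff wprim (lexx 0) r0 rT'; rewrite w0 in E1.
  have b2 : `|w r - 1| <= (2 * N * S) * rint 0 r (fun t => `|th t| + th t ^+ 2).
    rewrite E1; apply: ler_norm_rint.
    - exact: intg_sub (lexx 0) rT' (isprim_intg wprim).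
    - exact: intg_sub (lexx 0) rT' (intg_cont ck).
    - by move=> z /andP[z0 zr]; apply: bw; rewrite z0 (le_trans zr).
  have b3 : rint 0 r (fun t => `|th t| + th t ^+ 2) <= I.
    rewrite /I (rint_cat r0 rT' (intg_cont ck)) lerDl.
    by apply: rint_ge0 => z _; exact: k0.
  have NS0 : 0 <= 2 * N * S by apply: mulr_ge0 => //; exact: mulr_ge0.
  have b4 := ler_wpM2l NS0 b3.
  have b5 := ler_norm (- (w r - 1)); rewrite normrN in b5.
  have -> : 4 * N * I * S = 2 * (2 * N * S * I) by ring.
  have b6 := le_trans b5 (le_trans b2 b4); rewrite opprB in b6.
  exact: ler_wpM2l b6.
have SS : S ^+ 2 <= 4 * N * I * S.
  have X0 : 0 <= 4 * N * I * S by apply: le_trans (key t tT).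
  have : S <= Num.sqrt (4 * N * I * S).
    apply: ge_sup; first by exists (Num.sqrt (R2 t)); exists t.
    by move=> y [r rT ->]; apply: ler_wsqrtr; exact: key.
  by rewrite -ler_sqr ?nnegrE ?sqrtr_ge0// sqr_sqrtr.
have SB : S <= 4 * N * I.
  have [S00|Sn0] := eqVneq S 0; first by rewrite S00; apply: mulr_ge0 => //; exact: mulr_ge0.
  by rewrite -(@ler_pM2r _ S) -?expr2// lt_neqAle eq_sym Sn0.
have := hS t tT => h; have : R2 t <= S ^+ 2.
  by rewrite -[R2 t]sqr_sqrtr// ler_pXn2r// nnegrE// sqrtr_ge0.
by move=> /le_trans; apply; rewrite ler_pXn2r// nnegrE// mulr_ge0// mulr_ge0.
Qed.

End Frame.
End Rotation.

(** * First and second order expansions *)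

Section ComplexCalculus.
Variable R : realType.
Local Open Scope complex_scope.
Implicit Types (a b k s t x y T : R) (z w c : R[i]) (f g F G : R -> R[i]).

(* Submultiplicative, and without the square root of the modulus. *)
Definition n1 z : R := `|cre z| + `|cim z|.

Lemma n1_ge0 z : 0 <= n1 z. Proof. exact: addr_ge0. Qed.
Hint Resolve n1_ge0 : core.

Lemma n1_0 : n1 0 = 0. Proof. by rewrite /n1 /= normr0 addr0. Qed.

Lemma n1N z : n1 (- z) = n1 z. Proof. by rewrite /n1 !creimE !normrN. Qed.

Lemma n1D z w : n1 (z + w) <= n1 z + n1 w.
Proof.
rewrite /n1 !creimE.
by have := ler_normD (cre z) (cre w); have := ler_normD (cim z) (cim w); lra.
Qed.

Lemma n1B z w : n1 (z - w) <= n1 z + n1 w.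
Proof. by rewrite -(n1N w); exact: n1D. Qed.

Lemma n1M z w : n1 (z * w) <= n1 z * n1 w.
Proof.
rewrite /n1 !creimE.
have A := ler_normB (cre z * cre w) (cim z * cim w).
have B := ler_normD (cre z * cim w) (cim z * cre w).
by rewrite !normrM in A B; lra.
Qed.

Lemma n1_real x : n1 x%:C = `|x|. Proof. by rewrite /n1 !creimE normr0 addr0. Qed.
Lemma n1_i : n1 'i = 1. Proof. by rewrite /n1 !creimE normr0 normr1 add0r. Qed.

Lemma n1_exp x : n1 (cexp x) <= 2.
Proof. by rewrite /n1 !creimE; have := cos_max x; have := sin_max x; lra. Qed.

Lemma n1_expM x z : n1 (cexp x * z) <= 2 * n1 z.
Proof. by apply: le_trans (n1M _ _) _; apply: ler_wpM2r => //; exact: n1_exp. Qed.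

Lemma n1_sum (I : Type) (r : seq I) (P : pred I) (F : I -> R[i]) :
  n1 (\sum_(i <- r | P i) F i) <= \sum_(i <- r | P i) n1 (F i).
Proof.
apply: (big_ind2 (fun z x => n1 z <= x)) => //; first by rewrite n1_0.
by move=> z x w y zx wy; apply: le_trans (n1D _ _) _; exact: lerD.
Qed.

Lemma n1X z (n : nat) : n1 (z ^+ n) <= n1 z ^+ n.
Proof.
elim: n => [|n IH]; first by rewrite /n1 /= normr1 normr0 addr0.
by rewrite !exprS; apply: le_trans (n1M _ _) _; apply: ler_wpM2l.
Qed.

Lemma cim_n1 z : `|cim z| <= n1 z. Proof. by rewrite lerDr. Qed.

Lemma cexpD x y : cexp (x + y) = cexp x * cexp y.
Proof. by apply: complexP; rewrite !creimE ?cosD ?sinD// addrC. Qed.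

Lemma cexp0 : cexp 0 = 1 :> R[i]. Proof. by rewrite /cexp cos0 sin0. Qed.

Lemma cexpNK x : cexp (- x) * cexp x = 1. Proof. by rewrite -cexpD addNr cexp0. Qed.

Lemma cre_sum (I : Type) (r : seq I) (P : pred I) (F : I -> R[i]) :
  cre (\sum_(i <- r | P i) F i) = \sum_(i <- r | P i) cre (F i).
Proof. by apply: (big_morph _ (@creD R)). Qed.

Lemma cim_sum (I : Type) (r : seq I) (P : pred I) (F : I -> R[i]) :
  cim (\sum_(i <- r | P i) F i) = \sum_(i <- r | P i) cim (F i).
Proof. by apply: (big_morph _ (@cimD R)). Qed.

Definition cintg a b f := intg a b (fun t => cre (f t)) /\ intg a b (fun t => cim (f t)).
Definition ccont a b f := cont a b (fun t => cre (f t)) /\ cont a b (fun t => cim (f t)).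
Definition cprim a b F f :=
  isprim a b (fun t => cre (F t)) (fun t => cre (f t)) /\
  isprim a b (fun t => cim (F t)) (fun t => cim (f t)).

Lemma cprim_cont a b F f : a <= b -> cprim a b F f -> ccont a b F.
Proof. by move=> ab [h k]; split; [exact: isprim_cont h|exact: isprim_cont k]. Qed.

Lemma cprim_diff a b F f x y : cprim a b F f -> a <= x -> x <= y -> y <= b ->
  F y - F x = cint x y f.
Proof.
move=> [h k] ax xy yb.
by apply: complexP; rewrite !creimE ?cre_cint ?cim_cint; [exact: isprim_diff h _ _ _|exact: isprim_diff k _ _ _].
Qed.

Lemma cprim_ext a b F f G g : (forall x, a <= x <= b -> F x = G x) ->
  (forall x, a <= x <= b -> f x = g x) -> cprim a b F f -> cprim a b G g.
Proof.
by move=> FG fg [h k]; split; [apply: isprim_ext h|apply: isprim_ext k] => x xab; rewrite ?FG ?fg.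
Qed.

Lemma cprim_cst a b c : cprim a b (fun=> c) (fun=> 0).
Proof. by split; exact: isprim_cst. Qed.

Lemma cprimD a b F f G g : cprim a b F f -> cprim a b G g ->
  cprim a b (fun x => F x + G x) (fun x => f x + g x).
Proof.
move=> [h k] [h' k']; split; [apply: isprim_ext (isprimD h h')|apply: isprim_ext (isprimD k k')];
  by move=> x _; rewrite creimE.
Qed.

Lemma cprimN a b F f : cprim a b F f -> cprim a b (fun x => - F x) (fun x => - f x).
Proof.
by move=> [h k]; split; [apply: isprim_ext (isprimN h)|apply: isprim_ext (isprimN k)] => x _; rewrite creimE.
Qed.

Lemma cprimB a b F f G g : cprim a b F f -> cprim a b G g ->
  cprim a b (fun x => F x - G x) (fun x => f x - g x).
Proof. by move=> hF hG; apply: cprimD => //; exact: cprimN. Qed.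

Lemma cprimM a b F f G g : a <= b -> cprim a b F f -> cprim a b G g ->
  cprim a b (fun x => F x * G x) (fun x => f x * G x + F x * g x).
Proof.
move=> ab [h k] [h' k']; split.
  apply: isprim_ext (isprimB (isprimM ab h h') (isprimM ab k k')) => x _; rewrite !creimE//.
  by ring.
apply: isprim_ext (isprimD (isprimM ab h k') (isprimM ab k h')) => x _; rewrite !creimE//.
by ring.
Qed.

Lemma cprimZ a b c F f : a <= b -> cprim a b F f -> cprim a b (fun x => c * F x) (fun x => c * f x).
Proof.
by move=> ab hF; apply: cprim_ext (cprimM ab (cprim_cst a b c) hF) => x _ //; rewrite mul0r add0r.
Qed.

Lemma cprim_real a b (F f : R -> R) : isprim a b F f -> cprim a b (fun t => (F t)%:C) (fun t => (f t)%:C).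
Proof. by move=> h; split => //; exact: isprim_cst. Qed.

Lemma cprim_exp a b k : a <= b -> cprim a b (fun t => cexp (k * t)) (fun t => 'i * k%:C * cexp (k * t)).
Proof.
move=> ab; have hl := isprim_lin a b k.
split; [apply: isprim_ext (isprim_cos ab hl)|apply: isprim_ext (isprim_sin ab hl)] => x _ //;
  by rewrite !creimE; ring.
Qed.

Lemma cprim_cint a b f : a <= b -> cintg a b f -> cprim a b (fun t => cint a t f) f.
Proof. by move=> ab [h k]; split; exact: isprim_prim. Qed.

Lemma cintg_cont a b f : ccont a b f -> cintg a b f.
Proof. by move=> [h k]; split; exact: intg_cont. Qed.

Lemma ccont_real a b (f : R -> R) : cont a b f -> ccont a b (fun t => (f t)%:C).
Proof. by move=> h; split => //; exact: cont_cst. Qed.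

Lemma ccont_exp a b k : ccont a b (fun t => cexp (k * t)).
Proof. by split; [exact: cont_cosl|exact: cont_sinl]. Qed.

Lemma ccont_cst a b c : ccont a b (fun=> c).
Proof. by split; exact: cont_cst. Qed.

Lemma ccontD a b f g : ccont a b f -> ccont a b g -> ccont a b (fun t => f t + g t).
Proof.
move=> [h k] [h' k']; split; [apply: eq_cont (contD h h')|apply: eq_cont (contD k k')];
  by move=> x _; rewrite creimE.
Qed.

Lemma ccontN a b f : ccont a b f -> ccont a b (fun t => - f t).
Proof. by move=> [h k]; split; [apply: eq_cont (contN h)|apply: eq_cont (contN k)] => x _; rewrite creimE. Qed.

Lemma ccontM a b f g : ccont a b f -> ccont a b g -> ccont a b (fun t => f t * g t).
Proof.
move=> [h k] [h' k']; split.
  by apply: eq_cont (contB (contM h h') (contM k k')) => x _; rewrite !creimE.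
by apply: eq_cont (contD (contM h k') (contM k h')) => x _; rewrite !creimE.
Qed.

Lemma ccont_sum a b (I : Type) (r : seq I) (P : pred I) (f : I -> R -> R[i]) :
  (forall i, P i -> ccont a b (f i)) -> ccont a b (fun x => \sum_(i <- r | P i) f i x).
Proof.
move=> h; split.
  by apply: eq_cont (cont_sum r (fun i Pi => (h i Pi).1)) => x _; rewrite cre_sum.
by apply: eq_cont (cont_sum r (fun i Pi => (h i Pi).2)) => x _; rewrite cim_sum.
Qed.

Lemma eq_cint a b f g : (forall x, a <= x <= b -> f x = g x) -> cint a b f = cint a b g.
Proof. by move=> fg; congr (_ +i* _); apply: eq_rint => x /fg ->. Qed.

Lemma cintD a b f g : cintg a b f -> cintg a b g ->
  cint a b (fun t => f t + g t) = cint a b f + cint a b g.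
Proof.
move=> [h k] [h' k']; apply: complexP; rewrite !creimE ?cre_cint ?cim_cint.
  by rewrite -rintD//; apply: eq_rint => x _; rewrite creimE.
by rewrite -rintD//; apply: eq_rint => x _; rewrite creimE.
Qed.

Lemma cintZ a b c f : cintg a b f -> cint a b (fun t => c * f t) = c * cint a b f.
Proof.
move=> [h k]; apply: complexP; rewrite !creimE !cre_cint !cim_cint -!rintZ//.
  by rewrite -rintB; [|exact: intgZ..]; apply: eq_rint => x _; rewrite creimE.
by rewrite -rintD; [|exact: intgZ..]; apply: eq_rint => x _; rewrite creimE.
Qed.

(** No factor is lost because [n1] is additive in the two real components. *)
Lemma cint_norm a b f (h : R -> R) : cintg a b f -> intg a b h ->
  (forall x, a <= x <= b -> n1 (f x) <= h x) -> n1 (cint a b f) <= rint a b h.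
Proof.
move=> [hf kf] hh fh; rewrite /n1 cre_cint cim_cint.
apply: le_trans (lerD (rint_norm hf) (rint_norm kf)) _.
rewrite -rintD; [|exact: intg_norm..].
by apply: ler_rint => //; apply: intgD; exact: intg_norm.
Qed.

Lemma rint_cintg a b (f : R -> R) : cint a b (fun t => (f t)%:C) = (rint a b f)%:C.
Proof.
apply: complexP; rewrite ?cre_cint ?cim_cint//=.
have [ab|ab] := leP a b; first by rewrite rint_cst// mul0r.
by rewrite /rint Rintegral_cst ?mul0r//; exact: measurable_Icc.
Qed.

Lemma eq_ccont a b f g : (forall x, a <= x <= b -> f x = g x) -> ccont a b f -> ccont a b g.
Proof. by move=> fg [h k]; split; [apply: eq_cont h|apply: eq_cont k] => x /fg ->. Qed.

Lemma cint_sum a b (r : seq nat) (f : nat -> R -> R[i]) : (forall i, ccont a b (f i)) ->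
  cint a b (fun t => \sum_(i <- r) f i t) = \sum_(i <- r) cint a b (f i).
Proof.
move=> cf; elim: r => [|i r IH].
  rewrite big_nil (@eq_cint _ _ _ (fun=> (0 : R)%:C)) => [|x _]; last by rewrite big_nil.
  rewrite rint_cintg; congr (_%:C).
  by rewrite -[RHS](mul0r (rint a b (fun=> 0))) -rintZ; [apply: eq_rint => x _; rewrite mul0r|exact: intg_cst].
rewrite big_cons -IH -cintD; last 2 first.
- exact: cintg_cont.
- by apply: cintg_cont; exact: ccont_sum.
by apply: eq_cint => x _; rewrite big_cons.
Qed.

End ComplexCalculus.

(** * Orthogonality of the exponentials in time *)

Section TimeBessel.
Variable R : realType.
Implicit Types (a b k s t x y T : R) (f g h : R -> R) (j l N : nat).

Lemma rint_sinl a b k : a <= b -> k != 0 ->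
  rint a b (fun x => sin (k * x)) = (cos (k * a) - cos (k * b)) / k.
Proof.
move=> ab k0; have H := isprim_cos ab (isprim_lin a b k).
have E := isprim_diff H (lexx a) ab (lexx b).
apply: (mulIf k0); rewrite divfK// -[LHS]opprK -[RHS]opprK; congr (- _).
rewrite opprB [RHS]E mulrC -mulNr -rintZ; last by apply: intg_cont; exact: cont_sinl.
by apply: eq_rint => x _; ring.
Qed.

(** A common period of all exp(i (lam_l - lam_j) s): the phase reached at tau is 2 pi (l^2 -
    j^2). *)
Let tau : R := 2 / pi.
Let tau0 : 0 < tau. Proof. by rewrite divr_gt0// pi_gt0. Qed.

Let lam_tau j l : (lam R l - lam R j) * tau = 2 * (l%:R ^+ 2 * pi) - 2 * (j%:R ^+ 2 * pi).
Proof. have pn : (pi : R) != 0 by rewrite gt_eqF// pi_gt0.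
transitivity ((l%:R ^+ 2 - j%:R ^+ 2) * (2 * pi) * (pi / pi) : R); last by rewrite divff//; ring.
by rewrite /lam /tau; ring. Qed.

Let lam_neq j l : j != l -> lam R l - lam R j != 0.
Proof.
move=> jl; rewrite subr_eq0 /lam eqrXn2 ?mulr_ge0 ?pi_ge0//.
apply: contra jl => /eqP/(mulIf (lt0r_neq0 (pi_gt0 R)))/eqP.
by rewrite eqr_nat eq_sym.
Qed.

Let trig2 (n : nat) : cos (2 * (n%:R ^+ 2 * pi)) = 1 :> R /\ sin (2 * (n%:R ^+ 2 * pi)) = 0 :> R.
Proof.
rewrite (_ : 2 * (n%:R ^+ 2 * pi) = (2 * n ^ 2)%:R * pi); last by rewrite natrM natrX; ring.
by rewrite sin_natpi cos_natpi mulnC exprM sqrr_sign.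
Qed.

Let orth_cos j l : rint 0 tau (fun s => cos ((lam R l - lam R j) * s)) = (j == l)%:R * tau.
Proof.
have [->|jl] := eqVneq j l.
  rewrite (@eq_rint _ _ _ _ (fun=> 1)) ?rint_cst ?(ltW tau0)// ?subr0//.
  by move=> x _; rewrite subrr mul0r cos0.
rewrite rint_cosl ?lam_neq ?(ltW tau0)// lam_tau sinB.
have [-> ->] := trig2 l; have [-> ->] := trig2 j.
by rewrite [X in sin X]mulr0 sin0 mulr0n; ring.
Qed.

Let orth_sin j l : rint 0 tau (fun s => sin ((lam R l - lam R j) * s)) = 0.
Proof.
have [->|jl] := eqVneq j l.
  rewrite (@eq_rint _ _ _ _ (fun=> 0)) ?rint_cst ?(ltW tau0)// ?mul0r//.
  by move=> x _; rewrite subrr mul0r sin0.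
rewrite rint_sinl ?lam_neq ?(ltW tau0)// lam_tau cosB.
have [-> ->] := trig2 l; have [-> ->] := trig2 j.
by rewrite [X in cos X]mulr0 cos0; ring.
Qed.

(* The exponentials exp(i lam_j s) are orthogonal on [0, 2/pi], since lam_j is an integer multiple of pi^2. *)
Lemma time_Bessel T t k f N : 0 <= t -> t <= T -> T <= tau -> L2 t T f ->
  \sum_(1 <= j < N) (rint t T (fun s => f s * cos ((k - lam R j) * s)) ^+ 2 +
                     rint t T (fun s => f s * sin ((k - lam R j) * s)) ^+ 2)
  <= tau * ip t T f f.
Proof.
move=> t0 tT Tt Lf; pose X j := rint t T (fun s => f s * cos ((k - lam R j) * s)).
pose Y j := rint t T (fun s => f s * sin ((k - lam R j) * s)).
rewrite (eq_bigr (fun j => X j ^+ 2 + Y j ^+ 2))//.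
(* [A j] and [B j] are the real and imaginary parts of (X_j - i Y_j) exp(i (k - lam_j) s).
   Orthogonality holds for the sum of their products, which is why [B] accompanies [A]. *)
pose A j s : R := X j * cos ((k - lam R j) * s) + Y j * sin ((k - lam R j) * s).
pose B j s : R := X j * sin ((k - lam R j) * s) - Y j * cos ((k - lam R j) * s).
have cA a b j : cont a b (A j).
  by apply: contD; apply: contM (cont_cst _) _; [exact: cont_cosl|exact: cont_sinl].
have cB a b j : cont a b (B j).
  by apply: contB; apply: contM (cont_cst _) _; [exact: cont_sinl|exact: cont_cosl].
pose SA s := \sum_(1 <= j < N) A j s; pose SB s := \sum_(1 <= j < N) B j s.
have LA a b j : L2 a b (A j) by apply: L2_cont.
have LB a b j : L2 a b (B j) by apply: L2_cont.
have LSA a b : L2 a b SA by apply: L2_sum.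
have LSB a b : L2 a b SB by apply: L2_sum.
set S := \sum_(1 <= j < N) _.
have S0 : 0 <= S by apply: sumr_ge0 => j _; rewrite addr_ge0// sqr_ge0.
(* Duality: S pairs f with SA, whose squared norm over the full period is at most tau S, hence also
   over [t, T]. Cauchy-Schwarz gives S^2 <= <f, f> tau S. *)
have E1 : S = ip t T f SA.
  rewrite ipC ip_suml//; apply: eq_bigr => j _.
  have Lc : L2 t T (fun s => cos ((k - lam R j) * s)) by apply: L2_cont; exact: cont_cosl.
  have Ls : L2 t T (fun s => sin ((k - lam R j) * s)) by apply: L2_cont; exact: cont_sinl.
  rewrite ipC /A (ipDr (L2Z _ Lc) (L2Z _ Ls) Lf) (ipZr _ Lc Lf) (ipZr _ Ls Lf).
  by rewrite /ip -/(X j) -/(Y j) !expr2.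
have AB j l : ip 0 tau (A j) (A l) + ip 0 tau (B j) (B l) = (j == l)%:R * (tau * (X j ^+ 2 + Y j ^+ 2)).
  have ic (c : R) : intg 0 tau (fun s => c * cos ((lam R l - lam R j) * s)).
    by apply: intgZ; apply: intg_cont; exact: cont_cosl.
  have is_ (c : R) : intg 0 tau (fun s => c * sin ((lam R l - lam R j) * s)).
    by apply: intgZ; apply: intg_cont; exact: cont_sinl.
  rewrite /ip -rintD; [|exact: L2M_intg..].
  rewrite (@eq_rint _ _ _ _ (fun s => (X j * X l + Y j * Y l) * cos ((lam R l - lam R j) * s) +
     (Y j * X l - X j * Y l) * sin ((lam R l - lam R j) * s))); last first.
    move=> s _; rewrite /A /B (_ : (lam R l - lam R j) * s = (k - lam R j) * s - (k - lam R l) * s); last by ring.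
    by rewrite cosB sinB; ring.
  rewrite (rintD (ic _) (is_ _)) (rintZ _ (intg_cont (cont_cosl _))) (rintZ _ (intg_cont (cont_sinl _))).
  rewrite orth_cos orth_sin; case: eqVneq => [->|_]; last by rewrite !mul0r !mulr0 addr0.
  by rewrite mulr1n; ring.
have E2 : ip 0 tau SA SA + ip 0 tau SB SB = tau * S.
  rewrite (ip_suml _ (fun j _ => LA 0 tau j) (LSA 0 tau)) (ip_suml _ (fun j _ => LB 0 tau j) (LSB 0 tau)).
  rewrite -big_split mulr_sumr big_nat [RHS]big_nat /=; apply: eq_bigr => j jN.
  rewrite ipC (ip_suml _ (fun j _ => LA 0 tau j) (LA 0 tau j)).
  rewrite [X in _ + X]ipC (ip_suml _ (fun j _ => LB 0 tau j) (LB 0 tau j)) -big_split /=.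
  rewrite (eq_bigr (fun l => if l == j then tau * (X j ^+ 2 + Y j ^+ 2) else 0)); last first.
    move=> l _; rewrite ipC [X in _ + X]ipC AB eq_sym; case: eqVneq => _; rewrite ?mul1r ?mul0r//.
  rewrite -big_mkcond big_nat1_eq jN//.
have E3 : ip t T SA SA <= tau * S.
  rewrite -E2; apply: le_trans (_ : ip 0 tau SA SA <= _); last by rewrite lerDl ip_ge0.
  have iS a b : intg a b (fun x => SA x * SA x) by exact: L2M_intg.
  rewrite /ip (@rint_cat _ 0 tau t)//; last exact: le_trans Tt.
  rewrite (@rint_cat _ t tau T)//.
  have p1 : 0 <= rint 0 t (fun x => SA x * SA x) by apply: rint_ge0 => x _; rewrite -expr2 sqr_ge0.
  have p2 : 0 <= rint T tau (fun x => SA x * SA x) by apply: rint_ge0 => x _; rewrite -expr2 sqr_ge0.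
  by lra.
have CS := ip_CauchySchwarz2 Lf (LSA t T); rewrite -E1 in CS.
have := le_trans CS (ler_wpM2l (ip_ge0 t T f) E3) => h.
have [->|Sn] := eqVneq S 0; first by rewrite mulr_ge0 ?ip_ge0// ltW.
rewrite -(@ler_pM2r _ S); last by rewrite lt_neqAle eq_sym Sn.
by apply: le_trans (_ : ip t T f f * (tau * S) <= _); [rewrite -expr2|rewrite mulrCA mulrA].
Qed.

Lemma sum_phi_norm N (al : nat -> R) :
  L2norm 0 1 (fun x => \sum_(1 <= j < N) al j * phi j x) ^+ 2 = \sum_(1 <= j < N) al j ^+ 2.
Proof.
have L j : L2 0 1 (fun x => al j * phi j x : R) by apply: L2Z; exact: L2_phi.
have LS := L2_sum (index_iota 1 N) (fun j (_ : true) => L j).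
rewrite L2norm2 (ip_suml _ (fun j _ => L j) LS).
rewrite big_nat [RHS]big_nat /=; apply: eq_bigr => j jN; have /andP[j0 _] := jN.
rewrite ipC (ip_suml _ (fun j _ => L j))//.
rewrite (eq_bigr (fun l => if l == j then al j ^+ 2 else 0)) -?big_mkcond ?big_nat1_eq ?jN// => l _.
have Lp i : L2 0 1 (phi i : R -> R) by exact: L2_phi.
rewrite ipC (ipZl _ (Lp j) (L l)) (ipZr _ (Lp l) (Lp j)) ip_phi// eq_sym.
by case: eqVneq => [->|_]; rewrite ?mulr1n ?mulr0n; ring.
Qed.

Lemma sum_dphi_norm N (al : nat -> R) :
  L2norm 0 1 (fun x => \sum_(1 <= j < N) al j * dphi j x) ^+ 2 = \sum_(1 <= j < N) lam R j * al j ^+ 2.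
Proof.
have Ld j : L2 0 1 (dphi j : R -> R) by apply: L2_cont; exact: cont_dphi.
have L j : L2 0 1 (fun x => al j * dphi j x : R) by apply: L2Z.
have LS := L2_sum (index_iota 1 N) (fun j (_ : true) => L j).
rewrite L2norm2 (ip_suml _ (fun j _ => L j) LS).
rewrite big_nat [RHS]big_nat /=; apply: eq_bigr => j jN; have /andP[j0 _] := jN.
rewrite ipC (ip_suml _ (fun j _ => L j))//.
rewrite (eq_bigr (fun l => if l == j then lam R j * al j ^+ 2 else 0)) -?big_mkcond ?big_nat1_eq ?jN// => l _.
rewrite ipC (ipZl _ (Ld j) (L l)) (ipZr _ (Ld l) (Ld j)) ip_dphi// eq_sym.
by case: eqVneq => [->|_]; rewrite ?mulr1n ?mulr0n; ring.
Qed.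

Lemma lam_ge1 j : (1 <= j)%N -> 1 <= lam R j.
Proof.
move=> j1; rewrite /lam exprn_ege1// mulr_ege1 ?ler1n//.
by apply: le_trans (pi_ge2 R); rewrite ler1n.
Qed.

Section Operators.
Variables (m m1 m2 : R -> R).
Hypothesis m1_prim : isprim 0 1 m1 m2.
Hypothesis m2_cont : cont 0 1 m2.

(** A combination of the [Dop j] is 2 m' g' + m'' g for the single function g given by the same
    combination of the phi_j, so orthogonality of sines and cosines yields a weighted l^2 bound with
    a constant free of N. *)
Lemma Dop_sum : exists2 C : R, 0 <= C & forall N (al : nat -> R),
  L2norm 0 1 (fun x => \sum_(1 <= j < N) al j * Dop m1 m2 j x) <= C * Num.sqrt (\sum_(1 <= j < N) lam R j * al j ^+ 2).
Proof.
have cm1 := isprim_cont ler01 m1_prim.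
have [M1 M10 h1] := cont_bounded cm1; have [M2 M20 h2] := cont_bounded m2_cont.
exists (2 * M1 + M2) => [|N al]; first by rewrite addr_ge0// mulr_ge0.
set S := \sum_(1 <= j < N) lam R j * al j ^+ 2.
pose g x : R := \sum_(1 <= j < N) al j * phi j x; pose dg x : R := \sum_(1 <= j < N) al j * dphi j x.
have Lg : L2 0 1 g by apply: L2_sum => j _; apply: L2Z; exact: L2_phi.
have Ldg : L2 0 1 dg by apply: L2_sum => j _; apply: L2Z; apply: L2_cont; exact: cont_dphi.
have ng : L2norm 0 1 g <= Num.sqrt S.
  rewrite -(ger0_norm (L2norm_ge0 0 1 g)) -sqrtr_sqr sum_phi_norm; apply: ler_wsqrtr.
  apply: ler_sum_nat => j /andP[j1 _]; apply: ler_peMl; [exact: sqr_ge0|exact: lam_ge1].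
have ndg : L2norm 0 1 dg <= Num.sqrt S.
  by rewrite -(ger0_norm (L2norm_ge0 0 1 dg)) -sqrtr_sqr sum_dphi_norm.
have L1 : L2 0 1 (fun x => 2 * m1 x * dg x).
  by apply: L2Mc => //; apply: contM => //; exact: cont_cst.
have L2' : L2 0 1 (fun x => m2 x * g x) by apply: L2Mc.
rewrite (@eq_L2norm _ _ _ _ (fun x => 2 * m1 x * dg x + m2 x * g x)); last first.
  by move=> x _; rewrite /dg /g !mulr_sumr -big_split /=; apply: eq_bigr => j _; rewrite /Dop; ring.
apply: le_trans (L2norm_triangle L1 L2') _; rewrite mulrDl; apply: lerD.
  apply: le_trans (_ : 2 * M1 * L2norm 0 1 dg <= _); last by apply: ler_wpM2l => //; exact: mulr_ge0.
  apply: L2norm_dom => //; first exact: mulr_ge0.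
  move=> x x01; rewrite normrM; apply: ler_wpM2r => //; rewrite normrM ger0_norm//.
  by apply: ler_wpM2l => //; exact: h1.
apply: le_trans (_ : M2 * L2norm 0 1 g <= _); last exact: ler_wpM2l.
apply: L2norm_dom => //.
by move=> x x01; rewrite normrM; apply: ler_wpM2r => //; exact: h2.
Qed.

Lemma Vop_sum : exists2 C : R, 0 <= C & forall N (al : nat -> R),
  L2norm 0 1 (fun x => \sum_(1 <= j < N) al j * Vop m1 j x) <= C * Num.sqrt (\sum_(1 <= j < N) lam R j * al j ^+ 2).
Proof.
have cm1 := isprim_cont ler01 m1_prim; have cm2 := contX 2 cm1.
have [M M0 h] := cont_bounded cm2.
exists M => // N al; set S := \sum_(1 <= j < N) lam R j * al j ^+ 2.
pose g x : R := \sum_(1 <= j < N) al j * phi j x.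
have Lg : L2 0 1 g by apply: L2_sum => j _; apply: L2Z; exact: L2_phi.
have ng : L2norm 0 1 g <= Num.sqrt S.
  rewrite -(ger0_norm (L2norm_ge0 0 1 g)) -sqrtr_sqr sum_phi_norm; apply: ler_wsqrtr.
  apply: ler_sum_nat => j /andP[j1 _]; apply: ler_peMl; [exact: sqr_ge0|exact: lam_ge1].
rewrite (@eq_L2norm _ _ _ _ (fun x => m1 x ^+ 2 * g x)); last first.
  by move=> x _; rewrite /g !mulr_sumr; apply: eq_bigr => j _; rewrite /Vop; ring.
apply: le_trans (_ : M * L2norm 0 1 g <= _); last exact: ler_wpM2l.
apply: L2norm_dom => //; first exact: L2Mc.
by move=> x x01; rewrite normrM; apply: ler_wpM2r => //; exact: h.
Qed.

End Operators.
End TimeBessel.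

(** * First and second order expansion of the gauged coefficients *)

Section Expansion.
Variable R : realType.
Local Open Scope complex_scope.
Variables (m m1 m2 m3 : R -> R).
Hypothesis m_prim : isprim 0 1 m m1.
Hypothesis m1_prim : isprim 0 1 m1 m2.
Hypothesis m2_prim : isprim 0 1 m2 m3.
Variables (T : R) (u : R -> R) (p q : R -> R -> R).
Hypothesis T0 : 0 <= T.
Hypothesis Ttau : T <= 2 / pi.
Hypothesis iu : intg 0 T u.
Hypothesis pp : pathL2 T p.
Hypothesis pq : pathL2 T q.
Hypothesis ode : forall j, (1 <= j)%N -> coef_ode T u m p q j.
Hypothesis init : forall j, (1 <= j)%N ->
  ip 0 1 (p 0) (phi j) = (j == 1%N)%:R /\ ip 0 1 (q 0) (phi j) = 0.
Hypothesis th1 : forall t, 0 <= t <= T -> `|th u t| <= 1.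
Implicit Types (s t x y : R) (g h f : R -> R) (j k N : nat).

Local Notation Dop := (Dop m1 m2).
Local Notation Vop := (Vop m1).
Local Notation th := (th u).
Local Notation P := (pt m p q th).
Local Notation Q := (qt m p q th).

Let cm2 : cont 0 1 m2. Proof. exact: isprim_cont ler01 m2_prim. Qed.
Let LD j : L2 0 1 (Dop j). Proof. exact: (L2_Dop m1_prim cm2). Qed.
Let LV j : L2 0 1 (Vop j). Proof. exact: (L2_Vop m1_prim). Qed.
Let L2phi j : L2 0 1 (phi j : R -> R). Proof. exact: L2_phi. Qed.
Let pP : pathL2 T P. Proof. exact: (pathL2_P m_prim T0 iu pp pq). Qed.
Let pQ : pathL2 T Q. Proof. exact: (pathL2_Q m_prim T0 iu pp pq). Qed.
Let hth : isprim 0 T th u. Proof. exact: isprim_prim. Qed.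
Let cth : cont 0 T th. Proof. exact: isprim_cont T0 hth. Qed.
Let Lth : L2 0 T th. Proof. exact: L2_cont. Qed.
Let T1 : T <= 1.
Proof. by apply: le_trans Ttau _; rewrite ler_pdivrMr ?pi_gt0// mul1r pi_ge2. Qed.

Definition Zc t g : R[i] := ip 0 1 (P t) g +i* ip 0 1 (Q t) g.

Let E := L2norm 0 T th.
Let E0 : 0 <= E. Proof. exact: L2norm_ge0. Qed.
Let rint_th2 : rint 0 T (fun t => th t ^+ 2) = E ^+ 2.
Proof. by rewrite L2norm2; apply: eq_rint => t _; rewrite expr2. Qed.
Let ith2 : intg 0 T (fun t => th t ^+ 2). Proof. exact: L2_sq. Qed.
Let ith1 : intg 0 T (fun t => `|th t|). Proof. by apply: intg_norm; exact: L2_intg. Qed.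
Let E1 : E <= 1.
Proof.
rewrite -(@ler_pXn2r _ 2) ?nnegrE// expr1n -rint_th2; apply: le_trans (_ : rint 0 T (fun=> 1) <= _).
  apply: ler_rint => //; first exact: intg_cst.
  by move=> t tT; rewrite -real_normK ?num_real// exprn_ile1// th1.
by rewrite rint_cst// mul1r subr0.
Qed.
Let rint_th1 : rint 0 T (fun t => `|th t|) <= E.
Proof.
apply: le_trans (norm1_le_L2norm T0 Lth) _; rewrite -/E ler_piMl// subr0.
by rewrite -[leRHS]sqrtr1; exact: ler_wsqrtr.
Qed.
Let E2 : E ^+ 2 <= E.
Proof. by rewrite expr2 ler_piMl. Qed.

Let N1 := 4 * (L2norm 0 1 (Dop 1) + L2norm 0 1 (Vop 1)).
Let N10 : 0 <= N1.
Proof. by rewrite mulr_ge0// addr_ge0// L2norm_ge0. Qed.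

Let rp t x := P t x - cos (lam R 1 * t) * phi 1 x.
Let rq t x := Q t x + sin (lam R 1 * t) * phi 1 x.
(** The bound of [rho_bound] on the residual, the integral of |th| + th^2 being at most 2 E since E
    <= 1. *)
Let r := 2 * N1 * E.
Let r0 : 0 <= r. Proof. by apply: mulr_ge0 => //; exact: mulr_ge0. Qed.

Let Lrp t : 0 <= t <= T -> L2 0 1 (rp t).
Proof. exact: (pathL2_rp m_prim T0 iu pp pq).1. Qed.
Let Lrq t : 0 <= t <= T -> L2 0 1 (rq t).
Proof. exact: (pathL2_rq m_prim T0 iu pp pq).1. Qed.

Let rho_le t : 0 <= t <= T -> L2norm 0 1 (rp t) <= r /\ L2norm 0 1 (rq t) <= r.
Proof.
move=> tT; have B := rho_bound m_prim m1_prim m2_prim T0 iu pp pq ode init tT.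
have I2 : rint 0 T (fun t => `|th t| + th t ^+ 2) <= 2 * E.
  by rewrite rintD// rint_th2 (_ : 2 * E = E + E); [exact: lerD|ring].
have I0 : 0 <= rint 0 T (fun t => `|th t| + th t ^+ 2).
  by apply: rint_ge0 => t' _; rewrite addr_ge0// sqr_ge0.
have B' : ip 0 1 (rp t) (rp t) + ip 0 1 (rq t) (rq t) <= r ^+ 2.
  have X0 := mulr_ge0 N10 I0; apply: le_trans B _; rewrite ler_pXn2r ?nnegrE//.
  have -> : r = N1 * (2 * E) by rewrite /r; ring.
  exact: ler_wpM2l.
by split; rewrite -(@ler_pXn2r _ 2) ?nnegrE ?L2norm_ge0// L2norm2; apply: le_trans B' => //;
  [rewrite lerDl|rewrite lerDr]; exact: ip_ge0.
Qed.

Let PQ_le t : 0 <= t <= T -> L2norm 0 1 (P t) <= 1 /\ L2norm 0 1 (Q t) <= 1.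
Proof.
move=> tT; have B := frame_norm m_prim T0 iu pp pq ode init tT.
by split; rewrite -(@ler_pXn2r _ 2) ?nnegrE ?L2norm_ge0// L2norm2 expr1n -[leRHS]B;
  [rewrite lerDl|rewrite lerDr]; exact: ip_ge0.
Qed.

Let n1_pair (f g h : R -> R) (c : R) : L2 0 1 f -> L2 0 1 g -> L2 0 1 h -> L2norm 0 1 f <= c -> L2norm 0 1 g <= c ->
  n1 (ip 0 1 f h +i* ip 0 1 g h) <= 2 * c * L2norm 0 1 h.
Proof.
move=> hf hg hh fc gc; rewrite (_ : 2 * c * _ = c * L2norm 0 1 h + c * L2norm 0 1 h); last by ring.
by apply: lerD; [apply: le_trans (ip_CauchySchwarz hf hh) _|apply: le_trans (ip_CauchySchwarz hg hh) _];
  apply: ler_wpM2r => //; exact: L2norm_ge0.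
Qed.

Let nZ t g : 0 <= t <= T -> L2 0 1 g -> n1 (Zc t g) <= 2 * L2norm 0 1 g.
Proof.
move=> tT hg; have [h1 h2] := PQ_le tT.
by have := n1_pair (pP.1 t tT) (pQ.1 t tT) hg h1 h2; rewrite mulr1.
Qed.

Let Zr t g : R[i] := ip 0 1 (rp t) g +i* ip 0 1 (rq t) g.

Let ZcE t g : 0 <= t <= T -> L2 0 1 g -> Zc t g = cexp (- (lam R 1 * t)) * (ip 0 1 (phi 1) g)%:C + Zr t g.
Proof.
move=> tT hg; have LP := pP.1 t tT; have LQ := pQ.1 t tT.
have Lc : L2 0 1 (fun x => cos (lam R 1 * t) * phi 1 x) by exact: L2Z.
have Ls : L2 0 1 (fun x => sin (lam R 1 * t) * phi 1 x) by exact: L2Z.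
apply: complexP; rewrite !creimE /= cosN ?sinN.
  by rewrite (ipBl LP Lc hg) (ipZl _ (L2phi 1) hg); ring.
by rewrite (ipDl LQ Ls hg) (ipZl _ (L2phi 1) hg); ring.
Qed.

Let nZr t g : 0 <= t <= T -> L2 0 1 g -> n1 (Zr t g) <= 2 * r * L2norm 0 1 g.
Proof. by move=> tT hg; have [h1 h2] := rho_le tT; apply: n1_pair => //; [exact: Lrp|exact: Lrq]. Qed.

Let cZ g : L2 0 1 g -> ccont 0 T (Zc ^~ g).
Proof. by move=> hg; split; apply: pathL2_ipr. Qed.

(** Derivative of exp(i lam_j t) times the j-th coefficient: the phase removes the eigenvalue term,
    and all that remains carries a factor th. *)
Let zd j t := cexp (lam R j * t) * ((th t)%:C * Zc t (Dop j) - 'i * (th t ^+ 2)%:C * Zc t (Vop j)).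

Let zd_cont j : ccont 0 T (zd j).
Proof.
have cth2 := contX 2 cth.
apply: ccontM; first exact: ccont_exp.
apply: ccontD; first by apply: ccontM; [exact: ccont_real|exact: cZ].
apply: ccontN; apply: ccontM; last exact: cZ.
by apply: ccontM; [exact: ccont_cst|exact: ccont_real].
Qed.

Let zd_prim j : cprim 0 T (fun t => cexp (lam R j * t) * Zc t (phi j)) (zd j).
Proof.
have h1 := gauge_ode_re m_prim m1_prim m2_prim T0 iu pp pq ode j.
have h2 := gauge_ode_im m_prim m1_prim m2_prim T0 iu pp pq ode j.
have h : cprim 0 T (Zc ^~ (phi j)) (fun t => - 'i * (lam R j)%:C * Zc t (phi j) +
    ((th t)%:C * Zc t (Dop j) - 'i * (th t ^+ 2)%:C * Zc t (Vop j))).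
  split; [apply: isprim_ext h1|apply: isprim_ext h2] => t _ //; rewrite !creimE /=; ring.
apply: cprim_ext (cprimM T0 (@cprim_exp R 0 T (lam R j) T0) h) => t _ //.
by rewrite /zd; ring.
Qed.

Let Z0 j : (1 <= j)%N -> Zc 0 (phi j) = (j == 1%N)%:R.
Proof.
move=> j1; have [i1 i2] := init j1.
have t0 : th 0 = 0 by exact: rint_pt.
have eP : ip 0 1 (P 0) (phi j) = (j == 1%N)%:R.
  by rewrite -i1; apply: eq_ip => x _ //; rewrite /pt t0 mul0r cos0 sin0; ring.
have eQ : ip 0 1 (Q 0) (phi j) = 0.
  by rewrite -[RHS]i2; apply: eq_ip => x _ //; rewrite /qt t0 mul0r cos0 sin0; ring.
by rewrite /Zc eP eQ; case: (j == 1%N).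
Qed.

Let zjT j t : (1 <= j)%N -> 0 <= t <= T -> cexp (lam R j * t) * Zc t (phi j) - (j == 1%N)%:R = cint 0 t (zd j).
Proof.
move=> j1 /andP[t0 tT]; have := cprim_diff (zd_prim j) (lexx 0) t0 tT.
by rewrite mulr0 cexp0 mul1r Z0.
Qed.

(** In the Dop term of [zd j] the state is replaced by the ground state; the error is the residual,
    of order E, times the integral of |th|. The Vop term is already quadratic. *)
Lemma first_order j : (1 <= j)%N ->
  n1 (cexp (lam R j * T) * Zc T (phi j) - (j == 1%N)%:R -
      (ip 0 1 (phi 1) (Dop j))%:C * cint 0 T (fun t => (th t)%:C * cexp ((lam R j - lam R 1) * t)))
  <= (8 * N1 * L2norm 0 1 (Dop j) + 4 * L2norm 0 1 (Vop j)) * E ^+ 2.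
Proof.
move=> j1; rewrite zjT ?T0 ?lexx//.
have ic : ccont 0 T (fun t => (th t)%:C * cexp ((lam R j - lam R 1) * t)).
  by apply: ccontM; [exact: ccont_real|exact: ccont_exp].
set d := (ip 0 1 (phi 1) (Dop j))%:C.
have icd := ccontN (ccontM (ccont_cst 0 T d) ic).
have -> : cint 0 T (zd j) - d * cint 0 T (fun t => (th t)%:C * cexp ((lam R j - lam R 1) * t)) =
    cint 0 T (fun t => cexp (lam R j * t) * ((th t)%:C * Zr t (Dop j) - 'i * (th t ^+ 2)%:C * Zc t (Vop j))).
  rewrite -(cintZ d (cintg_cont ic)) -[X in _ + X]mulN1r -(cintZ (-1) (cintg_cont (ccontM (ccont_cst 0 T d) ic))).
  rewrite -cintD; [|exact: cintg_cont..|]; last first.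
    by apply: cintg_cont; exact: ccontM (ccont_cst _ _ _) (ccontM (ccont_cst 0 T d) ic).
  apply: eq_cint => t tT; rewrite /zd (ZcE tT (LD j)) -/d.
  by rewrite (_ : (lam R j - lam R 1) * t = lam R j * t + - (lam R 1 * t)); [rewrite cexpD; ring|ring].
have ND := L2norm_ge0 0 1 (Dop j); have NV := L2norm_ge0 0 1 (Vop j).
have ih : intg 0 T (fun t => (4 * r * L2norm 0 1 (Dop j)) * `|th t| + (4 * L2norm 0 1 (Vop j)) * th t ^+ 2).
  by apply: intgD; exact: intgZ.
apply: le_trans (cint_norm (h := fun t => (4 * r * L2norm 0 1 (Dop j)) * `|th t| + (4 * L2norm 0 1 (Vop j)) * th t ^+ 2) _ ih _) _.
- have := cintg_cont (ccontD (zd_cont j) icd).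
  move=> [k1 k2]; split; [apply: eq_intg k1|apply: eq_intg k2] => t tT; congr (_ _);
  rewrite /zd (ZcE tT (LD j)) -/d (_ : (lam R j - lam R 1) * t = lam R j * t + - (lam R 1 * t)); try (by ring);
  by rewrite cexpD; ring.
- move=> t tT; apply: le_trans (n1_expM _ _) _.
  have b1 : n1 ((th t)%:C * Zr t (Dop j)) <= `|th t| * (2 * r * L2norm 0 1 (Dop j)).
    by apply: le_trans (n1M _ _) _; rewrite n1_real; apply: ler_wpM2l => //; exact: nZr.
  have b2 : n1 ('i * (th t ^+ 2)%:C * Zc t (Vop j)) <= th t ^+ 2 * (2 * L2norm 0 1 (Vop j)).
    rewrite -mulrA; apply: le_trans (n1M _ _) _; rewrite n1_i mul1r.
    apply: le_trans (n1M _ _) _; rewrite n1_real ger0_norm ?sqr_ge0//.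
    by apply: ler_wpM2l; [exact: sqr_ge0|exact: nZ].
  have b3 := n1B ((th t)%:C * Zr t (Dop j)) ('i * (th t ^+ 2)%:C * Zc t (Vop j)).
  apply: le_trans (_ : 2 * (`|th t| * (2 * r * L2norm 0 1 (Dop j)) + th t ^+ 2 * (2 * L2norm 0 1 (Vop j))) <= _).
    by apply: ler_wpM2l => //; apply: le_trans b3 _; exact: lerD.
  by apply: le_eq; ring.
rewrite (rintD (intgZ _ ith1) (intgZ _ ith2)) (rintZ _ ith1) (rintZ _ ith2) rint_th2 [leRHS]mulrDl; apply: lerD => //.
apply: le_trans (_ : 4 * r * L2norm 0 1 (Dop j) * E <= _); last first.
  by apply: le_eq; rewrite /r; ring.
by apply: ler_wpM2l => //; apply: mulr_ge0 => //; exact: mulr_ge0.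
Qed.

(** The sum over j goes inside the inner product, so that [Dop_sum] or [Vop_sum] bounds one
    function. The factor 4 counts the real products of [ga] with f and g. *)
Let lin_bound (f g : R -> R) (G : nat -> R -> R) (c C : R) N (ga : nat -> R[i]) : 
  L2 0 1 f -> L2 0 1 g -> (forall j, L2 0 1 (G j)) -> L2norm 0 1 f <= c -> L2norm 0 1 g <= c -> 
  (forall al, L2norm 0 1 (fun x => \sum_(1 <= j < N) al j * G j x) <= C * Num.sqrt (\sum_(1 <= j < N) lam R j * al j ^+ 2)) ->
  0 <= C ->
  n1 (\sum_(1 <= j < N) ga j * (ip 0 1 f (G j) +i* ip 0 1 g (G j))) <=
  4 * c * C * Num.sqrt (\sum_(1 <= j < N) lam R j * (cre (ga j) ^+ 2 + cim (ga j) ^+ 2)).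
Proof.
move=> hf hg hG fc gc hC C0.
set S := \sum_(1 <= j < N) lam R j * _.
have c0 : 0 <= c := le_trans (L2norm_ge0 0 1 f) fc.
have lam0 j : 0 <= lam R j by rewrite /lam sqr_ge0.
have key (h : R -> R) (al : nat -> R) : L2 0 1 h -> L2norm 0 1 h <= c -> (forall j, al j ^+ 2 <= cre (ga j) ^+ 2 + cim (ga j) ^+ 2) ->
    `|\sum_(1 <= j < N) al j * ip 0 1 h (G j)| <= c * C * Num.sqrt S.
  move=> hh hc al2; have LZ j : L2 0 1 (fun x => al j * G j x) by exact: L2Z.
  have -> : \sum_(1 <= j < N) al j * ip 0 1 h (G j) = ip 0 1 h (fun x => \sum_(1 <= j < N) al j * G j x).
    rewrite ipC (ip_suml _ (fun j _ => LZ j) hh); apply: eq_bigr => j _.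
    by rewrite (ipZl _ (hG j) hh) ipC.
  apply: le_trans (ip_CauchySchwarz hh (L2_sum _ (fun j _ => LZ j))) _.
  rewrite -mulrA; apply: ler_pM => //; try exact: L2norm_ge0.
  apply: le_trans (hC al) _; apply: ler_wpM2l => //; apply: ler_wsqrtr.
  by apply: ler_sum => j _; apply: ler_wpM2l.
have al1 j : cre (ga j) ^+ 2 <= cre (ga j) ^+ 2 + cim (ga j) ^+ 2 by rewrite lerDl sqr_ge0.
have al2 j : cim (ga j) ^+ 2 <= cre (ga j) ^+ 2 + cim (ga j) ^+ 2 by rewrite lerDr sqr_ge0.
have k1 := key f (fun j => cre (ga j)) hf fc al1; have k2 := key f (fun j => cim (ga j)) hf fc al2.
have k3 := key g (fun j => cre (ga j)) hg gc al1; have k4 := key g (fun j => cim (ga j)) hg gc al2.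
rewrite /n1 cre_sum cim_sum.
rewrite (eq_bigr (fun j => cre (ga j) * ip 0 1 f (G j) - cim (ga j) * ip 0 1 g (G j))); last first.
  by move=> j _; rewrite creM.
rewrite [X in _ + `|X|](eq_bigr (fun j => cre (ga j) * ip 0 1 g (G j) + cim (ga j) * ip 0 1 f (G j))); last first.
  by move=> j _; rewrite cimM.
rewrite sumrB big_split /=.
have b1 := ler_normB (\sum_(1 <= j < N) cre (ga j) * ip 0 1 f (G j)) (\sum_(1 <= j < N) cim (ga j) * ip 0 1 g (G j)).
have b2 := ler_normD (\sum_(1 <= j < N) cre (ga j) * ip 0 1 g (G j)) (\sum_(1 <= j < N) cim (ga j) * ip 0 1 f (G j)).
apply: le_trans (lerD (le_trans b1 (lerD k1 k4)) (le_trans b2 (lerD k3 k2))) _.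
by apply: le_eq; ring.
Qed.

Section SecondOrder.
Variables (K N : nat) (CD CV Cd : R).
Hypothesis K1 : (1 <= K)%N.
Hypothesis DK1 : ip 0 1 (phi 1) (Dop K) = 0.
Hypothesis CD0 : 0 <= CD.
Hypothesis CV0 : 0 <= CV.
Hypothesis Cd0 : 0 <= Cd.
Hypothesis hCD : forall (al : nat -> R),
  L2norm 0 1 (fun x => \sum_(1 <= j < N) al j * Dop j x) <= CD * Num.sqrt (\sum_(1 <= j < N) lam R j * al j ^+ 2).
Hypothesis hCV : forall (al : nat -> R),
  L2norm 0 1 (fun x => \sum_(1 <= j < N) al j * Vop j x) <= CV * Num.sqrt (\sum_(1 <= j < N) lam R j * al j ^+ 2).
Hypothesis hCd : forall j, `|j%:R * ip 0 1 (Dop K) (phi j)| <= Cd.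

(** The antiderivative, vanishing at T, of minus th(t) exp(i (lam_K - lam_j) t); it serves the
    integration by parts in [parts]. *)
Definition Wc j t : R[i] := cint t T (fun s => (th s)%:C * cexp ((lam R K - lam R j) * s)).

Let kc j : ccont 0 T (fun s => (th s)%:C * cexp ((lam R K - lam R j) * s)).
Proof. by apply: ccontM; [exact: ccont_real|exact: ccont_exp]. Qed.

Lemma Wc_prim j : cprim 0 T (Wc j) (fun s => - ((th s)%:C * cexp ((lam R K - lam R j) * s))).
Proof.
pose w s : R[i] := (th s)%:C * cexp ((lam R K - lam R j) * s).
have h := cprim_cint T0 (cintg_cont (kc j)); rewrite -/w in h.
apply: cprim_ext (cprimB (cprim_cst 0 T (cint 0 T w)) h) => t tT; last by rewrite sub0r.
have /andP[t0 tT'] := tT; have := cprim_diff h t0 tT' (lexx T).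
by rewrite /= => ->.
Qed.

Let d j := ip 0 1 (Dop K) (phi j).
Let ga t j : R[i] := (d j)%:C * Wc j t * cexp (lam R j * t).

Let WcT j : Wc j T = 0.
Proof. by apply: complexP; rewrite /= rint_pt. Qed.

(** lam_j d_j^2 = pi^2 (j d_j)^2 is bounded through [hCd], and the squared moduli of the [Wc j t]
    sum to at most (2 / pi) E^2 by [time_Bessel]. The total 2 pi Cd^2 E^2 is below (3 Cd E)^2. Here
    the bound becomes uniform in N. *)
Let ga_bound t : 0 <= t <= T ->
  Num.sqrt (\sum_(1 <= j < N) lam R j * (cre (ga t j) ^+ 2 + cim (ga t j) ^+ 2)) <= 3 * Cd * E.
Proof.
move=> /andP[t0 tT].
have B := time_Bessel (lam R K) N t0 tT Ttau (L2_sub t0 (lexx T) Lth).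
have pi0 : 0 < pi :> R := pi_gt0 R.
have LE : ip t T th th <= E ^+ 2.
  rewrite /E L2norm2 /ip (rint_cat t0 tT (L2M_intg Lth Lth)).
  by rewrite lerDr; apply: rint_ge0 => x _; rewrite -expr2 sqr_ge0.
apply: le_trans (_ : Num.sqrt ((3 * Cd * E) ^+ 2) <= _); last first.
  by rewrite sqrtr_sqr ger0_norm// mulr_ge0// mulr_ge0.
apply: ler_wsqrtr.
have -> : (3 * Cd * E) ^+ 2 = 9 * Cd ^+ 2 * E ^+ 2 by ring.
have S1 : \sum_(1 <= j < N) lam R j * (cre (ga t j) ^+ 2 + cim (ga t j) ^+ 2) <=
    \sum_(1 <= j < N) (pi ^+ 2 * Cd ^+ 2) * (cre (Wc j t) ^+ 2 + cim (Wc j t) ^+ 2).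
  apply: ler_sum => j _.
  have -> : cre (ga t j) ^+ 2 + cim (ga t j) ^+ 2 = d j ^+ 2 * (cre (Wc j t) ^+ 2 + cim (Wc j t) ^+ 2).
    have c2 := cos2Dsin2 (lam R j * t); rewrite /ga !creimE.
    transitivity (d j ^+ 2 * (cre (Wc j t) ^+ 2 + cim (Wc j t) ^+ 2) * (cos (lam R j * t) ^+ 2 + sin (lam R j * t) ^+ 2)); first by ring.
    by rewrite c2 mulr1.
  rewrite mulrA; apply: ler_wpM2r; first by rewrite addr_ge0// sqr_ge0.
  have -> : lam R j * d j ^+ 2 = pi ^+ 2 * (j%:R * d j) ^+ 2 by rewrite /lam; ring.
  apply: ler_wpM2l; first exact: sqr_ge0.
  by rewrite -real_normK ?num_real// ler_pXn2r ?nnegrE//; exact: hCd.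
apply: le_trans S1 _; rewrite -mulr_sumr.
have B' : \sum_(1 <= j < N) (cre (Wc j t) ^+ 2 + cim (Wc j t) ^+ 2) <= 2 / pi * E ^+ 2.
  apply: le_trans (_ : 2 / pi * ip t T th th <= _); last by apply: ler_wpM2l => //; rewrite divr_ge0// ltW.
  apply: le_trans B; apply: ler_sum => j _; rewrite cre_cint cim_cint.
  by apply: lerD; apply: le_eq; congr (_ ^+ 2); apply: eq_rint => s _;
    rewrite !creimE; ring.
apply: le_trans (ler_wpM2l _ B') _; first by rewrite mulr_ge0// sqr_ge0.
have -> : pi ^+ 2 * Cd ^+ 2 * (2 / pi * E ^+ 2) = 2 * pi * (Cd ^+ 2 * E ^+ 2) * (pi / pi) by ring.
rewrite divff ?gt_eqF// mulr1 -[leRHS]mulrA; apply: ler_wpM2r; first by rewrite mulr_ge0// sqr_ge0.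
by have /andP[_] := pihalf_02 R; rewrite ltr_pdivrMr// => pi4; lra.
Qed.

Let eN x := Dop K x - PN N (Dop K) x.
Let LeN : L2 0 1 eN. Proof. by apply: L2B => //; exact: L2_PN. Qed.

Let ZrDK t : 0 <= t <= T -> Zr t (Dop K) = Zr t eN + \sum_(1 <= j < N) (d j)%:C * Zr t (phi j).
Proof.
move=> tT; have LPN := L2_PN N (Dop K).
have LZ j : L2 0 1 (fun x => d j * phi j x) by exact: L2Z.
have key (h : R -> R) : L2 0 1 h -> ip 0 1 h (Dop K) = ip 0 1 h eN + \sum_(1 <= j < N) d j * ip 0 1 h (phi j).
  move=> Lh; rewrite (ipBr (LD K) LPN Lh) [X in _ - X]ipC (ip_suml _ (fun j _ => LZ j) Lh).
  rewrite (eq_bigr (fun j => d j * ip 0 1 h (phi j))) ?subrK// => j _.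
  by rewrite (ipZl _ (L2phi j) Lh) ipC.
apply: complexP; rewrite creimE ?cre_sum ?cim_sum /=.
  by rewrite (key _ (Lrp tT)); congr (_ + _); apply: eq_bigr => j _; rewrite mul0r subr0.
by rewrite (key _ (Lrq tT)); congr (_ + _); apply: eq_bigr => j _; rewrite mul0r addr0.
Qed.

Let zt j t := cexp (lam R j * t) * Zc t (phi j) - (j == 1%N)%:R.

Let zt_prim j : cprim 0 T (zt j) (zd j).
Proof. by apply: cprim_ext (cprimB (zd_prim j) (cprim_cst 0 T _)) => t _ //; rewrite subr0. Qed.

Let zt_cont j : ccont 0 T (zt j). Proof. exact: cprim_cont T0 (zt_prim j). Qed.
Let Wc_cont j : ccont 0 T (Wc j). Proof. exact: cprim_cont T0 (Wc_prim j). Qed.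

(** No boundary terms appear: [Wc j] vanishes at T and [zt j] at 0. *)
Let parts j : (1 <= j)%N ->
  cint 0 T (fun t => (th t)%:C * cexp ((lam R K - lam R j) * t) * zt j t) = cint 0 T (fun t => Wc j t * zd j t).
Proof.
move=> j1; have h := cprim_diff (cprimM T0 (Wc_prim j) (zt_prim j)) (lexx 0) T0 (lexx T).
have z0 : zt j 0 = 0 by rewrite /zt mulr0 cexp0 mul1r Z0// subrr.
rewrite WcT z0 mul0r mulr0 subrr in h.
have c1 := ccontM (kc j) (zt_cont j); have c2 := ccontM (Wc_cont j) (zd_cont j).
have e : cint 0 T (fun t => - ((th t)%:C * cexp ((lam R K - lam R j) * t)) * zt j t) =
    - cint 0 T (fun t => (th t)%:C * cexp ((lam R K - lam R j) * t) * zt j t).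
  by rewrite -[RHS]mulN1r -(cintZ (-1) (cintg_cont c1)); apply: eq_cint => t _; ring.
rewrite cintD ?e in h; last 2 first.
- by apply: cintg_cont; apply: ccontM; [apply: ccontN; exact: kc|exact: zt_cont].
- exact: cintg_cont.
by apply/eqP; rewrite eq_sym -subr_eq0 addrC -h.
Qed.

Let cZr g : L2 0 1 g -> ccont 0 T (Zr ^~ g).
Proof.
move=> hg; have prp := pathL2_rp m_prim T0 iu pp pq; have prq := pathL2_rq m_prim T0 iu pp pq.
by split; apply: pathL2_ipr.
Qed.

(** [R1] carries the residual in the Vop term of mode K, [R2] the part of [Dop K] outside the modes
    below N, [R3] the residual and Vop terms met inside those modes. *)
Let R1 t := - 'i * cexp (lam R K * t) * (th t ^+ 2)%:C * Zr t (Vop K).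
Let R2 t := cexp (lam R K * t) * (th t)%:C * Zr t eN.
Let R3 t := \sum_(1 <= j < N) ga t j * ((th t)%:C * Zr t (Dop j) - 'i * (th t ^+ 2)%:C * Zc t (Vop j)).
Let V1K := ip 0 1 (phi 1) (Vop K).
Let D1 j := ip 0 1 (phi 1) (Dop j).

Let cth2 : ccont 0 T (fun t => (th t ^+ 2)%:C). Proof. by apply: ccont_real; exact: contX. Qed.
Let ccth : ccont 0 T (fun t => (th t)%:C). Proof. exact: ccont_real. Qed.

Let R1_cont : ccont 0 T R1.
Proof.
apply: ccontM; last exact: cZr.
by apply: ccontM => //; apply: ccontM; [exact: ccont_cst|exact: ccont_exp].
Qed.
Let R2_cont : ccont 0 T R2.
Proof. by apply: ccontM; [apply: ccontM => //; exact: ccont_exp|exact: cZr]. Qed.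
Let R3j_cont j : ccont 0 T (fun t => ga t j * ((th t)%:C * Zr t (Dop j) - 'i * (th t ^+ 2)%:C * Zc t (Vop j))).
Proof.
apply: ccontM.
  apply: ccontM; last exact: ccont_exp.
  by apply: ccontM; [exact: ccont_cst|exact: Wc_cont].
apply: ccontD; first by apply: ccontM => //; exact: cZr.
by apply: ccontN; apply: ccontM; [apply: ccontM => //; exact: ccont_cst|exact: cZ].
Qed.

Let zdKE t : 0 <= t <= T -> zd K t = R1 t + R2 t
  - 'i * V1K%:C * ((th t ^+ 2)%:C * cexp ((lam R K - lam R 1) * t))
  + \sum_(1 <= j < N) (d j)%:C * ((th t)%:C * cexp ((lam R K - lam R j) * t) * zt j t).
Proof.
move=> tT; rewrite /zd (ZcE tT (LD K)) DK1 (ZcE tT (LV K)) (ZrDK tT).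
have -> : \sum_(1 <= j < N) (d j)%:C * ((th t)%:C * cexp ((lam R K - lam R j) * t) * zt j t) =
    cexp (lam R K * t) * (th t)%:C * \sum_(1 <= j < N) (d j)%:C * Zr t (phi j).
  rewrite mulr_sumr big_nat [RHS]big_nat; apply: eq_bigr => j /andP[j1 _].
  have e1 : cexp (lam R K * t) = cexp ((lam R K - lam R j) * t) * cexp (lam R j * t).
    by rewrite -cexpD; congr cexp; ring.
  have -> : Zr t (phi j) = Zc t (phi j) - cexp (- (lam R 1 * t)) * (j == 1%N)%:R.
    rewrite (ZcE tT (L2phi j)) ip_phi// eq_sym.
    by case: (j == 1%N); rewrite /= ?mulr1n ?mulr0n; ring.
  rewrite e1 /zt; case: eqVneq => [->|_]; last by rewrite /= ?mulr0n; ring.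
  have e2 := cexpNK (lam R 1 * t); rewrite mulr1n.
  transitivity ((d 1%N)%:C * (th t)%:C * cexp ((lam R K - lam R 1) * t) * (cexp (lam R 1 * t) * Zc t (phi 1) - cexp (- (lam R 1 * t)) * cexp (lam R 1 * t))); last by ring.
  by rewrite e2; ring.
have -> : cexp ((lam R K - lam R 1) * t) = cexp (lam R K * t) * cexp (- (lam R 1 * t)).
  by rewrite -cexpD; congr cexp; ring.
by rewrite /R1 /R2 -/V1K (_ : 0%:C = 0)//; ring.
Qed.

Let WzdE j t : 0 <= t <= T -> (d j)%:C * (Wc j t * zd j t) =
  (d j * D1 j)%:C * ((th t)%:C * cexp ((lam R j - lam R 1) * t) * Wc j t) +
  ga t j * ((th t)%:C * Zr t (Dop j) - 'i * (th t ^+ 2)%:C * Zc t (Vop j)).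
Proof.
move=> tT; rewrite /zd (ZcE tT (LD j)) -/(D1 j) /ga.
have -> : cexp ((lam R j - lam R 1) * t) = cexp (lam R j * t) * cexp (- (lam R 1 * t)).
  by rewrite -cexpD; congr cexp; ring.
by rewrite (_ : (d j * D1 j)%:C = (d j)%:C * (D1 j)%:C) ?rmorphM//; ring.
Qed.

Let remainder :
  cexp (lam R K * T) * Zc T (phi K) - (K == 1%N)%:R
  + 'i * V1K%:C * cint 0 T (fun t => (th t ^+ 2)%:C * cexp ((lam R K - lam R 1) * t))
  - \sum_(1 <= j < N) (d j * D1 j)%:C * cint 0 T (fun t => (th t)%:C * cexp ((lam R j - lam R 1) * t) * Wc j t)
  = cint 0 T (fun t => R1 t + R2 t + R3 t).
Proof.
have c12 := ccontD R1_cont R2_cont.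
have cV : ccont 0 T (fun t => (th t ^+ 2)%:C * cexp ((lam R K - lam R 1) * t)).
  by apply: ccontM => //; exact: ccont_exp.
have czj j : ccont 0 T (fun t => (th t)%:C * cexp ((lam R K - lam R j) * t) * zt j t).
  by apply: ccontM => //; exact: kc.
have cWz j : ccont 0 T (fun t => Wc j t * zd j t) by apply: ccontM.
have cthW j : ccont 0 T (fun t => (th t)%:C * cexp ((lam R j - lam R 1) * t) * Wc j t).
  by apply: ccontM => //; apply: ccontM => //; exact: ccont_exp.
have cs c j (f : R -> R[i]) : ccont 0 T f -> ccont 0 T (fun t => c j * f t).
  by move=> cf; apply: ccontM => //; exact: ccont_cst.
rewrite zjT ?T0 ?lexx// (eq_cint zdKE).
rewrite cintD; last 2 first.
- apply: cintg_cont; apply: ccontD => //.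
  by apply: eq_ccont (cs (fun=> - 'i * V1K%:C) 0%N _ cV) => t _; ring.
- by apply: cintg_cont; apply: ccont_sum => j _; exact: cs (fun j => (d j)%:C) j _ (czj j).
rewrite cintD; last 2 first.
- exact: cintg_cont.
- by apply: cintg_cont; apply: eq_ccont (cs (fun=> - 'i * V1K%:C) 0%N _ cV) => t _; ring.
rewrite (@eq_cint _ _ _ (fun t => - ('i * V1K%:C * _)) (fun t => (- 'i * V1K%:C) * ((th t ^+ 2)%:C * cexp ((lam R K - lam R 1) * t)))); last first.
  by move=> t _; ring.
rewrite (cintZ _ (cintg_cont cV)).
rewrite cint_sum; last by move=> j; exact: cs (fun j => (d j)%:C) j _ (czj j).
have -> : \sum_(1 <= j < N) cint 0 T (fun t => (d j)%:C * ((th t)%:C * cexp ((lam R K - lam R j) * t) * zt j t)) =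
    \sum_(1 <= j < N) (d j * D1 j)%:C * cint 0 T (fun t => (th t)%:C * cexp ((lam R j - lam R 1) * t) * Wc j t) + cint 0 T R3.
  rewrite cint_sum// -big_split /= big_nat [RHS]big_nat; apply: eq_bigr => j /andP[j1 _].
  rewrite (cintZ _ (cintg_cont (czj j))) (parts j1) -(cintZ _ (cintg_cont (cWz j))) (eq_cint (WzdE j)).
  rewrite cintD; [|exact: cintg_cont (cs (fun j => (d j * D1 j)%:C) j _ (cthW j))|exact: cintg_cont].
  by rewrite (cintZ _ (cintg_cont (cthW j))).
rewrite [RHS]cintD; [|exact: cintg_cont|by apply: cintg_cont; exact: ccont_sum].
by ring.
Qed.

(** The residual paired with [Dop K] is expanded over the modes below N. Each coefficient is in turn
    the integral of [zd j], whose ground state part gives the iterated integral. What remains is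
    cubic in E, apart from the truncation of [Dop K], which vanishes as N grows. *)
Lemma second_order :
  n1 (cexp (lam R K * T) * Zc T (phi K) - (K == 1%N)%:R
  + 'i * (ip 0 1 (phi 1) (Vop K))%:C * cint 0 T (fun t => (th t ^+ 2)%:C * cexp ((lam R K - lam R 1) * t))
  - \sum_(1 <= j < N) (ip 0 1 (Dop K) (phi j) * ip 0 1 (phi 1) (Dop j))%:C *
      cint 0 T (fun t => (th t)%:C * cexp ((lam R j - lam R 1) * t) * Wc j t))
  <= (8 * N1 * L2norm 0 1 (Vop K) + 24 * N1 * CD * Cd + 12 * CV * Cd) * E ^+ 3
     + 8 * N1 * L2norm 0 1 (fun x => Dop K x - PN N (Dop K) x).
Proof.
rewrite remainder -/eN.
have NV := L2norm_ge0 0 1 (Vop K); have NeN := L2norm_ge0 0 1 eN.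
have cR3 : ccont 0 T R3 by apply: ccont_sum => j _; exact: R3j_cont.
pose a1 := 4 * r * L2norm 0 1 (Vop K) + 12 * CV * Cd * E.
pose a2 := 4 * r * L2norm 0 1 eN + 12 * r * CD * Cd * E.
have a10 : 0 <= a1 by rewrite /a1; nonneg.
have a20 : 0 <= a2 by rewrite /a2; nonneg.
have ih : intg 0 T (fun t => a1 * th t ^+ 2 + a2 * `|th t|) by apply: intgD; exact: intgZ.
apply: le_trans (cint_norm (h := fun t => a1 * th t ^+ 2 + a2 * `|th t|) _ ih _) _.
- by apply: cintg_cont; apply: ccontD => //; exact: ccontD.
- move=> t tT; apply: le_trans (n1D _ _) _; apply: le_trans (lerD (n1D _ _) (lexx _)) _.
  have s20 := sqr_ge0 (th t); have n20 := normr_ge0 (th t).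
  have nth2 : n1 (th t ^+ 2)%:C = th t ^+ 2 by rewrite n1_real ger0_norm.
  have b1 : n1 (R1 t) <= 4 * r * L2norm 0 1 (Vop K) * th t ^+ 2.
    rewrite /R1 (_ : - 'i * _ * _ * _ = cexp (lam R K * t) * (- 'i * ((th t ^+ 2)%:C * Zr t (Vop K)))); last by ring.
    apply: le_trans (n1_expM _ _) _; have := n1M (- 'i) ((th t ^+ 2)%:C * Zr t (Vop K)).
    rewrite n1N n1_i mul1r => h; apply: le_trans (ler_wpM2l _ (le_trans h (n1M _ _))) _ => //.
    rewrite nth2; have := ler_wpM2l s20 (nZr tT (LV K)); lra.
  have b2 : n1 (R2 t) <= 4 * r * L2norm 0 1 eN * `|th t|.
    rewrite /R2 -mulrA; apply: le_trans (n1_expM _ _) _.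
    have h := n1M (th t)%:C (Zr t eN); rewrite n1_real in h.
    by have := ler_wpM2l n20 (nZr tT LeN); lra.
  have b3 : n1 (R3 t) <= 12 * r * CD * Cd * E * `|th t| + 12 * CV * Cd * E * th t ^+ 2.
    have [h1 h2] := rho_le tT; have [h3 h4] := PQ_le tT; have gb := ga_bound tT.
    have k1 := lin_bound (ga t) (Lrp tT) (Lrq tT) LD h1 h2 hCD CD0.
    have k2 := lin_bound (ga t) (pP.1 t tT) (pQ.1 t tT) LV h3 h4 hCV CV0.
    have f1 : 0 <= 4 * r * CD by nonneg.
    have f2 : 0 <= 4 * 1 * CV by nonneg.
    have k1' := le_trans k1 (ler_wpM2l f1 gb); have k2' := le_trans k2 (ler_wpM2l f2 gb).
    rewrite (_ : R3 t = (th t)%:C * (\sum_(1 <= j < N) ga t j * Zr t (Dop j)) -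
      'i * ((th t ^+ 2)%:C * (\sum_(1 <= j < N) ga t j * Zc t (Vop j)))); last first.
      by rewrite /R3 !mulr_sumr -sumrB; apply: eq_bigr => j _; ring.
    apply: le_trans (n1B _ _) _.
    have g1 := n1M (th t)%:C (\sum_(1 <= j < N) ga t j * Zr t (Dop j)); rewrite n1_real in g1.
    have g2 := n1M 'i ((th t ^+ 2)%:C * (\sum_(1 <= j < N) ga t j * Zc t (Vop j))); rewrite n1_i mul1r in g2.
    have g3 := n1M (th t ^+ 2)%:C (\sum_(1 <= j < N) ga t j * Zc t (Vop j)); rewrite nth2 in g3.
    have g4 := ler_wpM2l n20 k1'; have g5 := ler_wpM2l s20 k2'.
    apply: le_trans (lerD (le_trans g1 g4) (le_trans g2 (le_trans g3 g5))) _.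
    by apply: le_eq; ring.
  apply: le_trans (lerD (lerD b1 b2) b3) _.
  by apply: le_eq; rewrite /a1 /a2; ring.
rewrite (rintD (intgZ _ ith2) (intgZ _ ith1)) (rintZ _ ith1) (rintZ _ ith2) rint_th2.
apply: le_trans (lerD (lexx _) (ler_wpM2l a20 rint_th1)) _.
rewrite /a1 /a2 /r.
(* E <= 1 makes the truncation error independent of the control. *)
have k : 8 * N1 * L2norm 0 1 eN * E ^+ 2 <= 8 * N1 * L2norm 0 1 eN.
  apply: ler_piMr; first by nonneg.
  exact: le_trans E2 E1.
apply: le_trans (lerD (lexx _) k).
by apply: le_eq; ring.
Qed.

End SecondOrder.
End Expansion.

(** * Repeated integration by parts *)

(** The algebra of [Dbl_rec] after integration: F, ea, eb are values at T, h stands for 1/2 and is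
    used only through h + h = 1, and W is the unknown. *)
Lemma half_elim (C : comNzRingType) (i a b h F ea eb W G1 G2 G3 : C) : h + h = 1 ->
  F * ea * (F * eb) - h * (F * F * (ea * eb)) =
    W + i * b * F * ea * G1 + (i * a - i * h * (a + b)) * G2 + a * b * G3 ->
  W = h * F ^+ 2 * (ea * eb) - i * b * F * ea * G1 + i * (h * (b - a)) * G2 - a * b * G3.
Proof.
move=> hh E; have -> : W = (F * ea * (F * eb) - h * (F * F * (ea * eb))) -
  (i * b * F * ea * G1 + (i * a - i * h * (a + b)) * G2 + a * b * G3) by rewrite E; ring.
have -> : i * a = i * a * (h + h) by rewrite hh mulr1.
have -> : F * ea * (F * eb) = F * ea * (F * eb) * (h + h) by rewrite hh mulr1.
ring.
Qed.

Section DoubleIntegrals.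
Variable R : realType.
Local Open Scope complex_scope.
Variables (T : R) (u : R -> R).
Hypothesis T0 : 0 <= T.
Hypothesis iu : intg 0 T u.
Implicit Types (a b t x : R) (i k n : nat).

Local Notation U := (prim u).

Lemma prim_isprim k : isprim 0 T (U k.+1) (U k).
Proof.
elim: k => [|k IH]; first exact: isprim_prim.
by apply: isprim_prim => //; apply: intg_cont; exact: isprim_cont T0 IH.
Qed.

Lemma cont_prims k : cont 0 T (U k.+1). Proof. exact: isprim_cont T0 (prim_isprim k). Qed.

Lemma intg_prims k : intg 0 T (U k). Proof. exact: isprim_intg (prim_isprim k). Qed.

Lemma prims0 k : U k.+1 0 = 0. Proof. exact: rint_pt. Qed.

Definition Gint b k : R[i] := cint 0 T (fun t => (U k t)%:C * cexp (b * t)).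
Definition Sint a k : R[i] := cint 0 T (fun t => (U k t ^+ 2)%:C * cexp (a * t)).
Definition Dbl a b k : R[i] :=
  cint 0 T (fun t => (U k t)%:C * cexp (b * t) * cint t T (fun s => (U k s)%:C * cexp (a * s))).

Let cU k : ccont 0 T (fun t => (U k.+1 t)%:C). Proof. exact/ccont_real/cont_prims. Qed.
Let pU k : cprim 0 T (fun t => (U k.+1 t)%:C) (fun t => (U k t)%:C). Proof. exact/cprim_real/prim_isprim. Qed.
Let pe b : cprim 0 T (fun t => cexp (b * t)) (fun t => 'i * b%:C * cexp (b * t)). Proof. exact: cprim_exp. Qed.
Let ce b : ccont 0 T (fun t => cexp (b * t)). Proof. exact: ccont_exp. Qed.
Let cUe b k : ccont 0 T (fun t => (U k.+1 t)%:C * cexp (b * t)). Proof. by apply: ccontM. Qed.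

Lemma Gint_rec b k : Gint b k.+1 = (U k.+2 T)%:C * cexp (b * T) - 'i * b%:C * Gint b k.+2.
Proof.
have := cprim_diff (cprimM T0 (pU k.+1) (pe b)) (lexx 0) T0 (lexx T).
rewrite prims0 (_ : 0%:C = 0)// mul0r subr0 => ->.
rewrite /Gint -(cintZ _ (cintg_cont (cUe b k.+1))).
rewrite cintD; last 2 first.
- exact: cintg_cont.
- by apply: cintg_cont; apply: ccontM => //; apply: ccontM => //; exact: ccont_cst.
rewrite [X in _ = _ + X - _](@eq_cint _ _ _ _ (fun t => 'i * b%:C * ((U k.+2 t)%:C * cexp (b * t)))) ?addrK//.
by move=> t _; ring.
Qed.

Let tail a k t : R[i] := cint t T (fun s => (U k s)%:C * cexp (a * s)).

Let tailE a k t : 0 <= t <= T -> tail a k.+1 t =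
  cint 0 T (fun s => (U k.+1 s)%:C * cexp (a * s)) - cint 0 t (fun s => (U k.+1 s)%:C * cexp (a * s)).
Proof.
move=> /andP[t0 tT].
by rewrite (cprim_diff (cprim_cint T0 (cintg_cont (cUe a k))) t0 tT (lexx T)).
Qed.

Let tail_prim a k : cprim 0 T (tail a k.+1) (fun t => - ((U k.+1 t)%:C * cexp (a * t))).
Proof.
apply: cprim_ext (cprimB (cprim_cst 0 T _) (cprim_cint T0 (cintg_cont (cUe a k)))) => t tT.
  by rewrite tailE.
by rewrite sub0r.
Qed.

Let tail_cont a k : ccont 0 T (tail a k.+1). Proof. exact: cprim_cont T0 (tail_prim a k). Qed.

Let tailT a k : tail a k T = 0. Proof. by apply: complexP; rewrite /= rint_pt. Qed.

Let tail_rec a k t : 0 <= t <= T ->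
  tail a k.+1 t = (U k.+2 T)%:C * cexp (a * T) - (U k.+2 t)%:C * cexp (a * t) - 'i * a%:C * tail a k.+2 t.
Proof.
move=> /andP[t0 tT]; rewrite (cprim_diff (cprimM T0 (pU k.+1) (pe a)) t0 tT (lexx T)).
have sub (f : R -> R[i]) : ccont 0 T f -> cintg t T f.
  by move=> /cintg_cont[h1 h2]; split; exact: intg_sub t0 (lexx T) _.
rewrite /tail -(cintZ _ (sub _ (cUe a k.+1))).
rewrite cintD; [|exact: sub|]; last first.
  by apply: sub; apply: ccontM => //; apply: ccontM => //; exact: ccont_cst.
rewrite [X in _ = _ + X - _](@eq_cint _ _ _ _ (fun t => 'i * a%:C * ((U k.+2 t)%:C * cexp (a * t)))) ?addrK//.
by move=> x _; ring.
Qed.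

(** Both copies of u_(k+1) are integrated by parts. The inner one leaves u_(k+2) u_(k+1), half the
    derivative of u_(k+2)^2, which produces the square term; its coefficient measures the asymmetry
    between the two frequencies. *)
Lemma Dbl_rec a b k : Dbl a b k.+1 =
  2^-1%:C * ((U k.+2 T) ^+ 2)%:C * cexp ((a + b) * T)
  - 'i * b%:C * (U k.+2 T)%:C * cexp (a * T) * Gint b k.+2
  + 'i * ((b - a) / 2)%:C * Sint (a + b) k.+2 - (a * b)%:C * Dbl a b k.+2.
Proof.
pose F t : R[i] := (U k.+2 t)%:C; pose f t : R[i] := (U k.+1 t)%:C; pose H := tail a k.+2.
have eab t : cexp ((a + b) * t) = cexp (a * t) * cexp (b * t) by rewrite mulrDl cexpD.
have FT0 : F 0 = 0 by rewrite /F prims0.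
have pF : cprim 0 T F f by exact: pU.
have pH : cprim 0 T H (fun t => - (F t * cexp (a * t))) by exact: tail_prim.
pose g1 t := F t * cexp (b * t); pose g2 t := F t ^+ 2 * cexp ((a + b) * t); pose g3 t := F t * cexp (b * t) * H t.
pose w t := f t * cexp (b * t) * tail a k.+1 t.
have cF : ccont 0 T F by exact: cU.
have cH : ccont 0 T H by exact: tail_cont.
have c1 : ccont 0 T g1 by apply: ccontM.
have c2 : ccont 0 T g2 by apply: ccontM => //; apply: eq_ccont (ccontM cF cF) => t _; rewrite expr2.
have c3 : ccont 0 T g3 by apply: ccontM.
have cw : ccont 0 T w := ccontM (cUe b k) (tail_cont a k).
(* The derivative of p1 - p2 - p3 contains the integrand of [Dbl a b k.+1]: p1 carries the boundary
   value at T, p2 the exact square, p3 the remaining iterated integral. *)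
have p1 := cprimZ (F T * cexp (a * T)) T0 (cprimM T0 pF (pe b)).
have p2 := cprimZ (2^-1%:C) T0 (cprimM T0 (cprimM T0 pF pF) (pe (a + b))).
have p3 := cprimZ ('i * a%:C) T0 (cprimM T0 (cprimM T0 pF (pe b)) pH).
have half : (2^-1%:C : R[i]) + 2^-1%:C = 1.
  by apply: complexP; rewrite !creimE/=; [field|rewrite addr0].
have hab : (a + b)%:C = a%:C + b%:C :> R[i] by rewrite rmorphD.
have hw t : 0 <= t <= T -> w t = f t * cexp (b * t) * (F T * cexp (a * T) - F t * cexp (a * t) - 'i * a%:C * H t).
  by move=> tT; rewrite /w tail_rec.
have D := cprim_diff (cprimB (cprimB p1 p2) p3) (lexx 0) T0 (lexx T).
rewrite [in RHS](@eq_cint _ _ _ _ (fun t => w t + ('i * b%:C * F T * cexp (a * T)) * g1 t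
    + ('i * a%:C - 'i * 2^-1%:C * (a + b)%:C) * g2 t + (a * b)%:C * g3 t)) in D; last first.
  move=> t tT; rewrite (hw t tT) /g1 /g2 /g3 !eab rmorphM hab.
  have i2 : 'i * 'i = -1 :> R[i] by rewrite -expr2 sqr_i.
  transitivity (f t * cexp (b * t) * (F T * cexp (a * T) - (2^-1%:C + 2^-1%:C) * F t * cexp (a * t) - 'i * a%:C * H t)
    + 'i * b%:C * F T * cexp (a * T) * (F t * cexp (b * t))
    + ('i * a%:C - 'i * 2^-1%:C * (a%:C + b%:C)) * (F t ^+ 2 * (cexp (a * t) * cexp (b * t)))
    - ('i * 'i) * a%:C * b%:C * (F t * cexp (b * t) * H t)); first by ring.
  by rewrite half i2; ring.
have cZ c (g : R -> R[i]) : ccont 0 T g -> ccont 0 T (fun t => c * g t) by move=> ?; apply: ccontM => //; exact: ccont_cst.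
rewrite cintD in D; last 2 first.
- by apply: cintg_cont; apply: ccontD; [apply: ccontD => //|]; exact: cZ.
- by apply: cintg_cont; exact: cZ.
rewrite cintD in D; last 2 first.
- by apply: cintg_cont; apply: ccontD => //; exact: cZ.
- by apply: cintg_cont; exact: cZ.
rewrite cintD in D; last 2 first.
- exact: cintg_cont.
- by apply: cintg_cont; exact: cZ.
rewrite !(cintZ _ (cintg_cont c1)) !(cintZ _ (cintg_cont c2)) !(cintZ _ (cintg_cont c3)) in D.
have E1 : Dbl a b k.+1 = cint 0 T w by [].
have E2 : Gint b k.+2 = cint 0 T g1 by [].
have E3 : Sint (a + b) k.+2 = cint 0 T g2 by apply: eq_cint => t _; rewrite /g2 /F rmorphXn.
have E4 : Dbl a b k.+2 = cint 0 T g3.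
  rewrite /Dbl; apply: eq_cint => t _.
  rewrite /g3 /F /H.
  congr (_ * _).
have HT : H T = 0 by exact: tailT.
have hm : (a * b)%:C = a%:C * b%:C :> R[i] by rewrite rmorphM.
have -> : ((b - a) / 2)%:C = 2^-1%:C * (b%:C - a%:C) :> R[i] by rewrite rmorphM rmorphB mulrC.
have -> : (U k.+2 T ^+ 2)%:C = F T ^+ 2 by rewrite rmorphXn.
rewrite E1 E2 E3 E4 hm eab -/(F T).
rewrite hab hm eab FT0 HT in D.
apply: half_elim half _; rewrite -D.
by rewrite !(mulr0, mul0r, subr0).
Qed.

Section Bounds.
Variables (n : nat) (y : R).
Hypothesis n1_pos : (1 <= n)%N.
Hypothesis hy : forall p, (1 <= p <= n)%N -> `|U p T| <= y.

Let X := L2norm 0 T (U n).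
(** Common size of the leftovers: boundary values, at most y, and the L^1 norm of u_n, at most sqrt
    T times its L^2 norm. *)
Let Y := y + Num.sqrt T * X.
Let X0 : 0 <= X. Proof. exact: L2norm_ge0. Qed.
Let y0 : 0 <= y. Proof. by apply: le_trans (hy (p := n) _); rewrite ?normr_ge0 ?n1_pos ?leqnn. Qed.
Let sX0 : 0 <= Num.sqrt T * X. Proof. by rewrite mulr_ge0// sqrtr_ge0. Qed.
Let yY : y <= Y. Proof. by rewrite lerDl. Qed.
Let Y0 : 0 <= Y. Proof. exact: le_trans yY. Qed.

Let LUn : L2 0 T (U n). Proof. by case: n n1_pos => // k _; apply: L2_cont; exact: cont_prims. Qed.
Let iUn : intg 0 T (fun t => `|U n t|). Proof. by apply: intg_norm; exact: intg_prims. Qed.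
Let Un_l1 : rint 0 T (fun t => `|U n t|) <= Y.
Proof.
apply: le_trans (norm1_le_L2norm T0 LUn) _; rewrite subr0.
by rewrite lerDr.
Qed.

Let Gn_bound b : n1 (Gint b n) <= 2 * Y.
Proof.
apply: le_trans (cint_norm (h := fun t => 2 * `|U n t|) _ (intgZ 2 iUn) _) _.
- by case: n n1_pos => // k _; exact: cintg_cont.
- by move=> t _; rewrite mulrC; have := n1_expM (b * t) (U n t)%:C; rewrite n1_real mulrC [X in _ <= X]mulrC.
by rewrite rintZ// ler_wpM2l.
Qed.

(** Each of the i integrations by parts costs a factor B and one boundary value. *)
Lemma Gint_bound B b i k : 1 <= B -> `|b| <= B -> (1 <= k)%N -> (k + i = n)%N ->
  n1 (Gint b k) <= 2 * i.+1%:R * B ^+ i * Y.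
Proof.
move=> B1 bB; have B0 : 0 <= B by exact: le_trans B1.
elim: i k => [|i IH] [//|k] _ kn.
  by rewrite addn0 in kn; rewrite kn mulr1 mulr1.
rewrite Gint_rec; apply: le_trans (n1B _ _) _.
have kn' : (k.+2 + i = n)%N by rewrite -kn addSnnS.
have h1 : n1 ((U k.+2 T)%:C * cexp (b * T)) <= 2 * B ^+ i.+1 * Y.
  rewrite mulrC; apply: le_trans (n1_expM _ _) _; rewrite n1_real -mulrA ler_wpM2l//.
  apply: le_trans (_ : 1 * Y <= _); last by rewrite ler_wpM2r// exprn_ege1.
  by rewrite mul1r; apply: le_trans yY; apply: hy; rewrite -kn' leq_addr.
have h2 : n1 ('i * b%:C * Gint b k.+2) <= B * (2 * i.+1%:R * B ^+ i * Y).
  rewrite -mulrA; apply: le_trans (n1M _ _) _; rewrite n1_i mul1r; apply: le_trans (n1M _ _) _; rewrite n1_real.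
  by apply: ler_pM => //; [exact: n1_ge0|exact: IH].
apply: le_trans (lerD h1 h2) _.
by apply: le_eq; rewrite -[i.+2%:R]natr1 exprS; ring.
Qed.

Let Dn_bound a b : n1 (Dbl a b n) <= 4 * Y ^+ 2.
Proof.
have I0 : 0 <= rint 0 T (fun t => `|U n t|) by apply: rint_ge0.
have [k kn] : exists k, n = k.+1 by case: n n1_pos => // k _; exists k.
have tb t : 0 <= t <= T -> n1 (tail a n t) <= 2 * Y.
  move=> /andP[t0 tT].
  apply: le_trans (cint_norm (h := fun t => 2 * `|U n t|) _ (intg_sub t0 (lexx T) (intgZ 2 iUn)) _) _.
  - have [h1 h2] := cintg_cont (cUe a k); rewrite -kn in h1 h2.
    by split; exact: intg_sub t0 (lexx T) _.
  - by move=> s _; rewrite mulrC; have := n1_expM (a * s) (U n s)%:C; rewrite n1_real mulrC [X in _ <= X]mulrC.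
  rewrite (rintZ 2 (intg_sub t0 (lexx T) iUn)) ler_wpM2l//; apply: le_trans Un_l1.
  by rewrite (rint_cat t0 tT iUn) lerDr; apply: rint_ge0.
apply: le_trans (cint_norm (h := fun t => (4 * Y) * `|U n t|) _ (intgZ _ iUn) _) _.
- by apply: cintg_cont; rewrite kn; apply: ccontM; [exact: cUe|exact: tail_cont].
- move=> t tT; apply: le_trans (n1M _ _) _.
  have h := n1_expM (b * t) (U n t)%:C; rewrite n1_real mulrC in h.
  have := ler_pM (n1_ge0 _) (n1_ge0 _) h (tb t tT); lra.
by rewrite (rintZ _ iUn) (_ : 4 * Y ^+ 2 = 4 * Y * Y); [apply: ler_wpM2l => //; exact: mulr_ge0|ring].
Qed.

(** [Dbl_rec] is iterated until the iterated integral involves u_n, where it is bounded directly;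
    the squares produced on the way are kept exactly. The constant propagates because 1 + 4 (i + 1)
    + 9 (i + 1)^2 <= 9 (i + 2)^2. *)
Lemma Dbl_bound B a b i k : 1 <= B -> `|a| <= B -> `|b| <= B -> (1 <= k)%N -> (k + i = n)%N ->
  n1 (Dbl a b k - 'i * ((b - a) / 2)%:C * \sum_(l < i) ((- (a * b)) ^+ l)%:C * Sint (a + b) (k + l.+1)%N)
  <= 9 * i.+1%:R ^+ 2 * B ^+ (2 * i) * Y ^+ 2.
Proof.
move=> B1 aB bB; have B0 : 0 <= B by exact: le_trans B1.
elim: i k => [|i IH] [//|k] _ kn.
  rewrite big_ord0 mulr0 subr0 addn0 in kn *; rewrite kn expr1n muln0 expr0 !mulr1.
  by apply: le_trans (Dn_bound a b) _; rewrite ler_wpM2r ?sqr_ge0//; lra.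
have kn' : (k.+2 + i = n)%N by rewrite -kn addSnnS.
rewrite Dbl_rec big_ord_recl /= expr0 addn1.
set D := Dbl a b k.+2; set S := Sint (a + b) k.+2.
have -> : \sum_(l < i) ((- (a * b)) ^+ bump 0 l)%:C * Sint (a + b) (k.+1 + (bump 0 l).+1)%N =
    - (a * b)%:C * \sum_(l < i) ((- (a * b)) ^+ l)%:C * Sint (a + b) (k.+2 + l.+1)%N.
  rewrite mulr_sumr; apply: eq_bigr => l _; have -> : bump 0 l = l.+1 by [].
  have -> : (k.+1 + l.+2)%N = (k.+2 + l.+1)%N by rewrite addnS.
  have -> : ((- (a * b)) ^+ l.+1)%:C = - (a * b)%:C * ((- (a * b)) ^+ l)%:C :> R[i].
    by rewrite exprS -rmorphN -rmorphM.
  by rewrite mulrA.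
set Sg := \sum_(l < i) _.
set t1 := 2^-1%:C * ((U k.+2 T) ^+ 2)%:C * cexp ((a + b) * T).
set t2 := 'i * b%:C * (U k.+2 T)%:C * cexp (a * T) * Gint b k.+2.
have -> : t1 - t2 + 'i * ((b - a) / 2)%:C * S - (a * b)%:C * D -
  'i * ((b - a) / 2)%:C * (1%:C * S + - (a * b)%:C * Sg) =
  t1 - t2 - (a * b)%:C * (D - 'i * ((b - a) / 2)%:C * Sg).
  by rewrite (_ : 1%:C = 1)//; ring.
have UY : `|U k.+2 T| <= Y by apply: le_trans yY; apply: hy; rewrite -kn' leq_addr.
have Bi1 : 1 <= B ^+ (2 * i) by exact: exprn_ege1.
have Y2 := sqr_ge0 Y.
have Bk : B ^+ (2 * i.+1) = B ^+ (2 * i) * B ^+ 2 by rewrite mulnS addnC exprD.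
have B21 : 1 <= B ^+ 2 by exact: exprn_ege1.
have h1 : n1 t1 <= B ^+ (2 * i.+1) * Y ^+ 2.
  rewrite /t1 mulrC; apply: le_trans (n1_expM _ _) _.
  apply: le_trans (ler_wpM2l _ (n1M _ _)) _ => //; rewrite !n1_real !ger0_norm ?sqr_ge0 ?invr_ge0//.
  rewrite mulrA divff// mul1r; apply: le_trans (_ : Y ^+ 2 <= _).
    by rewrite -real_normK ?num_real// ler_pXn2r ?nnegrE.
  by apply: ler_peMl => //; rewrite Bk mulr_ege1.
have h2 : n1 t2 <= 4 * i.+1%:R * B ^+ (2 * i.+1) * Y ^+ 2.
  rewrite /t2 (_ : 'i * b%:C * (U k.+2 T)%:C * cexp (a * T) * Gint b k.+2 = cexp (a * T) * ('i * (b%:C * ((U k.+2 T)%:C * Gint b k.+2)))); last by ring.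
  apply: le_trans (n1_expM _ _) _; apply: le_trans (ler_wpM2l _ (n1M _ _)) _ => //; rewrite n1_i mul1r.
  apply: le_trans (ler_wpM2l _ (n1M _ _)) _ => //; rewrite n1_real.
  apply: le_trans (ler_wpM2l _ (ler_pM _ _ bB (n1M _ _))) _ => //; try exact: n1_ge0.
  rewrite n1_real.
  have g := Gint_bound B1 bB (isT : (1 <= k.+2)%N) kn'.
  have g2 := ler_pM (normr_ge0 _) (n1_ge0 _) UY g.
  apply: le_trans (ler_wpM2l _ (ler_wpM2l B0 g2)) _ => //.
  rewrite (_ : 2 * (B * (Y * (2 * i.+1%:R * B ^+ i * Y))) = 4 * i.+1%:R * B ^+ i.+1 * Y ^+ 2); last by rewrite exprS; ring.
  apply: ler_wpM2r => //; apply: ler_wpM2l; first by rewrite mulr_ge0// ler0n.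
  by rewrite ler_weXn2l// mul2n -addnn leq_addr.
have h3 : n1 ((a * b)%:C * (D - 'i * ((b - a) / 2)%:C * Sg)) <= B ^+ 2 * (9 * i.+1%:R ^+ 2 * B ^+ (2 * i) * Y ^+ 2).
  apply: le_trans (n1M _ _) _; rewrite n1_real; apply: ler_pM => //; first exact: n1_ge0.
    by rewrite normrM expr2; exact: ler_pM.
  exact: IH.
apply: le_trans (n1B _ _) _; apply: le_trans (lerD (le_trans (n1B _ _) (lerD h1 h2)) h3) _.
have BY : 0 <= B ^+ (2 * i.+1) * Y ^+ 2 by rewrite mulr_ge0// exprn_ge0.
rewrite (_ : B ^+ (2 * i.+1) * Y ^+ 2 + 4 * i.+1%:R * B ^+ (2 * i.+1) * Y ^+ 2 + B ^+ 2 * (9 * i.+1%:R ^+ 2 * B ^+ (2 * i) * Y ^+ 2) =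
  (1 + 4 * i.+1%:R + 9 * i.+1%:R ^+ 2) * (B ^+ (2 * i.+1) * Y ^+ 2)); last by rewrite Bk; ring.
rewrite -[leRHS]mulrA; apply: ler_wpM2r => //.
by rewrite -[i.+2%:R]natr1; have := ler0n R i.+1; nra.
Qed.

End Bounds.
End DoubleIntegrals.

(** * The leading quadratic term *)

Section Asymptotics.
Variable R : realType.
Local Open Scope complex_scope.
Variables (m m1 m2 m3 : R -> R).
Hypothesis m_prim : isprim 0 1 m m1.
Hypothesis m1_prim : isprim 0 1 m1 m2.
Hypothesis m2_prim : isprim 0 1 m2 m3.
Implicit Types (s t x y T : R) (g h f : R -> R) (j k N : nat).

Local Notation Dop := (Dop m1 m2).
Local Notation Vop := (Vop m1).

(** A trajectory in real components, with the smallness used by the expansions: T <= 2 / pi serves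
    [time_Bessel], and |u_1| <= 1 lets higher powers of u_1 be bounded by lower ones. *)
Record flow T u (p q : R -> R -> R) : Prop := Flow {
  flow_ge0 : 0 <= T;
  flow_tau : T <= 2 / pi;
  flow_intg : intg 0 T u;
  flow_re : pathL2 T p;
  flow_im : pathL2 T q;
  flow_ode : forall j, (1 <= j)%N -> coef_ode T u m p q j;
  flow_init : forall j, (1 <= j)%N -> ip 0 1 (p 0) (phi j) = (j == 1%N)%:R /\ ip 0 1 (q 0) (phi j) = 0;
  flow_small : forall t, 0 <= t <= T -> `|th u t| <= 1 }.

Let cm2 : cont 0 1 m2. Proof. exact: isprim_cont ler01 m2_prim. Qed.
Let cm : cont 0 1 m. Proof. exact: isprim_cont ler01 m_prim. Qed.
Let LD j : L2 0 1 (Dop j). Proof. exact: (L2_Dop m1_prim cm2). Qed.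

Definition mc j k : R := ip 0 1 (fun x => m x * phi j x) (phi k).

Lemma mcC j k : mc j k = mc k j.
Proof. by apply: eq_rint => x _; ring. Qed.

Lemma phi1_Dop j : ip 0 1 (phi 1) (Dop j) = (lam R j - lam R 1) * mc 1 j.
Proof. by rewrite ipC (Dop_coef m_prim m1_prim m2_prim) -/(mc j 1) mcC. Qed.

Section Leading.
Variables (K n : nat) (A : nat -> R) (S : R).
Hypothesis K1 : (1 <= K)%N.
Hypothesis n_gt0 : (1 <= n)%N.
Hypothesis mcK1 : mc 1 K = 0.

(* aK and bK are the frequencies of the two exponentials in the iterated integral through the mode j;
   termK k is the summand of A^(k+1)_K. *)
Definition aK j : R := lam R K - lam R j.
Definition bK j : R := lam R j - lam R 1.
Definition termK k j : R := (lam R j - (lam R 1 + lam R K) / 2) * (- (aK j * bK j)) ^+ k * (mc 1 j * mc K j).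

Hypothesis A_lim : forall k, (k < n)%N -> (fun N => \sum_(1 <= j < N) termK k j) @ \oo --> A k.
Hypothesis A_zero : forall k, (k < n.-1)%N -> A k = 0.
Hypothesis S_bound : forall N, \sum_(1 <= j < N) j%:R ^+ (4 * n) * `|mc 1 j * mc K j| <= S.

(** The common bound is at least 1, as [Dbl_bound] demands, and grows like j^2, so that 2 n factors
    of it give the weight j^(4n) of (H2). *)
Lemma aK_le j : (1 <= j)%N -> `|aK j| <= lam R K * j%:R ^+ 2 /\ `|bK j| <= lam R K * j%:R ^+ 2 /\ 1 <= lam R K * j%:R ^+ 2.
Proof.
move=> j1; have K1' : (1 : R) <= K%:R ^+ 2 by rewrite exprn_ege1// ler1n.
have j1' : (1 : R) <= j%:R ^+ 2 by rewrite exprn_ege1// ler1n.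
have p1 : (1 : R) <= pi ^+ 2 by rewrite exprn_ege1//; apply: le_trans (pi_ge2 R); rewrite ler1n.
have lE (i : nat) : lam R i = pi ^+ 2 * i%:R ^+ 2 by rewrite /lam; ring.
rewrite /aK /bK !lE expr1n.
move: (K%:R ^+ 2 : R) (j%:R ^+ 2 : R) (pi ^+ 2 : R) K1' j1' p1 => k l z k1 l1 z1.
have k0 : 0 <= k by lra.
have l0 : 0 <= l by lra.
have z0 : 0 <= z by lra.
have kl1 : k <= k * l by rewrite ler_peMr.
have kl2 : l <= k * l by rewrite ler_peMl.
have kl : 1 <= k * l by lra.
rewrite -!mulrBr !normrM (ger0_norm z0) -!mulrA; split; [|split].
- by apply: ler_wpM2l => //; rewrite ler_norml; lra.
- by apply: ler_wpM2l => //; rewrite ler_norml; lra.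
- exact: mulr_ege1.
Qed.

(** Identifies the coefficient of the square of u_1, which comes from Vop, with A^1_K through
    [Vop_parseval]. *)
Let A0V : ip 0 1 (phi 1) (Vop K) = A 0.
Proof.
have h := @Vop_parseval R m m1 m2 m3 m_prim m1_prim m2_prim 1 K.
have -> : ip 0 1 (phi 1) (Vop K) = ip 0 1 (Vop 1) (phi K).
  by apply: eq_rint => x _; rewrite /Vop; ring.
apply: (cvg_unique _ h) => //.
have := A_lim n_gt0; apply: cvg_trans; apply: near_eq_cvg; near=> N.
by apply: eq_bigr => j _; rewrite /termK expr0 mulr1.
Unshelve. all: by end_near.
Qed.

(** [second_order] at cutoff N is followed by [Dbl_bound] in every mode. The kept squares regroup
    into partial sums of the coefficients [A], and the remaining errors are summed over j by the
    weighted bound S. The left side does not depend on N, so the truncation errors vanish in the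
    limit and only A (n - 1) survives. *)
Lemma main_expansion : exists2 C : R, 0 <= C & forall T u p q y, flow T u p q ->
  (forall k, (1 <= k <= n)%N -> `|prim u k T| <= y) ->
  n1 (cexp (lam R K * T) * Zc m u p q T (phi K) - (K == 1%N)%:R
      + 'i * (A n.-1)%:C * Sint T u (lam R K - lam R 1) n)
  <= C * (L2norm 0 T (prim u 1) ^+ 3 + (y + Num.sqrt T * L2norm 0 T (prim u n)) ^+ 2).
Proof.
have [CD CD0 hCD] := Dop_sum m1_prim cm2; have [CV CV0 hCV] := Vop_sum m1_prim.
have [Cd Cd0 hCd] := Dop_decay m1_prim m2_prim K.
set N1 := 4 * (L2norm 0 1 (Dop 1) + L2norm 0 1 (Vop 1)).
have N10 : 0 <= N1 by apply: mulr_ge0 => //; apply: addr_ge0; exact: L2norm_ge0.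
set C3 := 8 * N1 * L2norm 0 1 (Vop K) + 24 * N1 * CD * Cd + 12 * CV * Cd.
have NV := L2norm_ge0 0 1 (Vop K).
have C30 : 0 <= C3 by rewrite /C3; nonneg.
have S0 : 0 <= S by have := S_bound 0; rewrite big_geq.
have l0 : 0 <= lam R K by rewrite /lam sqr_ge0.
pose C4 := 9 * n%:R ^+ 2 * lam R K ^+ (2 * n) * S.
have P0 : 0 <= 9 * n%:R ^+ 2 * lam R K ^+ (2 * n).
  by apply: mulr_ge0; [apply: mulr_ge0; [done|exact: sqr_ge0]|exact: exprn_ge0].
have C40 : 0 <= C4 by exact: mulr_ge0.
exists (C3 + C4) => [|T u p q y [T0 Ttau iu pp pq ode init th1] hy]; first exact: addr_ge0.
set E := L2norm 0 T (prim u 1); set Y := y + _.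
have E0 : 0 <= E ^+ 3 by rewrite exprn_ge0// L2norm_ge0.
have Y0 := sqr_ge0 Y.
apply: le_trans (_ : C3 * E ^+ 3 + C4 * Y ^+ 2 <= _); last first.
  exact: lerD_mul.
have cprims k : cont 0 T (prim u k.+1) by exact: cont_prims.
pose z := cexp (lam R K * T) * Zc m u p q T (phi K) - (K == 1%N)%:R.
pose om := lam R K - lam R 1; pose Sn k := Sint T u om k.
pose eN N := L2norm 0 1 (fun x => Dop K x - PN N (Dop K) x).
pose AN N k := \sum_(1 <= j < N) termK k j.
pose D j := Dbl T u (aK j) (bK j) 1.
have DK1 : ip 0 1 (phi 1) (Dop K) = 0 by rewrite phi1_Dop mcK1 mulr0.
have abo j : aK j + bK j = om by rewrite /aK /bK /om; ring.
have step1 N : n1 (z + 'i * (A 0)%:C * Sn 1%N -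
    \sum_(1 <= j < N) (aK j * bK j * (mc 1 j * mc K j))%:C * D j) <= C3 * E ^+ 3 + 8 * N1 * eN N.
  have h := second_order m_prim m1_prim m2_prim T0 Ttau iu pp pq ode init th1 K1 DK1 CD0 CV0 Cd0 (hCD N) (hCV N) hCd.
  rewrite A0V -/N1 -/C3 -/z -/(eN N) -/E in h; apply: le_trans h; apply: le_eq; congr n1.
  congr (_ - _); apply: eq_bigr => j _; congr (_ * _); congr (_%:C).
  by rewrite phi1_Dop (Dop_coef m_prim m1_prim m2_prim) -/(mc K j) /aK /bK; ring.
(* The squares of u_2, ..., u_n kept by [Dbl_bound]; the square of u_1 is the Vop term, with
   coefficient A 0. *)
pose main j := 'i * ((bK j - aK j) / 2)%:C * \sum_(l < n.-1) ((- (aK j * bK j)) ^+ l)%:C * Sn (1 + l.+1)%N.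
have step2 N : n1 (\sum_(1 <= j < N) (aK j * bK j * (mc 1 j * mc K j))%:C * (D j - main j)) <= C4 * Y ^+ 2.
  apply: le_trans (n1_sum _ _ _) _.
  apply: le_trans (_ : \sum_(1 <= j < N) (9 * n%:R ^+ 2 * lam R K ^+ (2 * n) * Y ^+ 2) * (j%:R ^+ (4 * n) * `|mc 1 j * mc K j|) <= _); last first.
    rewrite -mulr_sumr /C4 (_ : 9 * n%:R ^+ 2 * lam R K ^+ (2 * n) * S * Y ^+ 2 = 9 * n%:R ^+ 2 * lam R K ^+ (2 * n) * Y ^+ 2 * S); last by ring.
    by apply: ler_wpM2l => //; exact: mulr_ge0.
  apply: ler_sum_nat => j /andP[j1 _]; have [h1 [h2 h3]] := aK_le j1.
  set B := lam R K * j%:R ^+ 2 in h1 h2 h3.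
  have n1n : (1 + n.-1 = n)%N by rewrite add1n prednK.
  have hD := Dbl_bound T0 iu n_gt0 hy h3 h1 h2 (leqnn 1) n1n.
  rewrite prednK// abo -/Y in hD.
  apply: le_trans (n1M _ _) _; rewrite n1_real.
  have B0 : 0 <= B by exact: le_trans h3.
  have f1 : `|aK j * bK j * (mc 1 j * mc K j)| <= B ^+ 2 * `|mc 1 j * mc K j|.
    by rewrite normrM; apply: ler_wpM2r => //; rewrite normrM expr2; exact: ler_pM.
  apply: le_trans (ler_pM (normr_ge0 _) (n1_ge0 _) f1 hD) _.
  (* Two factors B from a_j b_j and 2 (n - 1) from [Dbl_bound]: exactly the weight j^(4n). *)
  have e4 : B ^+ 2 * B ^+ (2 * n.-1) = lam R K ^+ (2 * n) * j%:R ^+ (4 * n).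
    rewrite -exprD (_ : (2 + 2 * n.-1 = 2 * n)%N); last by rewrite -mulnS prednK.
    by rewrite /B exprMn; congr (_ * _); rewrite -exprM mulnA.
  rewrite (_ : B ^+ 2 * `|mc 1 j * mc K j| * (9 * n%:R ^+ 2 * B ^+ (2 * n.-1) * Y ^+ 2) =
    (B ^+ 2 * B ^+ (2 * n.-1)) * (9 * n%:R ^+ 2 * Y ^+ 2 * `|mc 1 j * mc K j|)); last by ring.
  by rewrite e4; apply: le_eq; ring.
have step3 N : \sum_(1 <= j < N) (aK j * bK j * (mc 1 j * mc K j))%:C * main j =
    - 'i * \sum_(l < n.-1) (AN N l.+1)%:C * Sn l.+2.
  rewrite /main /AN mulr_sumr.
  transitivity (\sum_(1 <= j < N) \sum_(l < n.-1) - 'i * ((termK l.+1 j)%:C * Sn l.+2)).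
    apply: eq_bigr => j _; rewrite !mulr_sumr; apply: eq_bigr => l _.
    have -> : (termK l.+1 j)%:C = - (aK j * bK j * (mc 1 j * mc K j))%:C * ((bK j - aK j) / 2)%:C * ((- (aK j * bK j)) ^+ l)%:C :> R[i].
      rewrite -rmorphN -!rmorphM; congr (_%:C); rewrite /termK exprS.
      have -> : lam R j - (lam R 1 + lam R K) / 2 = (bK j - aK j) / 2 by rewrite /aK /bK; field.
      by ring.
    by rewrite add1n; ring.
  rewrite exchange_big; apply: eq_bigr => l _.
  by rewrite -mulr_sumr -mulr_suml -rmorph_sum.
have Alast : 'i * (A n.-1)%:C * Sn n = 'i * (A 0)%:C * Sn 1%N + 'i * \sum_(l < n.-1) (A l.+1)%:C * Sn l.+2.
  transitivity ('i * \sum_(l < n) (A l)%:C * Sn l.+1).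
    rewrite -[in RHS](prednK n_gt0) big_ord_recr /= (prednK n_gt0) big1 ?add0r ?mulrA// => l _.
    by rewrite A_zero// (_ : 0%:C = 0)// mul0r.
  by rewrite -[in LHS](prednK n_gt0) big_ord_recl /= mulrDr mulrA.
pose err N := \sum_(l < n.-1) `|AN N l.+1 - A l.+1| * n1 (Sn l.+2).
have step4 N : n1 (z + 'i * (A n.-1)%:C * Sn n) <= C3 * E ^+ 3 + 8 * N1 * eN N + C4 * Y ^+ 2 + err N.
  rewrite (_ : z + 'i * (A n.-1)%:C * Sn n =
    (z + 'i * (A 0)%:C * Sn 1%N - \sum_(1 <= j < N) (aK j * bK j * (mc 1 j * mc K j))%:C * D j) +
    \sum_(1 <= j < N) (aK j * bK j * (mc 1 j * mc K j))%:C * (D j - main j) -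
    'i * \sum_(l < n.-1) (AN N l.+1 - A l.+1)%:C * Sn l.+2); last first.
    have -> : \sum_(1 <= j < N) (aK j * bK j * (mc 1 j * mc K j))%:C * (D j - main j) =
       \sum_(1 <= j < N) (aK j * bK j * (mc 1 j * mc K j))%:C * D j + 'i * \sum_(l < n.-1) (AN N l.+1)%:C * Sn l.+2.
      by rewrite -[X in _ + X]opprK -mulNr -step3 -sumrB; apply: eq_bigr => j _; rewrite mulrBr.
    have -> : \sum_(l < n.-1) (AN N l.+1 - A l.+1)%:C * Sn l.+2 =
      \sum_(l < n.-1) (AN N l.+1)%:C * Sn l.+2 - \sum_(l < n.-1) (A l.+1)%:C * Sn l.+2.
      by rewrite -sumrB; apply: eq_bigr => l _; rewrite rmorphB mulrBl.
    by rewrite Alast; ring.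
  apply: le_trans (n1B _ _) _; apply: lerD.
    by apply: le_trans (n1D _ _) _; apply: lerD; [exact: step1|exact: step2].
  apply: le_trans (n1M _ _) _; rewrite n1_i mul1r; apply: le_trans (n1_sum _ _ _) _.
  by apply: ler_sum => l _; apply: le_trans (n1M _ _) _; rewrite n1_real.
(* N is chosen after the control, for which the integrals [Sn] are fixed numbers. *)
apply/ler_addgt0Pr => e e0.
have err0 : err @ \oo --> 0.
  have : err @ \oo --> \sum_(l < n.-1) (0 : R).
    apply: cvg_big => [|l _]; first exact: add_continuous.
    rewrite -[0](mul0r (n1 (Sn l.+2))); apply: cvgM; last exact: cvg_cst.
    have ln : (l.+1 < n)%N by have := ltn_ord l; rewrite -ltnS (prednK n_gt0).
    have : (fun N => `|AN N l.+1 - A l.+1|) @ \oo --> `|A l.+1 - A l.+1|.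
      by apply: cvg_norm; apply: cvgB; [exact: A_lim|exact: cvg_cst].
    by rewrite subrr normr0.
  by rewrite big1.
have e2 : 0 < e / 2 by rewrite divr_gt0.
have N1p : 0 < 8 * N1 + 1 by apply: ltr_wpDl => //; exact: mulr_ge0.
have e3 : 0 < e / 2 / (8 * N1 + 1) by rewrite divr_gt0.
have [Na hNa] := sine_complete (LD K) e3.
have /cvgrPdist_lt /(_ _ e2) [Nb _ hNb] := err0.
set N := maxn Na Nb.
have k1 := hNa N (leq_maxl _ _); have k2 := hNb N (leq_maxr _ _).
rewrite -/(eN N) in k1; rewrite sub0r normrN in k2.
have k3 := le_lt_trans (ler_norm _) k2; rewrite ltr_pdivlMr// in k1.
have eN0 : 0 <= eN N by exact: L2norm_ge0.
apply: le_trans (step4 N) _; move: k1 k3 eN0.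
by move: (eN N) (err N) (C3 * E ^+ 3) (C4 * Y ^+ 2) => v1 v2 v3 v4 *; lra.
Qed.

End Leading.
End Asymptotics.

(** * Boundary terms *)

Section Endpoint.
Variable R : realType.
Local Open Scope complex_scope.
Implicit Types (s t x y T : R) (g h f : R -> R) (j k N : nat).

Lemma lam_inj j k : lam R j = lam R k -> j = k.
Proof.
move=> /eqP; rewrite /lam eqrXn2 ?mulr_ge0 ?pi_ge0// => /eqP/(mulIf (lt0r_neq0 (pi_gt0 R)))/eqP.
by rewrite eqr_nat => /eqP.
Qed.

(** The nodes - i b_j are distinct, so the Vandermonde matrix is invertible, and C, the sum of the
    sizes of the entries of its inverse, depends on the nodes alone. *)
Lemma Vandermonde_bound n (b : 'I_n -> R) : injective b -> exists2 C : R, 0 <= C &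
  forall (U : nat -> R) (e : R),
  (forall i, n1 (\sum_(k < n) (- 'i * (b i)%:C) ^+ k * (U k)%:C) <= e) -> forall k, (k < n)%N -> `|U k| <= C * e.
Proof.
move=> binj; pose a : 'rV[R[i]]_n := \row_i (- 'i * (b i)%:C); pose V := Vandermonde n a.
have Vu : V \in unitmx.
  rewrite unitmxE det_Vandermonde unitfE; apply/prodf_neq0 => i _; apply/prodf_neq0 => j ij.
  rewrite !mxE -mulrBr mulf_neq0//.
    by rewrite oppr_eq0; apply/eqP => /(congr1 (@cim R)) /=; apply/eqP/oner_neq0.
  rewrite -rmorphB; apply/eqP => /(congr1 (@cre R)) /= /eqP; rewrite subr_eq0 => /eqP /binj ji.
  by rewrite ji ltnn in ij.
exists (\sum_i \sum_k n1 (invmx V i k)).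
  by apply: sumr_ge0 => i _; apply: sumr_ge0 => k _; exact: n1_ge0.
move=> U e he k kn; pose v : 'rV[R[i]]_n := \row_k (U k)%:C.
have e0 : 0 <= e by apply: le_trans (he (Ordinal kn)); exact: n1_ge0.
have vE : (U k)%:C = \sum_i (\sum_(l < n) (- 'i * (b i)%:C) ^+ l * (U l)%:C) * invmx V i (Ordinal kn).
  have -> : (U k)%:C = v 0 (Ordinal kn) by rewrite mxE.
  rewrite -{1}[v](mulmxK Vu) mxE; apply: eq_bigr => i _; congr (_ * _).
  by rewrite mxE; apply: eq_bigr => l _; rewrite !mxE mulrC.
rewrite -n1_real vE; apply: le_trans (n1_sum _ _ _) _; rewrite mulr_suml; apply: ler_sum => i _.
apply: le_trans (n1M _ _) _; rewrite mulrC; apply: ler_pM => //; try exact: n1_ge0.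
by rewrite (bigD1 (Ordinal kn))//= lerDl; apply: sumr_ge0 => l _; exact: n1_ge0.
Qed.

(** [Gint_rec] iterated, after division by exp(i b T). The left side is what the terminal state
    reveals at frequency b; the right side is a polynomial in - i b with coefficients u_1(T), ...,
    u_n(T), plus a term controlled by u_n. *)
Lemma Gint_unroll T u (b : R) n : 0 <= T -> intg 0 T u -> (1 <= n)%N ->
  (prim u 1 T)%:C - 'i * b%:C * (cexp (- (b * T)) * Gint T u b 1) =
  \sum_(k < n) (- 'i * b%:C) ^+ k * (prim u k.+1 T)%:C + (- 'i * b%:C) ^+ n * (cexp (- (b * T)) * Gint T u b n).
Proof.
move=> T0 iu; elim: n => // -[|n] IH _.
  by rewrite big_ord_recl big_ord0 /= expr0 expr1 mul1r addr0; ring.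
have E := Gint_rec T0 iu b n; move: (IH isT) (cexpNK (b * T)) E.
move: (Gint T u b) (prim u) (cexp (- (b * T))) (cexp (b * T)) => G U e1 e2 IH' e12 E.
rewrite IH' [in RHS]big_ord_recr /= E [(- 'i * b%:C) ^+ n.+2]exprS -!addrA; congr (_ + _).
move: (_ ^+ n.+1) => z.
transitivity (z * ((U n.+2 T)%:C * (e1 * e2) - 'i * b%:C * (e1 * G n.+2))); first by ring.
by rewrite e12; ring.
Qed.

Variables (m m1 m2 m3 : R -> R).
Hypothesis m_prim : isprim 0 1 m m1.
Hypothesis m1_prim : isprim 0 1 m1 m2.
Hypothesis m2_prim : isprim 0 1 m2 m3.

Local Notation Dop := (Dop m1 m2).
Local Notation Vop := (Vop m1).
Local Notation flow := (flow m).
Local Notation mc := (mc m).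

Let cm : cont 0 1 m. Proof. exact: isprim_cont ler01 m_prim. Qed.
Let L2phi j : L2 0 1 (phi j : R -> R). Proof. exact: L2_phi. Qed.

Let phi_norm j : (1 <= j)%N -> L2norm 0 1 (phi j : R -> R) = 1.
Proof.
move=> j1; rewrite -[RHS]sqrtr1 -(ger0_norm (L2norm_ge0 0 1 _)) -sqrtr_sqr L2norm2 ip_phi// eqxx.
by [].
Qed.

Definition psic (p q : R -> R) g : R[i] := ip 0 1 p g +i* ip 0 1 q g.

Let cmz z : cont 0 1 (fun x => cos (z * m x)).
Proof. by apply: (isprim_cont ler01 (isprim_cos ler01 (isprimZ z m_prim))). Qed.
Let smz z : cont 0 1 (fun x => sin (z * m x)).
Proof. by apply: (isprim_cont ler01 (isprim_sin ler01 (isprimZ z m_prim))). Qed.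

(** exp(- i z m) = 1 - i z m + O(z^2 m^2), read on the real part; the pair (q, -p) gives the
    imaginary part. *)
Let gauge_small M (p q : R -> R) z j : (forall x, 0 <= x <= 1 -> `|m x| <= M) ->
  L2 0 1 p -> L2 0 1 q -> L2norm 0 1 p <= 1 -> L2norm 0 1 q <= 1 -> (1 <= j)%N ->
  `|ip 0 1 (fun x => cos (z * m x) * p x + sin (z * m x) * q x) (phi j) - ip 0 1 p (phi j)
    - z * ip 0 1 (fun x => m x * q x) (phi j)| <= 2 * M ^+ 2 * z ^+ 2.
Proof.
move=> hM Lp Lq p1 q1 j1.
have Lcp : L2 0 1 (fun x => cos (z * m x) * p x) by apply: L2Mc.
have Lsq : L2 0 1 (fun x => sin (z * m x) * q x) by apply: L2Mc.
have Lmq : L2 0 1 (fun x => m x * q x) by apply: L2Mc.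
have cc : cont 0 1 (fun x => cos (z * m x) - 1) by apply: contB => //; exact: cont_cst.
have cs : cont 0 1 (fun x => sin (z * m x) - z * m x) by apply: contB => //; apply: contM => //; exact: cont_cst.
have L1 : L2 0 1 (fun x => (cos (z * m x) - 1) * p x) by apply: L2Mc.
have L2' : L2 0 1 (fun x => (sin (z * m x) - z * m x) * q x) by apply: L2Mc.
rewrite (ipDl Lcp Lsq (L2phi j)).
have -> : ip 0 1 (fun x => cos (z * m x) * p x) (phi j) = ip 0 1 p (phi j) + ip 0 1 (fun x => (cos (z * m x) - 1) * p x) (phi j).
  by rewrite -(ipDl Lp L1 (L2phi j)); apply: eq_ip => x _ //; ring.
have -> : ip 0 1 (fun x => sin (z * m x) * q x) (phi j) = z * ip 0 1 (fun x => m x * q x) (phi j) + ip 0 1 (fun x => (sin (z * m x) - z * m x) * q x) (phi j).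
  rewrite -(ipZl z Lmq (L2phi j)) -(ipDl (L2Z z Lmq) L2' (L2phi j)).
  by apply: eq_ip => x _ //; ring.
set a := ip 0 1 _ (phi j); set b := ip 0 1 _ (phi j); set c := ip 0 1 _ (phi j); set d := ip 0 1 _ (phi j).
have M2 : 0 <= M ^+ 2 * z ^+ 2 by apply: mulr_ge0; exact: sqr_ge0.
have key (f h : R -> R) : L2 0 1 f -> L2 0 1 (fun x => h x * f x) -> L2norm 0 1 f <= 1 ->
    (forall x, 0 <= x <= 1 -> `|h x| <= M ^+ 2 * z ^+ 2) -> `|ip 0 1 (fun x => h x * f x) (phi j)| <= M ^+ 2 * z ^+ 2.
  move=> Lf Lhf f1 hh; apply: le_trans (ip_CauchySchwarz Lhf (L2phi j)) _; rewrite phi_norm// mulr1.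
  apply: le_trans (L2norm_dom (M := M ^+ 2 * z ^+ 2) Lhf Lf M2 _) _.
    by move=> x x01; rewrite normrM; apply: ler_wpM2r => //; exact: hh.
  by apply: ler_piMr.
have zm x : 0 <= x <= 1 -> (z * m x - 0) ^+ 2 <= M ^+ 2 * z ^+ 2.
  move=> /hM h; rewrite subr0 exprMn mulrC; apply: ler_wpM2r; first exact: sqr_ge0.
  by rewrite -real_normK ?num_real// ler_pXn2r ?nnegrE// (le_trans _ h).
have kb : `|b| <= M ^+ 2 * z ^+ 2.
  apply: (key p) => // x x01; apply: le_trans (zm x x01).
  by have := cos_taylor1 0 (z * m x); rewrite cos0 sin0 oppr0 mul0r subr0.
have kd : `|d| <= M ^+ 2 * z ^+ 2.
  apply: (key q) => // x x01; apply: le_trans (zm x x01).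
  by have := sin_taylor1 0 (z * m x); rewrite cos0 sin0 mul1r !subr0.
rewrite (_ : a + b + (z * c + d) - a - z * c = b + d); last by ring.
have -> : 2 * M ^+ 2 * z ^+ 2 = M ^+ 2 * z ^+ 2 + M ^+ 2 * z ^+ 2 by ring.
by apply: le_trans (ler_normD _ _) _; exact: lerD.
Qed.

Lemma terminal_gauge : exists2 M : R, 0 <= M & forall T u p q j, flow T u p q -> (1 <= j)%N ->
  n1 (Zc m u p q T (phi j) - psic (p T) (q T) (phi j)
      + 'i * (prim u 1 T)%:C * psic (fun x => m x * p T x) (fun x => m x * q T x) (phi j))
  <= M * prim u 1 T ^+ 2.
Proof.
have [M M0 hM] := cont_bounded cm.
exists (4 * M ^+ 2) => [|T u p q j [T0 _ iu pp pq ode init _] j1]; first by rewrite mulr_ge0// sqr_ge0.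
have TT : 0 <= T <= T by rewrite T0 lexx.
have Lp := pp.1 T TT; have Lq := pq.1 T TT.
have N := evol_norm T0 iu cm pp pq ode init TT.
have sq1 (x : R) : 0 <= x -> x ^+ 2 <= 1 -> x <= 1 by move=> x0; rewrite expr_le1.
have p1 : L2norm 0 1 (p T) <= 1.
  by apply: sq1; rewrite ?L2norm_ge0// L2norm2 -[leRHS]N lerDl ip_ge0.
have q1 : L2norm 0 1 (q T) <= 1.
  by apply: sq1; rewrite ?L2norm_ge0// L2norm2 -[leRHS]N lerDr ip_ge0.
set z := prim u 1 T.
have k1 := gauge_small z hM Lp Lq p1 q1 j1.
have LNp : L2 0 1 (fun x => - p T x) by exact: L2N.
have Np1 : L2norm 0 1 (fun x => - p T x) <= 1 by rewrite L2normN.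
have k2 := gauge_small z hM Lq LNp q1 Np1 j1.
have Lmp : L2 0 1 (fun x => m x * p T x) by apply: L2Mc.
have e1 : ip 0 1 (fun x => m x * - p T x) (phi j) = - ip 0 1 (fun x => m x * p T x) (phi j).
  by rewrite -(ipNl Lmp (L2phi j)); apply: eq_ip => x _ //; ring.
have e2 : ip 0 1 (fun x => cos (z * m x) * q T x + sin (z * m x) * - p T x) (phi j) = ip 0 1 (qt m p q (th u) T) (phi j).
  by apply: eq_ip => x _ //; rewrite /qt /z /= /th; ring.
rewrite e1 e2 in k2.
rewrite /n1 !creimE /= -/z.
have -> : 4 * M ^+ 2 * z ^+ 2 = 2 * M ^+ 2 * z ^+ 2 + 2 * M ^+ 2 * z ^+ 2 by ring.
apply: lerD.
  apply: le_trans k1; apply: le_eq; congr `|_|.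
  rewrite /Zc /pt /z /= /th; ring.
apply: le_trans k2; apply: le_eq; congr `|_|; rewrite /z /=; ring.
Qed.

Section Bound.
Variables (n : nat) (f : 'I_n -> nat).
Hypothesis n_gt0 : (1 <= n)%N.
Hypothesis f_inj : injective f.
Hypothesis f_gt0 : forall i, (1 <= f i)%N.
Hypothesis f_mc : forall i, mc 1 (f i) != 0.

Let psic_le p q g d : L2 0 1 p -> L2 0 1 q -> L2 0 1 g -> L2norm 0 1 p <= d -> L2norm 0 1 q <= d ->
  n1 (psic p q g) <= 2 * (d * L2norm 0 1 g).
Proof.
move=> Lp Lq Lg pd qd; rewrite (_ : 2 * _ = d * L2norm 0 1 g + d * L2norm 0 1 g); last by ring.
apply: lerD; [apply: le_trans (ip_CauchySchwarz Lp Lg) _|apply: le_trans (ip_CauchySchwarz Lq Lg) _];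
  by apply: ler_wpM2r => //; exact: L2norm_ge0.
Qed.

Definition psi_re T (p : R -> R -> R) x : R := p T x - cos (lam R 1 * T) * phi 1 x.
Definition psi_im T (q : R -> R -> R) x : R := q T x + sin (lam R 1 * T) * phi 1 x.

Let psic_split T p q g : L2 0 1 (p T) -> L2 0 1 (q T) -> L2 0 1 g ->
  psic (p T) (q T) g = cexp (- (lam R 1 * T)) * (ip 0 1 (phi 1) g)%:C + psic (psi_re T p) (psi_im T q) g.
Proof.
move=> Lp Lq Lg.
have Lc : L2 0 1 (fun x => cos (lam R 1 * T) * phi 1 x) by exact: L2Z.
have Ls : L2 0 1 (fun x => sin (lam R 1 * T) * phi 1 x) by exact: L2Z.
apply: complexP; rewrite !creimE /= cosN ?sinN.
  by rewrite (ipBl Lp Lc Lg) (ipZl _ (L2phi 1) Lg); ring.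
by rewrite (ipDl Lq Ls Lg) (ipZl _ (L2phi 1) Lg); ring.
Qed.

Let psic_m p q j : psic (fun x => m x * p x) (fun x => m x * q x) (phi j) = psic p q (fun x => m x * phi j x).
Proof. by congr (_ +i* _); apply: eq_rint => x _; ring. Qed.

Let Lmphi j : L2 0 1 (fun x => m x * phi j x : R). Proof. exact: L2Mc. Qed.

(** The gauge has to be undone at time T. Its first-order effect - i u_1(T) <m psi(T), phi_j> is
    evaluated on the ground state, at the cost of |u_1(T)| times the distance d of psi(T) to it. *)
Lemma terminal_bound : exists2 M : R, 0 <= M & forall T u p q d j, flow T u p q -> (1 <= j)%N ->
  L2norm 0 1 (psi_re T p) <= d -> L2norm 0 1 (psi_im T q) <= d ->
  n1 (Zc m u p q T (phi j) - psic (p T) (q T) (phi j) + 'i * (prim u 1 T)%:C * cexp (- (lam R 1 * T)) * (mc 1 j)%:C)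
   <= M * (prim u 1 T ^+ 2 + `|prim u 1 T| * d) /\
  n1 (psic (p T) (q T) (phi j) - cexp (- (lam R 1 * T)) * (j == 1%N)%:R) <= 2 * d.
Proof.
have [M1 M10 h1] := terminal_gauge; have [M M0 hM] := cont_bounded cm.
exists (M1 + 2 * M) => [|T u p q d j F j1 pd qd]; first by rewrite addr_ge0// mulr_ge0.
have h := h1 _ _ _ _ _ F j1; have [T0 _ _ pp pq _ _ _] := F.
have TT : 0 <= T <= T by rewrite T0 lexx.
have Lp := pp.1 T TT; have Lq := pq.1 T TT.
have Ldp : L2 0 1 (psi_re T p) by apply: L2B => //; exact: L2Z.
have Ldq : L2 0 1 (psi_im T q) by apply: L2D => //; exact: L2Z.
have d0 : 0 <= d := le_trans (L2norm_ge0 0 1 _) pd.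
have nm : L2norm 0 1 (fun x => m x * phi j x : R) <= M.
  have h0 : L2norm 0 1 (fun x => m x * phi j x : R) <= M * L2norm 0 1 (phi j : R -> R).
    by apply: L2norm_dom => // x x01; rewrite normrM ler_wpM2r// hM.
  by rewrite (phi_norm j1) mulr1 in h0.
split; last first.
  rewrite (psic_split Lp Lq (L2phi j)) ip_phi// eq_sym.
  have -> : ((j == 1%N)%:R : R)%:C = (j == 1%N)%:R :> R[i] by case: (j == 1%N).
  rewrite addrC addrA addNr add0r; apply: le_trans (psic_le Ldp Ldq (L2phi j) pd qd) _.
  by rewrite phi_norm// mulr1.
rewrite psic_m (psic_split Lp Lq (Lmphi j)) in h.
have em : ip 0 1 (phi 1) (fun x => m x * phi j x) = mc 1 j by apply: eq_rint => x _; ring.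
rewrite em in h.
set z := prim u 1 T in h *; set w := psic (psi_re T p) (psi_im T q) _ in h.
rewrite (_ : Zc m u p q T (phi j) - psic (p T) (q T) (phi j) + 'i * z%:C * cexp (- (lam R 1 * T)) * (mc 1 j)%:C =
  (Zc m u p q T (phi j) - psic (p T) (q T) (phi j) + 'i * z%:C * (cexp (- (lam R 1 * T)) * (mc 1 j)%:C + w)) - 'i * (z%:C * w)); last by ring.
apply: le_trans (n1B _ _) _.
have hw : n1 ('i * (z%:C * w)) <= `|z| * (2 * (d * M)).
  apply: le_trans (n1M _ _) _; rewrite n1_i mul1r; apply: le_trans (n1M _ _) _; rewrite n1_real.
  apply: ler_wpM2l => //; apply: le_trans (psic_le Ldp Ldq (Lmphi j) pd qd) _.
  by apply: ler_wpM2l => //; apply: ler_wpM2l.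
apply: le_trans (lerD h hw) _.
rewrite (_ : `|z| * (2 * (d * M)) = 2 * M * (`|z| * d)); last by ring.
by apply: lerD_mul => //; [exact: mulr_ge0|exact: sqr_ge0|exact: mulr_ge0].
Qed.

(** In each active mode, the first-order expansion and the undone gauge combine, after division by
    <mu phi_1, phi_j>, into the left side of [Gint_unroll]; n distinct frequencies then determine
    the coefficients of the polynomial. The term u_1(T)^2 stays on the right, to be absorbed once
    u_1 is small. *)
Lemma endpoint_bound : exists2 C : R, 0 <= C & forall T u p q d, flow T u p q ->
  L2norm 0 1 (psi_re T p) <= d -> L2norm 0 1 (psi_im T q) <= d -> forall k, (1 <= k <= n)%N ->
  `|prim u k T| <= C * (d + prim u 1 T ^+ 2 + L2norm 0 T (prim u 1) ^+ 2 + Num.sqrt T * L2norm 0 T (prim u n)).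
Proof.
have [M M0 hM] := terminal_bound.
pose b i := bK R (f i).
have b_inj : injective b by move=> i j /addIr/lam_inj/f_inj.
have [C C0 hC] := Vandermonde_bound b_inj.
pose N1 := 4 * (L2norm 0 1 (Dop 1) + L2norm 0 1 (Vop 1)).
have N10 : 0 <= N1 by apply: mulr_ge0 => //; apply: addr_ge0; exact: L2norm_ge0.
pose G i := (4 * M + 4 + (8 * N1 * L2norm 0 1 (Dop (f i)) + 4 * L2norm 0 1 (Vop (f i)))).
have ND i := L2norm_ge0 0 1 (Dop (f i)); have NV i := L2norm_ge0 0 1 (Vop (f i)).
have G0 i : 0 <= G i.
  by rewrite /G; apply: addr_ge0; [apply: addr_ge0 => //; exact: mulr_ge0|nonneg].
(* [G i] collects the gauge, distance and second-order errors, here divided by the mode coefficient;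
   4 |b_i|^n pays for the last integral of [Gint_unroll]. *)
pose g i := 2 * G i / `|mc 1 (f i)| + 4 * `|b i| ^+ n.
have g0 i : 0 <= g i.
  by rewrite /g addr_ge0 ?divr_ge0 ?mulr_ge0 ?exprn_ge0.
exists (C * \sum_i g i) => [|T u p q d F pd qd]; first by rewrite mulr_ge0// sumr_ge0.
have [T0 Ttau iu pp pq ode init th1] := F.
set z := prim u 1 T; set E := L2norm 0 T (prim u 1); set X := Num.sqrt T * _.
have E0 : 0 <= E ^+ 2 by exact: sqr_ge0.
have X0 : 0 <= X by rewrite mulr_ge0// ?sqrtr_ge0// L2norm_ge0.
have d0 : 0 <= d := le_trans (L2norm_ge0 0 1 _) pd.
have z2 := sqr_ge0 z.
have z1 : `|z| <= 1 by apply: th1; rewrite T0 lexx.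
set e := d + z ^+ 2 + E ^+ 2 + X.
have e0 : 0 <= e by rewrite /e !addr_ge0.
have LUn : L2 0 T (prim u n).
  by case: n n_gt0 => // k _; apply: L2_cont; exact: cont_prims T0 iu k.
have Gn i : n1 (Gint T u (b i) n) <= 2 * X.
  have iUn := intg_norm (intg_prims T0 iu n).
  apply: le_trans (cint_norm (h := fun t => 2 * `|prim u n t|) _ (intgZ 2 iUn) _) _.
  - case: n n_gt0 => // k _; apply: cintg_cont; apply: ccontM; last exact: ccont_exp.
    by apply: ccont_real; exact: cont_prims T0 iu k.
  - by move=> t _; rewrite mulrC; have := n1_expM (b i * t) (prim u n t)%:C; rewrite n1_real mulrC [X in _ <= X]mulrC.
  rewrite (rintZ 2 iUn) ler_wpM2l//; apply: le_trans (norm1_le_L2norm T0 LUn) _.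
  by rewrite subr0.
have key i : n1 (\sum_(k < n) (- 'i * (b i)%:C) ^+ k * (prim u k.+1 T)%:C) <= (\sum_i g i) * e.
  apply: le_trans (_ : g i * e <= _); last first.
    by apply: ler_wpM2r => //; rewrite (bigD1 i)//= lerDl sumr_ge0.
  have [t1 t2] := hM _ _ _ _ _ (f i) F (f_gt0 i) pd qd.
  have fo := first_order m_prim m1_prim m2_prim T0 Ttau iu pp pq ode init th1 (f_gt0 i).
  rewrite -/N1 (phi1_Dop m_prim m1_prim m2_prim) -/(b i) -/(bK R (f i)) -/(b i) in fo.
  set Zj := Zc m u p q T (phi (f i)) in t1 fo; set Pj := psic (p T) (q T) (phi (f i)) in t1 t2.
  set mu := mc 1 (f i) in t1 fo; have mun : mu != 0 by exact: f_mc.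
  have un := Gint_unroll (b i) T0 iu n_gt0.
  have G1E : cint 0 T (fun t => (th u t)%:C * cexp (b i * t)) = Gint T u (b i) 1 by [].
  rewrite G1E in fo.
  set W := \sum_(k < n) _ in un *.
  have WE : W = (z%:C - 'i * (b i)%:C * (cexp (- (b i * T)) * Gint T u (b i) 1)) -
     (- 'i * (b i)%:C) ^+ n * (cexp (- (b i * T)) * Gint T u (b i) n) by rewrite un; ring.
  have hI : n1 (z%:C - 'i * (b i)%:C * (cexp (- (b i * T)) * Gint T u (b i) 1)) <= 2 * G i / `|mu| * e.
    have ed : cexp (b i * T) * (f i == 1%N)%:R = (f i == 1%N)%:R.
      case: eqVneq => [h|_]; last by rewrite mulr0.
      by rewrite /b h /bK subrr mul0r cexp0 mul1r.
    have eb : cexp (lam R (f i) * T) * cexp (- (lam R 1 * T)) = cexp (b i * T).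
      by rewrite -cexpD; congr cexp; rewrite /b /bK; ring.
    have t12 := n1_expM (lam R (f i) * T) ((Zj - Pj + 'i * z%:C * cexp (- (lam R 1 * T)) * mu%:C) +
      (Pj - cexp (- (lam R 1 * T)) * (f i == 1%N)%:R)).
    have t3 := le_trans t12 (ler_wpM2l (ler0n _ 2) (le_trans (n1D _ _) (lerD t1 t2))).
    have zd : `|z| * d <= d by rewrite ler_piMl.
    have t4 : M * (z ^+ 2 + `|z| * d) <= M * (z ^+ 2 + d) by apply: ler_wpM2l => //; rewrite lerD2l.
    set X1 := cexp (lam R (f i) * T) * _ in t3.
    set X2 := (X in n1 X <= _) in fo.
    have XE : z%:C - 'i * (b i)%:C * (cexp (- (b i * T)) * Gint T u (b i) 1) =
        cexp (- (b i * T)) * (- 'i * (mu^-1)%:C * (X1 - X2)).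
      have i2 : 'i * 'i = -1 :> R[i] by rewrite -expr2 sqr_i.
      have mv : (mu^-1)%:C * mu%:C = 1 :> R[i] by rewrite -rmorphM mulVf.
      have eNb := cexpNK (b i * T).
      have -> : X1 - X2 = mu%:C * ('i * z%:C * cexp (b i * T) + (b i)%:C * Gint T u (b i) 1).
        rewrite /X1 /X2 rmorphM.
        transitivity (mu%:C * ('i * z%:C * (cexp (lam R (f i) * T) * cexp (- (lam R 1 * T))) + (b i)%:C * Gint T u (b i) 1)
           - (cexp (lam R (f i) * T) * cexp (- (lam R 1 * T))) * (f i == 1%N)%:R + (f i == 1%N)%:R); first by ring.
        by rewrite eb ed subrK.
      transitivity (- ('i * 'i) * ((mu^-1)%:C * mu%:C) * z%:C * (cexp (- (b i * T)) * cexp (b i * T)) -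
        ((mu^-1)%:C * mu%:C) * ('i * (b i)%:C * (cexp (- (b i * T)) * Gint T u (b i) 1))); last by ring.
      by rewrite i2 mv eNb; ring.
    rewrite XE; apply: le_trans (n1_expM _ _) _; rewrite -!mulrA ler_wpM2l//.
    apply: le_trans (n1M _ _) _; rewrite n1N n1_i mul1r; apply: le_trans (n1M _ _) _; rewrite n1_real normfV.
    rewrite mulrCA ler_wpM2l ?invr_ge0//.
    apply: le_trans (n1B _ _) _; apply: le_trans (lerD t3 fo) _.
    have c0 : 0 <= 8 * N1 * L2norm 0 1 (Dop (f i)) + 4 * L2norm 0 1 (Vop (f i)) by nonneg.
    move: c0 t4; rewrite /G /e -/z; move: (8 * N1 * _ + _) => c c0 t4.
    have q1 : M * (z ^+ 2 + d) <= M * e by apply: ler_wpM2l => //; rewrite /e; lra.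
    have q2 : c * E ^+ 2 <= c * e by apply: ler_wpM2l => //; rewrite /e; lra.
    have q3 : d <= e by rewrite /e; lra.
    have q4 : 0 <= M * e := mulr_ge0 M0 e0.
    rewrite -/e; move: q1 q2 q3 q4 t4; rewrite -/E.
    move: (M * (z ^+ 2 + `|z| * d)) (M * (z ^+ 2 + d)) (c * E ^+ 2) => r1 r2 r3.
    by rewrite !mulrDl -mulrA; move: (M * e) (c * e) (4 * e) => r4 r5 r6 *; lra.
  have hL : n1 ((- 'i * (b i)%:C) ^+ n * (cexp (- (b i * T)) * Gint T u (b i) n)) <= 4 * `|b i| ^+ n * e.
    apply: le_trans (n1M _ _) _; rewrite (_ : 4 * `|b i| ^+ n * e = `|b i| ^+ n * (2 * (2 * e))); last by ring.
    apply: ler_pM; try exact: n1_ge0.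
      apply: le_trans (n1X _ _) _; rewrite lerXn2r ?nnegrE ?n1_ge0//.
      by apply: le_trans (n1M _ _) _; rewrite n1N n1_i mul1r n1_real.
    apply: le_trans (n1_expM _ _) _; rewrite ler_wpM2l//; apply: le_trans (Gn i) _.
    by rewrite ler_wpM2l// /e lerDr !addr_ge0.
  by rewrite WE; apply: le_trans (n1B _ _) _; rewrite /g [leRHS]mulrDl; apply: lerD.
move=> [//|k] /andP[_ kn]; have := hC (fun k => prim u k.+1 T) _ key k kn.
by rewrite mulrA.
Qed.

End Bound.
End Endpoint.

(** * Interpolation of the control *)

Section Interpolation.
Variable R : realType.
Local Notation leb := (@lebesgue_measure R).
Implicit Types (a b t x y T D : R) (f g F G : R -> R) (i j k n N : nat).

(** A Sobolev chain fixes each v_m up to a null set. For m < k it is replaced by the constant plus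
    primitive that it equals almost everywhere, the top derivative being kept, so that the calculus
    of primitives applies. *)
Lemma chain_rep a b k f v : a <= b -> Hk_chain a b k f v -> exists w : nat -> R -> R,
  [/\ forall m, (m < k)%N -> isprim a b (w m) (w m.+1),
      forall m, (m <= k)%N -> L2 a b (w m) &
      forall m, (m <= k)%N -> {ae leb, forall x, a <= x <= b -> v m x = w m x}].
Proof.
move=> ab [_ [Lv cv]].
have /choice[c hc] m : exists c : R, (m < k)%N -> {ae leb, forall x, a <= x <= b -> v m x = c + rint a x (v m.+1)}.
  have [mk|km] := ltnP m k; last by exists 0.
  by have [c hc] := cv m mk; exists c.
pose w m x := if (m < k)%N then c m + rint a x (v m.+1) else v m x.
have iv m : (m <= k)%N -> intg a b (v m) by move=> mk; exact: L2_intg (Lv m mk).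
have ew m : (m <= k)%N -> {ae leb, forall x, a <= x <= b -> v m x = w m x}.
  move=> mk; rewrite /w; case: ltnP => [mk'|_]; first exact: hc.
  exact/aeW.
have Lw m : (m <= k)%N -> L2 a b (w m).
  move=> mk; have [mk'|km] := ltnP m k.
    apply: L2_cont; apply: (@eq_cont _ _ _ (fun x => c m + rint a x (v m.+1))).
      by move=> x _; rewrite /w mk'.
    by apply: contD; [exact: cont_cst|exact: cont_prim ab (iv _ mk')].
  by rewrite (_ : w m = v m); [exact: Lv|apply/funext => x; rewrite /w ltnNge km].
exists w; split=> // m mk; split; first exact: L2_intg (Lw _ mk).
move=> t /andP[at_ tb]; rewrite /w mk rint_pt addr0; congr (_ + _).
apply: ae_rint.
- exact: (L2_sub (lexx a) tb (Lv _ mk)).1.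
- exact: (L2_sub (lexx a) tb (Lw _ mk)).1.
move: (ew _ mk); apply: negligibleS => x /= nx h; apply: nx => /andP[ax xt].
by apply: h; rewrite ax (le_trans xt).
Qed.

(** F(t)^2 - F(s)^2 is twice an integral of F f; averaging over s in [0, T] replaces a boundary
    condition and produces the factor 1 / T. *)
Lemma sup_sq_bound T F f t : 0 < T -> isprim 0 T F f -> L2 0 T f -> 0 <= t <= T ->
  F t ^+ 2 <= (T^-1 + 2) * (L2norm 0 T F * (L2norm 0 T F + L2norm 0 T f)).
Proof.
move=> T0 pF Lf tT; have T0' := ltW T0; have cF := isprim_cont T0' pF; have LF := L2_cont cF.
have pFF := isprimM T0' pF pF.
set X := L2norm 0 T F; set Z := L2norm 0 T f.
have X0 : 0 <= X by exact: L2norm_ge0. have Z0 : 0 <= Z by exact: L2norm_ge0.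
have iFf := L2M_intg LF Lf; have iN := intg_norm iFf.
have CS : rint 0 T (fun x => `|F x * f x|) <= X * Z.
  have LaF : L2 0 T (fun x => `|F x|) by apply: L2_cont; exact: cont_norm.
  have Laf : L2 0 T (fun x => `|f x|).
    apply: L2I; first exact: (intg_measurable (intg_norm (L2_intg Lf))).
    by apply: eq_intg (L2_sq Lf) => x _; rewrite real_normK ?num_real.
  have eN g : L2norm 0 T (fun x => `|g x|) = L2norm 0 T g.
    by congr Num.sqrt; apply: eq_rint => x _; rewrite real_normK ?num_real.
  rewrite /X /Z -(eN F) -(eN f); apply: le_trans (ip_CauchySchwarz LaF Laf).
  by rewrite /ip; apply: le_trans (ler_norm _); apply: le_eq; apply: eq_rint => x _; rewrite normrM.
have key s x : 0 <= s -> s <= x -> x <= T -> `|F x * F x - F s * F s| <= 2 * (X * Z).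
  move=> s0 sx xT; rewrite (isprim_diff pFF s0 sx xT).
  rewrite (@eq_rint _ _ _ _ (fun x => 2 * (F x * f x))); last by move=> y _; ring.
  have iS := intg_sub s0 xT iFf; rewrite (rintZ 2 iS) normrM ger0_norm// ler_wpM2l//.
  apply: le_trans (rint_norm iS) _; apply: le_trans CS.
  have n0 y : 0 <= `|F y * f y| by [].
  rewrite (rint_cat s0 (le_trans sx xT) iN).
  have sT : s <= T := le_trans sx xT.
  rewrite (rint_cat sx xT (intg_sub s0 (lexx T) iN)).
  have p1 : 0 <= rint 0 s (fun x => `|F x * f x|) by apply: rint_ge0.
  have p2 : 0 <= rint x T (fun x => `|F x * f x|) by apply: rint_ge0.
  by move: p1 p2; move: (rint _ _ _) (rint _ _ _) (rint _ _ _) => *; lra.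
have pt s : 0 <= s <= T -> F t ^+ 2 <= F s ^+ 2 + 2 * (X * Z).
  move=> /andP[s0 sT]; have /andP[t0 tT'] := tT; rewrite !expr2.
  have [st|ts] := leP s t.
    have := le_trans (ler_norm _) (key _ _ s0 st tT'); lra.
  have h := key _ _ t0 (ltW ts) sT; rewrite distrC in h.
  by have := le_trans (ler_norm _) h; lra.
have avg : T * F t ^+ 2 <= X ^+ 2 + T * (2 * (X * Z)).
  have iF2 := L2_sq LF.
  have := ler_rint (intg_cst 0 T (F t ^+ 2)) (intgD iF2 (intg_cst 0 T (2 * (X * Z)))) pt.
  rewrite (rintD iF2 (intg_cst 0 T _)) !rint_cst// subr0 L2norm2.
  have -> : rint 0 T (fun x => F x ^+ 2) = ip 0 T F F by apply: eq_rint => x _; rewrite expr2.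
  by rewrite ![_ * T]mulrC.
rewrite -(ler_pM2l T0); apply: le_trans avg _.
have -> : T * ((T^-1 + 2) * (X * (X + Z))) = (T * T^-1 + 2 * T) * (X * (X + Z)) by ring.
rewrite divff ?gt_eqF//.
have h1 : 0 <= X * Z by exact: mulr_ge0. have h2 : 0 <= X * X by exact: mulr_ge0.
have h3 := mulr_ge0 T0' h2.
have -> : (1 + 2 * T) * (X * (X + Z)) = X ^+ 2 + T * (2 * (X * Z)) + (X * Z + 2 * (T * (X * X))) by ring.
by rewrite lerDl addr_ge0// mulr_ge0.
Qed.

(** The integral of f^2 is the boundary term of F f minus the integral of F g. As F and f need not
    vanish at the ends, their values there are bounded through [sup_sq_bound]. *)
Lemma deriv_interp T F f g : 0 < T -> isprim 0 T F f -> isprim 0 T f g -> L2 0 T g ->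
  L2norm 0 T f ^+ 2 <= 2 * ((T^-1 + 2) * Num.sqrt (L2norm 0 T F * (L2norm 0 T F + L2norm 0 T f) *
    (L2norm 0 T f * (L2norm 0 T f + L2norm 0 T g)))) + L2norm 0 T F * L2norm 0 T g.
Proof.
move=> T0 pF pf Lg; have T0' := ltW T0; have LF := L2_cont (isprim_cont T0' pF).
have Lf := L2_cont (isprim_cont T0' pf).
set S := Num.sqrt _; set c := T^-1 + 2.
have c0 : 0 <= c by rewrite addr_ge0// invr_ge0.
have E := isprim_diff (isprimM T0' pF pf) (lexx 0) T0' (lexx T).
rewrite (rintD (L2M_intg Lf Lf) (L2M_intg LF Lg)) in E.
have e2 : L2norm 0 T f ^+ 2 = F T * f T - F 0 * f 0 - ip 0 T F g.
  by rewrite L2norm2; apply/eqP; rewrite eq_sym subr_eq E.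
have bd t : 0 <= t <= T -> `|F t * f t| <= c * S.
  move=> tT; have h1 := sup_sq_bound T0 pF Lf tT; have h2 := sup_sq_bound T0 pf Lg tT.
  have cS : 0 <= c * S by rewrite mulr_ge0// sqrtr_ge0.
  have P0 (x y : R) : 0 <= x -> 0 <= y -> 0 <= x * (x + y) by move=> x0 y0; rewrite mulr_ge0// addr_ge0.
  rewrite -(@ler_pXn2r _ 2) ?nnegrE// real_normK ?num_real// !exprMn sqr_sqrtr; last first.
    by apply: mulr_ge0; apply: P0; exact: L2norm_ge0.
  apply: le_trans (ler_pM (sqr_ge0 _) (sqr_ge0 _) h1 h2) _.
  by apply: le_eq; rewrite /c; ring.
have CS := ip_CauchySchwarz LF Lg.
have b1 := bd T; have b0 := bd 0; rewrite lexx T0' in b0; rewrite lexx T0' in b1.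
have := le_trans (ler_norm _) (b1 isT); have := le_trans (ler_norm _) (CS).
have := b0 isT; rewrite ler_norml => /andP[k1 _].
rewrite ler_norml in CS; have /andP[k2 _] := CS.
by rewrite e2; move: k1 k2; move: (c * S) (_ * L2norm 0 T g) (F T * f T) (F 0 * f 0) (ip _ _ _ _) => *; lra.
Qed.

(* The H^k(0, T) norm of w 0, when w i is the i-th derivative. *)
Definition sob (w : nat -> R -> R) T k : R := Num.sqrt (\sum_(i < k.+1) L2norm 0 T (w i) ^+ 2).

Lemma sob_sq w T k : sob w T k ^+ 2 = \sum_(i < k.+1) L2norm 0 T (w i) ^+ 2.
Proof. by rewrite sqr_sqrtr// sumr_ge0// => i _; exact: sqr_ge0. Qed.

Lemma sob_ge0 w T k : 0 <= sob w T k. Proof. exact: sqrtr_ge0. Qed.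

Lemma sob_mono w T k : sob w T k <= sob w T k.+1.
Proof. by apply: ler_wsqrtr; rewrite [leRHS]big_ord_recr lerDl sqr_ge0. Qed.

Lemma norm_le_sob w T k : L2norm 0 T (w k) <= sob w T k.
Proof.
rewrite -(ger0_norm (L2norm_ge0 0 T (w k))) -sqrtr_sqr; apply: ler_wsqrtr.
by rewrite big_ord_recr /= lerDr sumr_ge0// => i _; exact: sqr_ge0.
Qed.

(** Full Sobolev norms, unlike norms of single derivatives, increase with k. The lower-order terms
    of [deriv_interp] are therefore dominated, and a clean log-convexity results, with a constant
    depending on T. *)
Lemma sob_convex T w N k : 0 < T -> (forall i, (i < N)%N -> isprim 0 T (w i) (w i.+1)) ->
  (forall i, (i <= N)%N -> L2 0 T (w i)) -> (k.+2 <= N)%N ->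
  sob w T k.+1 ^+ 2 <= (4 * (T^-1 + 2) + 2) ^+ 2 * (sob w T k * sob w T k.+2).
Proof.
move=> T0 pw Lw kN.
have h := deriv_interp T0 (pw k (ltnW kN)) (pw k.+1 kN) (Lw k.+2 kN).
set c := T^-1 + 2 in h *; have c0 : 0 <= c by rewrite addr_ge0// invr_ge0 ltW.
have x0 := sob_ge0 w T k; have x1 := sob_ge0 w T k.+1; have x2 := sob_ge0 w T k.+2.
have m01 := sob_mono w T k; have m12 := sob_mono w T k.+1.
have n0 := norm_le_sob w T k; have nn1 := norm_le_sob w T k.+1; have n2 := norm_le_sob w T k.+2.
have e1 : sob w T k.+1 ^+ 2 = sob w T k ^+ 2 + L2norm 0 T (w k.+1) ^+ 2 by rewrite !sob_sq big_ord_recr.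
move: h; rewrite -/c.
have := L2norm_ge0 0 T (w k); have := L2norm_ge0 0 T (w k.+1); have := L2norm_ge0 0 T (w k.+2).
move: (sob w T k) (sob w T k.+1) (sob w T k.+2) x0 x1 x2 m01 m12 n0 nn1 n2 e1 => a0 a1 a2 x0 x1 x2 m01 m12.
move: (L2norm 0 T (w k)) (L2norm 0 T (w k.+1)) (L2norm 0 T (w k.+2)) => b0 b1 b2 n0 nn1 n2 e1 y2 y1 y0 h.
pose q := Num.sqrt (a0 * a2); have q0 : 0 <= q by exact: sqrtr_ge0.
have q2 : q ^+ 2 = a0 * a2 by rewrite sqr_sqrtr// mulr_ge0.
have hS : Num.sqrt (b0 * (b0 + b1) * (b1 * (b1 + b2))) <= 2 * a1 * q.
  have -> : 2 * a1 * q = Num.sqrt ((2 * a1 * q) ^+ 2).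
    by rewrite sqrtr_sqr ger0_norm// mulr_ge0// mulr_ge0.
  apply: ler_wsqrtr; rewrite exprMn q2.
  have u1 : b0 * (b0 + b1) <= a0 * (2 * a1) by apply: ler_pM => //; [exact: addr_ge0|lra].
  have u2 : b1 * (b1 + b2) <= a1 * (2 * a2) by apply: ler_pM => //; [exact: addr_ge0|lra].
  apply: le_trans (ler_pM _ _ u1 u2) _; try (by rewrite mulr_ge0// addr_ge0).
  by apply: le_eq; ring.
have hb : b0 * b2 <= q ^+ 2 by rewrite q2; exact: ler_pM.
have ha : a0 ^+ 2 <= q ^+ 2.
  by rewrite q2 expr2; apply: ler_wpM2l => //; exact: le_trans m01 m12.
have hc := ler_wpM2l c0 hS.
(* Quadratic in a1: if a1 exceeded (4 c + 2) q, it would exceed q as well, and the right side would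
   be smaller than a1^2. *)
have main : a1 ^+ 2 <= 2 * q ^+ 2 + 4 * c * a1 * q by lra.
rewrite -q2 -exprMn ler_pXn2r ?nnegrE//; last by rewrite mulr_ge0// addr_ge0// mulr_ge0.
rewrite leNgt; apply/negP => lt.
have cq : 0 <= c * q by exact: mulr_ge0.
have qa : q <= a1 by lra.
have a1p : 0 < a1 by apply: le_lt_trans lt; rewrite mulr_ge0// addr_ge0// mulr_ge0.
have lt2 : a1 * ((4 * c + 2) * q) < a1 * a1 by rewrite ltr_pM2l.
have e3 : a1 * ((4 * c + 2) * q) = 4 * c * a1 * q + 2 * (a1 * q) by ring.
have u3 : q * q <= a1 * q by exact: ler_wpM2r.
by move: lt2 main u3; rewrite e3 !expr2; move: (a1 * a1) (q * q) (a1 * q) (4 * c * a1 * q) => *; lra.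
Qed.

(* The ratios A (i + 1) / A i increase up to the factor D, so that (A k / A 0)^3 is at most A (3 k) / A 0. *)
Lemma logconvex_cube D k : 1 <= D -> (1 <= k)%N -> exists2 C : R, 0 <= C & forall A : nat -> R,
  (forall i, 0 <= A i) -> (forall i, A i <= A i.+1) ->
  (forall i, (i.+2 <= 3 * k)%N -> A i.+1 ^+ 2 <= D * (A i * A i.+2)) ->
  A k ^+ 3 <= C * (A 0%N ^+ 2 * A (3 * k)%N).
Proof.
move=> D1 k1; pose N := (3 * k)%N; pose E := D ^+ N; have D0 : 0 <= D := le_trans ler01 D1.
have E1 : 1 <= E by exact: exprn_ege1.
have E0 : 0 <= E := le_trans ler01 E1.
have Ek0 : 0 <= E ^+ k by exact: exprn_ge0.
exists (E ^+ k * E ^+ k) => [|A A0 Am Ac]; first exact: mulr_ge0.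
have kN : (k < N)%N by rewrite /N mulSn -[X in (X < _)%N]addn0 ltn_add2l muln_gt0 k1.
(* If A 0 = 0, the convexity inequality makes every A i with i < N vanish, A k among them; otherwise
   all terms are positive and ratios make sense. *)
have [Az|An] := eqVneq (A 0%N) 0.
  have Ai i : (i < N)%N -> A i = 0.
    elim: i => // i IH iN; have := Ac i iN; rewrite IH ?(ltnW iN)// mul0r mulr0 => h.
    by apply/eqP; rewrite -sqrf_eq0 eq_le h sqr_ge0.
  by rewrite Ai// expr0n Az expr0n mul0r mulr0.
have Ap i : 0 < A i.
  elim: i => [|i IH]; first by rewrite lt_neqAle eq_sym An A0.
  exact: lt_le_trans (Am i).
have step i l : (i + l < N)%N -> A i.+1 * A (i + l)%N <= D ^+ l * (A i * A (i + l).+1).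
  elim: l => [|l IH] h; first by rewrite addn0 mul1r mulrC.
  rewrite addnS in h *; have h1 := IH (ltnW h); have h2 := Ac _ h.
  have p := mulr_gt0 (Ap (i + l)%N) (Ap (i + l).+1); rewrite -(ler_pM2r p).
  have := ler_pM (mulr_ge0 (A0 _) (A0 _)) (sqr_ge0 _) h1 h2.
  rewrite (_ : A i.+1 * A (i + l)%N * A (i + l).+1 ^+ 2 = A i.+1 * A (i + l).+1 * (A (i + l)%N * A (i + l).+1)); last by ring.
  move=> /le_trans; apply; apply: le_eq; rewrite exprS; ring.
have stepE i j : (i <= j)%N -> (j < N)%N -> A i.+1 * A j <= E * (A i * A j.+1).
  move=> ij jN; have := step i (j - i)%N; rewrite subnKC// => /(_ jN) /le_trans; apply.
  apply: ler_wpM2r; first by rewrite mulr_ge0.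
  by apply: ler_weXn2l => //; apply: leq_trans (leq_subr _ _) (ltnW jN).
have shift i j l : (i <= j)%N -> (j + l <= N)%N -> A (i + l)%N * A j <= E ^+ l * (A i * A (j + l)%N).
  move=> ij; elim: l => [|l IH] h; first by rewrite !addn0 mul1r.
  rewrite !addnS in h *; have h1 := IH (ltnW h).
  have h2 : A (i + l).+1 * A (j + l)%N <= E * (A (i + l)%N * A (j + l).+1).
    by apply: stepE => //; rewrite leq_add2r.
  have p := mulr_gt0 (Ap (i + l)%N) (Ap (j + l)%N); rewrite -(ler_pM2r p).
  have := ler_pM (mulr_ge0 (A0 _) (A0 _)) (mulr_ge0 (A0 _) (A0 _)) h1 h2.
  rewrite (_ : A (i + l)%N * A j * (A (i + l).+1 * A (j + l)%N) = A (i + l).+1 * A j * (A (i + l)%N * A (j + l)%N)); last by ring.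
  move=> /le_trans; apply; apply: le_eq; rewrite exprS; ring.
have s1 := shift 0%N k k (leq0n _).
have s2 := shift 0%N (k + k)%N k (leq0n _).
have e3 : (k + k + k = N)%N by rewrite /N 2!mulSn mul1n addnA.
rewrite e3 !add0n in s1 s2; have s1' := s1 (ltac:(by rewrite -e3 leq_addr)); have s2' := s2 (leqnn _).
have -> : A k ^+ 3 = A k * (A k * A k) by rewrite !exprS expr0 mulr1.
apply: le_trans (ler_wpM2l (A0 k) s1') _.
have -> : A k * (E ^+ k * (A 0%N * A (k + k)%N)) = E ^+ k * (A 0%N * (A k * A (k + k)%N)) by ring.
have -> : E ^+ k * E ^+ k * (A 0%N ^+ 2 * A N) = E ^+ k * (A 0%N * (E ^+ k * (A 0%N * A N))) by ring.
by apply: ler_wpM2l => //; apply: ler_wpM2l.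
Qed.

Lemma prim_norm_le T f : 0 <= T -> T <= 1 -> L2 0 T f ->
  (forall t, 0 <= t <= T -> `|rint 0 t f| <= L2norm 0 T f) /\
  L2norm 0 T (fun t => rint 0 t f) <= L2norm 0 T f.
Proof.
move=> T0 T1 Lf; have f0 := L2norm_ge0 0 T f.
have h t : 0 <= t <= T -> `|rint 0 t f| <= L2norm 0 T f.
  move=> /andP[t0 tT]; have iff := L2_intg Lf.
  apply: le_trans (rint_norm (intg_sub (lexx 0) tT iff)) _.
  apply: le_trans (_ : rint 0 T (fun x => `|f x|) <= _).
    by rewrite (rint_cat t0 tT (intg_norm iff)) lerDl; apply: rint_ge0.
  apply: le_trans (norm1_le_L2norm T0 Lf) _; apply: ler_piMl => //.
  by rewrite subr0 -[leRHS]sqrtr1; exact: ler_wsqrtr.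
split=> //.
have c := cont_prim T0 (L2_intg Lf).
have L := L2_cont c; have L1 : L2 0 T (fun=> 1 : R) by apply: L2_cont; exact: cont_cst.
apply: le_trans (L2norm_dom L L1 f0 _) _.
  by move=> t tT; rewrite normr1 mulr1; exact: h.
apply: ler_piMr => //; rewrite -[leRHS]sqrtr1; apply: ler_wsqrtr.
by rewrite (@eq_rint _ _ _ _ (fun=> 1)) ?rint_cst// ?mul1r ?subr0// => x _; rewrite expr1n.
Qed.

(** In the chain u_n, ..., u_1, u, u', ..., u^(2n-3), each the derivative of the one before, u_1 has
    index n - 1 and the last index is n + (2n - 3) = 3 (n - 1). [logconvex_cube] thus bounds |u_1|^3
    by |u_n|^2 times the top norm, in which smallness enters linearly. For n = 1 the bound on sup
    |u_1| is enough. *)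
Lemma ctrl_interp n T : (1 <= n)%N -> 0 < T -> T <= 1 -> exists2 C : R, 0 <= C &
  forall u eta, L2 0 T u -> ctrl_small n T u eta ->
  (forall t, 0 <= t <= T -> `|prim u 1 t| <= eta) /\
  L2norm 0 T (prim u 1) ^+ 3 <= C * eta * L2norm 0 T (prim u n) ^+ 2.
Proof.
move=> n0 T0 T1; have T0' := ltW T0.
have [n2|n2] := leqP 2 n; last first.
  have -> : n = 1%N by apply/eqP; rewrite eqn_leq n0 -ltnS n2.
  exists 1 => // u eta Lu; rewrite /ctrl_small /= => h; split => //.
  have e0 : 0 <= eta by apply: le_trans (h 0 _); rewrite ?lexx.
  have L := L2_cont (cont_prim T0' (L2_intg Lu)).
  have L1 : L2 0 T (fun=> 1 : R) by apply: L2_cont; exact: cont_cst.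
  have le : L2norm 0 T (prim u 1) <= eta.
    apply: le_trans (L2norm_dom L L1 e0 _) _; first by move=> t tT; rewrite normr1 mulr1; exact: h.
    apply: ler_piMr => //; rewrite -[leRHS]sqrtr1; apply: ler_wsqrtr.
    by rewrite (@eq_rint _ _ _ _ (fun=> 1)) ?rint_cst// ?mul1r ?subr0// => x _; rewrite expr1n.
  by rewrite mul1r exprS; apply: ler_wpM2r => //; exact: sqr_ge0.
pose k := n.-1; pose N := (3 * k)%N; pose D : R := (4 * (T^-1 + 2) + 2) ^+ 2.
have k1 : (1 <= k)%N by rewrite /k -ltnS prednK.
have D1 : 1 <= D.
  rewrite exprn_ege1//; have : 0 <= T^-1 by rewrite invr_ge0.
  by move: T^-1 => *; lra.
have [C C0 hC] := logconvex_cube D1 k1.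
exists (C * N.+1%:R) => [|u eta Lu]; first by rewrite mulr_ge0.
rewrite /ctrl_small n2 => -[v [chv nv]].
have v0 : v 0%N = u := chv.1.
have [w [pw Lw ew]] := chain_rep T0' chv.
set l := (2 * n - 3)%N in chv nv pw Lw ew.
have l1 : (1 <= l)%N by rewrite /l; lia.
have Nl : (N = n + l)%N by rewrite /N /k /l; lia.
have Lv i : (i <= l)%N -> L2 0 T (v i) by exact: chv.2.1.
have e0 : 0 <= eta := le_trans (sqrtr_ge0 _) nv.
have wn i : (i <= l)%N -> L2norm 0 T (w i) <= eta.
  move=> il; apply: le_trans nv; apply: ler_wsqrtr.
  have -> : rint 0 T (fun x => w i x ^+ 2) = rint 0 T (fun x => v i x ^+ 2).
    apply: ae_rint; [exact: (intg_measurable (L2_sq (Lw _ il)))|exact: (intg_measurable (L2_sq (Lv _ il)))|].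
    by move: (ew i il); apply: negligibleS => x /= nx h; apply: nx => /h ->.
  have il' : (i < l.+1)%N by [].
  rewrite /Hk_norm2 (bigD1 (Ordinal il'))//= lerDl; apply: sumr_ge0 => j _.
  by apply: rint_ge0 => x _; exact: sqr_ge0.
have un : L2norm 0 T u <= eta.
  apply: le_trans (wn 0%N isT); apply: le_eq; congr Num.sqrt.
  apply: ae_rint; [exact: (intg_measurable (L2_sq Lu))|exact: (intg_measurable (L2_sq (Lw 0%N isT)))|].
  by move: (ew 0%N isT); rewrite v0; apply: negligibleS => x /= nx h; apply: nx => /h ->.
have iu := L2_intg Lu.
have LU i : L2 0 T (prim u i).
  by case: i => // i; apply: L2_cont; exact: cont_prims T0' iu i.
have Un i : L2norm 0 T (prim u i) <= eta.
  by elim: i => [|i IH] //; apply: le_trans IH; exact: (prim_norm_le T0' T1 (LU i)).2.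
split; first by move=> t tT; apply: le_trans un; exact: (prim_norm_le T0' T1 Lu).1.
pose W i := if (i < n)%N then prim u (n - i) else w (i - n)%N.
have pW i : (i < N)%N -> isprim 0 T (W i) (W i.+1).
  move=> iN; rewrite /W; have [in1|] := ltnP i.+1 n.
    by rewrite (ltnW in1) (_ : n - i = (n - i.+1).+1)%N; [exact: prim_isprim|lia].
  (* At the junction, u_1 is followed by [w 0], which agrees with u only almost everywhere. *)
  rewrite leq_eqVlt => /orP[/eqP nE|ni].
    have -> : (i < n)%N by lia.
    have -> : (n - i = 1)%N by lia.
    have -> : (i.+1 - n = 0)%N by lia.
    have [ip_ eqp] := prim_isprim T0' iu 0.
    split; first exact: L2_intg (Lw 0%N isT).
    move=> t tT; rewrite eqp//; congr (_ + _); have /andP[t0 tT'] := tT; apply: ae_rint.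
    - exact: (L2_sub (lexx 0) tT' Lu).1.
    - exact: (L2_sub (lexx 0) tT' (Lw 0%N isT)).1.
    move: (ew 0%N isT); rewrite v0; apply: negligibleS => x /= nx h; apply: nx => /andP[x0 xt].
    by apply: h; rewrite x0 (le_trans xt).
  have -> : (i < n)%N = false by lia.
  have -> : (i.+1 - n = (i - n).+1)%N by lia.
  by apply: pw; move: iN; rewrite Nl; lia.
have LW i : (i <= N)%N -> L2 0 T (W i).
  by move=> iN; rewrite /W; case: ltnP => // ni; apply: Lw; rewrite leq_subLR -Nl.
have Wn i : (i <= N)%N -> L2norm 0 T (W i) <= eta.
  by move=> iN; rewrite /W; case: ltnP => // ni; apply: wn; rewrite leq_subLR -Nl.
have A0 : sob W T 0 = L2norm 0 T (prim u n).
  by rewrite /sob big_ord_recl big_ord0 addr0 sqrtr_sqr ger0_norm ?L2norm_ge0// /W n0 subn0.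
have Ak : L2norm 0 T (prim u 1) <= sob W T k.
  have := norm_le_sob W T k; rewrite {1}/W /k prednK// leqnn -{1}(prednK n0) subSnn//.
have AN : sob W T N <= N.+1%:R * eta.
  rewrite -(@ler_pXn2r _ 2) ?nnegrE ?sob_ge0 ?mulr_ge0// sob_sq.
  apply: le_trans (_ : \sum_(i < N.+1) eta ^+ 2 <= _).
    by apply: ler_sum => i _; rewrite ler_pXn2r ?nnegrE ?L2norm_ge0//; apply: Wn; rewrite -ltnS.
  rewrite sumr_const card_ord -[leLHS]mulr_natl exprMn; apply: ler_wpM2r; first exact: sqr_ge0.
  by rewrite expr2 ler_peMr// ler1n.
have := hC (sob W T) (sob_ge0 W T) (sob_mono W T).
have hcv i : (i.+2 <= 3 * k)%N -> sob W T i.+1 ^+ 2 <= D * (sob W T i * sob W T i.+2).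
  by move=> iN; apply: (sob_convex T0 pW LW).
move=> /(_ hcv); rewrite -/N A0 => main.
apply: le_trans (_ : sob W T k ^+ 3 <= _).
  by rewrite ler_pXn2r ?nnegrE ?L2norm_ge0 ?sob_ge0.
apply: le_trans main _.
have -> : C * N.+1%:R * eta * L2norm 0 T (prim u n) ^+ 2 = C * (L2norm 0 T (prim u n) ^+ 2 * (N.+1%:R * eta)) by ring.
by apply: ler_wpM2l => //; apply: ler_wpM2l => //; exact: sqr_ge0.
Qed.

End Interpolation.

(** * The quadratic lower bound *)

Section Errors.
Variable F : realFieldType.

Lemma quad_error (Q z2 zd dd G : F) : z2 <= Q -> 2 * zd <= z2 + dd -> dd <= G -> 0 <= z2 -> 0 <= G ->
  z2 + zd <= 2 * Q + G.
Proof. lra. Qed.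

(** The final bookkeeping: of 3 aX, one aX is spent on T |u_n|^2 and one on the cubic term. *)
Lemma sum_error (aX TX E3 Cd Cd' ax s : F) : 3 * aX <= ax -> TX <= aX -> E3 <= aX ->
  s <= Cd + E3 + TX -> Cd <= Cd' -> aX - Cd' <= ax - s.
Proof. lra. Qed.

End Errors.

Section Core.
Variable R : realType.
Local Open Scope complex_scope.
Variables (m m1 m2 m3 : R -> R).
Hypothesis m_prim : isprim 0 1 m m1.
Hypothesis m1_prim : isprim 0 1 m1 m2.
Hypothesis m2_prim : isprim 0 1 m2 m3.
Implicit Types (s t x y T : R) (g h f : R -> R) (j k N : nat).
Variables (K n : nat) (A : nat -> R) (S : R).
Hypothesis K1 : (1 <= K)%N.
Hypothesis n_gt0 : (1 <= n)%N.
Hypothesis mcK1 : mc m 1 K = 0.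
Hypothesis A_lim : forall k, (k < n)%N -> (fun N => \sum_(1 <= j < N) termK m K k j) @ \oo --> A k.
Hypothesis A_zero : forall k, (k < n.-1)%N -> A k = 0.
Hypothesis A_neq0 : A n.-1 != 0.
Hypothesis S_bound : forall N, \sum_(1 <= j < N) j%:R ^+ (4 * n) * `|mc m 1 j * mc m K j| <= S.

(* With fewer than n active modes, the polynomial vanishing at their frequencies would give a
   linear relation expressing A (n - 1) through the vanishing lower coefficients. *)
Lemma many_modes : exists f : 'I_n -> nat,
  [/\ injective f, forall i, (1 <= f i)%N & forall i, mc m 1 (f i) != 0].
Proof.
pose P j := mc m 1 j * mc m K j != 0; pose s N := [seq j <- index_iota 1 N | P j].
have us N : uniq (s N) by rewrite filter_uniq// iota_uniq.
have [[N hN]|few] := pselect (exists N, (n <= size (s N))%N).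
  have ins (i : 'I_n) : nth 0%N (s N) i \in s N by rewrite mem_nth// (leq_trans (ltn_ord i)).
  exists (fun i : 'I_n => nth 0%N (s N) i); split.
  - move=> i j /eqP; rewrite nth_uniq ?(leq_trans (ltn_ord _))// => /eqP ij; exact: val_inj.
  - by move=> i; move: (ins i); rewrite mem_filter mem_index_iota => /and3P[].
  - move=> i; move: (ins i); rewrite mem_filter => /andP[+ _].
    by apply: contra => /eqP h; rewrite h mul0r.
have small N : (size (s N) < n)%N by rewrite ltnNge; apply/negP => h; apply: few; exists N.
(* The numbers of active modes below N stay under n; a maximal one is attained, after which the list
   [s N] no longer changes. *)
have ex : exists z, [exists i : 'I_n, `[< exists N, size (s N) = z >] && (z == i :> nat)].
  by exists (size (s 0%N)); apply/existsP; exists (Ordinal (small 0%N)); rewrite eqxx andbT; apply/asboolP; exists 0%N.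
have bd z : [exists i : 'I_n, `[< exists N, size (s N) = z >] && (z == i :> nat)] -> (z <= n)%N.
  by move=> /existsP[i /andP[_ /eqP ->]]; exact: ltnW.
have [z /existsP[i0 /andP[/asboolP[N0 zN0] _]] zmax] := ex_maxnP ex bd.
have tail N : (N0 <= N)%N -> (1 <= N0)%N -> s N = s N0.
  move=> N0N N01; have e : s N = s N0 ++ [seq j <- index_iota N0 N | P j].
    rewrite /s /index_iota -filter_cat (_ : N - 1 = (N0 - 1) + (N - N0))%N; last by lia.
    by rewrite iotaD (_ : 1 + (N0 - 1) = N0)%N//; lia.
  have : (size (s N) <= z)%N.
    by apply: zmax; apply/existsP; exists (Ordinal (small N)); rewrite eqxx andbT; apply/asboolP; exists N.
  rewrite e size_cat zN0 -{2}[z]addn0 leq_add2l leqn0 size_eq0 => /eqP ->.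
  by rewrite cats0.
have [N1 [N11 stail]] : exists N1, (1 <= N1)%N /\ forall N, (N1 <= N)%N -> s N = s N1.
  have [N00|N01] := leqP N0 0; last by exists N0; split => // N h; exact: tail.
  exists 1%N; split => // N _.
  have s1 : s 1%N = [::] by [].
  have z0 : z = 0%N by rewrite -zN0; move: N00; rewrite leqn0 => /eqP ->.
  have : (size (s N) <= z)%N.
    by apply: zmax; apply/existsP; exists (Ordinal (small N)); rewrite eqxx andbT; apply/asboolP; exists N.
  by rewrite z0 leqn0 size_eq0 s1 => /eqP.
have As k : (k < n)%N -> A k = \sum_(j <- s N1) termK m K k j.
  move=> kn; apply: cvg_unique (A_lim kn) _ => //.
  apply: cvg_near_cst; exists N1 => // N /= N1N.
  rewrite -(stail N N1N) big_filter [LHS](bigID P) /= [X in _ + X]big1 ?addr0// => j.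
  by rewrite /P negbK /termK => /eqP ->; rewrite mulr0.
pose X j := - (aK R K j * bK R j).
(* Monic of degree n - 1 and zero at every X_j: the sum of p_k A_k vanishes, and the leading
   coefficient isolates A (n - 1). *)
pose p := 'X^(n.-1 - size (s N1)) * \prod_(j <- s N1) ('X - (X j)%:P).
have sz1 : (size (s N1) <= n.-1)%N by rewrite -ltnS prednK.
have pm : p \is monic by rewrite monicMl ?monicXn//; exact: monic_prod_XsubC.
have sp : size p = n.
  rewrite size_monicM ?monicXn ?monic_neq0 ?monic_prod_XsubC// size_polyXn size_prod_XsubC.
  by lia.
have px j : j \in s N1 -> p.[X j] = 0.
  move=> js; apply/eqP; rewrite hornerM mulf_eq0; apply/orP; right; rewrite -/(root _ _).
  by rewrite -(big_map X xpredT (fun a => 'X - a%:P)) root_prod_XsubC; exact: map_f.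
have : \sum_(k < n) p`_k * A k = 0.
  rewrite (eq_bigr (fun k : 'I_n => \sum_(j <- s N1) p`_k * termK m K k j)); last first.
    by move=> k _; rewrite As// mulr_sumr.
  rewrite exchange_big big1_seq //= => j js.
  pose be := lam R j - (lam R 1 + lam R K) / 2.
  transitivity (be * (mc m 1 j * mc m K j) * p.[X j]); last by rewrite px// mulr0.
  rewrite horner_coef sp mulr_sumr; apply: eq_bigr => k _.
  by rewrite /termK -/be -/(X j); ring.
have pn1 : p`_n.-1 = 1 by move: pm; rewrite monicE /lead_coef sp => /eqP.
have -> : \sum_(k < n) p`_k * A k = A n.-1.
  rewrite -[in LHS](prednK n_gt0) big_ord_recr /= pn1 mul1r big1 ?add0r// => k _.
  by rewrite A_zero ?mulr0.
by move=> h; move: A_neq0; rewrite h eqxx.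
Qed.

(** The factor exp(- i om T) turns the phase into om (t - T), of size at most 1/2, where the cosine
    is at least 1 - 1/4. *)
Lemma Sint_re T u om : 0 <= T -> intg 0 T u -> `|om| * T <= 2^-1 ->
  3 / 4 * L2norm 0 T (prim u n) ^+ 2 <= cre (cexp (- (om * T)) * Sint T u om n).
Proof.
move=> T0 iu omT; have [k nE] : exists k, n = k.+1 by case: n n_gt0 => // k _; exists k.
have cU : cont 0 T (prim u n) by rewrite nE; exact: cont_prims.
have cU2 := contX 2 cU; have iU2 := intg_cont cU2.
have cS : ccont 0 T (fun t => (prim u n t ^+ 2)%:C * cexp (om * t)).
  by apply: ccontM; [exact: ccont_real|exact: ccont_exp].
rewrite -(cintZ _ (cintg_cont cS)) cre_cint.
have -> : L2norm 0 T (prim u n) ^+ 2 = rint 0 T (fun t => prim u n t ^+ 2).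
  by rewrite L2norm2; apply: eq_rint => t _; rewrite expr2.
rewrite -(rintZ _ iU2).
have e t : cre (cexp (- (om * T)) * ((prim u n t ^+ 2)%:C * cexp (om * t))) = prim u n t ^+ 2 * cos (om * (t - T)).
  rewrite !creimE (_ : om * (t - T) = - (om * T) + om * t); last by ring.
  by rewrite cosD; ring.
apply: ler_rint; first exact: intgZ.
  have [h _] := cintg_cont (ccontM (ccont_cst 0 T (cexp (- (om * T)))) cS).
  exact: h.
move=> t /andP[t0 tT]; rewrite e mulrC; apply: ler_wpM2l; first exact: sqr_ge0.
have := cos_taylor1 0 (om * (t - T)); rewrite cos0 sin0 oppr0 mul0r subr0 addr0.
have h : `|om * (t - T)| <= 2^-1.
  rewrite normrM; apply: le_trans omT; apply: ler_wpM2l => //.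
  by rewrite distrC ger0_norm ?subr_ge0// lerBlDr lerDl.
have h2 : (om * (t - T)) ^+ 2 <= 2^-1 ^+ 2.
  by rewrite -real_normK ?num_real// ler_pXn2r ?nnegrE// invr_ge0.
rewrite ler_norml => /andP[h3 _]; move: h2 h3; move: (_ ^+ 2) (cos _) => a b.
by rewrite (_ : 2^-1 ^+ 2 = 1 / 4 :> R); [lra|field].
Qed.

(** [endpoint_bound] feeds [main_expansion], so every error reduces to the sum G of the squared
    distance, |u_1|^3 and T |u_n|^2. The last is made small by T, the second by [ctrl_interp] and
    eta, and the first is the permitted loss. *)
Lemma core_estimate : exists C Ts : R, [/\ 0 < C, 0 < Ts, Ts <= 1 & forall T, 0 < T -> T < Ts ->
  exists eta : R, 0 < eta /\ forall u, L2 0 T u -> ctrl_small n T u eta ->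
  forall p q, pathL2 T p -> pathL2 T q -> (forall j, (1 <= j)%N -> coef_ode T u m p q j) ->
  (forall j, (1 <= j)%N -> ip 0 1 (p 0) (phi j) = (j == 1%N)%:R /\ ip 0 1 (q 0) (phi j) = 0) ->
  `|A n.-1| / 4 * L2norm 0 T (prim u n) ^+ 2
    - C * (L2norm 0 1 (psi_re T p) ^+ 2 + L2norm 0 1 (psi_im T q) ^+ 2)
  <= - Num.sg (A n.-1) * cim (cexp (lam R 1 * T) * psic (p T) (q T) (phi K))].
Proof.
have [C1 C10 h1] := main_expansion m_prim m1_prim m2_prim K1 n_gt0 mcK1 A_lim A_zero S_bound.
have [f [finj f1 fmc]] := many_modes.
have [C2 C20 h2] := endpoint_bound m_prim m1_prim m2_prim n_gt0 finj f1 fmc.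
have [C3 C30 h3] := terminal_bound m_prim.
set a := `|A n.-1|; have a0 : 0 < a by rewrite normr_gt0.
pose c2 := C2 * (1 + 2 * C2).
have c20 : 0 <= c2 by rewrite mulr_ge0// addr_ge0// mulr_ge0.
(* Combines the errors of [main_expansion] and of undoing the gauge, expressed through G; each
   factor 2 is the bound of [n1] on a phase. *)
pose C4 := 2 * C1 * (1 + 3 * (c2 + 1) ^+ 2) + 2 * C3 * (24 * C2 ^+ 2 + 1).
have C40 : 0 <= C4.
  by rewrite /C4 addr_ge0// mulr_ge0// ?mulr_ge0// addr_ge0// mulr_ge0// sqr_ge0.
pose om := lam R K - lam R 1.
(* In order: T <= 2 / pi, a phase of size at most 1/2, and C4 T at most a / 4. *)
pose Ts := Num.min (2^-1) (Num.min (2^-1 / (`|om| + 1)) (a / 4 / (C4 + 1))).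
have om1 : 0 < `|om| + 1 by rewrite ltr_wpDl.
have C41 : 0 < C4 + 1 by rewrite ltr_wpDl.
exists (C4 + 1), Ts; split => //.
- by rewrite !lt_min invr_gt0 ltr0n /= !divr_gt0// invr_gt0.
- by rewrite /Ts ge_min invf_le1 ?ler1n.
move=> T T0; rewrite !lt_min => /and3P[Th Tom TC].
have T0' := ltW T0; have T1 : T <= 1 by move: Th; lra.
have Ttau : T <= 2 / pi.
  rewrite ler_pdivlMr ?pi_gt0//; have /andP[_] := pihalf_02 R; rewrite ltr_pdivrMr// => pi4.
  apply: le_trans (ler_pM T0' (pi_ge0 R) (ltW Th) (ltW pi4)) _.
  by rewrite (_ : 2^-1 * (2 * 2) = 2 :> R)//; field.
have omT : `|om| * T <= 2^-1.
  rewrite ltr_pdivlMr// in Tom; apply: ltW; apply: le_lt_trans Tom.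
  by rewrite mulrC ler_wpM2l// lerDl.
have TC' : C4 * T <= a / 4.
  rewrite ltr_pdivlMr// in TC; apply: ltW; apply: le_lt_trans TC.
  by rewrite mulrC ler_wpM2l// lerDl.
have [CT CT0 hCT] := ctrl_interp n_gt0 T0 T1.
(* The first value gives |u_1| <= 1, the second absorbs u_1(T)^2 in [endpoint_bound], the third
   makes the cubic error at most (a / 4) |u_n|^2. *)
pose eta := Num.min 1 (Num.min (2^-1 / (C2 + 1)) (a / 4 / (C4 * CT + 1))).
have C21 : 0 < C2 + 1 by rewrite ltr_wpDl.
have CC0 : 0 <= C4 * CT by exact: mulr_ge0.
have CC1 : 0 < C4 * CT + 1 by rewrite ltr_wpDl.
have eta0 : 0 < eta by rewrite !lt_min ltr01 /= !divr_gt0// invr_gt0.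
exists eta; split => // u Lu su p q pp pq ode init.
have iu := L2_intg Lu; have [u1 E3] := hCT _ _ Lu su.
have e1 : eta <= 1 by rewrite /eta ge_min lexx.
have e2 : C2 * eta <= 2^-1.
  apply: le_trans (_ : (C2 + 1) * eta <= _); first by rewrite ler_wpM2r ?(ltW eta0)// lerDl.
  by rewrite mulrC -ler_pdivlMr// /eta !ge_min lexx orbT.
have e3 : C4 * (CT * eta) <= a / 4.
  apply: le_trans (_ : (C4 * CT + 1) * eta <= _); first by rewrite mulrA ler_wpM2r ?(ltW eta0)// lerDl.
  by rewrite mulrC -ler_pdivlMr// /eta !ge_min lexx !orbT.
have F : flow m T u p q.
  by split => // t tT; apply: le_trans e1; exact: u1.
have TT : 0 <= T <= T by rewrite T0' lexx.
set X := L2norm 0 T (prim u n) in E3 *; set E := L2norm 0 T (prim u 1) in E3.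
set z := prim u 1 T; have zeta : `|z| <= eta by exact: u1.
have X0 : 0 <= X by exact: L2norm_ge0.
have E0 : 0 <= E by exact: L2norm_ge0.
set dd := _ ^+ 2 + _ ^+ 2.
have dd0 : 0 <= dd by rewrite addr_ge0// sqr_ge0.
pose d := Num.sqrt dd; have d2 : d ^+ 2 = dd by rewrite sqr_sqrtr.
have d0 : 0 <= d by exact: sqrtr_ge0.
have pd : L2norm 0 1 (psi_re T p) <= d.
  by rewrite -(ger0_norm (L2norm_ge0 0 1 _)) -sqrtr_sqr ler_wsqrtr// lerDl sqr_ge0.
have qd : L2norm 0 1 (psi_im T q) <= d.
  by rewrite -(ger0_norm (L2norm_ge0 0 1 _)) -sqrtr_sqr ler_wsqrtr// lerDr sqr_ge0.
pose sX := Num.sqrt T * X; have sX0 : 0 <= sX by rewrite mulr_ge0// sqrtr_ge0.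
have sX2 : sX ^+ 2 = T * X ^+ 2 by rewrite exprMn sqr_sqrtr.
have hend := h2 _ _ _ _ _ F pd qd.
rewrite -/z -/E -/X -/sX in hend.
pose g := d + E ^+ 2 + sX.
have g0 : 0 <= g by rewrite /g !addr_ge0// sqr_ge0.
have z1 : `|z| <= 1 := le_trans zeta e1.
have zz : z ^+ 2 <= eta * `|z|.
  by rewrite -real_normK ?num_real// expr2 ler_wpM2r.
(* The bound C2 z^2 <= |z| / 2 lets the quadratic term be absorbed by the left side. *)
have zle : `|z| <= 2 * C2 * g.
  have k1 := hend 1%N; rewrite leqnn n_gt0 -/z in k1; have k := k1 isT.
  have k2 : C2 * z ^+ 2 <= 2^-1 * `|z|.
    apply: le_trans (ler_wpM2l C20 zz) _; rewrite mulrA; exact: ler_wpM2r.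
  have ek : C2 * (d + z ^+ 2 + E ^+ 2 + sX) = C2 * g + C2 * z ^+ 2 by rewrite /g; ring.
  by rewrite ek in k; rewrite -mulrA; exact: absorb_half k k2.
have zz2 : z ^+ 2 <= 2 * C2 * g.
  by apply: le_trans zle; rewrite -real_normK ?num_real// expr2 ler_piMl.
have hy k : (1 <= k <= n)%N -> `|prim u k T| <= c2 * g.
  move=> kn; apply: le_trans (hend k kn) _; rewrite /c2 -mulrA; apply: ler_wpM2l => //.
  have -> : d + z ^+ 2 + E ^+ 2 + sX = g + z ^+ 2 by rewrite /g; ring.
  by rewrite mulrDl mul1r lerD2l.
have EE1 : E <= 1.
  have hc : cont 0 T (prim u 1) by exact: cont_prims.
  have L1 : L2 0 T (fun=> 1 : R) by apply: L2_cont; exact: cont_cst.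
  apply: le_trans (L2norm_dom (M := 1) (L2_cont hc) L1 ler01 _) _.
    by move=> t tT; rewrite normr1 mulr1; apply: le_trans (u1 t tT) e1.
  rewrite mul1r -[leRHS]sqrtr1; apply: ler_wsqrtr.
  by rewrite (@eq_rint _ _ _ _ (fun=> 1)) ?rint_cst// ?mul1r ?subr0// => x _; rewrite expr1n.
pose G := dd + E ^+ 3 + T * X ^+ 2.
have E30 : 0 <= E ^+ 3 by exact: exprn_ge0.
have TX0 : 0 <= T * X ^+ 2 by rewrite mulr_ge0// sqr_ge0.
have G0 : 0 <= G by apply: addr_ge0 => //; exact: addr_ge0.
have gG : g ^+ 2 <= 3 * G.
  (* The first-order expansion leaves E^2, which is squared here; E <= 1 brings it down to the cubic
     term. *)
  have E4 : (E ^+ 2) ^+ 2 <= E ^+ 3.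
    by rewrite -exprM [in leLHS]exprS; apply: ler_piMl.
  apply: le_trans (sqr_sum3 d (E ^+ 2) sX) _.
  by rewrite ler_wpM2l// /G -d2 -sX2 lerD2r lerD2l.
have r2 : n1 (cexp (lam R K * T) * Zc m u p q T (phi K) - (K == 1%N)%:R + 'i * (A n.-1)%:C * Sint T u om n)
    <= C1 * (1 + 3 * (c2 + 1) ^+ 2) * G.
  apply: le_trans (h1 _ _ _ _ _ F hy) _; rewrite -/E -/X -/sX -mulrA; apply: ler_wpM2l => //.
  rewrite mulrDl mul1r; apply: lerD.
    by rewrite /G -addrA addrCA lerDl addr_ge0.
  apply: le_trans (_ : ((c2 + 1) * g) ^+ 2 <= _).
    have sg : sX <= g by rewrite /g lerDr addr_ge0// sqr_ge0.
    have l0 : 0 <= c2 * g + sX by rewrite addr_ge0// mulr_ge0.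
    have l1 : 0 <= (c2 + 1) * g by rewrite mulr_ge0// addr_ge0.
    by rewrite ler_pXn2r ?nnegrE// mulrDl mul1r lerD2l.
  by rewrite exprMn (_ : 3 * (c2 + 1) ^+ 2 * G = (c2 + 1) ^+ 2 * (3 * G)); [apply: ler_wpM2l => //; exact: sqr_ge0|ring].
have r1 : n1 (Zc m u p q T (phi K) - psic (p T) (q T) (phi K)) <= C3 * (24 * C2 ^+ 2 + 1) * G.
  have [+ _] := h3 _ _ _ _ _ _ F K1 pd qd; rewrite -/z mcK1 (_ : 0%:C = 0)// mulr0 addr0 => /le_trans; apply.
  rewrite -mulrA; apply: ler_wpM2l => //.
  have q1 : z ^+ 2 <= 4 * C2 ^+ 2 * g ^+ 2.
    rewrite -real_normK ?num_real// (_ : 4 * C2 ^+ 2 * g ^+ 2 = (2 * C2 * g) ^+ 2); last by ring.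
    by rewrite ler_pXn2r ?nnegrE// mulr_ge0// mulr_ge0.
  have q2 : 4 * C2 ^+ 2 * g ^+ 2 <= 4 * C2 ^+ 2 * (3 * G).
    by apply: ler_wpM2l => //; rewrite mulr_ge0// sqr_ge0.
  have q3 : 2 * (`|z| * d) <= z ^+ 2 + dd.
    by rewrite -d2 -(real_normK (num_real z)); exact: mul2_le_sqr.
  have q4 : dd <= G by rewrite /G -addrA lerDl addr_ge0.
  have -> : (24 * C2 ^+ 2 + 1) * G = 2 * (4 * C2 ^+ 2 * (3 * G)) + G by ring.
  exact: quad_error (le_trans q1 q2) q3 q4 (sqr_ge0 z) G0.
set r2v := (X in n1 X <= _) in r2; set r1v := (X in n1 X <= _) in r1.
(* The expansion carries the phase exp(i lam_K T), the conclusion exp(i lam_1 T); they differ by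
   exp(- i om T). *)
have wE : cexp (lam R 1 * T) * psic (p T) (q T) (phi K) =
    cexp (- (om * T)) * (K == 1%N)%:R - 'i * (A n.-1)%:C * (cexp (- (om * T)) * Sint T u om n)
    + cexp (- (om * T)) * r2v - cexp (lam R 1 * T) * r1v.
  have ee : cexp (- (om * T)) * cexp (lam R K * T) = cexp (lam R 1 * T).
    by rewrite -cexpD; congr cexp; rewrite /om; ring.
  rewrite /r2v /r1v -ee; move: (cexp (- _)) (cexp (lam R K * T)) (Zc _ _ _ _ _ _) (psic _ _ _) (Sint _ _ _ _) ((K == 1%N)%:R) => x1 x2 x3 x4 x5 x6.
  by ring.
(* For K = 1 the frequency om is 0 and the term equals 1; otherwise it is 0. In both cases it is
   real. *)
have i0 : cim (cexp (- (om * T)) * (K == 1%N)%:R) = 0.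
  rewrite /om; case: eqVneq => [->|_]; last by rewrite mulr0.
  by rewrite subrr mul0r oppr0 cexp0 mulr1.
have im : cim (cexp (lam R 1 * T) * psic (p T) (q T) (phi K)) =
    - (A n.-1 * cre (cexp (- (om * T)) * Sint T u om n)) + cim (cexp (- (om * T)) * r2v) - cim (cexp (lam R 1 * T) * r1v).
  rewrite wE; move: (cexp (- (om * T)) * Sint T u om n) (cexp (- (om * T)) * r2v) (cexp (lam R 1 * T) * r1v) i0 => x1 x2 x3 i0.
  by rewrite 2!cimD cimN cimD cimN i0 -mulrA !creimE; ring.
have b2 : `|cim (cexp (- (om * T)) * r2v)| <= 2 * (C1 * (1 + 3 * (c2 + 1) ^+ 2) * G).
  by apply: le_trans (cim_n1 _) _; apply: le_trans (n1_expM _ _) _; rewrite ler_wpM2l.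
have b1 : `|cim (cexp (lam R 1 * T) * r1v)| <= 2 * (C3 * (24 * C2 ^+ 2 + 1) * G).
  by apply: le_trans (cim_n1 _) _; apply: le_trans (n1_expM _ _) _; rewrite ler_wpM2l.
have Sr := Sint_re T0' iu omT; rewrite -/X in Sr.
have C4G : 2 * (C1 * (1 + 3 * (c2 + 1) ^+ 2) * G) + 2 * (C3 * (24 * C2 ^+ 2 + 1) * G) = C4 * G.
  by rewrite /C4; ring.
have sga : Num.sg (A n.-1) * A n.-1 = a by rewrite /a normrEsg.
have sg1 : `|Num.sg (A n.-1)| <= 1 by rewrite normr_sg; case: (_ != _); rewrite ?ler01.
rewrite im; set x1 := cre _ in Sr *; set x2 := cim _ in b2 *; set x3 := cim _ in b1 *.
have eR : - Num.sg (A n.-1) * (- (A n.-1 * x1) + x2 - x3) = a * x1 - Num.sg (A n.-1) * (x2 - x3).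
  by rewrite -sga; ring.
have bs : `|Num.sg (A n.-1) * (x2 - x3)| <= C4 * G.
  rewrite normrM -C4G; apply: le_trans (_ : 1 * `|x2 - x3| <= _); first exact: ler_wpM2r.
  by rewrite mul1r; apply: le_trans (ler_normB _ _) _; exact: lerD.
rewrite eR.
have Sr' := ler_wpM2l (ltW a0) Sr.
have X20 : 0 <= X ^+ 2 by exact: sqr_ge0.
have g1 := ler_wpM2r X20 TC'; have g2 := ler_wpM2r X20 e3.
have g3 := ler_wpM2l C40 E3.
have GE : C4 * G = C4 * dd + C4 * E ^+ 3 + C4 * T * X ^+ 2 by rewrite /G; ring.
have g3' : C4 * E ^+ 3 <= a / 4 * X ^+ 2.
  by apply: le_trans g3 _; rewrite mulrA.
have bs' := le_trans (ler_norm _) bs; rewrite GE in bs'.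
have d4 : C4 * dd <= (C4 + 1) * dd by rewrite ler_wpM2r// lerDl.
have aX : a * (3 / 4 * X ^+ 2) = 3 * (a / 4 * X ^+ 2) by ring.
rewrite aX in Sr'; exact: sum_error Sr' g1 g3' bs' d4.
Qed.

End Core.

(** * Unreachable targets *)

Section Conclusion.
Variable R : realType.
Local Open Scope complex_scope.
Local Notation leb := (@lebesgue_measure R).
Implicit Types (s t x y T : R) (g h f : R -> R) (j k N : nat).

Let L2phi j : L2 0 1 (phi j : R -> R). Proof. exact: L2_phi. Qed.

Lemma sum1_series (F : nat -> R) :
  (fun N => \sum_(1 <= j < N) F j) = series (fun j => if j == 0%N then 0 else F j).
Proof.
apply/funext => -[|N]; first by rewrite /series /= !big_geq.
rewrite /series /= [RHS]big_ltn//= add0r big_nat [RHS]big_nat; apply: eq_bigr => j /andP[j1 _].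
by rewrite gtn_eqF.
Qed.

Lemma sum1_cvg_le (F G : nat -> R) (C : R) : 0 <= C ->
  (forall j, (1 <= j)%N -> `|F j| <= C * G j) -> (forall j, (1 <= j)%N -> 0 <= G j) ->
  cvgn (fun N => \sum_(1 <= j < N) G j) -> cvgn (fun N => \sum_(1 <= j < N) F j).
Proof.
move=> C0 FG G0; rewrite !sum1_series => cG; apply: normed_cvg.
have cCG : cvgn (series (fun j => C * (if j == 0%N then 0 else G j))).
  rewrite (_ : series _ = (fun N => C * series (fun j => if j == 0%N then 0 else G j) N)).
    by apply: is_cvgM => //; exact: is_cvg_cst.
  by apply/funext => N; rewrite /series /= mulr_sumr.
apply: series_le_cvg cCG => j //=.
- by case: j => [|j]; rewrite ?mulr0// mulr_ge0// G0.
- by case: j => [|j]; rewrite ?normr0 ?mulr0// FG.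
Qed.

Lemma sum1_le_lim (G : nat -> R) N : (forall j, 0 <= G j) ->
  cvgn (fun N => \sum_(1 <= j < N) G j) -> \sum_(1 <= j < N) G j <= limn (fun N => \sum_(1 <= j < N) G j).
Proof.
move=> G0 cG; apply: (nondecreasing_cvgn_le _ cG) => i k ik.
have [i1|i1] := leqP 1 i; last first.
  by rewrite big_geq// ?sumr_ge0// ltnW.
by rewrite (big_cat_nat i1 ik)/= lerDl sumr_ge0.
Qed.

Lemma cL2norm_sq (F : R -> R[i]) : cL2 0 1 F ->
  cL2norm F ^+ 2 = L2norm 0 1 (fun x => cre (F x)) ^+ 2 + L2norm 0 1 (fun x => cim (F x)) ^+ 2.
Proof.
move=> [h1 h2]; rewrite !L2norm2 /cL2norm sqr_sqrtr; last first.
  by apply: rint_ge0 => x _; rewrite addr_ge0// sqr_ge0.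
by rewrite (rintD (L2_sq h1) (L2_sq h2)); congr (_ + _); apply: eq_rint => x _; rewrite expr2.
Qed.

Lemma cinner_phase (F : R -> R[i]) g y : cL2 0 1 F -> L2 0 1 g ->
  cinner F (fun x => (g x)%:C * cexp (- y)) =
  cexp y * psic (fun x => cre (F x)) (fun x => cim (F x)) g.
Proof.
move=> [h1 h2] Lg; have i1 := L2M_intg h1 Lg; have i2 := L2M_intg h2 Lg.
apply: complexP.
  transitivity (cos y * ip 0 1 (fun x => cre (F x)) g - sin y * ip 0 1 (fun x => cim (F x)) g); last by rewrite !creimE.
  rewrite /ip -(rintZ _ i1) -(rintZ _ i2) -rintB; [|exact: intgZ..].
  by rewrite /cinner cre_cint; apply: eq_rint => x _; rewrite !creimE cosN sinN; ring.
transitivity (cos y * ip 0 1 (fun x => cim (F x)) g + sin y * ip 0 1 (fun x => cre (F x)) g); last by rewrite !creimE.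
rewrite /ip -(rintZ _ i1) -(rintZ _ i2) -rintD; [|exact: intgZ..].
by rewrite /cinner cim_cint; apply: eq_rint => x _; rewrite !creimE cosN sinN; ring.
Qed.

Lemma cL2_psi1 T : cL2 0 1 (psi1 T : R -> R[i]).
Proof.
split; [apply: eq_L2 (L2Z (cos (- (lam R 1 * T))) (L2phi 1))|apply: eq_L2 (L2Z (sin (- (lam R 1 * T))) (L2phi 1))];
  by move=> x _; rewrite /psi1 !creimE; ring.
Qed.

Lemma cre_sub_psi1 T (F : R -> R -> R[i]) x : cre (F T x - psi1 T x) = psi_re T (fun t x => cre (F t x)) x.
Proof. by rewrite /psi1 /psi_re !creimE cosN; ring. Qed.

Lemma cim_sub_psi1 T (F : R -> R -> R[i]) x : cim (F T x - psi1 T x) = psi_im T (fun t x => cim (F t x)) x.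
Proof. by rewrite /psi1 /psi_im !creimE sinN; ring. Qed.

Lemma cL2B (F G : R -> R[i]) : cL2 0 1 F -> cL2 0 1 G -> cL2 0 1 (fun x => F x - G x).
Proof.
move=> [h1 h2] [k1 k2]; split; [apply: eq_L2 (L2B h1 k1)|apply: eq_L2 (L2B h2 k2)];
  by move=> x _; rewrite !creimE.
Qed.

Section Target.
Variables (K : nat) (y be : R) (a : R).
Hypothesis K1 : (1 <= K)%N.
Hypothesis a2 : a ^+ 2 = 1.

(* For K = 1 this is a phase rotation of the ground state, still of norm 1. *)
Definition target x : R[i] := (cos be * phi 1 x +i* (a * sin be * phi K x)) * cexp (- y).

Let ta x := cos be * phi 1 x.
Let tb x := a * sin be * phi K x.
Let La : L2 0 1 ta. Proof. exact: L2Z. Qed.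
Let Lb : L2 0 1 tb. Proof. exact: L2Z. Qed.

Lemma cre_target x : cre (target x) = cos y * ta x + sin y * tb x.
Proof. by rewrite /target /ta /tb !creimE /= cosN sinN; ring. Qed.
Lemma cim_target x : cim (target x) = cos y * tb x - sin y * ta x.
Proof. by rewrite /target /ta /tb !creimE /= cosN sinN; ring. Qed.

Lemma cL2_target : cL2 0 1 target.
Proof.
split.
  by apply: eq_L2 (L2D (L2Z (cos y) La) (L2Z (sin y) Lb)) => x _; rewrite cre_target.
by apply: eq_L2 (L2B (L2Z (cos y) Lb) (L2Z (sin y) La)) => x _; rewrite cim_target.
Qed.

Let phi_sq j : (1 <= j)%N -> rint 0 1 (fun x => phi j x ^+ 2) = 1 :> R.
Proof.
move=> j1; rewrite -[RHS](_ : ip 0 1 (phi j) (phi j) = 1); last by rewrite ip_phi// eqxx.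
by apply: eq_rint => x _; rewrite expr2.
Qed.

Let rint_sq (c d : R) : rint 0 1 (fun x => (c * phi 1 x) ^+ 2 + (d * phi K x) ^+ 2) = c ^+ 2 + d ^+ 2.
Proof.
have h j c' : rint 0 1 (fun x => (c' * phi j x) ^+ 2) = c' ^+ 2 * rint 0 1 (fun x => phi j x ^+ 2).
  by rewrite -(rintZ _ (L2_sq (L2phi j))); apply: eq_rint => x _; ring.
rewrite (rintD (L2_sq (L2Z _ (L2phi 1))) (L2_sq (L2Z _ (L2phi K)))) !h.
by rewrite !phi_sq// !mulr1.
Qed.

Let rot2 (c d : R) : (cos y * c + sin y * d) ^+ 2 + (cos y * d - sin y * c) ^+ 2 = c ^+ 2 + d ^+ 2.
Proof.
transitivity ((cos y ^+ 2 + sin y ^+ 2) * (c ^+ 2 + d ^+ 2)); first by ring.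
by rewrite cos2Dsin2 mul1r.
Qed.

Let sin2a : (a * sin be) ^+ 2 = sin be ^+ 2. Proof. by rewrite exprMn a2 mul1r. Qed.

Lemma target_norm : cL2norm target = 1.
Proof.
rewrite /cL2norm -[RHS]sqrtr1; congr Num.sqrt.
rewrite (@eq_rint _ _ _ _ (fun x => (cos be * phi 1 x) ^+ 2 + ((a * sin be) * phi K x) ^+ 2)); last first.
  by move=> x _; rewrite cre_target cim_target rot2.
by rewrite rint_sq sin2a cos2Dsin2.
Qed.

Let dre x : cre (target x - (phi 1 x)%:C * cexp (- y)) = cos y * ((cos be - 1) * phi 1 x) + sin y * tb x.
Proof. by rewrite creD creN cre_target !creimE cosN sinN /ta; ring. Qed.
Let dim_ x : cim (target x - (phi 1 x)%:C * cexp (- y)) = cos y * tb x - sin y * ((cos be - 1) * phi 1 x).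
Proof. by rewrite cimD cimN cim_target !creimE cosN sinN /ta; ring. Qed.

Lemma target_dist :
  L2norm 0 1 (fun x => cre (target x - (phi 1 x)%:C * cexp (- y))) ^+ 2 +
  L2norm 0 1 (fun x => cim (target x - (phi 1 x)%:C * cexp (- y))) ^+ 2 =
  (cos be - 1) ^+ 2 + sin be ^+ 2.
Proof.
have Lc : L2 0 1 (fun x => (cos be - 1) * phi 1 x) by exact: L2Z.
rewrite (@eq_L2norm _ _ _ (fun x => cre _) _ (fun x _ => dre x)) (@eq_L2norm _ _ _ (fun x => cim _) _ (fun x _ => dim_ x)).
rewrite !L2norm2 /ip -rintD; last 2 first.
- by apply: L2M_intg; apply: L2D; exact: L2Z.
- by apply: L2M_intg; apply: L2B; exact: L2Z.
rewrite (@eq_rint _ _ _ _ (fun x => ((cos be - 1) * phi 1 x) ^+ 2 + ((a * sin be) * phi K x) ^+ 2)); last first.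
  by move=> x _; rewrite -rot2 -!expr2.
by rewrite rint_sq sin2a.
Qed.

Lemma target_psic : cim (cexp y * psic (fun x => cre (target x)) (fun x => cim (target x)) (phi K)) = a * sin be.
Proof.
have e1 : ip 0 1 (fun x => cre (target x)) (phi K) = cos y * ip 0 1 ta (phi K) + sin y * ip 0 1 tb (phi K).
  rewrite -(ipZl _ La (L2phi K)) -(ipZl _ Lb (L2phi K)) -(ipDl (L2Z _ La) (L2Z _ Lb) (L2phi K)).
  by apply: eq_ip => x _ //; exact: cre_target.
have e2 : ip 0 1 (fun x => cim (target x)) (phi K) = cos y * ip 0 1 tb (phi K) - sin y * ip 0 1 ta (phi K).
  rewrite -(ipZl _ La (L2phi K)) -(ipZl _ Lb (L2phi K)) -(ipBl (L2Z _ Lb) (L2Z _ La) (L2phi K)).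
  by apply: eq_ip => x _ //; exact: cim_target.
rewrite !creimE /= e1 e2.
transitivity ((cos y ^+ 2 + sin y ^+ 2) * ip 0 1 tb (phi K)); first by ring.
by rewrite cos2Dsin2 mul1r (ipZl _ (L2phi K) (L2phi K)) ip_phi// eqxx mulr1.
Qed.

(** The difference has only the modes 1 and K, so its norm is finite for every s and involves s
    through K^(2s) alone. *)
Lemma target_Hs (s : nat) (de : R) : (cos be - 1) ^+ 2 + K%:R ^+ (2 * s) * sin be ^+ 2 < de ^+ 2 ->
  Hs0_lt s (fun x => target x - (phi 1 x)%:C * cexp (- y)) de.
Proof.
move=> hde; set g := fun x => _; pose c := cos be - 1; pose d := a * sin be.
have Lc : L2 0 1 (fun x => c * phi 1 x) by exact: L2Z.
have co j : (1 <= j)%N -> cre (cinner g (fun x => (phi j x)%:C)) ^+ 2 + cim (cinner g (fun x => (phi j x)%:C)) ^+ 2 =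
    (if j == 1%N then c ^+ 2 else 0) + (if j == K then d ^+ 2 else 0).
  move=> j1; rewrite cre_cinner cim_cinner.
  have e1 : ip 0 1 (fun x => cre (g x)) (phi j) = cos y * ip 0 1 (fun x => c * phi 1 x) (phi j) + sin y * ip 0 1 tb (phi j).
    rewrite -(ipZl _ Lc (L2phi j)) -(ipZl _ Lb (L2phi j)) -(ipDl (L2Z _ Lc) (L2Z _ Lb) (L2phi j)).
    by apply: eq_ip => x _ //; exact: dre.
  have e2 : ip 0 1 (fun x => cim (g x)) (phi j) = cos y * ip 0 1 tb (phi j) - sin y * ip 0 1 (fun x => c * phi 1 x) (phi j).
    rewrite -(ipZl _ Lc (L2phi j)) -(ipZl _ Lb (L2phi j)) -(ipBl (L2Z _ Lb) (L2Z _ Lc) (L2phi j)).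
    by apply: eq_ip => x _ //; exact: dim_.
  rewrite e1 e2 rot2 (ipZl _ (L2phi 1) (L2phi j)) (ipZl _ (L2phi K) (L2phi j)) !ip_phi//.
  rewrite ![in LHS](eq_sym _ j) -/d !exprMn.
  by congr (_ + _); case: eqVneq => _; rewrite ?mulr1n ?mulr0n ?expr1n ?expr0n ?mulr1 ?mulr0.
rewrite /Hs0_lt; apply: le_lt_trans (_ : ((c ^+ 2 + K%:R ^+ (2 * s) * d ^+ 2)%:E < _)%E); last first.
  by rewrite lte_fin /d sin2a.
apply: lime_le; first by apply: is_cvg_nneseries => j _ _; rewrite lee_fin mulr_ge0// ?exprn_ge0// addr_ge0// sqr_ge0.
apply: nearW => N; rewrite sumEFin lee_fin.
rewrite big_nat (eq_bigr (fun j => (if j == 1%N then c ^+ 2 else 0) + (if j == K then K%:R ^+ (2 * s) * d ^+ 2 else 0))); last first.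
  move=> j /andP[j1 _]; rewrite co// mulrDr; congr (_ + _); last by case: eqVneq => [->|_]; rewrite ?mulr0.
  by case: eqVneq => [->|_]; rewrite ?mulr0// expr1n mul1r.
rewrite -big_nat big_split /= -!big_mkcond !big_nat1_eq; apply: lerD.
  by case: ifP => // _; exact: sqr_ge0.
by case: ifP => // _; apply: mulr_ge0; [exact: exprn_ge0|exact: sqr_ge0].
Qed.

End Target.
Lemma mcoef_mc (mu m : R -> R) j k : measurable_fun (Icc 0 1) mu -> cont 0 1 m ->
  {ae leb, forall x, 0 <= x <= 1 -> mu x = m x} -> mcoef mu j k = mc m j k.
Proof.
by move=> mmu cm ae; apply: (ae_ip_mul mmu cm ae); apply: cont_measurable; exact: cont_phi.
Qed.

Lemma ApK_termE (mu m : R -> R) K j k : (forall i l, mcoef mu i l = mc m i l) ->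
  ApK_term mu K k.+1 j = termK m K k j.
Proof.
move=> e; rewrite /ApK_term /termK /cK !e /aK /bK.
have -> : (- ((lam R K - lam R j) * (lam R j - lam R 1))) ^+ k =
    (-1) ^+ k * (lam R K - lam R j) ^+ k * (lam R j - lam R 1) ^+ k by rewrite [LHS]exprNn exprMn mulrA.
by ring.
Qed.

(** [ApK] is a [limn], informative only when the series converges. The summand of A^(k+1)_K is at
    most a constant times j^(4k + 2) |c_j|, and 4k + 2 <= 4n since k < n. *)
Lemma termK_cvg (m : R -> R) K n k : (1 <= K)%N -> (k < n)%N ->
  cvgn (fun N => \sum_(1 <= j < N) j%:R ^+ (4 * n) * `|mc m 1 j * mc m K j|) ->
  cvgn (fun N => \sum_(1 <= j < N) termK m K k j).
Proof.
move=> K1 kn; have l0 : 0 <= lam R K by rewrite /lam sqr_ge0.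
apply: sum1_cvg_le (_ : 0 <= lam R K ^+ (2 * k).+1) _ _; first exact: exprn_ge0.
  move=> j j1; have [h1 [h2 h3]] := aK_le R K1 j1; set B := lam R K * j%:R ^+ 2 in h1 h2 h3.
  have B0 : 0 <= B by exact: le_trans h3.
  have eb : lam R j - (lam R 1 + lam R K) / 2 = (bK R j - aK R K j) / 2 by rewrite /aK /bK; field.
  have hb : `|(bK R j - aK R K j) / 2| <= B.
    rewrite normrM [`|2^-1|]ger0_norm ?invr_ge0// ler_pdivrMr//.
    by apply: le_trans (ler_normB _ _) _; lra.
  have hab : `|- (aK R K j * bK R j)| <= B ^+ 2.
    by rewrite normrN normrM expr2; apply: ler_pM.
  rewrite /termK eb normrM mulrA; apply: ler_wpM2r => //.
  rewrite normrM normrX; apply: le_trans (_ : B * (B ^+ 2) ^+ k <= _).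
    by apply: ler_pM => //; rewrite ?exprn_ge0// lerXn2r ?nnegrE// exprn_ge0.
  have -> : B * (B ^+ 2) ^+ k = lam R K ^+ (2 * k).+1 * j%:R ^+ (2 * (2 * k).+1).
    by rewrite -exprM -exprS /B exprMn -[(j%:R ^+ 2) ^+ _]exprM.
  apply: ler_wpM2l; first exact: exprn_ge0.
  by apply: ler_weXn2l; [rewrite ler1n|lia].
by move=> j _; rewrite mulr_ge0// exprn_ge0.
Qed.

Lemma sg_sqr (a : R) : a != 0 -> Num.sg a ^+ 2 = 1.
Proof. by move=> a0; rewrite sqr_sg a0. Qed.

Section NotControllable.
Variables (mu m m1 m2 m3 : R -> R) (K n : nat) (A : nat -> R) (S : R).
Hypothesis m_prim : isprim 0 1 m m1.
Hypothesis m1_prim : isprim 0 1 m1 m2.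
Hypothesis m2_prim : isprim 0 1 m2 m3.
Hypothesis mmu : measurable_fun (Icc 0 1) mu.
Hypothesis mu_m : {ae leb, forall x, 0 <= x <= 1 -> mu x = m x}.
Hypothesis K1 : (1 <= K)%N.
Hypothesis n_gt0 : (1 <= n)%N.
Hypothesis mcK1 : mc m 1 K = 0.
Hypothesis A_lim : forall k, (k < n)%N -> (fun N => \sum_(1 <= j < N) termK m K k j) @ \oo --> A k.
Hypothesis A_zero : forall k, (k < n.-1)%N -> A k = 0.
Hypothesis A_neq0 : A n.-1 != 0.
Hypothesis S_bound : forall N, \sum_(1 <= j < N) j%:R ^+ (4 * n) * `|mc m 1 j * mc m K j| <= S.

Let cm : cont 0 1 m. Proof. exact: isprim_cont ler01 m_prim. Qed.

Lemma sol_estimate : exists C Ts : R, [/\ 0 < C, 0 < Ts & forall T, 0 < T -> T < Ts ->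
  exists eta : R, 0 < eta /\ forall u, L2 0 T u -> ctrl_small n T u eta ->
  forall psi, is_solution mu T u psi ->
  `|A n.-1| / 4 * L2norm 0 T (prim u n) ^+ 2
    - C * (L2norm 0 1 (psi_re T (fun t x => cre (psi t x))) ^+ 2 + L2norm 0 1 (psi_im T (fun t x => cim (psi t x))) ^+ 2)
  <= - Num.sg (A n.-1) * cim (cexp (lam R 1 * T) * psic (fun x => cre (psi T x)) (fun x => cim (psi T x)) (phi K))].
Proof.
have [C [Ts [C0 Ts0 _ h]]] := core_estimate m_prim m1_prim m2_prim K1 n_gt0 mcK1 A_lim A_zero A_neq0 S_bound.
exists C, Ts; split=> // T T0 TTs; have [eta [eta0 he]] := h T T0 TTs; have T0' := ltW T0.
exists eta; split=> // u Lu su psi hsol; have [pp pq] := sol_pathL2 hsol.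
apply: (he u Lu su _ _ pp pq) => j j1; first exact: (sol_coef_ode mmu cm mu_m T0' Lu hsol j1).
exact: (sol_init mmu cm mu_m T0' hsol j1).
Qed.

(** At a reached target the estimate yields sin be <= 2 C be^2, whereas sin be >= be - be^2, which
    is impossible for small be > 0. The norm [EN] enters only through [ctrl_small], so both kinds of
    controllability are treated at once. *)
Lemma not_STLC (EN : R -> (R -> R) -> R -> Prop) :
  (forall T u e, EN T u e -> ctrl_small n T u e) -> ~ STLC mu EN.
Proof.
move=> hEN [s hs]; have [C [Ts [C0 Ts0 hest]]] := sol_estimate.
pose T := Ts / 2; have T0 : 0 < T by rewrite divr_gt0.
have TTs : T < Ts by rewrite ltr_pdivrMr// mulr_natr mulr2n ltrDr.
have [eta [eta0 he]] := hest T T0 TTs; have [de [de0 hd]] := hs T T0 eta eta0.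
pose k : R := K%:R ^+ (2 * s); have k0 : 0 <= k by exact: exprn_ge0.
have c1 : 0 < 2 * (2 * C + 1) by rewrite mulr_gt0// addr_gt0// mulr_gt0.
have k1 : 0 < 2 * (1 + k) by rewrite mulr_gt0// ltr_pwDl.
(* The value 1 serves the Taylor bounds, the second contradicts be - be^2 <= 2 C be^2, the third
   brings the target within de in the norm of order s. *)
pose be := Num.min 1 (Num.min ((2 * (2 * C + 1))^-1) (de / (2 * (1 + k)))).
have be0 : 0 < be by rewrite !lt_min ltr01 invr_gt0 c1 divr_gt0.
have be1 : be <= 1 by rewrite ge_min lexx.
have be2 : be * (2 * (2 * C + 1)) <= 1 by rewrite -ler_pdivlMr// div1r !ge_min lexx orbT.
have be3 : be * (2 * (1 + k)) <= de by rewrite -ler_pdivlMr// !ge_min lexx !orbT.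
have be20 := sqr_ge0 be.
have hc : (cos be - 1) ^+ 2 <= be ^+ 2.
  have := cos_taylor1 0 be; rewrite cos0 sin0 oppr0 mul0r subr0 addr0 => h.
  rewrite -(real_normK (num_real (cos be - 1))); apply: le_trans (_ : (be ^+ 2) ^+ 2 <= _).
    by rewrite lerXn2r ?nnegrE.
  by rewrite [leLHS]expr2 ler_piMl// exprn_ile1// ltW.
have hs2 : sin be ^+ 2 <= be ^+ 2.
  have := sin_lip 0 be; rewrite sin0 !subr0 (ger0_norm (ltW be0)) => h.
  by rewrite -(real_normK (num_real (sin be))) lerXn2r ?nnegrE// ltW.
have hs1 : be - be ^+ 2 <= sin be.
  have := sin_taylor1 0 be; rewrite sin0 cos0 mul1r !subr0 ler_norml => /andP[h _].
  by move: h; move: (sin be) (be ^+ 2) => *; lra.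
set sg := Num.sg (A n.-1) in he; have sg2 : sg ^+ 2 = 1 by exact: sg_sqr.
have small : (cos be - 1) ^+ 2 + K%:R ^+ (2 * s) * sin be ^+ 2 < de ^+ 2.
  rewrite -/k; apply: le_lt_trans (_ : (1 + k) * be ^+ 2 < _).
    by rewrite mulrDl mul1r; apply: lerD => //; exact: ler_wpM2l.
  have p : 0 < (1 + k) * be ^+ 2 by rewrite mulr_gt0 ?ltr_pwDl// exprn_gt0.
  have q : (be * (2 * (1 + k))) ^+ 2 <= de ^+ 2 by rewrite lerXn2r ?nnegrE ?mulr_ge0 ?addr_ge0 ?(ltW be0) ?(ltW de0).
  apply: lt_le_trans q; rewrite (_ : (be * (2 * (1 + k))) ^+ 2 = 4 * (1 + k) * ((1 + k) * be ^+ 2)); last by ring.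
  rewrite ltr_pMl//; have : 1 <= 1 + k by rewrite lerDl.
  by move: (1 + k) => *; lra.
pose y := lam R 1 * T; pose psif := target K y be sg.
have tL := cL2_target K y be sg.
have [u [Lu [su [psi [hsol hpsi]]]]] := hd psif tL (target_norm y be K1 sg2) (target_Hs y K1 sg2 small).
have [hcL _] := hsol; have TT : 0 <= T <= T by rewrite lexx ltW.
have pL := hcL T TT; have fit := he u Lu (hEN _ _ _ su) psi hsol.
(* The reached state agrees with the target only up to a null function, hence the transfer of inner
   products and norms below. *)
have DL := cL2B pL tL; have := cL2norm_sq DL; rewrite hpsi expr0n /= => /esym/eqP.
rewrite paddr_eq0 ?sqr_ge0// !sqrf_eq0 => /andP[/eqP z1 /eqP z2].
have D1 : L2 0 1 (fun x => cre (psi T x - psif x)) := DL.1.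
have D2 : L2 0 1 (fun x => cim (psi T x - psif x)) := DL.2.
have L2p1 : L2 0 1 (phi K : R -> R) by [].
have eip (F G : R -> R) : L2 0 1 F -> L2 0 1 G -> L2norm 0 1 (fun x => F x - G x) = 0 -> ip 0 1 F (phi K) = ip 0 1 G (phi K).
  move=> LF LG z; apply/eqP; rewrite -subr_eq0 -(ipBl LF LG L2p1) -normr_eq0 eq_le normr_ge0 andbT.
  by apply: le_trans (ip_CauchySchwarz (L2B LF LG) L2p1) _; rewrite z mul0r.
have zz1 : L2norm 0 1 (fun x => cre (psi T x) - cre (psif x)) = 0.
  by rewrite -[RHS]z1; apply: eq_L2norm => x _; rewrite creD creN.
have zz2 : L2norm 0 1 (fun x => cim (psi T x) - cim (psif x)) = 0.
  by rewrite -[RHS]z2; apply: eq_L2norm => x _; rewrite cimD cimN.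
have epsic : psic (fun x => cre (psi T x)) (fun x => cim (psi T x)) (phi K) =
    psic (fun x => cre (psif x)) (fun x => cim (psif x)) (phi K).
  by congr (_ +i* _); apply: eip; [exact: pL.1|exact: tL.1|exact: zz1|exact: pL.2|exact: tL.2|exact: zz2].
rewrite epsic (target_psic y be sg K1) in fit.
have PL := cL2B tL (cL2_psi1 T).
have n1' : L2norm 0 1 (psi_re T (fun t x => cre (psi t x))) <= L2norm 0 1 (fun x => cre (psif x - psi1 T x)).
  rewrite (@eq_L2norm _ _ _ _ (fun x => cre (psi T x - psif x) + cre (psif x - psi1 T x))); last first.
    by move=> x _; rewrite -cre_sub_psi1 -creD; congr cre; rewrite addrA subrK.
  by apply: le_trans (L2norm_triangle D1 PL.1) _; rewrite z1 add0r.
have n2' : L2norm 0 1 (psi_im T (fun t x => cim (psi t x))) <= L2norm 0 1 (fun x => cim (psif x - psi1 T x)).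
  rewrite (@eq_L2norm _ _ _ _ (fun x => cim (psi T x - psif x) + cim (psif x - psi1 T x))); last first.
    by move=> x _; rewrite -cim_sub_psi1 -cimD; congr cim; rewrite addrA subrK.
  by apply: le_trans (L2norm_triangle D2 PL.2) _; rewrite z2 add0r.
have dist := target_dist y be K1 sg2.
set dd := (_ ^+ 2 + _ ^+ 2) in fit.
have hdd : dd <= 2 * be ^+ 2.
  apply: le_trans (_ : (cos be - 1) ^+ 2 + sin be ^+ 2 <= _); last first.
    by rewrite mulr_natl mulr2n; exact: lerD.
  by rewrite -dist; apply: lerD; rewrite lerXn2r ?nnegrE ?L2norm_ge0.
have a0 : 0 <= `|A n.-1| / 4 * L2norm 0 T (prim u n) ^+ 2 by rewrite mulr_ge0 ?divr_ge0 ?sqr_ge0.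
have e4 : - sg * (sg * sin be) = - sin be by rewrite mulNr mulrA -expr2 sg2 mul1r.
rewrite e4 in fit; have hC := ler_wpM2l (ltW C0) hdd.
have fin : be * (2 * C + 1) * be <= 2^-1 * be.
  apply: ler_wpM2r; first exact: ltW.
  by move: be2; rewrite mulrCA; move: (be * (2 * C + 1)) => *; lra.
have e5 : be * (2 * C + 1) * be = C * (2 * be ^+ 2) + be ^+ 2 by ring.
rewrite e5 in fin; move: fit a0 hC fin hs1 be0.
by move: (`|A n.-1| / 4 * _) (C * dd) (C * (2 * be ^+ 2)) (be ^+ 2) (sin be) => *; lra.
Qed.

End NotControllable.
End Conclusion.

Local Open Scope ring_scope.
Local Open Scope complex_scope.

Theorem theorem1p1 (R : realType) (K n : nat) (mu : R -> R) :
  (1 <= K)%N -> (1 <= n)%N ->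
  inHk 0 1 3 mu -> H1 mu K -> H2 mu K n ->
  ((2 <= n)%N -> ~ STLC_H mu (2 * n - 3)) /\
  (n = 1%N -> ~ STLC_W mu) /\
  (exists C : R, 0 < C /\
   forall A : R, 0 < A -> A < `|ApK mu K n| / 4 ->
   exists Tstar : R, 0 < Tstar /\
   forall T : R, 0 < T -> T < Tstar ->
   exists eta : R, 0 < eta /\
   forall u : R -> R, L2 0 T u -> ctrl_small n T u eta ->
   forall psi : R -> R -> R[i], is_solution mu T u psi ->
     - Num.sg (ApK mu K n)
       * cim (cinner (psi T) (fun x => (phi K x)%:C * cexp (- (lam R 1 * T))))
     >= A * rint 0 T (fun t => prim u n t ^+ 2)
        - C * cL2norm (fun x => psi T x - psi1 T x) ^+ 2).
Proof.
move=> K1 n_gt0 [v chv] hH1 [cS [Az An0]].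
(* [w 0] is the continuous representative of [mu]; [w 1], [w 2] and [w 3] are its successive
   derivatives. *)
have [w [pw Lw ew]] := chain_rep (ler01 : 0 <= 1 :> R) chv.
have v0 : v 0%N = mu := chv.1.
have mmu : measurable_fun (Icc 0 1) mu by rewrite -v0; exact: (chv.2.1 0%N isT).1.
have mu_m : {ae lebesgue_measure, forall x : R, 0 <= x <= 1 -> mu x = w 0%N x}.
  by rewrite -v0; exact: ew.
have m_prim := pw 0%N isT; have m1_prim := pw 1%N isT; have m2_prim := pw 2%N isT.
have cm := isprim_cont ler01 m_prim.
have mcE i l : mcoef mu i l = mc (w 0%N) i l by exact: mcoef_mc.
pose m := w 0%N; have mcK1 : mc m 1 K = 0 by rewrite -mcE.
have cS' : cvgn (fun N => \sum_(1 <= j < N) j%:R ^+ (4 * n) * `|mc m 1 j * mc m K j|).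
  rewrite (_ : (fun N => _) = (fun N => \sum_(1 <= j < N) (j%:R ^+ (4 * n) * `|cK mu K j|)))//.
  by apply/funext => N; apply: eq_bigr => j _; rewrite /cK !mcE.
have S_bound N := sum1_le_lim N (fun j => mulr_ge0 (exprn_ge0 _ (ler0n _ j)) (normr_ge0 _)) cS'.
(* Index shift: A k is A^(k+1)_K, so the surviving coefficient is A (n - 1). *)
pose A k := ApK mu K k.+1.
have A_lim k : (k < n)%N -> (fun N => \sum_(1 <= j < N) termK m K k j) @ \oo --> A k.
  move=> kn; have := termK_cvg K1 kn cS'; rewrite /A /ApK.
  rewrite (_ : (fun N => \sum_(1 <= j < N) ApK_term mu K k.+1 j) = (fun N => \sum_(1 <= j < N) termK m K k j))//.
  by apply/funext => N; apply: eq_bigr => j _; exact: ApK_termE.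
have A_zero k : (k < n.-1)%N -> A k = 0.
  by move=> kn; apply: Az; rewrite /= -ltn_predRL.
have An : A n.-1 = ApK mu K n by rewrite /A prednK.
have A_neq0 : A n.-1 != 0 by rewrite An.
split; [|split].
- move=> n2; apply: (not_STLC m_prim m1_prim m2_prim mmu mu_m K1 n_gt0 mcK1 A_lim A_zero A_neq0 S_bound).
  move=> T u e [v' [hv' lt]]; rewrite /ctrl_small n2; exists v'; split => //; exact: ltW.
- move=> n1; apply: (not_STLC m_prim m1_prim m2_prim mmu mu_m K1 n_gt0 mcK1 A_lim A_zero A_neq0 S_bound).
  by move=> T u e h; rewrite /ctrl_small n1 /= => t tT; apply/ltW/h.
have [C [Ts [C0 Ts0 hest]]] := sol_estimate m_prim m1_prim m2_prim mmu mu_m K1 n_gt0 mcK1 A_lim A_zero A_neq0 S_bound.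
(* The same [Ts] serves every admissible constant, since the estimate holds with |A^n_K| / 4
   itself. *)
exists C; split => // B B0 BA; exists Ts; split => // T T0 TTs.
have [eta [eta0 he]] := hest T T0 TTs; exists eta; split => // u Lu su psi hsol.
have fit := he u Lu su psi hsol; rewrite An in fit.
have [hcL _] := hsol; have TT : 0 <= T <= T by rewrite lexx ltW.
have pL := hcL T TT.
rewrite (cinner_phase _ pL (L2_phi 0 1 K)); apply: le_trans fit.
rewrite (cL2norm_sq (cL2B pL (cL2_psi1 T))).
rewrite (@eq_L2norm _ _ _ (fun x => cre _) _ (fun x _ => cre_sub_psi1 T psi x)).
rewrite (@eq_L2norm _ _ _ (fun x => cim _) _ (fun x _ => cim_sub_psi1 T psi x)).
apply: lerB => //.
rewrite L2norm2 (_ : ip 0 T _ _ = rint 0 T (fun t => prim u n t ^+ 2)); last first.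
  by apply: eq_rint => t _; rewrite expr2.
apply: ler_wpM2r; last exact: ltW.
by apply: rint_ge0 => t _; exact: sqr_ge0.
Qed.
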